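(* Let $\Phi:\bar M\to N$ be an immersion of degree $d$ of a smooth $m$-dimensional manifold into an $n$-dimensional equiregular graded manifold equipped with a Riemannian metric $g$. Assume that there exists an admissible variation $\Gamma:\bar M\times(-\varepsilon,\varepsilon)\to N$ with associated variational field $V$ with compact support. Then $$\frac{d}{dt}\bigg|_{t=0}A_d(\Gamma_t(\bar M))=\int_{\bar M}\langle V,\mathbf H_d\rangle\,d\mu,$$ where $\mathbf H_d$ is the vector field $$\mathbf H_d=-\sum_{j=m+1}^n\sum_{i=1}^m\mathrm{div}_M(\xi_{ij}E_i)\,N_j+\sum_{j=m+1}^n\sum_{i=1}^m\Big\langle E_1\wedge\dots\wedge\overset{(i)}{\nabla_{E_i}N_j}\wedge\dots\wedge E_m,\frac{(E_1\wedge\dots\wedge E_m)_d}{|(E_1\wedge\dots\wedge E_m)_d|}\Big\rangle N_j+\sum_{j=m+1}^n\frac{f(N_j)}{\Theta}N_j.$$ Here $(E_i)_i$ is a local orthonormal basis of $TM$, $(N_j)_j$ is a local orthonormal basis of $TM^\perp$, and $$\xi_{ij}=\Big\langle E_1\wedge\dots\wedge\overset{(i)}{N_j}\wedge\dots\wedge E_m,\frac{(E_1\wedge\dots\wedge E_m)_d}{|(E_1\wedge\dots\wedge E_m)_d|}\Big\rangle .$$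
   Context: **Graded manifolds and degree.** A graded manifold $(N,(\mathcal H^i))$ is a smooth manifold with a flag of sub-bundles $\mathcal H^1\subset\mathcal H^2\subset\cdots\subset TN$ with $[\mathcal H^i,\mathcal H^j]\subset\mathcal H^{i+j}$, $\bigcup_i\mathcal H^i=TN$, and $\mathcal H^s_p=T_pN$ for some $s=s(p)$ at each $p$; it is equiregular if all $n_i=\dim\mathcal H^i_p$ are constant ($n_0=0$). A local frame $(X_1,\dots,X_n)$ is adapted if $X_1,\dots,X_{n_i}$ span $\mathcal H^i$ for each $i$; then $\deg X_j=i$ for $n_{i-1}<j\le n_i$. For $J=(j_1<\dots<j_m)$, $X_J=X_{j_1}\wedge\dots\wedge X_{j_m}$, $\deg X_J=\sum_i\deg X_{j_i}$. The degree of an $m$-vector $\sum\lambda_JX_J$ is $\max\{\deg X_J:\lambda_J\ne0\}$. For an orthonormal adapted frame, $(\sum\lambda_JX_J)_d=\sum_{\deg X_J=d}\lambda_JX_J$. The metric is extended to $m$-vectors by $\langle v_1\wedge\dots\wedge v_m,w_1\wedge\dots\wedge w_m\rangle=\det(\langle v_i,w_j\rangle)$. The degree of an immersion is the maximum over its points of the degree of $e_1\wedge\dots\wedge e_m$, $(e_i)$ a basis of the tangent space. **Area.** For an immersion $\Psi:\bar M\to N$ of degree $d$, $A_d(\Psi(\bar M))=\int_{\bar M}|(e_1\wedge\dots\wedge e_m)_d|\,d\mu_\Psi$, where $\mu_\Psi=\Psi^*g$ and $e_i=d\Psi(\bar e_i)$ with $(\bar e_i)$ $\mu_\Psi$-orthonormal.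 For $\Phi$ write $\mu=\Phi^*g$, $M=\Phi(\bar M)$, $\Theta=|(e_1\wedge\dots\wedge e_m)_d|$ ($e_i$ an orthonormal basis of $T_pM$). **Admissible variation.** A smooth map $\Gamma:\bar M\times(-\varepsilon,\varepsilon)\to N$ with $\Gamma_t=\Gamma(\cdot,t)$, $\Gamma_0=\Phi$, $\Gamma_t$ an immersion of the same degree as $\Phi$ for small $t$, and $\Gamma_t=\Phi$ outside a given compact subset of $\bar M$. Its variational field is $V(\bar p)=\frac{\partial\Gamma}{\partial t}(\bar p,0)$. **The function $f$.** With $(X_i)$ an orthonormal adapted frame and $\nabla$ the Levi-Civita connection of $g$, for a vector $V$ at $p=\Phi(\bar p)$ and $(e_i)$ an orthonormal basis of $T_pM$, $$f(V)=\sum_{\deg(X_J)=d}\langle e_1\wedge\dots\wedge e_m,\nabla_VX_J\rangle\,\langle e_1\wedge\dots\wedge e_m,X_J\rangle .$$ $\mathrm{div}_M$ is the divergence on $M$, $\mathrm{div}_M X=\sum_i\langle\nabla_{e_i}X,e_i\rangle$. The superscript $(i)$ indicates that the vector occupies the $i$-th position.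
   Formalization: Assumes Θ ≠ 0 on the support of V, since H_d divides by Θ = |(E_1∧…∧E_m)_d| and is undefined at points of degree less than d; the area is taken over a Borel set containing the compact set of the variation (all of M̄ allowed) on which A_d(Φ) is finite. *)

(* Defs.v *)
From mathcomp Require Import all_boot all_order all_algebra.
From mathcomp Require Import all_classical all_reals all_analysis.

Set Implicit Arguments.
Unset Strict Implicit.
Unset Printing Implicit Defensive.

Import Order.TTheory GRing.Theory Num.Theory.
Import numFieldNormedType.Exports.

Local Open Scope classical_set_scope.
Local Open Scope ring_scope.

(* Meant for finite-dimensional [V]: class C^k on [U] by iterated directional
   derivatives. *)
Fixpoint Ck (R : realType) (V W : normedModType R) (k : nat) (U : set V)
    (f : V -> W) : Prop :=
  match k with
  | 0 => forall x, U x -> {for x, continuous f}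
  | k'.+1 => (forall x, U x -> differentiable f x) /\
             (forall v, Ck k' U (fun x => 'D_v f x))
  end.

Definition smooth_on (R : realType) (V W : normedModType R) (U : set V)
    (f : V -> W) : Prop := forall k, Ck k U f.

Definition smooth_at (R : realType) (V W : normedModType R) (f : V -> W)
    (x : V) : Prop := exists2 U : set V, open_nbhs x U & smooth_on U f.

Record chart (R : realType) (n : nat) (T : topologicalType) := Chart {
  cdom : set T ;
  cmap : T -> 'rV[R]_n ;
  cinv : 'rV[R]_n -> T ;
  cdom_open : open cdom ;
  cimg_open : open (cmap @` cdom) ;
  cmapK : forall q, cdom q -> cinv (cmap q) = q ;
  cmap_continuous : forall q, cdom q -> {for q, continuous cmap} ;
  cinv_continuous :
    forall x, (cmap @` cdom) x -> {for x, continuous cinv} }.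

(* The atlas is indexed by the points: [chart_at p] is a chart around [p].
   The tangent space at [p] is then ['rV[R]_n], a tangent vector being given by
   its components in [chart_at p].  Manifolds are nonempty. *)
Record manifold (R : realType) (n : nat) := Manifold {
  mcarrier :> ptopologicalType ;
  chart_at : mcarrier -> chart R n mcarrier ;
  chart_atP : forall p, cdom (chart_at p) p ;
  chart_at_smooth : forall p q,
    smooth_on (cmap (chart_at p) @` (cdom (chart_at p) `&` cdom (chart_at q)))
      (cmap (chart_at q) \o cinv (chart_at p)) ;
  mhausdorff : hausdorff_space mcarrier ;
  msecond_countable : @second_countable mcarrier }.

Section Tangent.
Context (R : realType) (n : nat) (N : manifold R n).

Definition pt (p : N) : 'rV[R]_n := cmap (chart_at p) p.

(* components, in an arbitrary chart [c] around [q], of a tangent vector at [q] *)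
Definition to_chart (c : chart R n N) (q : N) (v : 'rV[R]_n) : 'rV[R]_n :=
  'D_v (cmap c \o cinv (chart_at q)) (pt q).

(* inverse of [to_chart c q] *)
Definition of_chart (c : chart R n N) (q : N) (v : 'rV[R]_n) : 'rV[R]_n :=
  'D_v (cmap (chart_at q) \o cinv c) (cmap c q).

End Tangent.

Section Maps.
Context (R : realType) (m n : nat) (M : manifold R m) (N : manifold R n).
Implicit Types (F : M -> N) (p : M).

Definition map_in_charts F p : 'rV[R]_m -> 'rV[R]_n :=
  cmap (chart_at (F p)) \o F \o cinv (chart_at p).

Definition smooth_map F : Prop :=
  forall p, {for p, continuous F} /\ smooth_at (map_in_charts F p) (pt p).

Definition dmap F p (v : 'rV[R]_m) : 'rV[R]_n :=
  'D_v (map_in_charts F p) (pt p).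

Definition immersion F : Prop :=
  smooth_map F /\ forall p v, dmap F p v = 0 -> v = 0.

(* Local representation near [p] of a vector field [Y] along [F], that is, of a
   section of F^*TN: [Y q] is a tangent vector at [F q]. *)
Definition field_in_charts F (Y : M -> 'rV[R]_n) p : 'rV[R]_m -> 'rV[R]_n :=
  fun x => let q := cinv (chart_at p) x in
           to_chart (chart_at (F p)) (F q) (Y q).

Definition smooth_field_at F (Y : M -> 'rV[R]_n) p : Prop :=
  smooth_at (field_in_charts F Y p) (pt p).

End Maps.

(* Lie bracket of two vector fields, computed in the preferred chart at [q] *)
Definition lie_bracket (R : realType) (n : nat) (N : manifold R n)
    (X Y : N -> 'rV[R]_n) (q : N) : 'rV[R]_n :=
  'D_(X q) (field_in_charts idfun Y q) (pt q)
  - 'D_(Y q) (field_in_charts idfun X q) (pt q).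

(* components in the chart [c], at the point of coordinates [x], of a field [h]
   of bilinear forms *)
Definition form_in_chart (R : realType) (n : nat) (N : manifold R n)
    (h : N -> 'rV[R]_n -> 'rV[R]_n -> R) (c : chart R n N) (u v : 'rV[R]_n)
    (x : 'rV[R]_n) : R^o :=
  let q := cinv c x in h q (of_chart c q u) (of_chart c q v).

Record riemannian_metric (R : realType) (n : nat) (N : manifold R n) :=
  RiemannianMetric {
  metric :> N -> 'rV[R]_n -> 'rV[R]_n -> R ;
  metric_linear : forall q a u v w,
    metric q (a *: u + v) w = a * metric q u w + metric q v w ;
  metric_sym : forall q u v, metric q u v = metric q v u ;
  metric_pos : forall q v, v != 0 -> 0 < metric q v v ;
  metric_smooth : forall q u v,
    smooth_at (form_in_chart metric (chart_at q) u v) (pt q) }.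

Section Connection.
Context (R : realType) (n : nat) (N : manifold R n) (g : riemannian_metric N).

(* <nabla_u v, w> at [q] for the coordinate vector fields with constant
   components [u], [v], [w] in the preferred chart at [q] (Koszul formula) *)
Definition koszul (q : N) (u v w : 'rV[R]_n) : R :=
  let G a b := form_in_chart g (chart_at q) a b in
  2^-1 * ('D_u (G v w) (pt q) + 'D_v (G u w) (pt q) - 'D_w (G u v) (pt q)).

(* Christoffel symbols of the Levi-Civita connection, as a bilinear map:
   the vector whose inner product with every [w] is [koszul q u v w] *)
Definition christoffel (q : N) (u v : 'rV[R]_n) : 'rV[R]_n :=
  (\row_k koszul q u v (delta_mx 0 k))
  *m invmx (\matrix_(i, j) g q (delta_mx 0 i) (delta_mx 0 j)).

(* Covariant derivative at [p] of a vector field [Y] along [F] in the direction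
   [v] of T_pM.  For [F = idfun] this is the Levi-Civita connection of [g]; if
   [Y = Z \o F], it is the covariant derivative of [Z] along [dmap F p v]. *)
Definition cov (m : nat) (M : manifold R m) (F : M -> N) (Y : M -> 'rV[R]_n)
    (p : M) (v : 'rV[R]_m) : 'rV[R]_n :=
  'D_v (field_in_charts F Y p) (pt p) + christoffel (F p) (dmap F p v) (Y p).

Definition pullback (m : nat) (M : manifold R m) (F : M -> N) :
    M -> 'rV[R]_m -> 'rV[R]_m -> R :=
  fun p u v => g (F p) (dmap F p u) (dmap F p v).

End Connection.

(* Lebesgue integral of a nonnegative Borel function on R^n, as an iterated
   integral (Tonelli) *)
Fixpoint lebesgue_int (R : realType) (n : nat) : ('rV[R]_n -> \bar R) -> \bar R :=
  match n return ('rV[R]_n -> \bar R) -> \bar R with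
  | 0 => fun f => f 0
  | n'.+1 => fun f =>
      (\int[@lebesgue_measure R]_a
         lebesgue_int (fun x : 'rV[R]_n' => f (row_mx (a%:M : 'rV[R]_1) x)))%E
  end.

Definition borel (T : ptopologicalType) := g_sigma_algebraType (@open T).

(* [mu] is the Riemannian measure of [h]: in every chart it has density
   sqrt(det h_ij).  Since the charts cover the manifold, which is second
   countable, this determines [mu]. *)
Definition is_riemannian_measure (R : realType) (m : nat) (M : manifold R m)
    (h : M -> 'rV[R]_m -> 'rV[R]_m -> R)
    (mu : {measure set (borel M) -> \bar R}) : Prop :=
  forall (p : M) (B : set (borel M)), measurable B ->
    B `<=` cdom (chart_at p) ->
    mu B = lebesgue_int (fun x : 'rV[R]_m =>
      (\1_(cmap (chart_at p) @` B) x *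
       Num.sqrt (\det (\matrix_(i, j) form_in_chart h (chart_at p)
                         (delta_mx 0 i) (delta_mx 0 j) x)))%:E).

(* strictly increasing multi-indices J = (j_1 < ... < j_m) *)
Definition midx (n m : nat) :=
  {J : {ffun 'I_m -> 'I_n} | [forall i : 'I_m, forall k : 'I_m, (i < k)%N ==> (J i < J k)%N]}.

(* An m-vector is given by its coordinates in the basis e_J of the m-th exterior
   power induced by the standard basis (e_j) of ['rV[R]_n]. *)
Definition mvec (R : realType) (n m : nat) := {ffun midx n m -> R^o}.

Section MVectors.
Context (R : realType) (n m : nat).

Definition wedge (v : 'I_m -> 'rV[R]_n) : mvec R n m :=
  [ffun J : midx n m => \det (\matrix_(i, k) v i 0 (val J k))].

(* bilinear extension of
   <v_1 ^ ... ^ v_m, w_1 ^ ... ^ w_m> = det (<v_i, w_j>) *)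
Definition mdot (h : 'rV[R]_n -> 'rV[R]_n -> R) (a b : mvec R n m) : R :=
  \sum_(J : midx n m) \sum_(K : midx n m) a J * b K *
    \det (\matrix_(i, k) h (delta_mx 0 (val J i)) (delta_mx 0 (val K k))).

Definition mnorm (h : 'rV[R]_n -> 'rV[R]_n -> R) (a : mvec R n m) : R :=
  Num.sqrt (mdot h a a).

Definition wedge_frame (X : 'I_n -> 'rV[R]_n) (J : midx n m) : mvec R n m :=
  wedge (fun k => X (val J k)).

Definition wedge_at (v : 'I_m -> 'rV[R]_n) (i : 'I_m) (x : 'rV[R]_n) :
    mvec R n m :=
  wedge (fun k => if k == i then x else v k).

End MVectors.

Record equiregular_grading (R : realType) (n : nat) (N : manifold R n) :=
  EquiregularGrading {
  flag :> nat -> N -> {vspace 'rV[R]_n} ;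
  rk : nat -> nat ;
  flag_dim : forall i q, \dim (flag i q) = rk i ;
  flag0 : rk 0 = 0%N ;
  flag_sub : forall i q, (flag i q <= flag i.+1 q)%VS ;
  flag_full : forall q, exists s, flag s q = fullv ;
  flag_subbundle : forall i q, exists (U : set N) (Y : 'I_(rk i) -> N -> 'rV[R]_n),
    [/\ open_nbhs q U,
        forall j x, U x -> smooth_field_at idfun (Y j) x
      & forall x, U x -> flag i x = <<[seq Y j x | j : 'I_(rk i)]>>%VS] ;
  flag_bracket : forall i j (U : set N) (X Y : N -> 'rV[R]_n),
    open U ->
    (forall x, U x -> smooth_field_at idfun X x /\ smooth_field_at idfun Y x) ->
    (forall x, U x -> X x \in flag i x /\ Y x \in flag j x) ->
    forall x, U x -> lie_bracket X Y x \in flag (i + j)%N x }.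

Section Graded.
Context (R : realType) (n : nat) (N : manifold R n)
  (g : riemannian_metric N) (H : equiregular_grading N).

(* degree of the [j]-th vector of an adapted frame; [j] is counted from 0, so
   that the condition n_{i-1} < j <= n_i is shifted by one *)
Definition vdeg (j : 'I_n) : nat :=
  xget 0%N [set i | (0 < i)%N /\ (rk H i.-1 <= j < rk H i)%N].

Definition mdeg (m : nat) (J : midx n m) : nat := \sum_(k < m) vdeg (val J k).

Definition adapted (q : N) (X : 'I_n -> 'rV[R]_n) : Prop :=
  forall i, H i q = <<[seq X j | j : 'I_n <- enum 'I_n & (j < rk H i)%N]>>%VS.

Definition adapted_orthonormal (q : N) (X : 'I_n -> 'rV[R]_n) : Prop :=
  adapted q X /\ forall i j, g q (X i) (X j) = (i == j)%:R.

(* [w], an m-vector at [q], has degree [k]; this does not depend on the adapted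
   basis *)
Definition mvec_degree (m : nat) (q : N) (w : mvec R n m) (k : nat) : Prop :=
  exists (X : 'I_n -> 'rV[R]_n) (lam : midx n m -> R),
    [/\ adapted q X, w = \sum_(J : midx n m) lam J *: wedge_frame X J
      & k = (\max_(J : midx n m | (lam J != 0)%R) mdeg J)%N].

(* (w)_d; this does not depend on the chosen orthonormal adapted basis *)
Definition mvec_part (m : nat) (d : nat) (q : N) (w : mvec R n m) : mvec R n m :=
  let X := xget (fun=> 0) [set X | adapted_orthonormal q X] in
  \sum_(J : midx n m | mdeg J == d)
    mdot (g q) w (wedge_frame X J) *: wedge_frame X J.

Section Immersions.
Context (m : nat) (M : manifold R m).
Implicit Types (F : M -> N) (p : M) (d : nat).

Definition pointwise_degree F p d : Prop :=
  exists2 b : m.-tuple 'rV[R]_m, basis_of fullv b &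
    mvec_degree (F p) (wedge (fun i => dmap F p (tnth b i))) d.

Definition immersion_degree F d : Prop :=
  (exists p, pointwise_degree F p d) /\
  (forall p k, pointwise_degree F p k -> (k <= d)%N).

Definition orthonormal_basis F p (e : 'I_m -> 'rV[R]_m) : Prop :=
  forall i j, pullback g F p (e i) (e j) = (i == j)%:R.

(* Theta = |(e_1 ^ ... ^ e_m)_d|; this does not depend on the chosen orthonormal
   basis *)
Definition Theta d F p : R :=
  let e := xget (fun=> 0) [set e | orthonormal_basis F p e] in
  mnorm (g (F p)) (mvec_part d (F p) (wedge (fun i => dmap F p (e i)))).

(* The integral over [D] defining the area A_d, [mu] being the Riemannian measure
   of the pullback metric; A_d itself is the case [D = setT]. *)
Definition area d F (mu : {measure set (borel M) -> \bar R})
    (D : set (borel M)) : \bar R :=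
  (\int[mu]_(p in D) (Theta d F p)%:E)%E.

(* Admissible variation of [F], an immersion of degree [d]; the map is only
   relevant on M x ]-eps, eps[, where it is smooth, and [K] is the given compact
   set *)
Definition admissible_variation d F (eps : R) (K : set M) (G : M -> R -> N) :
    Prop :=
  [/\ (forall p t, `|t| < eps ->
         {for (p, t), continuous (fun z : M * R => G z.1 z.2)} /\
         smooth_at (fun z : 'rV[R]_m * R^o =>
             cmap (chart_at (G p t)) (G (cinv (chart_at p) z.1) z.2))
           (pt p, t)),
      G ^~ 0 = F,
      \forall t \near (0 : R),
        immersion (G ^~ t) /\ immersion_degree (G ^~ t) d,
      compact K
    & forall p t, `|t| < eps -> ~ K p -> G p t = F p].

Definition variational_field (G : M -> R -> N) p : 'rV[R]_n :=
  'D_1 (fun t : R^o => cmap (chart_at (G p 0)) (G p t)) 0.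

(* Local orthonormal frames near [p] of TM, of its normal bundle, and orthonormal
   adapted frames near [F p].  A frame of TM is given by fields [E i] on the
   source of the immersion, its vectors in TN being [dmap F q (E i q)]. *)
Definition tangent_frame F p (E : 'I_m -> M -> 'rV[R]_m) : Prop :=
  exists2 U : set M, open_nbhs p U & forall q, U q ->
    (forall i, smooth_field_at idfun (E i) q) /\ orthonormal_basis F q (E ^~ q).

Definition normal_frame F p (Nu : 'I_(n - m) -> M -> 'rV[R]_n) : Prop :=
  exists2 U : set M, open_nbhs p U & forall q, U q ->
    [/\ forall j, smooth_field_at F (Nu j) q,
        forall j v, g (F q) (Nu j q) (dmap F q v) = 0
      & forall j k, g (F q) (Nu j q) (Nu k q) = (j == k)%:R].

Definition adapted_frame (x : N) (X : 'I_n -> N -> 'rV[R]_n) : Prop :=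
  exists2 U : set N, open_nbhs x U & forall q, U q ->
    (forall i, smooth_field_at idfun (X i) q) /\ adapted_orthonormal q (X ^~ q).

(* nabla_v X_J, with the Levi-Civita connection extended to m-vectors as a
   derivation *)
Definition cov_wedge_frame (X : 'I_n -> N -> 'rV[R]_n) (J : midx n m) (x : N)
    (v : 'rV[R]_n) : mvec R n m :=
  \sum_(k < m) wedge_at (fun l => X (val J l) x) k
                        (cov g idfun (X (val J k)) x v).

Section MeanCurvature.
Context (d : nat) (F : M -> N) (E : 'I_m -> M -> 'rV[R]_m)
  (Nu : 'I_(n - m) -> M -> 'rV[R]_n) (X : 'I_n -> N -> 'rV[R]_n).

Definition tvec (q : M) (i : 'I_m) : 'rV[R]_n := dmap F q (E i q).

Definition f_fun (p : M) (v : 'rV[R]_n) : R :=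
  \sum_(J : midx n m | mdeg J == d)
    mdot (g (F p)) (wedge (tvec p)) (cov_wedge_frame X J (F p) v) *
    mdot (g (F p)) (wedge (tvec p)) (wedge_frame (X ^~ (F p)) J).

(* (E_1 ^ ... ^ E_m)_d / |(E_1 ^ ... ^ E_m)_d| *)
Definition unit_part (q : M) : mvec R n m :=
  let w := mvec_part d (F q) (wedge (tvec q)) in (mnorm (g (F q)) w)^-1 *: w.

Definition xi (i : 'I_m) (j : 'I_(n - m)) (q : M) : R :=
  mdot (g (F q)) (wedge_at (tvec q) i (Nu j q)) (unit_part q).

Definition div_along (Y : M -> 'rV[R]_n) (p : M) : R :=
  \sum_(k < m) g (F p) (cov g F Y p (E k p)) (tvec p k).

Definition mean_curvature (p : M) : 'rV[R]_n :=
  - (\sum_(j < n - m) \sum_(i < m)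
       div_along (fun q => xi i j q *: tvec q i) p *: Nu j p)
  + \sum_(j < n - m) \sum_(i < m)
       mdot (g (F p)) (wedge_at (tvec p) i (cov g F (Nu j) p (E i p)))
            (unit_part p) *: Nu j p
  + \sum_(j < n - m) (f_fun p (Nu j p) / Theta d F p) *: Nu j p.

End MeanCurvature.

End Immersions.

End Graded.

(* Main.v *)
(** Let [S(x, t)] be, in a chart of [M], the square root of the sum over the
    multi-indices [J] of degree [d] of the squared [J]-minors of the matrix
    [(<d_i Gam, X_k>)], [X] being an orthonormal adapted frame.  It does not depend
    on [X], because the transition matrix between two such frames is block
    diagonal, and [S = Theta(Gam_t) * density(Gam_t^* g)]; so [S] has to be
    differentiated at [t = 0].

    Where [S > 0], the identity [d_t S - sum_k d_k Z_k = density * <V, H_d>] holds,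
    with the flux [Z = density * W] and
    [W = sum_i <E_1 ^ ... ^ V ^ ... ^ E_m, (E_1 ^ ... ^ E_m)_d / |...|> E_i]
    ([V] in the [i]-th place): decompose [V] into its normal and tangent parts; the
    normal part gives [H_d] after exchanging covariant derivatives along [M] and in
    time, and the tangent part gives a divergence.  Off the support of [V] the
    density [S] may vanish and fail to be smooth, but there the [t]-derivative of
    every minor is [0] and [S] is Lipschitz in the minors, so that [d_t S = 0].

    For [chi_j] a partition of unity on the compact set [K], differentiating
    [int chi_j S] under the integral sign gives
    [int chi_j <V, H_d> - int W(chi_j)], as the integral of
    [sum_k d_k (chi_j Z_k)] is [0] by translation invariance of the Lebesgue
    integral.  Finally [sum_j W(chi_j) = 0] on [K], and nothing moves outside [K]. *)

(* Tangent vectors are stored by their components in a preferred chart at each point, and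
   [christoffel] gives the connection only at the centre of that chart. The identity at [q] is
   therefore computed in the target chart centred at [Phi q], where the covariant derivative of the
   coordinates is [cov], with the frames chosen for [q]; it is then carried to the single chart used
   for integration, because [S] and [Z] have expressions free of the target chart and of the adapted
   frame.

   The frames are chosen separately for every point, so the measurability of [<V, H_d>] cannot be
   read off its definition. It comes out of the differentiation under the integral sign: [d_t S] is
   a limit of measurable difference quotients, and removing the divergence of the flux leaves the
   integrand.

   Neither [chi_j] nor the flux need be smooth everywhere. Only the products [chi_j Z_k] are shown
   to be of class C^1 on the whole of R^m, one factor vanishing nearby wherever the other
   misbehaves. *)
From HB Require Import structures.
From mathcomp Require Import all_boot all_order all_algebra.
From mathcomp Require Import fingroup perm finmap.
From mathcomp Require Import all_classical all_reals all_analysis.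
From mathcomp Require Import measurable_realfun.
From mathcomp Require Import ring lra.
Require Import Defs.

Set Implicit Arguments.
Unset Strict Implicit.
Unset Printing Implicit Defensive.

Import Order.TTheory GRing.Theory Num.Theory.
Import numFieldNormedType.Exports.

Local Open Scope classical_set_scope.
Local Open Scope ring_scope.

(** * Multilinear algebra *)

Section CauchyBinet.
Context (R : comNzRingType) (m n : nat).

Definition minor (J : midx n m) (A : 'M[R]_(m, n)) : R := \det (colsub (val J) A).

Lemma midx_lt (J : midx n m) (i k : 'I_m) : (i < k)%N -> (val J i < val J k)%N.
Proof. by move=> ik; have /forallP/(_ i)/forallP/(_ k)/implyP := valP J; apply. Qed.

Lemma midx_inj (J : midx n m) : injective (val J).
Proof.
move=> i k eqJ; apply: val_inj => /=.
by case: (ltngtP i k) => // /(midx_lt J); rewrite eqJ ltnn.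
Qed.

Lemma midx_sorted (J : midx n m) : sorted ltn [seq nat_of_ord (val J i) | i <- enum 'I_m].
Proof.
rewrite sorted_pairwise; last exact: ltn_trans.
rewrite pairwise_map.
have : pairwise ltn (map val (enum 'I_m)).
  rewrite val_enum_ord -sorted_pairwise; last exact: ltn_trans.
  exact: iota_ltn_sorted.
rewrite pairwise_map; apply: sub_pairwise => i k; exact: midx_lt.
Qed.

(* An injective map 'I_m -> 'I_n factors uniquely as a permutation followed by
   a strictly increasing map. *)
Lemma midx_perm_inj (J K : midx n m) (s t : 'S_m) :
  (forall i, val J (s i) = val K (t i)) -> J = K /\ s = t.
Proof.
move=> JK; have eJK : J = K.
  have sJ := midx_sorted J; have sK := midx_sorted K.
  have e : [seq nat_of_ord (val J i) | i <- enum 'I_m] =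
           [seq nat_of_ord (val K i) | i <- enum 'I_m].
    apply: (irr_sorted_eq ltn_trans ltnn sJ sK) => x.
    apply/mapP/mapP => -[i _ ->].
      exists (t (s^-1%g i)); first by rewrite mem_enum.
      by rewrite -JK permKV.
    exists (s (t^-1%g i)); first by rewrite mem_enum.
    by rewrite JK permKV.
  apply: val_inj; apply/ffunP => i; apply: val_inj.
  by have /eq_in_map := e; apply; rewrite mem_enum.
split=> //; apply/permP => i; apply: (@midx_inj K).
by rewrite -JK eJK.
Qed.

(** [J] lists the values of [f] in increasing order and [s] records the order in which [f] takes
    them. *)
Lemma midx_perm_exists (f : {ffun 'I_m -> 'I_n}) : injective f ->
  exists (J : midx n m) (s : 'S_m), forall i, f i = val J (s i).
Proof.
move=> finj; pose t := [tuple f i | i < m].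
pose u := sort (fun a b : 'I_n => (a <= b)%N) t.
have szu : size u = m by rewrite size_sort size_tuple.
have us : sorted (fun a b : 'I_n => (a < b)%N) u.
  have : sorted ltn (map val u).
    rewrite ltn_sorted_uniq_leq map_inj_uniq; last exact: val_inj.
    rewrite sort_uniq map_inj_uniq ?enum_uniq// sorted_map.
    by apply: sort_sorted => a b /=; exact: leq_total.
  by rewrite sorted_map.
have : perm_eq t (Tuple (introT eqP szu)) by rewrite perm_sym perm_sort.
move=> /tuple_permP[s es].
pose K := [ffun i => tnth (Tuple (introT eqP szu)) i].
have KP : [forall i : 'I_m, forall k : 'I_m, (i < k)%N ==> (K i < K k)%N].
  apply/forallP => i; apply/forallP => k; apply/implyP => ik.
  rewrite !ffunE !(tnth_nth (f i)) /=.
  by apply: (sorted_ltn_nth (leT := fun a b : 'I_n => (a < b)%N)) => //;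
    [move=> a b c; exact: ltn_trans | rewrite inE szu | rewrite inE szu].
exists (exist _ K KP), s => i /=; rewrite ffunE.
have -> : f i = tnth t i by rewrite tnth_mktuple.
by rewrite (tnth_nth (f i)) es nth_mktuple.
Qed.

(** Expanding the rows of the product gives a sum over all maps [f] from rows to indices. A map that
    is not injective repeats a row of [B]; an injective one is an increasing map after a
    permutation. *)
Lemma cauchy_binet (A : 'M[R]_(m, n)) (B : 'M[R]_(n, m)) :
  \det (A *m B) = \sum_(J : midx n m) minor J A * \det (rowsub (val J) B).
Proof.
have -> : \det (A *m B) =
    \sum_(f : {ffun 'I_m -> 'I_n}) (\prod_i A i (f i)) * \det (rowsub f B).
  rewrite {1}/determinant.
  under eq_bigr => s _.
    under eq_bigr => i _ do rewrite mxE.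
    rewrite bigA_distr_bigA /= big_distrr /=.
    over.
  rewrite exchange_big /=; apply: eq_bigr => f _.
  rewrite /determinant big_distrr /=; apply: eq_bigr => s _.
  rewrite big_split /= mulrCA; congr (_ * (_ * _)).
  by apply: eq_bigr => i _; rewrite !mxE.
rewrite (bigID (fun f : {ffun 'I_m -> 'I_n} => injectiveb f)) /=.
rewrite [X in _ + X]big1 ?addr0; last first.
  move=> f /injectivePn[i [k ik fik]].
  rewrite (determinant_alternate ik) ?mulr0// => l.
  by rewrite !mxE fik.
rewrite /minor.
under [RHS]eq_bigr => J _.
  rewrite {1}/determinant big_distrl /=.
  over.
rewrite pair_big /=.
(* The pairs [(J, s)] parametrize the injective maps. Reordering the rows of [B] by [s] produces the
   sign with which the sum over [s] becomes a minor of [A]. *)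
pose h (p : midx n m * 'S_m) : {ffun 'I_m -> 'I_n} := [ffun i => val p.1 (p.2 i)].
have hinj : injective h.
  move=> [J s] [K t] /ffunP e.
  have [i|-> ->//] := @midx_perm_inj J K s t.
  by have := e i; rewrite !ffunE.
rewrite [LHS](_ : _ = \sum_(f in [set h p | p in [set: midx n m * 'S_m]%SET]%SET)
     (\prod_i A i (f i)) * \det (rowsub f B)); last first.
  apply: eq_bigl => f; apply/injectiveP/imsetP => [/midx_perm_exists[J [s fJ]]|].
    by exists (J, s); rewrite ?inE//; apply/ffunP => i; rewrite ffunE fJ.
  move=> [[J s] _ ->] i k; rewrite !ffunE => /midx_inj; exact: perm_inj.
rewrite big_imset /=; last by move=> p q _ _; exact: hinj.
rewrite (eq_bigl xpredT) => [|p]; last by rewrite inE.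
apply: eq_bigr => -[J s] _ /=.
have -> : rowsub (h (J, s)) B = row_perm s (rowsub (val J) B).
  by apply/matrixP => i k; rewrite !mxE ffunE.
rewrite row_permE det_mulmx det_perm mulrA [_ * (-1) ^+ _]mulrC; congr (_ * _ * _).
by apply: eq_bigr => i _; rewrite !mxE ffunE.
Qed.

End CauchyBinet.

Section Adjugate.

(** Both sides agree after multiplication by [P] on the right, and multiplying further by [\adj P]
    leaves the nonzero scalar [\det P], which cancels. *)
Lemma adj_mulmx_idom (R : idomainType) m (e P : 'M[R]_m) : \det P != 0 ->
  \adj (e *m P) *m e = \det e *: \adj P.
Proof.
move=> P0; pose D := \adj (e *m P) *m e - \det e *: \adj P.
have DP : D *m P = 0.
  rewrite mulmxBl -mulmxA mul_adj_mx -scalemxAl mul_adj_mx det_mulmx.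
  by rewrite scale_scalar_mx subrr.
have : D *m P *m \adj P = 0 by rewrite DP mul0mx.
rewrite -mulmxA mul_mx_adj mul_mx_scalar => /matrixP D0.
apply/eqP; rewrite -subr_eq0; apply/eqP/matrixP => i k.
have := D0 i k; rewrite -/D mxE => /eqP.
by rewrite [X in _ == X]mxE mulf_eq0 (negPf P0) => /eqP ->; rewrite mxE.
Qed.

(** The submatrices to which this is applied may be singular, so [P] is first perturbed. *)
Lemma adj_mulmx (R : idomainType) m (e P : 'M[R]_m) :
  \adj (e *m P) *m e = \det e *: \adj P.
Proof.
(* [P'] is ['X + P] over the polynomials; its determinant is monic, hence nonzero. Evaluation at 0
   gives back [P]. *)
pose e' := map_mx polyC e; pose P' := char_poly_mx (- P).
have P'0 : \det P' != 0 by have /monic_neq0 := char_poly_monic (- P).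
have := adj_mulmx_idom e' P'0.
move=> /(congr1 (map_mx (horner_eval (0 : R)))).
have e0 : map_mx (horner_eval (0 : R)) e' = e.
  by apply/matrixP => i k; rewrite !mxE /horner_eval hornerC.
have P0 : map_mx (horner_eval (0 : R)) P' = P.
  apply/matrixP => i k; rewrite /P' /char_poly_mx !mxE /horner_eval.
  by rewrite !(hornerE, hornerMn) mul0rn sub0r opprK.
rewrite map_mxM map_mx_adj map_mxM e0 P0 => ->.
have -> : map_mx (horner_eval (0 : R)) (\det e' *: \adj P') =
    horner_eval 0 (\det e') *: map_mx (horner_eval 0) (\adj P').
  by apply/matrixP => i k; rewrite !mxE rmorphM.
by rewrite map_mx_adj P0 -det_map_mx e0.
Qed.

End Adjugate.

Section DetLinear.
Context (R : comNzRingType) (m : nat).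

Definition set_row (A : 'M[R]_m) (i : 'I_m) (y : 'rV[R]_m) : 'M[R]_m :=
  \matrix_(k, l) if k == i then y 0 l else A k l.

Lemma det_set_row (A : 'M[R]_m) i y : \det (set_row A i y) = (y *m \adj A) 0 i.
Proof.
rewrite (expand_det_row _ i) mxE; apply: eq_bigr => j _.
rewrite !mxE eqxx; congr (_ * _); rewrite /cofactor; congr (_ * \det _).
by apply/matrixP => k l; rewrite !mxE [lift _ _ == _]eq_sym (negPf (neq_lift _ _)).
Qed.

Lemma det_set_col (A : 'M[R]_m) k (y : 'cV[R]_m) :
  \det (\matrix_(i, l) if l == k then y i 0 else A i l) = (\adj A *m y) k 0.
Proof.
rewrite -det_tr; have -> : (\matrix_(i, l) (if l == k then y i 0 else A i l))^T =
    set_row A^T k y^T by apply/matrixP => i l; rewrite !mxE.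
by rewrite det_set_row -trmx_adj -trmx_mul mxE.
Qed.

End DetLinear.

Section Pairing.
Context (R : idomainType) (m n : nat) (deg : 'I_n -> nat) (d : nat).
Implicit Types (A B : 'M[R]_(m, n)) (y : 'rV[R]_n) (J : midx n m).

Definition jdeg J : nat := \sum_(k < m) deg (val J k).

(** If the rows of [A] and [B] are the components of vectors in an orthonormal adapted frame, this
    is the inner product of the degree [d] parts of the two wedge products. *)
Definition pairing A B : R := \sum_(J | jdeg J == d) minor J A * minor J B.

(* The [k]-th entry is [pairing (set_mxrow A k y) A]. *)
Definition pairing_row A y : 'rV[R]_m :=
  \sum_(J | jdeg J == d) minor J A *: (colsub (val J) y *m \adj (colsub (val J) A)).

(* Half the derivative at [A] of [A |-> pairing A A] in the direction [B]. *)
Definition dpairing A B : R :=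
  \sum_(J | jdeg J == d) minor J A * \tr (colsub (val J) B *m \adj (colsub (val J) A)).

Definition set_mxrow A (k : 'I_m) y : 'M[R]_(m, n) :=
  \matrix_(i, l) if i == k then y 0 l else A i l.

Lemma pairing_rowE A y k : pairing_row A y 0 k = pairing (set_mxrow A k y) A.
Proof.
rewrite /pairing_row summxE; apply: eq_bigr => J _.
rewrite mxE -det_set_row mulrC; congr (\det _ * _).
by apply/matrixP => i l; rewrite !mxE.
Qed.

Lemma pairing_row_is_linear A a y z :
  pairing_row A (a *: y + z) = a *: pairing_row A y + pairing_row A z.
Proof.
rewrite /pairing_row scaler_sumr -big_split /=; apply: eq_bigr => J _.
have -> : colsub (val J) (a *: y + z) = a *: colsub (val J) y + colsub (val J) z.
  by apply/matrixP => i k; rewrite !mxE.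
by rewrite mulmxDl -scalemxAl scalerDr !scalerA mulrC.
Qed.

Lemma pairing_row0 A : pairing_row A 0 = 0.
Proof.
by have := pairing_row_is_linear A (-1) 0 0;
  rewrite scaler0 addr0 scaleN1r addNr.
Qed.

Lemma pairing_rowZ A a y : pairing_row A (a *: y) = a *: pairing_row A y.
Proof. by rewrite -[a *: y]addr0 pairing_row_is_linear pairing_row0 addr0. Qed.

Lemma pairing_rowD A y z : pairing_row A (y + z) = pairing_row A y + pairing_row A z.
Proof. by rewrite -[y]scale1r pairing_row_is_linear !scale1r. Qed.

Lemma pairing_row_sum A (I : finType) (F : I -> 'rV[R]_n) :
  pairing_row A (\sum_i F i) = \sum_i pairing_row A (F i).
Proof.
exact: (big_morph _ (pairing_rowD A) (pairing_row0 A)).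
Qed.

Lemma dpairingE A B : dpairing A B = \sum_i pairing_row A (row i B) 0 i.
Proof.
under eq_bigr => i _ do rewrite /pairing_row summxE.
rewrite exchange_big /=; apply: eq_bigr => J _.
rewrite /mxtrace big_distrr /=; apply: eq_bigr => i _.
rewrite !mxE; congr (_ * _); apply: eq_bigr => k _; by rewrite !mxE.
Qed.

Lemma dpairing_is_linear A a B C :
  dpairing A (a *: B + C) = a * dpairing A B + dpairing A C.
Proof.
rewrite !dpairingE big_distrr -big_split /=; apply: eq_bigr => i _.
by rewrite linearP pairing_row_is_linear !mxE.
Qed.

(** A row of [A] put in the place of another one makes every minor vanish. Hence a tangent component
    of [V] contributes to one entry of the flux only. *)
Lemma pairing_row_row A l : pairing_row A (row l A) = pairing A A *: delta_mx 0 l.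
Proof.
rewrite /pairing_row /pairing scaler_suml; apply: eq_bigr => J _.
have -> : colsub (val J) (row l A) = row l (colsub (val J) A).
  by apply/matrixP => i k; rewrite !mxE.
rewrite -row_mul mul_mx_adj -scalerA; congr (_ *: _).
by apply/matrixP => i k; rewrite !mxE !ord1 eqxx /= mulr_natr [k == l]eq_sym.
Qed.

Lemma minor_mull (e : 'M[R]_m) A J : minor J (e *m A) = \det e * minor J A.
Proof.
rewrite /minor -det_mulmx; congr (\det _).
by apply/matrixP => i k; rewrite !mxE; apply: eq_bigr => j _; rewrite !mxE.
Qed.

Lemma pairing_mull (e : 'M[R]_m) A B :
  pairing (e *m A) (e *m B) = \det e ^+ 2 * pairing A B.
Proof.
rewrite /pairing big_distrr; apply: eq_bigr => J _ /=.
by rewrite !minor_mull expr2 mulrACA.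
Qed.

(** Behaviour under a change of basis of the tangent space. It is the reason why the flux, after
    division by the area, is a vector density: the coordinate expression and the one in an
    orthonormal frame differ by a Jacobian. *)
Lemma pairing_row_mull (e : 'M[R]_m) A y :
  pairing_row (e *m A) y *m e = \det e ^+ 2 *: pairing_row A y.
Proof.
rewrite /pairing_row mulmx_suml scaler_sumr; apply: eq_bigr => J _ /=.
rewrite minor_mull -scalemxAl -mulmxA.
have -> : colsub (val J) (e *m A) = e *m colsub (val J) A.
  by apply/matrixP => i k; rewrite !mxE; apply: eq_bigr => j _; rewrite !mxE.
by rewrite adj_mulmx -scalemxAr !scalerA mulrAC expr2.
Qed.

Lemma dpairing_mull (e : 'M[R]_m) A B :
  dpairing (e *m A) (e *m B) = \det e ^+ 2 * dpairing A B.
Proof.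
rewrite !dpairingE big_distrr /=.
under [RHS]eq_bigr => l _.
  have -> : \det e ^+ 2 * pairing_row A (row l B) 0 l =
    (\det e ^+ 2 *: pairing_row A (row l B)) 0 l by rewrite mxE.
  rewrite -pairing_row_mull mxE.
  over.
rewrite exchange_big /=; apply: eq_bigr => i _.
have -> : row i (e *m B) = \sum_l e i l *: row l B.
  by rewrite row_mul mulmx_sum_row; apply: eq_bigr => l _; rewrite mxE.
rewrite pairing_row_sum summxE; apply: eq_bigr => l _.
by rewrite pairing_rowZ mxE mulrC.
Qed.

(** A nonzero term of the Leibniz expansion matches the entries of [K] with those of [J], each with
    one of the same degree. *)
Lemma minor_prod_neq0 (O : 'M[R]_n) (J K : midx n m) :
  (forall j k, O j k != 0 -> deg j = deg k) ->
  \det (mxsub (val K) (val J) O) != 0 -> jdeg K = jdeg J.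
Proof.
move=> Odeg; rewrite /determinant => nz.
have [s] : exists s : 'S_m, \prod_i (mxsub (val K) (val J) O) i (s i) != 0.
  apply/existsP; apply: contra_neqT nz => /existsPn h.
  by rewrite big1// => s _; move: (h s); rewrite negbK => /eqP ->; rewrite mulr0.
move=> /prodf_neq0 h; rewrite /jdeg.
rewrite [RHS](reindex_inj (@perm_inj _ s)) /=; apply: eq_bigr => i _.
by have := h i isT; rewrite mxE => /Odeg.
Qed.

Lemma minor_mulr A (O : 'M[R]_n) J :
  minor J (A *m O) = \sum_K minor K A * \det (mxsub (val K) (val J) O).
Proof.
rewrite /minor; have -> : colsub (val J) (A *m O) = A *m colsub (val J) O.
  by apply/matrixP => i k; rewrite !mxE; apply: eq_bigr => j _; rewrite !mxE.
rewrite cauchy_binet; apply: eq_bigr => K _; congr (_ * \det _).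
by apply/matrixP => i k; rewrite !mxE.
Qed.

(* [O] plays the part of the transition matrix between two orthonormal adapted
   frames. *)
Lemma pairing_mulr (O : 'M[R]_n) A B : O *m O^T = 1%:M ->
  (forall j k, O j k != 0 -> deg j = deg k) ->
  pairing (A *m O) (B *m O) = pairing A B.
Proof.
move=> OO Odeg; rewrite /pairing.
(* The matrix of all [m]-minors of an orthogonal matrix is orthogonal, by Cauchy-Binet applied to
   [O *m O^T]. *)
have key (K L : midx n m) : \sum_(J : midx n m) \det (mxsub (val K) (val J) O) * \det (mxsub (val L) (val J) O)
    = (K == L)%:R.
  have -> : \sum_(J : midx n m) \det (mxsub (val K) (val J) O) * \det (mxsub (val L) (val J) O)
     = \det (mxsub (val K) (val L) (1%:M : 'M[R]_n)).
    rewrite -OO.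
    have -> : mxsub (val K) (val L) (O *m O^T) = rowsub (val K) O *m (rowsub (val L) O)^T.
      by apply/matrixP => i k; rewrite !mxE; apply: eq_bigr => j _; rewrite !mxE.
    rewrite cauchy_binet; apply: eq_bigr => J _; congr (\det _ * _).
      by apply/matrixP => i k; rewrite !mxE.
    by rewrite -[RHS]det_tr; congr (\det _); apply/matrixP => i k; rewrite !mxE.
  have [<-|KL] := eqVneq K L.
    rewrite [X in \det X](_ : _ = 1%:M) ?det1//.
    by apply/matrixP => i k; rewrite !mxE (inj_eq (@midx_inj _ _ K)).
  apply/eqP; apply: contra_neqT KL; rewrite /determinant => nz.
  have [s] : exists s : 'S_m, \prod_i (mxsub (val K) (val L) (1%:M : 'M[R]_n)) i (s i) != 0.
    apply/existsP; apply: contra_neqT nz => /existsPn h.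
    by rewrite big1// => s _; move: (h s); rewrite negbK => /eqP ->; rewrite mulr0.
  move=> /prodf_neq0 h.
  have [|-> //] := @midx_perm_inj _ _ K L 1%g s => i.
  have := h i isT; rewrite !mxE perm1.
  by case: (val K i =P val L (s i)) => [-> //|_]; rewrite mulr0n eqxx.
(* By [minor_prod_neq0] the matrix of minors is block diagonal for the degree, so the sum may be
   restricted to degree [d]. *)
have mE A' J : jdeg J == d ->
    minor J (A' *m O) = \sum_(K | jdeg K == d) minor K A' * \det (mxsub (val K) (val J) O).
  move=> Jd; rewrite minor_mulr (bigID (fun K => jdeg K == d)) /=.
  rewrite [X in _ + X]big1 ?addr0// => K Kd.
  have [->|/(minor_prod_neq0 Odeg) KJ] := eqVneq (\det (mxsub (val K) (val J) O)) 0.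
    by rewrite mulr0.
  by rewrite KJ Jd in Kd.
under eq_bigr => J Jd.
  rewrite !mE// big_distrl /=.
  under eq_bigr => K _ do rewrite big_distrr /=.
  over.
rewrite exchange_big /=; apply: eq_bigr => K Kd.
rewrite exchange_big /=.
rewrite [LHS](bigD1 K)//= [X in _ + X]big1 ?addr0 => [|L /andP[Ld LK]].
  transitivity (minor K A * minor K B * \sum_(J | jdeg J == d)
     \det (mxsub (val K) (val J) O) * \det (mxsub (val K) (val J) O)).
    by rewrite big_distrr; apply: eq_bigr => J _ /=; ring.
  rewrite [X in _ * X](_ : _ = 1) ?mulr1//; have := key K K; rewrite eqxx mulr1n => <-.
  rewrite [RHS](bigID (fun J => jdeg J == d)) /= [X in _ + X]big1 ?addr0// => J Jd.
  have [->|/(minor_prod_neq0 Odeg) KJ] := eqVneq (\det (mxsub (val K) (val J) O)) 0.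
    by rewrite mulr0.
  by rewrite -KJ Kd in Jd.
transitivity (minor K A * minor L B * \sum_(J | jdeg J == d)
     \det (mxsub (val K) (val J) O) * \det (mxsub (val L) (val J) O)).
  by rewrite big_distrr; apply: eq_bigr => J _ /=; ring.
rewrite [X in _ * X](_ : _ = 0) ?mulr0//; have := key K L.
rewrite eq_sym (negPf LK) mulr0n => kKL; rewrite -[RHS]kKL.
rewrite [RHS](bigID (fun J => jdeg J == d)) /= [X in _ + X]big1 ?addr0// => J Jd.
have [->|/(minor_prod_neq0 Odeg) KJ] := eqVneq (\det (mxsub (val K) (val J) O)) 0.
  by rewrite mul0r.
by rewrite -KJ Kd in Jd.
Qed.

Lemma pairing_row_mulr (O : 'M[R]_n) A y : O *m O^T = 1%:M ->
  (forall j k, O j k != 0 -> deg j = deg k) ->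
  pairing_row (A *m O) (y *m O) = pairing_row A y.
Proof.
move=> OO Odeg; apply/rowP => k; rewrite !pairing_rowE -[RHS](pairing_mulr _ _ OO Odeg).
congr (pairing _ _); apply/matrixP => i j; rewrite !mxE.
have [->|ik] := eqVneq i k.
  by apply: eq_bigr => l _; rewrite !mxE eqxx.
by apply: eq_bigr => l _; rewrite !mxE (negPf ik).
Qed.

End Pairing.

(** * Inner products of m-vectors *)

Section MdotWedge.
Context (R : realType) (n m : nat) (h : 'rV[R]_n -> 'rV[R]_n -> R).
Hypothesis hlin : forall a u v w, h (a *: u + v) w = a * h u w + h v w.
Hypothesis hsym : forall u v, h u v = h v u.

Lemma form0l w : h 0 w = 0.
Proof. by have := hlin (-1) 0 0 w; rewrite scaler0 addr0 mulN1r addNr. Qed.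

Lemma formZl a u w : h (a *: u) w = a * h u w.
Proof. by rewrite -[a *: u]addr0 hlin form0l addr0. Qed.

Lemma formDl u v w : h (u + v) w = h u w + h v w.
Proof. by rewrite -[u]scale1r hlin mul1r scale1r. Qed.

Lemma form_suml (I : finType) (P : pred I) (F : I -> 'rV[R]_n) w :
  h (\sum_(i | P i) F i) w = \sum_(i | P i) h (F i) w.
Proof. exact: (big_morph (h^~ w) (fun u v => formDl u v w) (form0l w)). Qed.

Lemma form_sumr (I : finType) (P : pred I) (F : I -> 'rV[R]_n) w :
  h w (\sum_(i | P i) F i) = \sum_(i | P i) h w (F i).
Proof. by rewrite hsym form_suml; apply: eq_bigr => i _; rewrite hsym. Qed.

Lemma formZr a u w : h w (a *: u) = a * h w u.
Proof. by rewrite hsym formZl hsym. Qed.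

Lemma formDr u v w : h w (u + v) = h w u + h w v.
Proof. by rewrite hsym formDl !(hsym w). Qed.

Definition form_mx : 'M[R]_n := \matrix_(i, j) h (delta_mx 0 i) (delta_mx 0 j).

Lemma formE u v : h u v = (u *m form_mx *m v^T) 0 0.
Proof.
rewrite {1}(row_sum_delta u) {1}(row_sum_delta v) form_suml -mulmxA mxE.
apply: eq_bigr => i _; rewrite formZl form_sumr mxE; congr (_ * _).
by apply: eq_bigr => j _; rewrite formZr !mxE mulrC.
Qed.

(** [mdot] is defined on the basis [e_J]; the matrix of inner products factors as [V *m (G *m W^T)]
    with [G] the Gram matrix of the standard basis, and Cauchy-Binet is used for each of the two
    products. *)
Lemma mdot_wedge (v w : 'I_m -> 'rV[R]_n) :
  mdot h (wedge v) (wedge w) = \det (\matrix_(i, k) h (v i) (w k)).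
Proof.
pose V := \matrix_i v i; pose W := \matrix_i w i.
have -> : \matrix_(i, k) h (v i) (w k) = V *m (form_mx *m W^T).
  apply/matrixP => i k; rewrite !mxE.
  transitivity ((v i *m (form_mx *m (w k)^T)) 0 0); first by rewrite formE mulmxA.
  rewrite mxE; apply: eq_bigr => j _; congr (_ * _); rewrite !mxE//.
  by apply: eq_bigr => l _; rewrite !mxE.
rewrite cauchy_binet; apply: eq_bigr => J _.
have -> : rowsub (val J) (form_mx *m W^T) = rowsub (val J) form_mx *m W^T.
  by apply/matrixP => i k; rewrite !mxE; apply: eq_bigr => j _; rewrite !mxE.
rewrite cauchy_binet big_distrr; apply: eq_bigr => K _ /=.
rewrite !ffunE /minor -mulrA; congr (\det _ * _).
  by apply/matrixP => i k; rewrite !mxE.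
rewrite mulrC; congr (\det _ * _); first by apply/matrixP => i k; rewrite !mxE.
by rewrite -[RHS]det_tr; congr (\det _); apply/matrixP => i k; rewrite !mxE.
Qed.

Lemma mdotDl (a b c : mvec R n m) : mdot h (a + b) c = mdot h a c + mdot h b c.
Proof.
rewrite /mdot -big_split; apply: eq_bigr => J _ /=; rewrite -big_split.
by apply: eq_bigr => K _ /=; rewrite !ffunE !mulrDl.
Qed.

Lemma mdotDr (a b c : mvec R n m) : mdot h c (a + b) = mdot h c a + mdot h c b.
Proof.
rewrite /mdot -big_split; apply: eq_bigr => J _ /=; rewrite -big_split.
by apply: eq_bigr => K _ /=; rewrite !ffunE mulrDr !mulrDl.
Qed.

Lemma mdotZl x (a b : mvec R n m) : mdot h (x *: a) b = x * mdot h a b.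
Proof.
rewrite /mdot big_distrr; apply: eq_bigr => J _ /=; rewrite big_distrr.
by apply: eq_bigr => K _ /=; rewrite !ffunE -!mulrA.
Qed.

Lemma mdotZr x (a b : mvec R n m) : mdot h a (x *: b) = x * mdot h a b.
Proof.
rewrite /mdot big_distrr; apply: eq_bigr => J _ /=; rewrite big_distrr.
by apply: eq_bigr => K _ /=; rewrite !ffunE /GRing.scale /=; ring.
Qed.

Lemma mdot_suml (I : finType) (P : pred I) (F : I -> mvec R n m) b :
  mdot h (\sum_(i | P i) F i) b = \sum_(i | P i) mdot h (F i) b.
Proof.
apply: (big_morph (fun a => mdot h a b)) => [x y|]; first exact: mdotDl.
by have := mdotZl 0 0 b; rewrite scale0r mul0r.
Qed.

Lemma mdot_sumr (I : finType) (P : pred I) (F : I -> mvec R n m) b :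
  mdot h b (\sum_(i | P i) F i) = \sum_(i | P i) mdot h b (F i).
Proof.
apply: (big_morph (mdot h b)) => [x y|]; first exact: mdotDr.
by have := mdotZr 0 b 0; rewrite scale0r mul0r.
Qed.

End MdotWedge.

(** * Functions of class C^k *)

Section Differentiability.
Context (R : realType).
Implicit Types (V W : normedModType R).

Lemma near_eq_differentiable V W (f g : V -> W) (x : V) :
  {near x, f =1 g} -> differentiable f x -> differentiable g x.
Proof.
move=> fg df.
have fgx : f x = g x := nbhs_singleton fg.
have key : g \o shift x = cst (g x) + 'd f x +o_ 0 id.
  apply/eqaddoP => e e0.
  have := diff_locally df => /eqaddoP /(_ e e0); apply: filter_app.
  have : \forall y \near (0 : V), f (y + x) = g (y + x).
    have : \near x, f x = g x by exact: fg.
    rewrite (near_shift 0 x) => fg'.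
    by apply: filterS fg' => y; rewrite /= subr0.
  by apply: filterS => y /= fgy; rewrite !fctE /= -fgx -fgy.
have /diff_locallyP[dfc _] := df.
by apply/diff_locallyP; rewrite (diff_unique dfc key).
Qed.

Lemma deriveDl V W (f : V -> W) (x u v : V) : differentiable f x ->
  'D_(u + v) f x = 'D_u f x + 'D_v f x.
Proof. by move=> df; rewrite !deriveE// linearD. Qed.

Lemma deriveZl V W (f : V -> W) (x v : V) (a : R) : differentiable f x ->
  'D_(a *: v) f x = a *: 'D_v f x.
Proof. by move=> df; rewrite !deriveE// linearZ. Qed.

Lemma derive_suml V W (f : V -> W) (x : V) (I : finType) (F : I -> V) :
  differentiable f x -> 'D_(\sum_i F i) f x = \sum_i 'D_(F i) f x.
Proof. by move=> df; rewrite deriveE// linear_sum; apply: eq_bigr => i _; rewrite deriveE. Qed.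

Lemma derive_coord W n (f : 'rV[R]_n -> W) x v : differentiable f x ->
  'D_v f x = \sum_k v 0 k *: 'D_(delta_mx 0 k) f x.
Proof.
move=> df; rewrite {1}(row_sum_delta v) derive_suml//.
by apply: eq_bigr => k _; rewrite deriveZl.
Qed.

Lemma derive_chain (U V W : normedModType R) (f : V -> W) (g : U -> V) x v :
  differentiable g x -> differentiable f (g x) ->
  'D_v (f \o g) x = 'D_('D_v g x) f (g x).
Proof.
move=> dg df; rewrite !deriveE//; last exact: differentiable_comp.
by rewrite diff_comp.
Qed.

(** Gives access to the one-variable results: derivative of the square root, mean value theorem,
    comparison of slices. *)
Lemma derive_line V W (f : V -> W) x v : 'D_v f x = 'D_1 (fun h : R => f (h *: v + x)) 0.
Proof.
rewrite /derive; set g1 := fun h => h^-1 *: _; set g2 := fun h => h^-1 *: _.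
suff -> : g1 = g2 by [].
by rewrite funeqE /g1 /g2 => h /=; rewrite addr0 scale0r add0r [_%:A]mulr1.
Qed.

Lemma differentiable_mxP V m n (f : V -> 'M[R]_(m, n)) x :
  differentiable f x <-> forall i j, differentiable (fun y => f y i j : R^o) x.
Proof.
split=> [df i j|df].
  apply: (@differentiable_comp _ _ _ _ f (fun N : 'M[R]_(m, n) => N i j : R^o)) => //.
  exact: differentiable_coord.
have -> : f = \sum_(i < m) \sum_(j < n) (fun y => (f y i j : R^o) *: delta_mx i j).
  apply/funext => y; rewrite {1}(matrix_sum_delta (f y)) fct_sumE.
  by apply: eq_bigr => i _; rewrite fct_sumE.
apply: differentiable_sum => i; apply: differentiable_sum => j.
exact: differentiableZl.
Qed.

Lemma derive_mxE V m n (f : V -> 'M[R]_(m, n)) x v i j : derivable f x v ->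
  ('D_v f x) i j = 'D_v (fun y => f y i j : R^o) x.
Proof. by move=> df; rewrite derive_mx// mxE. Qed.

Lemma differentiable_is_derive V W (f : V -> W) x v :
  differentiable f x -> is_derive x v f ('D_v f x).
Proof. by move=> df; apply: derivableP; exact: diff_derivable. Qed.

Lemma continuous_mxP (T : topologicalType) m n (f : T -> 'M[R]_(m, n)) x :
  {for x, continuous f} <-> forall i j, {for x, continuous (fun y => f y i j : R^o)}.
Proof.
split=> [cf i j|cf].
  by apply: (@continuous_comp _ _ _ f (fun N : 'M[R]_(m, n) => N i j : R^o)) => //;
    exact: coord_continuous.
apply/cvgrPdist_le => e e0.
have : \forall t \near x, forall i j, `|f x i j - f t i j| <= e.
  apply: filter_forall => i; apply: filter_forall => j.
  by have /cvgrPdist_le /(_ e e0) := cf i j.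
apply: filterS => t h; rewrite [leLHS]/Num.Def.normr/= mx_normrE.
by rewrite (bigmax_le _ (ltW e0))// => -[i j] _; rewrite !mxE.
Qed.

Lemma is_derive_prod V m (f : 'I_m -> V -> R^o) (f' : 'I_m -> R) x v :
  (forall i, is_derive x v (f i) (f' i)) ->
  is_derive x v (fun y => \prod_i f i y : R^o)
    (\sum_j \prod_i (if i == j then f' i else f i x)).
Proof.
elim: m f f' => [|m IH] f f' df.
  rewrite big_ord0.
  under eq_fun do rewrite big_ord0.
  exact: is_derive_cst.
have -> : (fun y => \prod_i f i y : R^o) =
  (f ord0 : V -> R^o) * (fun y => \prod_i f (lift ord0 i) y : R^o).
  by apply/funext => y; rewrite big_ord_recl.
have {}IH := IH _ _ (fun i => df (lift ord0 i)).
apply: is_derive_eq.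
rewrite [RHS]big_ord_recl [X in _ = X + _]big_ord_recl eqxx /= [LHS]addrC; congr (_ + _).
  rewrite /GRing.scale /= mulrC; congr (_ * _).
rewrite /GRing.scale /= big_distrr /=; apply: eq_bigr => j _.
rewrite big_ord_recl (negPf (neq_lift _ _)); congr (_ * _).
Qed.

Lemma is_derive_bigsum V (I : finType) (P : pred I) (f : I -> V -> R^o) (f' : I -> R) x v :
  (forall i, P i -> is_derive x v (f i) (f' i)) ->
  is_derive x v (fun y => \sum_(i | P i) f i y : R^o) (\sum_(i | P i) f' i).
Proof.
move=> df; rewrite -(fct_sumE _ P f).
by elim/big_ind2 : _ => [|? ? ? ? ? ?|//]; [exact: is_derive_cst | exact: is_deriveD].
Qed.

(** Jacobi's formula. The derivative of the Leibniz expansion, grouped by the row that is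
    differentiated, is a sum of determinants with one row replaced, and [det_set_row] evaluates each
    of them. *)
Lemma is_derive_det V m (A : 'I_m -> 'I_m -> V -> R^o) (A' : 'M[R]_m) x v :
  (forall i j, is_derive x v (A i j) (A' i j)) ->
  is_derive x v (fun y => \det (\matrix_(i, j) A i j y) : R^o)
    (\tr (A' *m \adj (\matrix_(i, j) A i j x))).
Proof.
move=> dA.
have -> : (fun y => \det (\matrix_(i, j) A i j y) : R^o) =
   (fun y => \sum_(s : 'S_m) (-1) ^+ s * \prod_i A i (s i) y : R^o).
  by apply/funext => y; apply: eq_bigr => s _; congr (_ * _);
    apply: eq_bigr => i _; rewrite mxE.
have -> : \tr (A' *m \adj (\matrix_(i, j) A i j x)) = \sum_(s : 'S_m) (-1) ^+ s *
    \sum_j \prod_i (if i == j then A' i (s i) else A i (s i) x).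
  under [RHS]eq_bigr => s _ do rewrite big_distrr /=.
  rewrite exchange_big /=; apply: eq_bigr => i _.
  have -> : (A' *m \adj (\matrix_(k, j) A k j x)) i i =
      (row i A' *m \adj (\matrix_(k, j) A k j x)) 0 i.
    by rewrite -row_mul [RHS]mxE.
  rewrite -det_set_row; apply: eq_bigr => s _; congr (_ * _).
  by apply: eq_bigr => k _; rewrite !mxE; case: eqP => [->|].
apply: is_derive_bigsum => s _.
have := is_deriveZ ((-1) ^+ s) (is_derive_prod (fun i => dA i (s i))).
exact.
Qed.

Lemma is_derive_minor V m n (J : midx n m) (A : V -> 'M[R]_(m, n)) (A' : 'M[R]_(m, n)) x v :
  (forall i j, is_derive x v (fun y => A y i j : R^o) (A' i j)) ->
  is_derive x v (fun y => minor J (A y) : R^o)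
    (\tr (colsub (val J) A' *m \adj (colsub (val J) (A x)))).
Proof.
move=> dA; have := @is_derive_det V m (fun i k y => A y i (val J k)) (colsub (val J) A') x v.
have e y : \matrix_(i, j) A y i (val J j) = colsub (val J) (A y).
  by apply/matrixP => i k; rewrite !mxE.
rewrite e => h.
have -> : (fun y => minor J (A y) : R^o) = (fun y => \det (\matrix_(i, j) A y i (val J j)) : R^o).
  by apply/funext => y; rewrite e.
by apply: h => i j; rewrite mxE.
Qed.

Lemma is_derive_pairing V m n (deg : 'I_n -> nat) d (A : V -> 'M[R]_(m, n)) (A' : 'M[R]_(m, n)) x v :
  (forall i j, is_derive x v (fun y => A y i j : R^o) (A' i j)) ->
  is_derive x v (fun y => pairing deg d (A y) (A y) : R^o)
    (2 * dpairing deg d (A x) A').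
Proof.
move=> dA; rewrite /pairing /dpairing big_distrr /=.
apply: is_derive_bigsum => J _.
have dJ := is_derive_minor J dA.
apply: is_derive_eq.
by rewrite /GRing.scale /=; ring.
Qed.

End Differentiability.

Section ClassCk.
Context (R : realType).
Implicit Types (V W : normedModType R).

Lemma Ck_subset V W k (U U' : set V) (f : V -> W) : U' `<=` U -> Ck k U f -> Ck k U' f.
Proof.
move=> UU; elim: k f => [|k IH] f /=; first by move=> cf x /UU; exact: cf.
by move=> [df cf]; split=> [x /UU|v]; [exact: df | exact/IH/cf].
Qed.

Lemma Ck_eq V W k (U : set V) (f g : V -> W) : open U -> (forall x, U x -> f x = g x) ->
  Ck k U f -> Ck k U g.
Proof.
move=> oU; elim: k f g => [|k IH] f g fg /= => [cf x Ux|[df cf]].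
  have nfg : \forall y \near x, f y = g y by apply: filterS (open_nbhs_nbhs (conj oU Ux)).
  have : f @ x --> g x by rewrite -fg//; exact: cf.
  apply: cvg_trans; apply: near_eq_cvg; exact: nfg.
have nfg x : U x -> \forall y \near x, f y = g y.
  by move=> Ux; apply: filterS (open_nbhs_nbhs (conj oU Ux)).
split=> [x Ux|v]; first exact: near_eq_differentiable (nfg _ Ux) (df _ Ux).
by apply: IH (cf v) => x Ux; exact/near_eq_derive/nfg.
Qed.

Lemma Ck_continuous V W k (U : set V) (f : V -> W) x : Ck k U f -> U x -> {for x, continuous f}.
Proof. by case: k => [|k] /= => [cf|[df _]] Ux; [exact: cf | exact/differentiable_continuous/df]. Qed.

Lemma CkW V W k (U : set V) (f : V -> W) : Ck k.+1 U f -> Ck k U f.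
Proof.
elim: k f => [|k IH] f; first by move=> [df _] x /df; exact: differentiable_continuous.
by move=> [df cf]; split=> // v; exact/IH/cf.
Qed.

Lemma Ck_mxP V m n k (U : set V) (f : V -> 'M[R]_(m, n)) : open U ->
  Ck k U f <-> forall i j, Ck k U (fun x => f x i j : R^o).
Proof.
move=> oU; elim: k f => [|k IH] f /=.
  split=> [cf i j x Ux|cf x Ux]; first exact: (iffLR (@continuous_mxP R V m n f x) (cf x Ux)).
  by apply: (iffRL (@continuous_mxP R V m n f x)) => i j; exact: cf.
split=> [[df cf] i j|cf].
  split=> [x Ux|v]; first by have /differentiable_mxP := df x Ux.
  have /IH /(_ i j) := cf v; apply: Ck_eq => // x Ux.
  by rewrite derive_mxE//; exact/diff_derivable/df.
have df x : U x -> differentiable f x.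
  by move=> Ux; apply/differentiable_mxP => i j; have [+ _] := cf i j; exact.
split=> // v; apply/IH => i j; have [_ /(_ v)] := cf i j.
apply: Ck_eq => // x Ux; rewrite derive_mxE//; exact/diff_derivable/df.
Qed.

Lemma Ck_cst V W k (U : set V) (w : W) : Ck k U (cst w : V -> W).
Proof.
elim: k w => [|k IH] w /=; first by move=> x _; exact: cst_continuous.
split=> [x _|v]; first exact: differentiable_cst.
have -> : (fun x : V => 'D_v (cst w) x) = cst 0 by apply/funext => x; rewrite derive_cst.
exact: IH.
Qed.

Lemma Ck_add V W k (U : set V) (f g : V -> W) : open U -> Ck k U f -> Ck k U g ->
  Ck k U (fun x => f x + g x).
Proof.
move=> oU; elim: k f g => [|k IH] f g /= => [cf cg x Ux|[df cf] [dg cg]].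
  by apply: cvgD; [exact: cf | exact: cg].
split=> [x Ux|v]; first by apply: differentiableD; [exact: df | exact: dg].
apply: Ck_eq (IH _ _ (cf v) (cg v)) => // x Ux.
by rewrite -[LHS]deriveD//; [exact/diff_derivable/df | exact/diff_derivable/dg].
Qed.

Lemma Ck_mul V k (U : set V) (f g : V -> R^o) : open U -> Ck k U f -> Ck k U g ->
  Ck k U (fun x => f x * g x : R^o).
Proof.
move=> oU; elim: k f g => [|k IH] f g /= => [cf cg x Ux|[df cf] [dg cg]].
  by apply: cvgM; [exact: cf | exact: cg].
have cf' : Ck k U f by apply: CkW.
have cg' : Ck k U g by apply: CkW.
split=> [x Ux|v]; first by apply: differentiableM; [exact: df | exact: dg].
apply: Ck_eq (Ck_add oU (IH _ _ cf' (cg v)) (IH _ _ (cf v) cg')) => // x Ux.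
rewrite [RHS](@deriveM _ _ f g)//; [|exact/diff_derivable/df | exact/diff_derivable/dg].
by rewrite /GRing.scale /= [_ * g x]mulrC.
Qed.

Lemma Ck_sum V W k (U : set V) (I : Type) (r : seq I) (P : pred I) (f : I -> V -> W) : open U ->
  (forall i, P i -> Ck k U (f i)) -> Ck k U (fun x => \sum_(i <- r | P i) f i x).
Proof.
move=> oU cf; rewrite -(fct_sumE r P f).
by elim/big_ind : _ => [|? ? ? ?|//]; [exact: Ck_cst | exact: Ck_add].
Qed.

Lemma Ck_prod V k (U : set V) (I : Type) (r : seq I) (P : pred I) (f : I -> V -> R^o) : open U ->
  (forall i, P i -> Ck k U (f i)) -> Ck k U (fun x => \prod_(i <- r | P i) f i x : R^o).
Proof.
move=> oU cf; elim: r => [|a r IH].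
  under eq_fun do rewrite big_nil.
  exact: (Ck_cst k U (1 : R^o)).
under eq_fun do rewrite big_cons.
by have [Pa|//] := boolP (P a); apply: Ck_mul => //; exact: cf.
Qed.

Lemma Ck_det V m k (U : set V) (A : V -> 'M[R]_m) : open U -> Ck k U A ->
  Ck k U (fun x => \det (A x) : R^o).
Proof.
move=> oU /(Ck_mxP _ _ oU) cA; apply: Ck_sum => // s _.
apply: Ck_mul => //; first exact: (Ck_cst k U ((-1) ^+ s : R^o)).
by apply: Ck_prod => // i _; exact: cA.
Qed.

(** For scalar [f], the chain rule in coordinates writes the derivative of the composite as a finite
    sum of products, to which the induction hypothesis and [Ck_mul] apply. *)
Lemma Ck_comp V n k (U : set V) (O : set 'rV[R]_n) (f : 'rV[R]_n -> R^o) (g : V -> 'rV[R]_n) :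
  open U -> (forall x, U x -> O (g x)) -> Ck k U g -> Ck k O f -> Ck k U (f \o g).
Proof.
move=> oU UO; elim: k f => [|k IH] f /= => [cg cf x Ux|[dg cg] [df cf]].
  by apply: continuous_comp; [exact: cg | exact/cf/UO].
have cg' : Ck k U g by apply: CkW.
split=> [x Ux|v]; first by apply: differentiable_comp; [exact: dg | exact/df/UO].
apply: (@Ck_eq _ _ _ _ (fun x => \sum_(j < n) 'D_v g x 0 j * 'D_(delta_mx 0 j) f (g x) : R^o)) => //.
  move=> x Ux; rewrite (derive_chain v (dg x Ux) (df _ (UO x Ux))).
  by rewrite [RHS]derive_coord//; exact/df/UO.
apply: Ck_sum => // j _; apply: Ck_mul => //.
  by have /(Ck_mxP _ _ oU) := cg v; exact.
exact: (IH _ cg' (cf _)).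
Qed.

Lemma Ck_comp_mx V n p q k (U : set V) (O : set 'rV[R]_n) (f : 'rV[R]_n -> 'M[R]_(p, q))
    (g : V -> 'rV[R]_n) : open U -> open O -> (forall x, U x -> O (g x)) ->
  Ck k U g -> Ck k O f -> Ck k U (f \o g).
Proof.
move=> oU oO UO cg /(Ck_mxP _ _ oO) cf; apply/(Ck_mxP _ _ oU) => i j.
exact: (Ck_comp oU UO cg (cf i j)).
Qed.

Lemma Ck_inv V k (U : set V) (f : V -> R^o) : open U -> (forall x, U x -> f x != 0) ->
  Ck k U f -> Ck k U (fun x => (f x)^-1 : R^o).
Proof.
move=> oU f0; elim: k => [|k IH] cf; first by move=> x Ux; apply: cvgV; [exact: f0 | exact: cf].
have [df dcf] := cf.
split=> [x Ux|v]; first by apply: differentiableV; [exact: df | exact: f0].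
have cV := IH (CkW cf).
apply: (@Ck_eq _ _ _ _ (fun x => (- 1) * ((f x)^-1 * (f x)^-1) * 'D_v f x : R^o)) => //.
  move=> x Ux; rewrite [RHS](@deriveV _ _ f)//; [|exact: f0|exact/diff_derivable/df].
  by rewrite /GRing.scale /= mulN1r -invfM expr2.
by apply: Ck_mul (dcf v) => //; apply: Ck_mul; [| exact: (Ck_cst k U (-1 : R^o)) | exact: Ck_mul].
Qed.

Lemma is_derive_sqrt V (f : V -> R^o) x v (f' : R) : 0 < f x -> is_derive x v f f' ->
  is_derive x v (fun y => Num.sqrt (f y) : R^o) (f' / (2 * Num.sqrt (f x))).
Proof.
move=> fx0 [df dfE].
pose F := fun h : R => f (h *: v + x) : R^o.
have F0 : F 0 = f x by rewrite /F scale0r add0r.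
have dF : is_derive (0 : R) (1 : R) F f'.
  split; first exact: (iffLR (derivable1P f x v) df).
  by rewrite -derive_line.
have dS : is_derive (F 0) (1 : R) (Num.sqrt : R -> R) (2 * Num.sqrt (F 0))^-1.
  by apply: is_derive1_sqrt; rewrite F0.
have := @is_derive1_comp _ Num.sqrt F 0 _ _ dS dF.
rewrite F0 => -[dSF dSFE]; split; first exact: (iffRL (derivable1P (fun y => Num.sqrt (f y) : R^o) x v) dSF).
by rewrite derive_line mulrC.
Qed.

Lemma differentiable_sqrt V (f : V -> R^o) x : 0 < f x -> differentiable f x ->
  differentiable (fun y => Num.sqrt (f y) : R^o) x.
Proof.
move=> fx0 df; apply: (@differentiable_comp _ _ _ _ f (Num.sqrt : R^o -> R^o)) => //.
by apply/derivable1_diffP; have [] := is_derive1_sqrt fx0.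
Qed.

Lemma Ck_sqrt V k (U : set V) (f : V -> R^o) : open U -> (forall x, U x -> 0 < f x) ->
  Ck k U f -> Ck k U (fun x => Num.sqrt (f x) : R^o).
Proof.
move=> oU f0; elim: k => [|k IH] cf.
  by move=> x Ux; apply: (@continuous_comp _ _ _ f Num.sqrt); [exact: cf | exact: sqrt_continuous].
have [df dcf] := cf.
split=> [x Ux|v]; first by apply: differentiable_sqrt; [exact: f0 | exact: df].
have cS := IH (CkW cf).
apply: (@Ck_eq _ _ _ _ (fun x => 'D_v f x * (2 * Num.sqrt (f x))^-1 : R^o)) => //.
  move=> x Ux; have dfx : is_derive x v f ('D_v f x) by exact/differentiable_is_derive/df.
  by have [_ ->] := is_derive_sqrt (f0 x Ux) dfx.
apply: Ck_mul => //; first exact: dcf.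
apply: Ck_inv => //.
  by move=> x Ux; rewrite mulf_neq0// gt_eqF// sqrtr_gt0 f0.
by apply: Ck_mul => //; exact: (Ck_cst k U (2 : R^o)).
Qed.

Lemma is_derive_line V W (g : V -> W) y w (a : R) : differentiable g (y + a *: w) ->
  is_derive a (1 : R) (fun b : R => g (y + b *: w)) ('D_w g (y + a *: w)).
Proof.
move=> dg.
have dl : differentiable (fun b : R => y + b *: w) a.
  by apply: differentiableD => //; exact: differentiableZl.
split.
  apply/diff_derivable.
  exact: (@differentiable_comp _ _ _ _ (fun b : R => y + b *: w) g).
rewrite derive_line [RHS]derive_line.
set g1 := (X in derive X _ _ = _); set g2 := (X in _ = derive X _ _).
suff -> : g1 = g2 by [].
by apply/funext => b; rewrite /g1 /g2 [b *: _]mulr1 scalerDl addrCA addrC.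
Qed.

Lemma MVT_closed (f df : R -> R) (a b : R) : a < b ->
  (forall x, a <= x <= b -> is_derive x (1 : R) f (df x)) ->
  exists2 c, a <= c <= b & f b - f a = df c * (b - a).
Proof.
move=> ab dF; have [||c cab ->] := @MVT R f df a b ab.
- by move=> x; rewrite in_itv /= => /andP[/ltW ax /ltW xb]; apply: dF; rewrite ax.
- apply: derivable_within_continuous => x; rewrite in_itv /= => xab.
  by have [] := dF x xab.
by exists c => //; move: cab; rewrite in_itv /= => /andP[/ltW -> /ltW ->].
Qed.

(* The mean value theorem, applied twice. *)
Lemma second_difference V (U : set V) (f : V -> R^o) x u v (r : R) :
  (forall a b : R, `|a| <= r -> `|b| <= r -> U (x + a *: u + b *: v)) ->
  (forall y, U y -> differentiable f y) ->
  (forall y, U y -> differentiable (fun z => 'D_v f z : R^o) y) ->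
  forall h : R, 0 < h <= r -> exists a b : R, [/\ `|a| <= r, `|b| <= r &
    f (x + h *: u + h *: v) - f (x + h *: u) - f (x + h *: v) + f x =
    'D_u (fun z => 'D_v f z : R^o) (x + a *: u + b *: v) * h * h].
Proof.
move=> Ur df ddf h /andP[h0 hr].
have hin (a : R) : 0 <= a <= h -> `|a| <= r.
  by move=> /andP[a0 ah]; rewrite ger0_norm// (le_trans ah).
have hh : `|h| <= r by apply: hin; rewrite lexx ltW.
have h00 : `|0 : R| <= r by apply: hin; rewrite lexx ltW.
pose phi b := f (x + h *: u + b *: v) - f (x + b *: v) : R.
have dphi b : 0 <= b <= h -> is_derive b (1 : R) phi
   ('D_v f (x + h *: u + b *: v) - 'D_v f (x + b *: v)).
  move=> bh; apply: is_deriveB.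
    by apply: is_derive_line; apply: df; apply: Ur => //; exact: hin.
  apply: is_derive_line; apply: df.
  by have := Ur 0 b; rewrite scale0r addr0; apply => //; exact: hin.
have [b bh eb] := MVT_closed h0 dphi.
pose psi a := 'D_v f (x + b *: v + a *: u) : R.
have dpsi a : 0 <= a <= h -> is_derive a (1 : R) psi
   ('D_u (fun z => 'D_v f z : R^o) (x + b *: v + a *: u)).
  move=> ah; apply: is_derive_line; apply: ddf; rewrite addrAC; apply: Ur; exact: hin.
have [a ah ea] := MVT_closed h0 dpsi.
exists a, b; split; [exact: hin | exact: hin |].
move: ea eb; rewrite /psi /phi !subr0 !scale0r !addr0 => ea eb.
rewrite -[x + a *: u + b *: v]addrAC -ea.
rewrite [x + b *: v + h *: u]addrAC -eb.
by ring.
Qed.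

Lemma near_plane V (P : set V) x u v : (\forall y \near x, P y) ->
  exists2 r : R, 0 < r & forall a b : R, `|a| <= r -> `|b| <= r -> P (x + a *: u + b *: v).
Proof.
move=> /nbhs_ballP[e /= e0 eP]; pose D := 1 + `|u| + `|v|.
have D0 : 0 < D by rewrite /D -addrA ltr_pwDl// addr_ge0.
(* The displacement has norm at most [e / 2 / D * (|u| + |v|)], and [D] exceeds [|u| + |v|]; the
   summand 1 of [D] keeps it positive. *)
exists (e / 2 / D); first by rewrite !divr_gt0.
move=> a b ar br; apply: eP; rewrite -ball_normE /ball_ /= -addrA opprD addNKr normrN.
apply: le_lt_trans (ler_normD _ _) _; rewrite !normrZ.
have le1 : `|a| * `|u| <= e / 2 / D * `|u| by rewrite ler_wpM2r.
have le2 : `|b| * `|v| <= e / 2 / D * `|v| by rewrite ler_wpM2r.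
apply: (le_lt_trans (lerD le1 le2)); rewrite -mulrDr -mulrA mulrC.
have : D^-1 * (`|u| + `|v|) <= 1.
  by rewrite ler_pdivrMl// mulr1 /D -addrA lerDr.
move=> le3; apply: (@le_lt_trans _ _ (1 * (e / 2))); first by rewrite ler_wpM2r// ltW// divr_gt0.
by rewrite mul1r ltr_pdivrMr// ltr_pMr// ltr1n.
Qed.

Lemma cancel_sq (r X Y A B : R) : r != 0 -> X = A * r * r -> Y = B * r * r -> X = Y -> A = B.
Proof. by move=> r0 -> -> /(mulIf r0)/(mulIf r0). Qed.

Lemma close_half (e A B A' B' : R) : `|A - A'| <= e / 2 -> `|B - B'| <= e / 2 -> A' = B' ->
  `|A - B| <= e.
Proof.
move=> h1 h2 AB; rewrite [e]splitr -(subrK A' A) -addrA.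
by apply: le_trans (ler_normD _ _) _; rewrite lerD// AB distrC.
Qed.

(** Schwarz. On a small parallelogram at [x], the same second difference equals [r * r] times either
    mixed derivative at some point of it; by continuity each of these values is within [e / 2] of
    the value at [x]. *)
Lemma derive_swap V (U : set V) (f : V -> R^o) x u v : open U -> Ck 2 U f -> U x ->
  'D_u (fun z => 'D_v f z : R^o) x = 'D_v (fun z => 'D_u f z : R^o) x.
Proof.
move=> oU [df cf] Ux; have [dfu cfu] := cf u; have [dfv cfv] := cf v.
apply/eqP; rewrite -subr_eq0 -normr_le0; apply/ler_addgt0Pr => e e0; rewrite add0r.
have e20 : 0 < e / 2 by rewrite divr_gt0.
have near_x : \forall y \near x, [/\ U y,
    `|'D_u (fun z => 'D_v f z : R^o) x - 'D_u (fun z => 'D_v f z : R^o) y| <= e / 2 &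
    `|'D_v (fun z => 'D_u f z : R^o) x - 'D_v (fun z => 'D_u f z : R^o) y| <= e / 2].
  have h1 := open_nbhs_nbhs (conj oU Ux).
  have /cvgrPdist_le /(_ _ e20) h2 := cfv u x Ux.
  have /cvgrPdist_le /(_ _ e20) h3 := cfu v x Ux.
  by apply: filterS3 h1 h2 h3 => y p1 p2 p3; exact: (And3 p1 p2 p3).
have [r r0 rP] := near_plane u v near_x.
have Ur (a b : R) : `|a| <= r -> `|b| <= r -> U (x + a *: u + b *: v).
  by move=> ar br; have [] := rP a b ar br.
have Ur' (a b : R) : `|a| <= r -> `|b| <= r -> U (x + a *: v + b *: u).
  by move=> ar br; rewrite addrAC; exact: Ur.
have rr : 0 < r <= r by rewrite r0 lexx.
have [a [b [ar br e1]]] := second_difference Ur df dfv rr.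
have [a' [b' [ar' br' e2]]] := second_difference Ur' df dfu rr.
have [_ le1 _] := rP a b ar br.
have [_ _] := rP b' a' br' ar'; rewrite addrAC => le2.
have rn0 : r != 0 by rewrite gt_eqF.
apply: (close_half le1 le2); apply: (cancel_sq rn0 e1 e2).
by rewrite [x + r *: v + r *: u]addrAC; ring.
Qed.

End ClassCk.

(** * Lebesgue measure on R^n and integration in charts *)

Section AsSigmaFinite.
Context d (T : measurableType d) (R : realType) (mu : {measure set T -> \bar R}).
Hypothesis sf : sigma_finite setT mu.

(** A copy of [mu] that carries the proof of sigma-finiteness, so that the corresponding structure
    can be attached to it. *)
Definition as_sigma_finite of sigma_finite setT mu : set T -> \bar R := mu.

HB.instance Definition _ := Measure.on (as_sigma_finite sf).

HB.instance Definition _ :=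
  Measure_isSigmaFinite.Build _ _ _ (as_sigma_finite sf) sf.

End AsSigmaFinite.

Section BorelMeasurability.
Context (R : realType).

Lemma borel_open (T : ptopologicalType) (U : set (borel T)) : @open T U -> measurable U.
Proof. by move=> oU; apply: sub_sigma_algebra. Qed.

Lemma borel_closed (T : ptopologicalType) (U : set (borel T)) : @closed T U -> measurable U.
Proof. move=> cU; rewrite -[U]setCK; apply: measurableC; apply: borel_open.
exact: closed_openC. Qed.

Lemma continuous_preimage_open (T T' : topologicalType) (D : set T) (f : T -> T') (U : set T') :
  open D -> (forall x, D x -> {for x, continuous f}) -> open U -> open (D `&` f @^-1` U).
Proof.
move=> oD cf oU; rewrite openE => x [Dx Ufx].
apply: filterI; first exact: open_nbhs_nbhs.
exact: (cf x Dx _ (open_nbhs_nbhs (conj oU Ufx))).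
Qed.

Lemma continuous_borel_measurable (T T' : ptopologicalType) (D : set T) (f : T -> T') :
  open D -> (forall x, D x -> {for x, continuous f}) ->
  measurable_fun (D : set (borel T)) (f : borel T -> borel T').
Proof.
move=> oD cf; apply: (@measurability _ _ (borel T) (borel T') D f (@open T')) => //.
move=> _ [U oU <-]; apply: borel_open; exact: continuous_preimage_open.
Qed.

Lemma continuous_real_measurable (T : ptopologicalType) (D : set T) (f : T -> R) :
  open D -> (forall x, D x -> {for x, continuous f}) ->
  measurable_fun (D : set (borel T)) (f : borel T -> R).
Proof.
move=> oD cf; apply: (measurability _ (RGenOpens.measurableE R)).
move=> _ [_ [a [b ->]] <-]; apply: borel_open; apply: continuous_preimage_open => //.
Qed.

(** The product sigma-algebra contains the Borel sets of R^(n+1), because an open set is a countable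
    union of boxes. *)
Lemma measurable_row_cons n :
  measurable_fun setT (fun z : measurableTypeR R * borel 'rV[R]_n =>
    (row_mx (z.1%:M : 'rV[R]_1) z.2 : borel 'rV[R]_n.+1)).
Proof.
apply: (@measurability _ _ _ (borel 'rV[R]_n.+1) _ _ (@open 'rV[R]_n.+1)) => //.
move=> _ [U oU <-]; rewrite setTI.
pose phi (z : measurableTypeR R * borel 'rV[R]_n) : 'rV[R]_n.+1 := row_mx (z.1%:M : 'rV[R]_1) z.2.
pose box (i : rat * 'rV[rat]_n * nat) : set (measurableTypeR R * borel 'rV[R]_n) :=
  [set a : R | `|ratr i.1.1 - a| < i.2.+1%:R^-1] `*`
  [set x : 'rV[R]_n | `|map_mx ratr i.1.2 - x| < i.2.+1%:R^-1].
(* Rational centres and radii [1 / (k + 1)] make the indices countable; a box that leaves the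
   preimage of [U] is replaced by the empty set. *)
pose F i := if `[< box i `<=` phi @^-1` U >] then box i else set0.
have -> : phi @^-1` U = \bigcup_i F i.
  apply/seteqP; split=> [[a x] /= Uax|z [i _]]; last first.
    by rewrite /F; case: asboolP => // bU /bU.
  have /nbhs_ballP[e /= e0 eU] := open_nbhs_nbhs (conj oU Uax).
  have [N Ne] : exists N : nat, (N.+1%:R^-1 : R) < e / 2.
    have [k] := @ltr_add_invr R 0 (e / 2) (divr_gt0 e0 (ltr0Sn _ 1)).
    by rewrite add0r => ke; exists k.
  have N0 : 0 < (N.+1%:R^-1 : R) by rewrite invr_gt0 ltr0n.
  have approx (b : R) : exists q : rat, `|ratr q - b| < N.+1%:R^-1.
    have [q] : exists q : rat, ratr q \in `]b - N.+1%:R^-1, b + N.+1%:R^-1[.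
      by apply: rat_in_itvoo; rewrite ltrBlDr -addrA ltrDl addr_gt0.
    by rewrite in_itv /= -ltr_distlC distrC => qb; exists q.
  have [q qa] := approx a.
  have [c cx] : exists c : 'rV[rat]_n, `|map_mx ratr c - x| < N.+1%:R^-1.
    have [c cP] := choice (fun j => approx (x 0 j)).
    exists (\row_j c j).
    rewrite [ltLHS]/Num.Def.normr/= mx_normrE; apply/bigmax_ltP; split => // -[i j] _ /=.
    by rewrite !mxE !ord1; exact: cP.
  exists (q, c, N) => //; rewrite /F; case: asboolP => [_|]; first by split.
  case=> -[b y] [/= bq yc]; apply: eU; rewrite -ball_normE /ball_ /=.
  have hb : `|a - b| < e.
    rewrite -(subrKA (ratr q)); apply: le_lt_trans (ler_normD _ _) _.
    rewrite [ltRHS]splitr ltrD//; first by rewrite distrC (lt_trans qa).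
    by rewrite (lt_trans bq).
  have hy : `|x - y| < e.
    rewrite -(subrKA (map_mx ratr c)); apply: le_lt_trans (ler_normD _ _) _.
    rewrite [ltRHS]splitr ltrD//; first by rewrite distrC (lt_trans cx).
    by rewrite (lt_trans yc).
  rewrite [ltLHS]/Num.Def.normr/= mx_normrE; apply/bigmax_ltP; split => // -[i j] _ /=.
  rewrite /phi !mxE /=; case: splitP => k _.
    by rewrite !mxE !ord1 eqxx !mulr1n.
  apply: le_lt_trans hy; rewrite [leRHS]/Num.Def.normr/= mx_normrE.
  by apply: le_trans (le_bigmax _ _ (i, k)); rewrite !mxE.
apply: countable_bigcupT_measurable; first exact: countableP.
move=> i; rewrite /F; case: asboolP => // _; apply: measurableX.
  have -> : [set a : R | `|ratr i.1.1 - a| < i.2.+1%:R^-1] = ball (ratr i.1.1 : R) i.2.+1%:R^-1.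
    by rewrite -ball_normE.
  by apply: open_measurable; exact: ball_open.
apply: borel_open.
have -> : [set x : 'rV[R]_n | `|map_mx ratr i.1.2 - x| < i.2.+1%:R^-1] =
    ball (map_mx ratr i.1.2 : 'rV[R]_n) i.2.+1%:R^-1 by rewrite -ball_normE.
exact: ball_open.
Qed.

(** The translated measure has the same value on half-open intervals, hence it is the Lebesgue
    measure. *)
Lemma lebesgue_shift (v : R) (f : R -> \bar R) : measurable_fun setT f -> (forall x, 0 <= f x)%E ->
  (\int[@lebesgue_measure R]_x f ((x : R) + v)%R = \int[@lebesgue_measure R]_x f x)%E.
Proof.
move=> mf f0.
have ms : measurable_fun setT (fun x : measurableTypeR R => (x + v : measurableTypeR R)).
  exact: measurable_funD.
pose nu : {measure set (measurableTypeR R) -> \bar R} :=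
  measure_function_pushforward__canonical__measure_function_Measure (@lebesgue_measure R) ms.
transitivity (\int[nu]_x f x)%E.
  by rewrite [RHS](ge0_integral_pushforward ms)// preimage_setT.
apply: eq_measure_integral => A mA _; apply/esym/lebesgue_measure_unique => // X.
move=> [[a b] _ <-]; rewrite /nu /= /pushforward.
have -> : (fun x => x + v) @^-1` `]a, b] = `]a - v, b - v]%classic.
  by apply/seteqP; split => x /=; rewrite !in_itv /= ltrBlDr lerBrDr.
rewrite !lebesgue_measure_itv /= !lte_fin ltrD2r; case: ifP => // _.
by rewrite -!EFinB opprB addrA subrK.
Qed.

(** [lebesgue_int] is a functional on nonnegative functions. Integrability, dominated convergence
    and signed integrals require a measure that represents it. *)
Definition is_lebesgue n (l : {sigma_finite_measure set (borel 'rV[R]_n) -> \bar R}) : Prop :=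
  [/\ forall f : borel 'rV[R]_n -> \bar R, measurable_fun setT f -> (forall x, 0 <= f x)%E ->
        lebesgue_int f = (\int[l]_x f x)%E,
      forall r : R, (l [set x : 'rV[R]_n | (`|x| <= r)%R] < +oo)%E
    & forall (v : 'rV[R]_n) (f : borel 'rV[R]_n -> \bar R), measurable_fun setT f ->
        (forall x, 0 <= f x)%E -> (\int[l]_x f (x + v)%R = \int[l]_x f x)%E].

Lemma closed_ball_measurable n (r : R) :
  measurable ([set x : 'rV[R]_n | `|x| <= r] : set (borel 'rV[R]_n)).
Proof.
apply: borel_closed.
have -> : [set x : 'rV[R]_n | `|x| <= r] = (fun x => `|x|) @^-1` [set y | y <= r] by [].
by apply: closed_comp => [x _|]; [exact: norm_continuous | exact: closed_le].
Qed.

Lemma measurable_shift n (v : 'rV[R]_n) :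
  measurable_fun setT (fun x : borel 'rV[R]_n => (x + v : borel 'rV[R]_n)).
Proof.
apply: (continuous_borel_measurable (f := fun x : 'rV[R]_n => x + v)) => [|x _].
  exact: openT.
exact: (cvgD cvg_id (cvg_cst v)).
Qed.

(** By induction: the product of the Lebesgue measure on the line and of the measure in dimension
    [n], pushed forward to row vectors. Tonelli's theorem identifies its integral with the iterated
    one. *)
Lemma lebesgue_exists n :
  exists l : {sigma_finite_measure set (borel 'rV[R]_n) -> \bar R}, is_lebesgue l.
Proof.
elim: n => [|n [l [lint lfin ltrans]]].
  exists (\d_(0 : borel 'rV[R]_0)); split=> [f mf f0|r|v f mf f0].
  - by rewrite integral_dirac// diracT mul1e.
  - by rewrite /= diracE ltry.
  - rewrite !integral_dirac// ?diracT ?mul1e; first by rewrite !thinmx0.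
    by under eq_fun => x do rewrite [_ + _]thinmx0 -[0](thinmx0 x).
have mphi := @measurable_row_cons n.
pose phi (z : measurableTypeR R * borel 'rV[R]_n) : borel 'rV[R]_n.+1 := row_mx (z.1%:M : 'rV[R]_1) z.2.
pose P : {measure set (measurableTypeR R * borel 'rV[R]_n) -> \bar R} :=
  (@lebesgue_measure R \x l)%E.
pose l0 : {measure set (borel 'rV[R]_n.+1) -> \bar R} :=
  measure_function_pushforward__canonical__measure_function_Measure P mphi.
have l0fin (r : R) : (l0 [set x : 'rV[R]_n.+1 | (`|x| <= r)%R] < +oo)%E.
  have mI : measurable ([set a : R | `|a| <= r] : set (measurableTypeR R)).
    have -> : [set a : R | `|a| <= r] = `[- r, r]%classic.
      by apply/seteqP; split => x /=; rewrite in_itv /= ler_norml.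
    exact: measurable_itv.
  have mB : measurable ([set a : R | `|a| <= r] `*` [set x : 'rV[R]_n | `|x| <= r]
       : set (measurableTypeR R * borel 'rV[R]_n)).
    by apply: measurableX => //; exact: closed_ball_measurable.
  apply: (@le_lt_trans _ _ (P ([set a : R | `|a| <= r] `*` [set x : 'rV[R]_n | `|x| <= r]))).
    rewrite -[leLHS]/(P (phi @^-1` [set x : 'rV[R]_n.+1 | (`|x| <= r)%R])).
    apply: le_measure; rewrite ?inE//.
      rewrite -[X in measurable X]setTI.
      exact: (@measurable_row_cons n measurableT _ (closed_ball_measurable r)).
    move=> [a x] /= h.
    have hij j : `|(row_mx (a%:M : 'rV[R]_1) x) 0 j| <= r.
      apply: le_trans h; rewrite [leRHS]/Num.Def.normr/= mx_normrE.
      by apply: le_trans (le_bigmax _ _ (0, j)).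
    have r0 : 0 <= r by apply: le_trans h.
    split=> /=.
      by have := hij (lshift n 0); rewrite row_mxEl mxE eqxx mulr1n.
    rewrite [leLHS]/Num.Def.normr/= mx_normrE; apply/bigmax_leP; split => // -[i j] _ /=.
    by rewrite ord1; have := hij (rshift 1 j); rewrite row_mxEr.
  rewrite [ltLHS](product_measure1E (@lebesgue_measure R) l mI (closed_ball_measurable r)).
  apply: lte_mul_pinfty => //.
    rewrite fin_numElt; apply/andP; split; first exact: lt_le_trans (measure_ge0 _ _).
    have -> : [set a : R | `|a| <= r] = `[- r, r]%classic.
      by apply/seteqP; split => x /=; rewrite in_itv /= ler_norml.
    rewrite [ltLHS](lebesgue_measure_itv `[(- r)%R, r]) /=.
    by case: ifP => _; rewrite ?ltry.
have sf0 : sigma_finite setT l0.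
  exists (fun k => [set x : 'rV[R]_n.+1 | `|x| <= k%:R]).
    apply/seteqP; split => // x _; exists (Num.bound `|x|) => //=.
    exact/ltW/archi_boundP.
  by move=> k; split; [exact: closed_ball_measurable | exact: l0fin].
pose l1 : {sigma_finite_measure set (borel 'rV[R]_n.+1) -> \bar R} := as_sigma_finite sf0.
have l1E (f : borel 'rV[R]_n.+1 -> \bar R) : measurable_fun setT f -> (forall x, 0 <= f x)%E ->
    (\int[l1]_x f x = \int[@lebesgue_measure R]_a \int[l]_x f (row_mx (a%:M : 'rV[R]_1) x))%E.
  move=> mf f0; rewrite -[LHS]/(\int[pushforward P phi]_x f x)%E.
  rewrite (ge0_integral_pushforward mphi)// preimage_setT.
  apply: (@fubini_tonelli1 _ _ _ _ R (@lebesgue_measure R) l (f \o phi)) => [|z].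
    exact: (measurableT_comp mf mphi).
  exact: f0.
have msec (f : borel 'rV[R]_n.+1 -> \bar R) a : measurable_fun setT f ->
    measurable_fun setT (fun x : borel 'rV[R]_n => f (row_mx (a%:M : 'rV[R]_1) x)).
  move=> mf; apply: (measurableT_comp mf).
  exact: (measurableT_comp mphi (pair1_measurable a)).
exists l1; split=> [f mf f0|//|v f mf f0].
  rewrite l1E//=; apply: eq_integral => a _; apply: lint => //; exact: msec.
rewrite (l1E _ mf f0) l1E => [|| x]; last 2 first.
- exact: (measurableT_comp mf (measurable_shift v)).
- exact: f0.
(* A translation moves the first coordinate and the others separately: the induction hypothesis
   treats the inner integral and [lebesgue_shift] the outer one. *)
have vE (a : R) (x : 'rV[R]_n) : row_mx (a%:M : 'rV[R]_1) x + v =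
    row_mx ((a + v 0 0)%:M : 'rV[R]_1) (x + rsubmx (v : 'rV[R]_(1 + n))).
  rewrite -[in LHS](hsubmxK (v : 'rV[R]_(1 + n))) add_row_mx; congr row_mx.
  apply/rowP => j; rewrite !mxE !ord1 eqxx !mulr1n; congr (_ + v _ _).
  exact: val_inj.
under eq_integral => a _.
  under eq_integral => x _ do rewrite vE.
  rewrite (ltrans _ (fun x => f (row_mx ((a + v 0 0)%:M : 'rV[R]_1) x)))//; last exact: msec.
  over.
apply: (lebesgue_shift (v 0 0) (f := fun a => (\int[l]_x f (row_mx (a%:M : 'rV[R]_1) x))%E)).
  apply: (@measurable_fun_fubini_tonelli_F _ _ _ _ R l (f \o phi)) => [|z]; last exact: f0.
  exact: (measurableT_comp mf mphi).
by move=> a; exact: integral_ge0.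
Qed.

End BorelMeasurability.

(** * Change of variables for an integral over a set *)

Section Transfer.
Local Open Scope ereal_scope.
Context d1 d2 (X : measurableType d1) (Y : measurableType d2) (R : realType).
Context (l : {measure set X -> \bar R}) (mu : {measure set Y -> \bar R}).
Context (A : set X) (B : set Y) (psi : X -> Y) (rho : X -> R).
Hypothesis mA : measurable A.
Hypothesis mB : measurable B.
Hypothesis mpsi : measurable_fun A psi.
Hypothesis psiAB : forall x, A x -> B (psi x).
Hypothesis mrho : measurable_fun A rho.
Hypothesis rho0 : forall x, A x -> (0 <= rho x)%R.
Hypothesis muE : forall C, measurable C -> C `<=` B ->
  mu C = \int[l]_(x in A) (\1_C (psi x) * rho x)%:E.

Import HBNNSimple.

(** [muE] is the case of an indicator function; linearity gives simple functions and monotone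
    convergence the rest. *)
Lemma ge0_integral_transfer (f : Y -> \bar R) : measurable_fun B f ->
  (forall y, B y -> 0 <= f y) ->
  \int[mu]_(y in B) f y = \int[l]_(x in A) (f (psi x) * (rho x)%:E).
Proof.
move=> mf f0; pose f_ := nnsfun_approx mB mf.
have mf_ n : measurable_fun A (fun x => f_ n (psi x)).
  by apply: (measurable_comp measurableT) => //; exact: measurable_funP.
have step n : \int[mu]_(y in B) (f_ n y)%:E = \int[l]_(x in A) ((f_ n (psi x))%:E * (rho x)%:E).
  have fE y : (f_ n y)%:E = \sum_(r \in range (f_ n)) (r * \1_(f_ n @^-1` [set r]) y)%:E.
    by rewrite fsumEFin// -fimfunE.
  under eq_integral do rewrite fE.
  rewrite ge0_integral_fsum//; last 2 first.
  - by move=> r; exact/measurable_EFinP/measurable_funM.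
  - by move=> r y By; rewrite nnfun_muleindic_ge0.
  under [RHS]eq_integral => x _.
    rewrite fE ge0_mule_fsuml; last by move=> r; rewrite nnfun_muleindic_ge0.
    over.
  rewrite ge0_integral_fsum//; last 2 first.
  - move=> r; apply/emeasurable_funM; last exact/measurable_EFinP.
    apply/measurable_EFinP/measurable_funM => //.
    by apply: (measurable_comp measurableT) => //.
  - move=> r x Ax; rewrite mule_ge0// ?nnfun_muleindic_ge0// lee_fin; exact: rho0.
  apply: eq_fsbigr => r /[!inE] -[y0 _ ry0]; rewrite integralZl_indic_nnsfun// integral_indic//.
  have r0 : (0 <= r)%R by rewrite -ry0.
  rewrite muE; [|exact: measurableI|by move=> y []].
  rewrite -ge0_integralZl_EFin//.
  - apply: eq_integral => x /[!inE] Ax; rewrite -!EFinM mulrA; congr (_ * _ * _)%:E.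
    by rewrite !indicE in_setI [psi x \in B]mem_set ?andbT//; exact: psiAB.
  - by move=> x Ax; rewrite lee_fin mulr_ge0//; exact: rho0.
  - apply/measurable_EFinP/measurable_funM => //.
    apply: (measurable_comp measurableT) => //.
    by apply: measurable_indic; exact: measurableI.
have f_cvg y : B y -> (f_ n y)%:E @[n --> \oo] --> f y.
  by move=> By; exact: cvg_nnsfun_approx.
transitivity (limn (fun n => \int[mu]_(y in B) (f_ n y)%:E)).
  rewrite -monotone_convergence//.
  - by apply: eq_integral => y /[!inE] By; apply/esym/cvg_lim => //; exact: f_cvg.
  - by move=> n; exact/measurable_EFinP/measurable_funTS.
  - by move=> n y _; rewrite lee_fin.
  - by move=> y _ a b ab; rewrite lee_fin; exact/lefP/nd_nnsfun_approx.
rewrite (_ : (fun n => _) = (fun n => \int[l]_(x in A) ((f_ n (psi x))%:E * (rho x)%:E))); last first.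
  by apply/funext => n; exact: step.
rewrite -monotone_convergence//.
- apply: eq_integral => x /[!inE] Ax; apply/cvg_lim => //.
  by apply: cvgeZr => //; exact/f_cvg/psiAB.
- by move=> n; apply: emeasurable_funM; exact/measurable_EFinP.
- by move=> n x Ax; rewrite mule_ge0// lee_fin//; exact: rho0.
- move=> x Ax a b ab; apply: lee_wpmul2r; first by rewrite lee_fin; exact: rho0.
  by rewrite lee_fin; exact/lefP/nd_nnsfun_approx.
Qed.

Lemma integral_transfer (f : Y -> \bar R) : measurable_fun B f ->
  \int[mu]_(y in B) f y = \int[l]_(x in A) (f (psi x) * (rho x)%:E).
Proof.
move=> mf; rewrite integralE [RHS]integralE; congr (_ - _).
  rewrite ge0_integral_transfer//; last exact: measurable_funepos.
  apply: eq_integral => x /[!inE] Ax; rewrite !funeposE.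
  by rewrite maxe_pMl ?mul0e// lee_fin; exact: rho0.
rewrite ge0_integral_transfer//; last exact: measurable_funeneg.
apply: eq_integral => x /[!inE] Ax; rewrite !funenegE -mulNe.
by rewrite maxe_pMl ?mul0e// lee_fin; exact: rho0.
Qed.

End Transfer.

(** * Differentiation under the integral sign *)

Section UnderIntegral.
Context d (T : measurableType d) (R : realType) (l : {measure set T -> \bar R}).
Context (A : set T) (mA : measurable A) (lA : (l A < +oo)%E).

Lemma bounded_integrable (f : T -> R) (C : R) : measurable_fun A f ->
  (forall x, A x -> `|f x| <= C) -> l.-integrable A (EFin \o f).
Proof.
move=> mf fC; apply: measurable_bounded_integrable => //.
exists C; split; first exact: num_real.
by move=> M CM x Ax /=; rewrite (le_trans (fC x Ax))// ltW.
Qed.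

(** Differentiability and the Lipschitz bound are asked at time 0 alone, since the area density may
    fail to be differentiable at other times. That [f'] is measurable and integrable is a
    conclusion: it is a pointwise limit of difference quotients bounded by [C] on a set of finite
    measure. *)
Lemma is_derive_under_integral (f : R -> T -> R) (f' : T -> R) (r C : R) : 0 < r ->
  (forall t, `|t| < r -> l.-integrable A (EFin \o f t)) ->
  (forall x, A x -> is_derive (0 : R) (1 : R) (f ^~ x : R -> R) (f' x)) ->
  (forall t x, `|t| < r -> A x -> `|f t x - f 0 x| <= C * `|t|) ->
  l.-integrable A (EFin \o f') /\
  is_derive (0 : R) (1 : R) (fun t : R => \int[l]_(x in A) f t x : R) (\int[l]_(x in A) f' x).
Proof.
move=> r0 intf df fC.
have int0 : l.-integrable A (EFin \o f 0) by apply: intf; rewrite normr0.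
pose q (h : R) x := h^-1 * (f h x - f 0 x).
have intq h : `|h| < r -> l.-integrable A (EFin \o q h).
  move=> hr; have -> : EFin \o q h = (fun x => (h^-1)%:E * ((EFin \o f h) x - (EFin \o f 0%R) x))%E.
    by apply/funext => x; rewrite /q /= EFinM EFinB.
  by apply: integrableZl => //; apply: integrableB => //; exact: intf.
have qC h x : `|h| < r -> h != 0 -> A x -> `|q h x| <= C.
  move=> hr h0 Ax; rewrite /q normrM normfV ler_pdivrMl ?normr_gt0//.
  by rewrite mulrC; exact: fC.
have intC : l.-integrable A (EFin \o cst C).
  by apply: (@bounded_integrable _ `|C|) => // x _; rewrite /cst.
have qlim x : A x -> q h x @[h --> 0^'] --> f' x.
  move=> Ax; have [dfx <-] := df x Ax.
  have := dfx; rewrite /derivable /derive => /cvg_ex[/= y fy].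
  have -> : lim ((fun h : R => h^-1 *: (f (h *: 1 + 0) x - f 0 x)) @ 0^') = y.
    exact/cvg_lim.
  apply: cvg_trans fy; apply: near_eq_cvg; near=> h.
  by rewrite /q addr0 [h *: 1]mulr1.
(* Dominated convergence is available for sequences, and the limit at 0 is tested on sequences. *)
have main (u : R^nat) : (forall n, u n != 0) -> (forall n, `|u n| < r) ->
    u n @[n --> \oo] --> (0 : R) ->
    l.-integrable A (EFin \o f') /\
    \int[l]_(x in A) q (u n) x @[n --> \oo] --> \int[l]_(x in A) f' x.
  move=> un0 unr u0.
  have mq n : measurable_fun A (EFin \o q (u n)) by exact: (measurable_int _ (intq _ (unr n))).
  have cq x : A x -> (q (u n) x)%:E @[n --> \oo] --> (f' x)%:E.
    move=> Ax; apply: cvg_EFin; first exact: nearW.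
    by have /cvgr_dnbhsP := qlim x Ax; apply; split.
  have mf' : measurable_fun A (EFin \o f') by apply: (emeasurable_fun_cvg _ _ mq cq).
  have [? _ h] := @dominated_convergence _ _ _ l _ mA (fun n x => (q (u n) x)%:E) (EFin \o f')
    (EFin \o cst C) mq mf' (aeW _ cq) intC (aeW _ (fun x n Ax => (qC _ x (unr n) (un0 n) Ax))).
  split=> //; apply: fine_cvg.
  by rewrite fineK// integrable_fin_num.
have intf' : l.-integrable A (EFin \o f').
  (* Any sequence of nonzero times below [r] that tends to 0 will do here. *)
  have [] // := main (fun n => r / 2 * n.+1%:R^-1).
  - by move=> n; rewrite mulf_neq0// gt_eqF// divr_gt0.
  - move=> n; rewrite ger0_norm; last by rewrite mulr_ge0// ltW// divr_gt0.
    rewrite (@le_lt_trans _ _ (r / 2))//; last by rewrite ltr_pdivrMr// ltr_pMr// ltr1n.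
    by rewrite ler_piMr ?(ltW (divr_gt0 r0 _))// invf_le1 ?ltr0n// ler1n.
  - by rewrite -(mulr0 (r / 2)); apply: cvgMr; exact: cvg_harmonic.
split=> //.
pose F (t : R) := \int[l]_(x in A) f t x : R.
have key : h^-1 *: (F (h *: 1 + 0) - F 0) @[h --> 0^'] --> \int[l]_(x in A) f' x.
  apply/cvgr_dnbhsP => u [un0 u0].
  have [N _ uN] := (cvgr0_norm_lt _ u0) _ r0.
  (* The bounds hold for [|t| < r] only, so the sequence is started late enough. *)
  have uN0 : u (n + N)%N @[n --> \oo] --> (0 : R) by rewrite (cvg_shiftn N).
  have [_ h] := main (fun n => u (n + N)%N) (fun n => un0 _) (fun n => uN _ (leq_addl _ _)) uN0.
  rewrite -(cvg_shiftn N); apply: cvg_trans h; last first.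
  apply: near_eq_cvg; near=> n.
  rewrite /= /F addr0 [_ *: 1]mulr1 -RintegralB//; last exact/intf/uN/leq_addl.
  rewrite -[RHS]RintegralZl//.
  have -> : (EFin \o (fun x => f (u (n + N)%N) x - f 0 x)) =
     (fun x => (EFin \o f (u (n + N)%N)) x - (EFin \o f 0%R) x)%E by apply/funext => x.
  by apply: integrableB => //; apply: intf; apply: uN; exact: leq_addl.
split; first by apply/cvg_ex; exists (\int[l]_(x in A) f' x).
exact/cvg_lim.
Unshelve. all: by end_near. Qed.

End UnderIntegral.

Section LebesgueDerivative.
Context (R : realType) (n : nat) (l : {sigma_finite_measure set (borel 'rV[R]_n) -> \bar R}).
Hypothesis lL : is_lebesgue l.

Lemma mvt_bound (g g' : R -> R) (r C : R) :
  (forall s, `|s| < r -> is_derive s (1 : R) g (g' s)) ->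
  (forall s, `|s| < r -> `|g' s| <= C) ->
  forall t, `|t| < r -> `|g t - g 0| <= C * `|t|.
Proof.
move=> dg gC t tr; have [t0|t0|->] := ltgtP t 0; last by rewrite subrr normr0 mulr0.
- have tin x : t <= x <= 0 -> `|x| < r.
    move=> /andP[tx x0]; apply: le_lt_trans tr.
    by rewrite !ler0_norm ?lerN2// ltW.
  have [c /tin cr e] := MVT_closed t0 (fun x xt => dg x (tin x xt)).
  by rewrite distrC e sub0r normrM normrN ler_wpM2r// gC.
- have tin x : 0 <= x <= t -> `|x| < r.
    move=> /andP[x0 xt]; apply: le_lt_trans tr.
    by rewrite !ger0_norm// ltW.
  have [c /tin cr e] := MVT_closed t0 (fun x xt => dg x (tin x xt)).
  by rewrite e subr0 normrM ler_wpM2r// gC.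
Qed.

Lemma lebesgue_integral_shift (v : 'rV[R]_n) (f : borel 'rV[R]_n -> \bar R) :
  measurable_fun setT f -> (\int[l]_x f (x + v)%R = \int[l]_x f x)%E.
Proof.
have [_ _ lshift] := lL.
move=> mf; rewrite integralE [RHS]integralE; congr (_ - _)%E.
  rewrite -(lshift v (f^\+)%E (measurable_funepos mf) (funepos_ge0 f)).
  by apply: eq_integral => x _; rewrite !funeposE.
rewrite -(lshift v (f^\-)%E (measurable_funeneg mf) (funeneg_ge0 f)).
by apply: eq_integral => x _; rewrite !funenegE.
Qed.

Lemma Rintegral_support (D D' : set (borel 'rV[R]_n)) (f : 'rV[R]_n -> R) :
  (forall x, ~ D x -> f x = 0) -> (forall x, ~ D' x -> f x = 0) ->
  \int[l]_(x in D) f x = \int[l]_(x in D') f x.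
Proof.
move=> fD fD'; rewrite Rintegral_mkcond [RHS]Rintegral_mkcond; apply: eq_Rintegral => x _.
by rewrite /patch; case: ifPn => [|/negP]; rewrite inE => xD; case: ifPn => [|/negP];
  rewrite inE => xD' //; [rewrite fD' | rewrite fD].
Qed.

Lemma closed_ball_compact (r : R) : compact [set x : 'rV[R]_n | `|x| <= r].
Proof.
apply: bounded_closed_compact.
  exists r; split; first exact: num_real.
  by move=> M rM x /= xr; rewrite (le_trans xr)// ltW.
have -> : [set x : 'rV[R]_n | `|x| <= r] = (fun x => `|x|) @^-1` [set y | y <= r] by [].
by apply: closed_comp => [x _|]; [exact: norm_continuous | exact: closed_le].
Qed.

Lemma continuous_bounded_support (f : 'rV[R]_n -> R) (r : R) :
  continuous f -> (forall x, r < `|x| -> f x = 0) -> exists C, forall x, `|f x| <= C.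
Proof.
move=> cf f0.
have [||c _ cP] := @EVT_max_rV R n (fun x => `|f x|) [set x | `|x| <= `|r|] _ (@closed_ball_compact _).
- by exists 0; rewrite /= normr0.
- apply: continuous_subspaceT => x.
  exact: (@continuous_comp _ _ _ f (@Num.norm _ R) x (cf x) (@norm_continuous _ R _)).
exists `|f c| => x; have [xr|xr] := leP `|x| `|r|; first by apply: cP; rewrite inE.
by rewrite f0 ?normr0//; apply: le_lt_trans xr; exact: ler_norm.
Qed.

(** The integral of [phi (x + t *: v)] does not depend on [t], by translation invariance; its
    derivative at [t = 0], taken under the integral sign, is the integral of ['D_v phi]. *)
Lemma integral_derive_eq0 (phi : 'rV[R]_n -> R^o) (v : 'rV[R]_n) (r : R) (D : set (borel 'rV[R]_n)) :
  (forall x, differentiable phi x) -> continuous (fun x => 'D_v phi x : R^o) ->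
  (forall x, r < `|x| -> phi x = 0) -> (forall x, ~ D x -> 'D_v phi x = 0) ->
  \int[l]_(x in D) 'D_v phi x = 0 :> R.
Proof.
move=> dphi cphi phi0 dphiD; have [_ lfin _] := lL.
have dphi0 x : r < `|x| -> 'D_v phi x = 0.
  move=> xr; rewrite -[RHS](derive_cst (0 : R^o) x v); apply: near_eq_derive.
  have : open [set y : 'rV[R]_n | r < `|y|].
    have -> : [set y : 'rV[R]_n | r < `|y|] = (fun x => `|x|) @^-1` [set y | r < y] by [].
    by apply: open_comp => [y _|]; [exact: norm_continuous | exact: open_gt].
  by move=> o; apply: filterS (open_nbhs_nbhs (conj o xr)) => y /phi0.
(* A ball of finite measure that contains the supports of all translates with [|t| < 1]. *)
pose B : set (borel 'rV[R]_n) := [set x : 'rV[R]_n | `|x| <= r + `|v|].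
have phiB t x : `|t| < 1 -> ~ B x -> phi (x + t *: v) = 0.
  move=> t1 /negP; rewrite -ltNge => xr; apply: phi0.
  have : `|x| <= `|x + t *: v| + `|t *: v| by rewrite -{1}(addrK (t *: v) x) ler_normB.
  move=> h; rewrite -(ltrD2r `|t *: v|); apply: lt_le_trans h; apply: le_lt_trans xr.
  by rewrite lerD2l normrZ ler_piMl// ltW.
rewrite (@Rintegral_support D B)//; last first.
  move=> x /negP; rewrite -ltNge => xr; apply: dphi0; apply: le_lt_trans xr.
  by rewrite lerDl.
have [C CP] := continuous_bounded_support cphi dphi0.
have [C' C'P] := continuous_bounded_support (fun x => differentiable_continuous (dphi x)) phi0.
have mB : measurable B := closed_ball_measurable _.
have cphit t : continuous (fun x : 'rV[R]_n => phi (x + t *: v)).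
  move=> x; have h1 : {for x, continuous (fun x : 'rV[R]_n => x + t *: v)}.
    exact: (cvgD cvg_id (cvg_cst _)).
  exact: (continuous_comp h1 (differentiable_continuous (dphi _))).
have mphi t : measurable_fun setT (fun x : borel 'rV[R]_n => phi (x + t *: v) : R).
  apply: (@continuous_real_measurable R 'rV[R]_n setT) => [|x _]; [exact: openT | exact: cphit].
have intt t : l.-integrable B (EFin \o (fun x => phi (x + t *: v) : R)).
  apply: (@bounded_integrable _ _ _ l B mB (lfin _) _ C') => [|x _]; last exact: C'P.
  exact: measurable_funTS.
have dt x s : is_derive s (1 : R) (fun t : R => phi (x + t *: v) : R) ('D_v phi (x + s *: v)).
  exact: is_derive_line.
have [_ dint] := @is_derive_under_integral _ _ _ l B mB (lfin _)
  (fun t x => phi (x + t *: v)) (fun x => 'D_v phi x) 1 C ltr01 (fun t _ => intt t)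
  (fun x _ => is_derive_eq (dt x 0) (congr1 (fun y => 'D_v phi y) (etrans (congr1 (+%R x) (scale0r v)) (addr0 x))))
  (fun t x t1 _ => @mvt_bound _ (fun s => 'D_v phi (x + s *: v)) 1 C (fun s _ => dt x s) (fun s _ => CP _) t t1).
have [_ <-] := dint.
rewrite -[RHS](derive_cst (\int[l]_x phi x : R^o) (0 : R) (1 : R)).
apply: near_eq_derive.
exists 1 => //= t; rewrite /ball_ /= sub0r normrN => t1.
rewrite (@Rintegral_support B setT); [|by move=> x xB; exact: phiB|by move=> x /(_ I)].
rewrite /cst /Rintegral; congr fine.
have mphi0 : measurable_fun setT (fun x : borel 'rV[R]_n => (phi x)%:E).
  apply/measurable_EFinP; apply: (@continuous_real_measurable R 'rV[R]_n setT) => [|x _].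
    exact: openT.
  exact: differentiable_continuous.
exact: (lebesgue_integral_shift (t *: v) mphi0).
Qed.

End LebesgueDerivative.

Section ChartIntegral.
Context (R : realType) (m : nat) (M : manifold R m).
Context (l : {sigma_finite_measure set (borel 'rV[R]_m) -> \bar R}).
Hypothesis lL : is_lebesgue l.

Lemma chart_compact_image (c : chart R m M) (C : set M) : compact C -> C `<=` cdom c ->
  compact (cmap c @` C).
Proof.
move=> cC Cc; apply: continuous_compact cC; apply: continuous_in_subspaceT => x /[!inE] Cx.
exact/cmap_continuous/Cc.
Qed.

Definition density (h : M -> 'rV[R]_m -> 'rV[R]_m -> R) (c : chart R m M) (x : 'rV[R]_m) : R :=
  Num.sqrt (\det (\matrix_(i, j) form_in_chart h c (delta_mx 0 i) (delta_mx 0 j) x)).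

(** [is_riemannian_measure] gives the measure of Borel sets inside a chart, which is the hypothesis
    [muE] of the change of variables. *)
Lemma chart_integral (h : M -> 'rV[R]_m -> 'rV[R]_m -> R)
    (mu : {measure set (borel M) -> \bar R}) (p : M) (C : set (borel M)) (f : borel M -> \bar R) :
  is_riemannian_measure h mu -> compact (C : set M) -> C `<=` cdom (chart_at p) ->
  measurable_fun (cmap (chart_at p) @` C : set (borel 'rV[R]_m)) (density h (chart_at p)) ->
  measurable_fun C f ->
  (\int[mu]_(q in C) f q =
   \int[l]_(x in (cmap (chart_at p) @` C : set (borel 'rV[R]_m)))
     (f (cinv (chart_at p) x) * (density h (chart_at p) x)%:E))%E.
Proof.
set c := chart_at p => muP cC Cc md mf; have [lint _ _] := lL.
have oU : open (cmap c @` cdom c) := @cimg_open _ _ _ c.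
have AU : cmap c @` C `<=` cmap c @` cdom c by apply: image_subset.
have mU : measurable (cmap c @` cdom c : set (borel 'rV[R]_m)) by exact: borel_open.
have mA : measurable (cmap c @` C : set (borel 'rV[R]_m)).
  by apply: borel_closed; apply: compact_closed; [exact: norm_hausdorff | exact: chart_compact_image].
have mC : measurable C by apply: borel_closed; apply: compact_closed => //; exact: mhausdorff.
have mpsi : measurable_fun (cmap c @` C : set (borel 'rV[R]_m)) (cinv c : _ -> borel M).
  apply: (measurable_funS mU AU); apply: (continuous_borel_measurable oU) => x.
  exact: cinv_continuous.
have psiAB x : (cmap c @` C) x -> C (cinv c x).
  by move=> [q Cq <-]; rewrite cmapK//; exact: Cc.
apply: integral_transfer => //; first by move=> x _; exact: sqrtr_ge0.
move=> B mB BC; rewrite (muP p)//; last exact: subset_trans Cc.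
have indE x : (cmap c @` C) x -> \1_(cmap c @` B) x = \1_B (cinv c x) :> R.
  move=> [q Cq <-]; rewrite cmapK; last exact: Cc.
  rewrite !indicE; congr (_%:R); congr nat_of_bool; apply/idP/idP; rewrite !inE.
    by move=> [q' Bq' e]; rewrite -(cmapK (Cc _ Cq)) -e cmapK//; exact/Cc/BC.
  by move=> Bq; exists q.
(* The density is known to be measurable on the image of [C] only; the extension by zero is the
   function in the definition of the measure, since [B] lies in [C]. *)
pose F : borel 'rV[R]_m -> R := (fun x => \1_B (cinv c x) * density h c x) \_ (cmap c @` C).
have FE : (fun x : 'rV[R]_m => (\1_(cmap c @` B) x * density h c x)%:E) = EFin \o F.
  apply/funext => x; rewrite /F /= /patch; case: ifPn => [/[!inE] Ax|/negP].
    by rewrite indE.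
  rewrite inE => Ax; rewrite indicE memNset ?mul0r// => -[q Bq qx]; apply: Ax.
  by exists q => //; exact: BC.
have mF : measurable_fun setT F.
  apply/(measurable_restrictT _ _).1 => //; apply: measurable_funM => //.
  by apply: (measurableT_comp _ mpsi); exact: measurable_indic.
rewrite [LHS](_ : _ = lebesgue_int (EFin \o F)); last by rewrite -FE.
rewrite lint//; last 2 first.
- exact/measurable_EFinP.
- by move=> x; rewrite -FE lee_fin mulr_ge0// sqrtr_ge0.
rewrite [RHS]integral_mkcond; apply: eq_integral => x _; rewrite /F /= /patch.
by case: ifP.
Qed.

End ChartIntegral.

(** * The first variation in coordinates *)

Section CovariantCalculus.
Context (R : realType) (n : nat) (gam : 'I_n -> 'I_n -> 'rV[R]_n -> R^o).

Definition coef_form (y a b : 'rV[R]_n) : R :=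
  \sum_i \sum_j a 0 i * b 0 j * gam i j y.

Lemma coef_form_linear y c a a' b :
  coef_form y (c *: a + a') b = c * coef_form y a b + coef_form y a' b.
Proof.
rewrite /coef_form big_distrr -big_split; apply: eq_bigr => i _ /=.
rewrite big_distrr -big_split; apply: eq_bigr => j _ /=.
by rewrite !mxE; ring.
Qed.

Context (y0 : 'rV[R]_n) (ch : 'rV[R]_n -> 'rV[R]_n -> 'rV[R]_n).
Hypothesis dgam : forall i j, differentiable (gam i j) y0.
Hypothesis gam_sym : forall i j, gam i j y0 = gam j i y0.
Hypothesis ch_sym : forall u v, ch u v = ch v u.
Hypothesis ch_linear : forall c u u' v, ch (c *: u + u') v = c *: ch u v + ch u' v.
Hypothesis compat : forall u a b : 'rV[R]_n,
  \sum_i \sum_j a 0 i * b 0 j * 'D_u (gam i j) y0 =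
  coef_form y0 (ch u a) b + coef_form y0 a (ch u b).

Lemma coef_form_sym a b : coef_form y0 a b = coef_form y0 b a.
Proof.
rewrite /coef_form exchange_big; apply: eq_bigr => i _; apply: eq_bigr => j _.
by rewrite gam_sym [a 0 _ * _]mulrC.
Qed.

Let g0 := coef_form y0.

Let g0_linear : forall c a a' b, g0 (c *: a + a') b = c * g0 a b + g0 a' b.
Proof. exact: coef_form_linear. Qed.

(** Covariant derivative of the field [Y] along [f]. As [ch] stands for the Christoffel symbols at
    the one point [y0], it has this meaning where [f z0 = y0]. *)
Definition cder (V : normedModType R) (f Y : V -> 'rV[R]_n) (z0 w : V) : 'rV[R]_n :=
  'D_w Y z0 + ch ('D_w f z0) (Y z0).

(** The product rule leaves a term with the derivative of the coefficients along [f], which [compat]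
    converts into the two Christoffel terms. *)
Lemma is_derive_coef_form (V : normedModType R) (f Y Z : V -> 'rV[R]_n) z0 w :
  f z0 = y0 -> differentiable f z0 -> differentiable Y z0 -> differentiable Z z0 ->
  is_derive z0 w (fun z => coef_form (f z) (Y z) (Z z) : R^o)
    (g0 (cder f Y z0 w) (Z z0) + g0 (Y z0) (cder f Z z0 w)).
Proof.
move=> fz0 df dY dZ.
have dcoord (T : V -> 'rV[R]_n) i : differentiable T z0 ->
    is_derive z0 w (fun z => T z 0 i : R^o) (('D_w T z0) 0 i).
  move=> dT; rewrite derive_mxE; last exact: diff_derivable.
  by apply: differentiable_is_derive; have /differentiable_mxP := dT.
have dg i j : is_derive z0 w (fun z => gam i j (f z) : R^o) ('D_('D_w f z0) (gam i j) y0).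
  rewrite -{1}fz0 -derive_chain//; last by rewrite fz0.
  by apply: differentiable_is_derive; apply: differentiable_comp => //; rewrite fz0.
apply: is_derive_eq.
  apply: is_derive_bigsum => i _; apply: is_derive_bigsum => j _.
  exact: (is_deriveM (is_deriveM (dcoord _ i dY) (dcoord _ j dZ)) (dg i j)).
have e1 : g0 (cder f Y z0 w) (Z z0) = g0 ('D_w Y z0) (Z z0) + g0 (ch ('D_w f z0) (Y z0)) (Z z0).
  by rewrite /cder -{1}['D_w Y z0]scale1r g0_linear mul1r.
have e2 : g0 (Y z0) (cder f Z z0 w) = g0 (Y z0) ('D_w Z z0) + g0 (Y z0) (ch ('D_w f z0) (Z z0)).
  rewrite /g0 coef_form_sym -/g0 /cder -{1}['D_w Z z0]scale1r g0_linear mul1r.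
  by congr (_ + _); exact: coef_form_sym.
have := compat ('D_w f z0) (Y z0) (Z z0) => e3.
rewrite e1 e2 addrACA -/(g0 _ _) in e3 *.
rewrite -e3 /g0 /coef_form -!big_split; apply: eq_bigr => i _ /=.
rewrite -!big_split; apply: eq_bigr => j _ /=.
by rewrite !fctE fz0 /GRing.scale /=; ring.
Qed.

Lemma cder_chain (V : normedModType R) (f : V -> 'rV[R]_n) (X : 'rV[R]_n -> 'rV[R]_n) z0 w :
  f z0 = y0 -> differentiable f z0 -> differentiable X y0 ->
  cder f (X \o f) z0 w = cder id X y0 ('D_w f z0).
Proof.
move=> fz0 df dX; rewrite /cder derive_chain//; last by rewrite fz0.
by rewrite fz0 /= derive_id fz0.
Qed.

Lemma cderD (V : normedModType R) (f Y Z : V -> 'rV[R]_n) z0 w :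
  differentiable Y z0 -> differentiable Z z0 ->
  cder f (fun z => Y z + Z z) z0 w = cder f Y z0 w + cder f Z z0 w.
Proof.
move=> dY dZ; rewrite /cder.
have -> : 'D_w (fun z => Y z + Z z) z0 = 'D_w Y z0 + 'D_w Z z0.
  by rewrite -deriveD//; exact: diff_derivable.
rewrite ch_sym -{1}[Y z0]scale1r ch_linear scale1r !(ch_sym _ ('D_w f z0)).
by rewrite addrACA.
Qed.

Lemma cderZ (V : normedModType R) (f Y : V -> 'rV[R]_n) (a : V -> R^o) z0 w :
  differentiable a z0 -> differentiable Y z0 ->
  cder f (fun z => a z *: Y z) z0 w = 'D_w a z0 *: Y z0 + a z0 *: cder f Y z0 w.
Proof.
move=> da dY; rewrite /cder.
have daY : differentiable (fun z => a z *: Y z) z0.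
  apply/differentiable_mxP => i j.
  have -> : (fun z => (a z *: Y z) i j : R^o) = a * (fun z => Y z i j : R^o).
    by apply/funext => z; rewrite mxE.
  by apply: differentiableM => //; have /differentiable_mxP := dY.
have -> : 'D_w (fun z => a z *: Y z) z0 = 'D_w a z0 *: Y z0 + a z0 *: 'D_w Y z0.
  apply/rowP => j; rewrite derive_mxE; last exact: diff_derivable.
  have -> : (fun z => (a z *: Y z) 0 j : R^o) = a * (fun z => Y z 0 j : R^o).
    by apply/funext => z; rewrite mxE.
  have /differentiable_mxP/(_ 0 j) dYj := dY.
  rewrite deriveM; [|exact: diff_derivable|exact: diff_derivable].
  rewrite !mxE derive_mxE; last exact: diff_derivable.
  by rewrite /GRing.scale /= addrC [Y z0 0 j * _]mulrC.
rewrite ch_sym -{1}[a z0 *: Y z0]addr0 ch_linear (ch_sym (Y z0)).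
have -> : ch 0 ('D_w f z0) = 0.
  by have := ch_linear (-1) 0 0 ('D_w f z0); rewrite scaler0 addr0 scaleN1r addNr.
by rewrite addr0 scalerDr addrA.
Qed.

Lemma cder_near (V : normedModType R) (f Y Z : V -> 'rV[R]_n) z0 w :
  (\forall z \near z0, Y z = Z z) -> cder f Y z0 w = cder f Z z0 w.
Proof.
by move=> YZ; rewrite /cder (near_eq_derive _ YZ) (nbhs_singleton YZ).
Qed.

End CovariantCalculus.

Section ProductDerivatives.
Context (R : realType) (m : nat) (W : normedModType R).
Implicit Types (h : 'rV[R]_m * R^o -> W).

Lemma derive_slice1 h x (t : R^o) v : 'D_v (fun y => h (y, t)) x = 'D_((v, 0) : 'rV[R]_m * R^o) h (x, t).
Proof.
rewrite derive_line [RHS]derive_line.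
set f1 := (X in derive X _ _ = _); set f2 := (X in _ = derive X _ _).
suff -> : f1 = f2 by [].
apply/funext => s; rewrite /f1 /f2; congr h.
have -> : s *: ((v, 0) : 'rV[R]_m * R^o) + (x, t) = (s *: v + x, s *: (0 : R^o) + t) by [].
by rewrite scaler0 add0r.
Qed.

Lemma derive_slice2 h x (t : R^o) : 'D_(1 : R^o) (fun s : R^o => h (x, s)) t = 'D_((0, 1) : 'rV[R]_m * R^o) h (x, t).
Proof.
rewrite derive_line [RHS]derive_line.
set f1 := (X in derive X _ _ = _); set f2 := (X in _ = derive X _ _).
suff -> : f1 = f2 by [].
apply/funext => s; rewrite /f1 /f2; congr h.
have -> : s *: ((0, 1) : 'rV[R]_m * R^o) + (x, t) = (s *: (0 : 'rV[R]_m) + x, s *: (1 : R^o) + t) by [].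
by rewrite scaler0 add0r.
Qed.

Lemma differentiable_slice1 h x (t : R^o) : differentiable h (x, t) -> differentiable (fun y => h (y, t)) x.
Proof.
move=> dh; apply: (@differentiable_comp _ _ _ _ (fun y => (y, t)) h) => //.
Qed.

Lemma differentiable_slice2 h x (t : R^o) : differentiable h (x, t) -> differentiable (fun s : R^o => h (x, s)) t.
Proof.
move=> dh; apply: (@differentiable_comp _ _ _ _ (fun s : R^o => (x, s)) h) => //.
Qed.

End ProductDerivatives.

Section DifferentiableAlgebra.
Context (R : realType) (V : normedModType R).

Lemma differentiable_bigsum (I : Type) (r : seq I) (P : pred I) (W : normedModType R)
    (f : I -> V -> W) x :
  (forall i, P i -> differentiable (f i) x) -> differentiable (fun y => \sum_(i <- r | P i) f i y) x.
Proof.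
move=> df; rewrite -(fct_sumE r P f).
by elim/big_ind : _ => [|? ? ? ?|//]; [exact: differentiable_cst | exact: differentiableD].
Qed.

Lemma differentiable_bigprod (I : Type) (r : seq I) (f : I -> V -> R^o) x :
  (forall i, differentiable (f i) x) -> differentiable (fun y => \prod_(i <- r) f i y : R^o) x.
Proof.
move=> df; elim: r => [|a r IH].
  under eq_fun do rewrite big_nil.
  exact: differentiable_cst.
under eq_fun do rewrite big_cons.
by apply: (@differentiableM _ _ (f a)).
Qed.

Lemma differentiable_det m (A : V -> 'M[R]_m) x :
  (forall i j, differentiable (fun y => A y i j : R^o) x) ->
  differentiable (fun y => \det (A y) : R^o) x.
Proof.
move=> dA; apply: differentiable_bigsum => s _.
apply: (@differentiableM _ _ (cst ((-1) ^+ s : R^o))); first exact: differentiable_cst.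
by apply: differentiable_bigprod.
Qed.

Lemma differentiable_pairing m n (deg : 'I_n -> nat) d (A B : V -> 'M[R]_(m, n)) x :
  (forall i j, differentiable (fun y => A y i j : R^o) x) ->
  (forall i j, differentiable (fun y => B y i j : R^o) x) ->
  differentiable (fun y => pairing deg d (A y) (B y) : R^o) x.
Proof.
move=> dA dB; apply: differentiable_bigsum => J _.
by apply: differentiableM; apply: differentiable_det => i j;
  under eq_fun do rewrite mxE.
Qed.

Lemma differentiable_pairing_row m n (deg : 'I_n -> nat) d (A : V -> 'M[R]_(m, n))
    (y : V -> 'rV[R]_n) x i :
  (forall i j, differentiable (fun y => A y i j : R^o) x) ->
  (forall j, differentiable (fun z => y z 0 j : R^o) x) ->
  differentiable (fun z => pairing_row deg d (A z) (y z) 0 i : R^o) x.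
Proof.
move=> dA dy; under eq_fun do rewrite pairing_rowE.
apply: differentiable_pairing => // k j.
by case: (eqVneq k i) => ki; under eq_fun do rewrite mxE ?ki ?eqxx ?(negPf ki).
Qed.

Lemma is_derive_sqrt_pairing m n (deg : 'I_n -> nat) d (A : V -> 'M[R]_(m, n))
    (A' : 'M[R]_(m, n)) x v :
  (forall i j, is_derive x v (fun y => A y i j : R^o) (A' i j)) ->
  0 < pairing deg d (A x) (A x) ->
  is_derive x v (fun y => Num.sqrt (pairing deg d (A y) (A y)) : R^o)
    (dpairing deg d (A x) A' / Num.sqrt (pairing deg d (A x) (A x))).
Proof.
move=> dA A0; have h1 := is_derive_pairing deg d dA.
apply: (is_derive_eq (@is_derive_sqrt R V (fun y => pairing deg d (A y) (A y)) x v _ A0 h1)).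
by rewrite -mulf_div divff ?mul1r// pnatr_eq0.
Qed.

Lemma derive2_mxE p q (U : set V) (f : V -> 'M[R]_(p, q)) x u v i j : open U -> Ck 2 U f -> U x ->
  'D_u (fun z => 'D_v f z) x i j =
  'D_u (fun z => 'D_v (fun y => f y i j : R^o) z : R^o) x.
Proof.
move=> oU [df cf] Ux; have [dDf _] := cf v.
apply: (etrans (derive_mxE i j (@diff_derivable _ _ _ _ x u (dDf x Ux)))).
apply: near_eq_derive; apply: filterS (open_nbhs_nbhs (conj oU Ux)) => z Uz.
exact: (derive_mxE i j (@diff_derivable _ _ _ _ z v (df z Uz))).
Qed.

Lemma derive_mx_swap p q (U : set V) (f : V -> 'M[R]_(p, q)) x u v : open U -> Ck 2 U f -> U x ->
  'D_u (fun z => 'D_v f z) x = 'D_v (fun z => 'D_u f z) x.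
Proof.
move=> oU cf Ux; apply/matrixP => i j.
have cfj : Ck 2 U (fun z' => f z' i j : R^o) := (iffLR (Ck_mxP 2 f oU) cf) i j.
exact: (etrans (derive2_mxE u v i j oU cf Ux)
  (etrans (derive_swap u v oU cfj Ux) (esym (derive2_mxE v u i j oU cf Ux)))).
Qed.

End DifferentiableAlgebra.

(** A tangent frame completed by a normal one is indexed by [m + (n - m)], which equals [n] but is
    not convertible to it. *)
Lemma mulmx1C_eqdim (R : comUnitRingType) a b (A : 'M[R]_(a, b)) (B : 'M[R]_(b, a)) :
  a = b -> A *m B = 1%:M -> B *m A = 1%:M.
Proof. by move=> eab; case: _ / eab in A B * => /mulmx1C. Qed.

(** * Orthonormal families for a bilinear form *)

Section OrthonormalFrames.
Context (R : realType) (n k : nat) (h : 'rV[R]_n -> 'rV[R]_n -> R).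
Hypothesis hlin : forall a u v w, h (a *: u + v) w = a * h u w + h v w.
Hypothesis hsym : forall u v, h u v = h v u.
Context (Y : 'I_k -> 'rV[R]_n).

Lemma gram_mx (p : nat) (Z : 'I_p -> 'rV[R]_n) :
  (\matrix_i Y i) *m (form_mx h *m (\matrix_i Z i)^T) = \matrix_(i, j) h (Y i) (Z j).
Proof.
apply/matrixP => i j; rewrite mxE [RHS]mxE (formE hlin hsym) -mulmxA mxE.
apply: eq_bigr => l _; rewrite !mxE; congr (_ * _).
by apply: eq_bigr => l' _; rewrite !mxE.
Qed.

Hypothesis Yon : forall i j, h (Y i) (Y j) = (i == j)%:R.

Let YY : (\matrix_i Y i) *m (form_mx h *m (\matrix_i Y i)^T) = 1%:M.
Proof. by rewrite gram_mx; apply/matrixP => i j; rewrite !mxE. Qed.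

Lemma orthonormal_leq : (k <= n)%N.
Proof.
rewrite -(mxrank1 R k) -YY; apply: leq_trans (mxrankM_maxl _ _) _.
exact: rank_leq_col.
Qed.

Lemma orthonormal_basis_decomp : k = n -> forall v, v = \sum_i h v (Y i) *: Y i.
Proof.
move=> kn v; have := mulmx1C_eqdim kn YY => e1.
have e2 : v = (v *m (form_mx h *m (\matrix_i Y i)^T)) *m \matrix_i Y i.
  by rewrite -mulmxA e1 mulmx1.
rewrite {1}e2 mulmx_sum_row; apply: eq_bigr => i _; rewrite rowK; congr (_ *: _).
rewrite (formE hlin hsym) mulmxA !mxE; apply: eq_bigr => l _; rewrite !mxE.
by congr (_ * _).
Qed.

Lemma parseval : k = n -> forall u v, h u v = \sum_i h u (Y i) * h v (Y i).
Proof.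
move=> kn u v; rewrite {1}(orthonormal_basis_decomp kn u) (form_suml hlin).
by apply: eq_bigr => i _; rewrite (formZl hlin) [h (Y i) _]hsym.
Qed.

End OrthonormalFrames.

(** The parts [s] and [t] are the second-order terms, equal by symmetry; what is left is the
    bracket. *)
Lemma bracket_algebra (R : pzRingType) (W : lmodType R) (K : finType) (p q : W) (a b : K -> R)
    (c : K -> W) (s t : W) :
  p = \sum_k a k *: c k + s -> q = \sum_k b k *: c k + t -> s = t ->
  p = q + \sum_k (a k - b k) *: c k.
Proof.
move=> -> -> ->; rewrite [RHS]addrAC -big_split; congr (_ + _); apply: eq_bigr => k _ /=.
by rewrite -scalerDl addrC subrK.
Qed.

Lemma pairing_ge0 (R : realDomainType) m n (deg : 'I_n -> nat) d (A : 'M[R]_(m, n)) : 0 <= pairing deg d A A.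
Proof. by apply: sumr_ge0 => J _; rewrite -expr2 sqr_ge0. Qed.

Lemma scaled_sum_div (R : realFieldType) (I : finType) (u v : I -> R) (D S : R) :
  (D ^+ 2)^-1 * (\sum_i u i * v i) / S = `|D|^-1 * \sum_i (u i / (`|D| * S)) * v i.
Proof.
rewrite -[D ^+ 2]real_normK ?num_real// [_ ^+ 2]expr2 invfM !big_distrr big_distrl.
by apply: eq_bigr => i _ /=; rewrite invfM; ring.
Qed.

Lemma is_derive_inv (R : realType) (V : normedModType R) (f : V -> R^o) x v (f' : R) :
  f x != 0 -> is_derive x v f f' -> is_derive x v (fun y => (f y)^-1 : R^o) (- f x ^- 2 * f').
Proof.
move=> f0 [df dfE]; split; first exact: derivableV.
by rewrite deriveV// dfE.
Qed.

Lemma is_derive_slice2 (R : realType) (V W : normedModType R) (h : V * R^o -> W) x (t : R) l :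
  is_derive ((x, t) : V * R^o) ((0, 1) : V * R^o) h l ->
  is_derive t (1 : R) (fun s : R => h (x, s)) l.
Proof.
have E : (fun r : R => r^-1 *: (((fun s : R => h (x, s)) \o shift t) (r *: (1 : R)) - h (x, t))) =
    (fun r : R => r^-1 *: ((h \o shift ((x, t) : V * R^o)) (r *: ((0, 1) : V * R^o)) - h (x, t))).
  apply/funext => r; congr (_ *: (h _ - _)).
  have -> : shift ((x, t) : V * R^o) (r *: ((0, 1) : V * R^o)) = (r *: (0 : V) + x, r *: (1 : R) + t) by [].
  by rewrite scaler0 add0r.
case=> dh dhE.
split; first by rewrite /derivable E.
by rewrite -dhE /derive E.
Qed.

Section ScalarLinear.
Context (R : pzRingType) (V : lmodType R) (L : V -> R).
Hypothesis LP : forall c u v, L (c *: u + v) = c * L u + L v.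

Lemma scalar_linearD u v : L (u + v) = L u + L v.
Proof. by have := LP 1 u v; rewrite scale1r mul1r. Qed.

Lemma scalar_linear_sum (I : finType) (c : I -> R) (w : I -> V) :
  L (\sum_k c k *: w k) = \sum_k c k * L (w k).
Proof.
have L0 : L 0 = 0 by have := LP (-1) 0 0; rewrite scaler0 addr0 mulN1r addNr.
rewrite (big_morph L scalar_linearD L0); apply: eq_bigr => k _.
by have := LP (c k) (w k) 0; rewrite !addr0 L0 addr0.
Qed.

End ScalarLinear.

Section DivergenceAlgebra.
Context (R : realType) (m p : nat).

Lemma derive_flux_sum (J : 'rV[R]_m -> R^o) (W : 'I_m -> 'rV[R]_m -> R^o)
    (e : 'I_m -> 'rV[R]_m -> 'rV[R]_m) x0 :
  differentiable J x0 -> (forall i, differentiable (W i) x0) ->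
  (forall i k, differentiable (fun x => e i x 0 k : R^o) x0) ->
  \sum_k 'D_(delta_mx 0 k) (fun x => J x * \sum_i W i x * e i x 0 k : R^o) x0 =
  \sum_i (J x0 * 'D_(e i x0) (W i) x0 + W i x0 * 'D_(e i x0) J x0
    + J x0 * W i x0 * \sum_k 'D_(delta_mx 0 k) (fun x => e i x 0 k : R^o) x0).
Proof.
move=> dJ dW de.
(* Existential names hide the derivatives, so that [ring] meets atoms. *)
have [J' J'P] : exists J' : 'I_m -> R, forall k, is_derive x0 (delta_mx 0 k) J (J' k).
  by exists (fun k => 'D_(delta_mx 0 k) J x0) => k; exact: differentiable_is_derive.
have [W' W'P] : exists W' : 'I_m -> 'I_m -> R, forall i k, is_derive x0 (delta_mx 0 k) (W i) (W' i k).
  by exists (fun i k => 'D_(delta_mx 0 k) (W i) x0) => i k; exact: differentiable_is_derive.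
have [e' e'P] : exists e' : 'I_m -> 'I_m -> R, forall i k,
    is_derive x0 (delta_mx 0 k) (fun x => e i x 0 k : R^o) (e' i k).
  by exists (fun i k => 'D_(delta_mx 0 k) (fun x => e i x 0 k : R^o) x0) => i k; exact: differentiable_is_derive.
have DJ i : 'D_(e i x0) J x0 = \sum_k e i x0 0 k * J' k.
  by rewrite derive_coord//; apply: eq_bigr => k _; have [_ ->] := J'P k.
have DW i : 'D_(e i x0) (W i) x0 = \sum_k e i x0 0 k * W' i k.
  by rewrite derive_coord//; apply: eq_bigr => k _; have [_ ->] := W'P i k.
have key k : 'D_(delta_mx 0 k) (fun x => J x * \sum_i W i x * e i x 0 k : R^o) x0 =
    \sum_i (J x0 * (e i x0 0 k * W' i k) + W i x0 * (e i x0 0 k * J' k) + J x0 * W i x0 * e' i k).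
  have h : is_derive x0 (delta_mx 0 k) (fun x => \sum_i W i x * e i x 0 k : R^o)
      (\sum_i (W i x0 * e' i k + e i x0 0 k * W' i k)).
    by apply: is_derive_bigsum => i _; exact: (is_deriveM (W'P i k) (e'P i k)).
  have [_ ->] := is_deriveM (J'P k) h.
  rewrite /GRing.scale /= !big_distrr big_distrl -big_split.
  by apply: eq_bigr => i _ /=; ring.
rewrite (eq_bigr _ (fun k _ => key k)) exchange_big; apply: eq_bigr => i _.
rewrite DJ DW !big_distrr -!big_split; apply: eq_bigr => k _ /=.
by have [_ ->] := e'P i k.
Qed.

Lemma derive_sum_mul (a : 'I_p -> 'rV[R]_m -> R^o) (x : 'I_p -> 'rV[R]_m -> R^o) (b t : 'rV[R]_m -> R^o)
    x0 w :
  (forall j, differentiable (a j) x0) -> (forall j, differentiable (x j) x0) ->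
  differentiable b x0 -> differentiable t x0 ->
  'D_w (fun y => \sum_j a j y * x j y + b y * t y : R^o) x0 =
  \sum_j ('D_w (a j) x0 * x j x0 + a j x0 * 'D_w (x j) x0) + 'D_w b x0 * t x0 + b x0 * 'D_w t x0.
Proof.
move=> da dx db dt.
have [a' a'P] : exists a' : 'I_p -> R, forall j, is_derive x0 w (a j) (a' j).
  by exists (fun j => 'D_w (a j) x0) => j; exact: differentiable_is_derive.
have [x' x'P] : exists x' : 'I_p -> R, forall j, is_derive x0 w (x j) (x' j).
  by exists (fun j => 'D_w (x j) x0) => j; exact: differentiable_is_derive.
have [b' b'P] : exists b' : R, is_derive x0 w b b'.
  by exists ('D_w b x0); exact: differentiable_is_derive.
have [t' t'P] : exists t' : R, is_derive x0 w t t'.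
  by exists ('D_w t x0); exact: differentiable_is_derive.
have h : is_derive x0 w (fun y => \sum_j a j y * x j y : R^o)
    (\sum_j (a j x0 * x' j + x j x0 * a' j)).
  by apply: is_derive_bigsum => j _; exact: (is_deriveM (a'P j) (x'P j)).
have [_ ->] := is_deriveD h (is_deriveM b'P t'P).
have [_ ->] := b'P; have [_ ->] := t'P.
rewrite /GRing.scale /= addrA addrAC [t x0 * _]mulrC; congr (_ + _ + _); apply: eq_bigr => j _.
by have [_ ->] := a'P j; have [_ ->] := x'P j; rewrite addrC [x j x0 * _]mulrC.
Qed.

(** The computation stripped of its analysis. [a] and [b] are the normal and tangent components of
    [V]; primes are derivatives along [e_i]; [P] and [Q] come from the covariant derivatives of the
    [N_j] and of the [T_l], [phiN] and [phiT] from those of the adapted frame; [s] is the coordinate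
    divergence of the frame, [tr] minus the logarithmic derivative of [J], and [c] the Riemannian
    divergence. The first hypothesis makes all terms in [b] cancel. *)
Lemma first_variation_algebra (J Th : R) (a phiN : 'I_p -> R) (b b' Th' c tr s phiT W : 'I_m -> R)
    (xi a' xi' P : 'I_m -> 'I_p -> R) (Q : 'I_m -> 'I_m -> R) :
  (forall l, \sum_i Q i l + phiT l = Th' l + Th * c l) ->
  (forall i, c i = s i - tr i) -> (forall i, W i = \sum_j a j * xi i j + b i * Th) ->
  J * (\sum_i (\sum_j (a' i j * xi i j + a j * P i j) + (b' i * Th + \sum_l b l * Q i l))
       + (\sum_j a j * phiN j + \sum_l b l * phiT l))
  - \sum_i (J * (\sum_j (a' i j * xi i j + a j * xi' i j) + b' i * Th + b i * Th' i)
       + W i * (- J * tr i) + J * W i * s i) =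
  J * \sum_j a j * (- \sum_i (xi' i j + xi i j * c i) + \sum_i P i j + phiN j).
Proof.
move=> H cE WE.
have e1 : \sum_i \sum_l b l * Q i l + \sum_l b l * phiT l = \sum_l b l * (Th' l + Th * c l).
  rewrite exchange_big -big_split; apply: eq_bigr => l _ /=.
  by rewrite -big_distrr /= -mulrDr H.
have e2 : \sum_i (J * (\sum_j (a' i j * xi i j + a j * xi' i j) + b' i * Th + b i * Th' i)
       + W i * (- J * tr i) + J * W i * s i) =
    J * (\sum_i \sum_j a' i j * xi i j + \sum_i \sum_j a j * (xi' i j + xi i j * c i) + \sum_i b' i * Th
      + \sum_l b l * (Th' l + Th * c l)).
  rewrite -!big_split big_distrr; apply: eq_bigr => i _ /=; rewrite WE cE.
  rewrite big_split /=.
  have -> : \sum_j a j * (xi' i j + xi i j * (s i - tr i)) =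
      \sum_j a j * xi' i j + (\sum_j a j * xi i j) * (s i - tr i).
    by rewrite big_distrl -big_split; apply: eq_bigr => j _ /=; rewrite mulrDr mulrA.
  by ring.
rewrite e2 -mulrBr; congr (_ * _).
have -> : \sum_i (\sum_j (a' i j * xi i j + a j * P i j) + (b' i * Th + \sum_l b l * Q i l)) =
   \sum_i \sum_j a' i j * xi i j + \sum_i \sum_j a j * P i j + (\sum_i b' i * Th + \sum_i \sum_l b l * Q i l).
  by rewrite -!big_split; apply: eq_bigr => i _ /=; rewrite big_split.
have -> : \sum_j a j * (- \sum_i (xi' i j + xi i j * c i) + \sum_i P i j + phiN j) =
   - \sum_i \sum_j a j * (xi' i j + xi i j * c i) + \sum_i \sum_j a j * P i j + \sum_j a j * phiN j.
  have E (G : 'I_m -> 'I_p -> R) : \sum_i \sum_j a j * G i j = \sum_j a j * \sum_i G i j.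
    by rewrite exchange_big; apply: eq_bigr => j _; rewrite big_distrr.
  rewrite (E (fun i j => xi' i j + xi i j * c i)) (E P) -sumrN -!big_split.
  by apply: eq_bigr => j _ /=; rewrite !mulrDr mulrN.
by rewrite -e1; ring.
Qed.

End DivergenceAlgebra.

Section EuclideanNorm.
Context (R : rcfType).

(** Controls the area density by the minors even where the density vanishes and the square root is
    not differentiable. The induction step is a triangle inequality in the plane. *)
Lemma sqrt_sum_dist (I : Type) (r : seq I) (P : pred I) (a b : I -> R) :
  `|Num.sqrt (\sum_(i <- r | P i) a i * a i) - Num.sqrt (\sum_(i <- r | P i) b i * b i)| <=
  \sum_(i <- r | P i) `|a i - b i|.
Proof.
elim: r => [|i r IH]; first by rewrite !big_nil subrr normr0.
rewrite !big_cons; case: ifP => // _.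
set A := \sum_(j <- r | P j) a j * a j in IH *; set B := \sum_(j <- r | P j) b j * b j in IH *.
have A0 : 0 <= A by apply: sumr_ge0 => j _; rewrite -expr2 sqr_ge0.
have B0 : 0 <= B by apply: sumr_ge0 => j _; rewrite -expr2 sqr_ge0.
apply: (@le_trans _ _ (`|a i - b i| + `|Num.sqrt A - Num.sqrt B|)); last by rewrite lerD2l.
set s := Num.sqrt (_ + A); set t := Num.sqrt (_ + B).
have s0 : 0 <= s := sqrtr_ge0 _; have t0 : 0 <= t := sqrtr_ge0 _.
have sE : s ^+ 2 = a i ^+ 2 + Num.sqrt A ^+ 2 by rewrite !sqr_sqrtr// addr_ge0// -expr2 sqr_ge0.
have tE : t ^+ 2 = b i ^+ 2 + Num.sqrt B ^+ 2 by rewrite !sqr_sqrtr// addr_ge0// -expr2 sqr_ge0.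
have p0 : 0 <= Num.sqrt A := sqrtr_ge0 _; have q0 : 0 <= Num.sqrt B := sqrtr_ge0 _.
move: sE tE p0 q0 s0 t0; move: s t (Num.sqrt A) (Num.sqrt B) (a i) (b i) => s t p q x y sE tE p0 q0 s0 t0.
have xs : `|x| <= s by rewrite -ler_sqr ?nnegrE// real_normK ?num_real// sE lerDl sqr_ge0.
have yt : `|y| <= t by rewrite -ler_sqr ?nnegrE// real_normK ?num_real// tE lerDl sqr_ge0.
have ps : p <= s by rewrite -ler_sqr ?nnegrE// sE lerDr sqr_ge0.
have qt : q <= t by rewrite -ler_sqr ?nnegrE// tE lerDr sqr_ge0.
have [st0|st0] := eqVneq (s + t) 0.
  have : s = 0 /\ t = 0 by split; lra.
  by move=> [-> ->]; rewrite subrr normr0 addr_ge0.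
have st : 0 < s + t by rewrite lt_def st0 addr_ge0.
(* Multiplying by [s + t] replaces the difference of the norms by differences of squares, which
   factor; each of [|x|], [|y|], [p], [q] is at most the corresponding norm. *)
rewrite -(ler_pM2r st) -{1}(ger0_norm (ltW st)) -normrM.
have -> : (s - t) * (s + t) = (x - y) * (x + y) + (p - q) * (p + q).
  by rewrite -!subr_sqr sE tE; ring.
apply: (le_trans (ler_normD _ _)); rewrite !normrM mulrDl; apply: lerD; apply: ler_wpM2l => //.
  by apply: (le_trans (ler_normD _ _)); exact: lerD.
by rewrite ger0_norm ?addr_ge0// lerD.
Qed.

End EuclideanNorm.

(** The difference quotient of [s] is bounded by the sum of those of the [f i], all of which tend to
    0; [s] may be any function. *)
Lemma is_derive0_dist (R : realType) (I : finType) (P : pred I) (s : R -> R) (f : I -> R -> R) :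
  (forall i, P i -> is_derive (0 : R) (1 : R) (f i) 0) ->
  (forall t, `|s t - s 0| <= \sum_(i | P i) `|f i t - f i 0|) ->
  is_derive (0 : R) (1 : R) s 0.
Proof.
move=> df sf.
have fq i : P i -> h^-1 * (f i h - f i 0) @[h --> 0^'] --> 'D_1 (f i) 0.
  move=> Pi; have [dfi _] := df i Pi.
  have := dfi; rewrite /derivable /derive => /cvg_ex[/= y fy].
  have -> : lim ((fun h : R => h^-1 *: (f i (h *: 1 + 0) - f i 0)) @ 0^') = y by exact/cvg_lim.
  apply: cvg_trans fy; apply: near_eq_cvg; near=> h.
  by rewrite addr0 [h *: 1]mulr1.
have sq : h^-1 * (s h - s 0) @[h --> 0^'] --> (0 : R).
  (* The successor avoids a division by zero when [I] is empty. *)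
  apply/cvgr0Pnorm_le => e e0; pose e' := e / #|I|.+1%:R.
  have e'0 : 0 < e' by rewrite divr_gt0.
  have fe : \forall h \near 0^', forall i, P i -> `|h^-1 * (f i h - f i 0)| <= e'.
    apply: filter_forall => i; case: (boolP (P i)) => [Pi|nPi]; last by near=> h.
    have := fq i Pi; have [_ ->] := df i Pi => /cvgr0_norm_le/(_ _ e'0).
    by apply: filterS => h ? _.
  apply: filterS fe => h fe.
  rewrite normrM; apply: (@le_trans _ _ (`|h^-1| * \sum_(i | P i) `|f i h - f i 0|)).
    by rewrite ler_wpM2l.
  rewrite big_distrr /=; apply: (@le_trans _ _ (\sum_(i | P i) e')).
    by apply: ler_sum => i Pi; rewrite -normrM; exact: fe.
  rewrite sumr_const -mulr_natr /e' -mulrA ler_piMr ?(ltW e0)//.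
  by rewrite mulrC ler_pdivrMr// mul1r ler_nat leqW// max_card.
have E : (fun h : R => h^-1 *: (s (h *: 1 + 0) - s 0)) = (fun h => h^-1 * (s h - s 0)).
  by apply/funext => h; rewrite addr0 [h *: 1]mulr1.
split; first by rewrite /derivable /comp /= E; apply/cvg_ex; exists 0.
by rewrite /derive /comp /= E; exact/cvg_lim.
Unshelve. all: by end_near. Qed.

(** * The first variation identity at one point, in coordinates *)

Section FirstVariationEuclid.
Context (R : realType) (n m : nat) (deg : 'I_n -> nat) (d : nat).
Context (gam : 'I_n -> 'I_n -> 'rV[R]_n -> R^o) (ch : 'rV[R]_n -> 'rV[R]_n -> 'rV[R]_n).
Context (F : 'rV[R]_m * R^o -> 'rV[R]_n) (x0 : 'rV[R]_m) (U : set ('rV[R]_m * R^o)).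
Local Notation y0 := (F (x0, 0)).
Hypothesis dgam : forall i j, differentiable (gam i j) y0.
Hypothesis gam_sym : forall i j, gam i j y0 = gam j i y0.
Hypothesis ch_sym : forall u v, ch u v = ch v u.
Hypothesis ch_linear : forall c u u' v, ch (c *: u + u') v = c *: ch u v + ch u' v.
Hypothesis compat : forall u a b : 'rV[R]_n,
  \sum_i \sum_j a 0 i * b 0 j * 'D_u (gam i j) y0 =
  coef_form gam y0 (ch u a) b + coef_form gam y0 a (ch u b).
Hypothesis oU : open U.
Hypothesis Ux0 : U (x0, 0).
Hypothesis cF : Ck 2 U F.
Context (X : 'I_n -> 'rV[R]_n -> 'rV[R]_n) (e : 'I_m -> 'rV[R]_m -> 'rV[R]_m)
  (Nn : 'I_(n - m) -> 'rV[R]_m -> 'rV[R]_n).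
Hypothesis dX : forall k, differentiable (X k) y0.
Hypothesis de : forall i, differentiable (e i) x0.
Hypothesis dN : forall j, differentiable (Nn j) x0.

Let f0 (x : 'rV[R]_m) := F (x, 0).
Let g x := coef_form gam (f0 x).
Let g0 := coef_form gam y0.

Definition coord_vec (k : 'I_m) (x : 'rV[R]_m) : 'rV[R]_n :=
  'D_((delta_mx 0 k, 0) : 'rV[R]_m * R^o) F (x, 0).
Definition frame_vec (i : 'I_m) (x : 'rV[R]_m) : 'rV[R]_n :=
  'D_((e i x, 0) : 'rV[R]_m * R^o) F (x, 0).
Definition var_vec (x : 'rV[R]_m) : 'rV[R]_n := 'D_((0, 1) : 'rV[R]_m * R^o) F (x, 0).

Local Notation T := frame_vec.
Local Notation V := var_vec.

Definition frame_comp x (y : 'rV[R]_n) : 'rV[R]_n := \row_k g x y (X k (f0 x)).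
Definition frame_mx x : 'M[R]_(m, n) := \matrix_(i, k) g x (T i x) (X k (f0 x)).
Definition coord_mx (z : 'rV[R]_m * R^o) : 'M[R]_(m, n) :=
  \matrix_(i, k) coef_form gam (F z) ('D_((delta_mx 0 i, 0) : 'rV[R]_m * R^o) F z) (X k (F z)).
(** The density [S] of the overview. *)
Definition coord_area (z : 'rV[R]_m * R^o) : R :=
  Num.sqrt (pairing deg d (coord_mx z) (coord_mx z)).
(** The flux [Z] of the overview. Written with the coordinate fields instead of the [E_i], it
    involves no frame of the tangent bundle and is one function on the whole chart. *)
Definition flux (k : 'I_m) x : R :=
  pairing_row deg d (coord_mx (x, 0)) (frame_comp x (V x)) 0 k / coord_area (x, 0).
Definition frame_area x : R := Num.sqrt (pairing deg d (frame_mx x) (frame_mx x)).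
Definition frame_xi i j x : R :=
  pairing_row deg d (frame_mx x) (frame_comp x (Nn j x)) 0 i / frame_area x.

Local Notation rho := frame_comp.
Local Notation A := frame_mx.
Local Notation Th := frame_area.
Local Notation xi := frame_xi.

Definition nabla (Y : 'rV[R]_m -> 'rV[R]_n) (w : 'rV[R]_m) : 'rV[R]_n := cder ch f0 Y x0 w.
Definition divergence (Y : 'rV[R]_m -> 'rV[R]_n) : R :=
  \sum_k g0 (nabla Y (e k x0)) (T k x0).
Definition nabla_frame k (v : 'rV[R]_n) : 'rV[R]_n := cder ch id (X k) y0 v.
(** [dpairing] of the frame matrix with this one is the function [f] at [v]. *)
Definition f_mx (v : 'rV[R]_n) : 'M[R]_(m, n) :=
  \matrix_(i, k) g0 (T i x0) (nabla_frame k v).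

Hypothesis g_sym : \forall x \near x0, forall a b, g x a b = g x b a.
Hypothesis TT : \forall x \near x0, forall i j, g x (T i x) (T j x) = (i == j)%:R.
Hypothesis NT : \forall x \near x0, forall j i, g x (Nn j x) (T i x) = 0.
Hypothesis NN : \forall x \near x0, forall j k, g x (Nn j x) (Nn k x) = (j == k)%:R.
Hypothesis area_gt0 : 0 < pairing deg d (A x0) (A x0).

Let Ux : \forall x \near x0, U (x, 0).
Proof.
have : {for x0, continuous (fun x : 'rV[R]_m => (x, 0 : R^o))}.
  by apply: differentiable_continuous; exact: differentiable_pair.
by apply; exact: open_nbhs_nbhs.
Qed.

Let dF z : U z -> differentiable F z.
Proof. by have [+ _] := cF; exact. Qed.

Let dDF w z : U z -> differentiable (fun z' => 'D_w F z') z.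
Proof. by have [_ /(_ w)[+ _]] := cF; exact. Qed.

Let df0 : differentiable f0 x0.
Proof. exact/differentiable_slice1/dF. Qed.

Lemma derive_F_swap z u v : U z ->
  'D_u (fun z' => 'D_v F z') z = 'D_v (fun z' => 'D_u F z') z.
Proof.
by move=> Uz; exact: (derive_mx_swap u v oU cF Uz).
Qed.

Lemma coord_vec_sum v x : U (x, 0) ->
  'D_((v, 0) : 'rV[R]_m * R^o) F (x, 0) = \sum_k v 0 k *: coord_vec k x.
Proof.
move=> Ux'; rewrite -(derive_slice1 F x 0 v) derive_coord.
  by apply: eq_bigr => k _; rewrite derive_slice1.
exact/differentiable_slice1/dF.
Qed.

Lemma derive_f0 v x : 'D_v f0 x = 'D_((v, 0) : 'rV[R]_m * R^o) F (x, 0).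
Proof. exact: derive_slice1. Qed.

Lemma differentiable_coord_vec k : differentiable (coord_vec k) x0.
Proof. by apply: (@differentiable_slice1 _ _ _ (fun z => 'D_((delta_mx 0 k, 0) : 'rV[R]_m * R^o) F z)); exact: dDF. Qed.

Lemma differentiable_var_vec : differentiable V x0.
Proof. by apply: (@differentiable_slice1 _ _ _ (fun z => 'D_((0, 1) : 'rV[R]_m * R^o) F z)); exact: dDF. Qed.

Lemma frame_vec_near i : \forall x \near x0, T i x = \sum_k e i x 0 k *: coord_vec k x.
Proof. by apply: filterS Ux => x; exact: coord_vec_sum. Qed.

Lemma differentiable_scale (W : normedModType R) (a : W -> R^o) (p q : nat) (Y : W -> 'M[R]_(p, q)) x :
  differentiable a x -> differentiable Y x -> differentiable (fun z => a z *: Y z) x.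
Proof.
move=> da dY; apply/differentiable_mxP => i j.
have -> : (fun z => (a z *: Y z) i j : R^o) = a * (fun z => Y z i j : R^o).
  by apply/funext => z; rewrite mxE.
by apply: differentiableM => //; have /differentiable_mxP := dY.
Qed.

Let dek i k : differentiable (fun x => e i x 0 k : R^o) x0.
Proof. by have /differentiable_mxP := de i; exact. Qed.

Lemma differentiable_frame_vec i : differentiable (T i) x0.
Proof.
apply: (@near_eq_differentiable _ _ _ (fun x => \sum_k e i x 0 k *: coord_vec k x)).
  by apply: filterS (frame_vec_near i) => x ->.
by apply: differentiable_bigsum => k _; apply: differentiable_scale => //; exact: differentiable_coord_vec.
Qed.

Lemma nabla_sum (I : finType) (Y : I -> 'rV[R]_m -> 'rV[R]_n) w :
  (forall i, differentiable (Y i) x0) -> nabla (fun x => \sum_i Y i x) w = \sum_i nabla (Y i) w.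
Proof.
move=> dY; elim: (index_enum I) => [|a r IH].
  under eq_fun do rewrite big_nil.
  rewrite big_nil /nabla /cder derive_cst add0r ch_sym.
  by have := ch_linear (-1) 0 0 ('D_w f0 x0); rewrite scaler0 addr0 scaleN1r addNr.
under eq_fun do rewrite big_cons.
rewrite big_cons -IH /nabla cderD//; exact: differentiable_bigsum.
Qed.

Lemma nabla_scale (a : 'rV[R]_m -> R^o) (Y : 'rV[R]_m -> 'rV[R]_n) w :
  differentiable a x0 -> differentiable Y x0 ->
  nabla (fun x => a x *: Y x) w = 'D_w a x0 *: Y x0 + a x0 *: nabla Y w.
Proof. exact: cderZ. Qed.

Lemma nabla_lin (Y : 'rV[R]_m -> 'rV[R]_n) (I : finType) (c : I -> R) (w : I -> 'rV[R]_m) :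
  differentiable Y x0 -> nabla Y (\sum_i c i *: w i) = \sum_i c i *: nabla Y (w i).
Proof.
move=> dY; rewrite /nabla /cder !derive_suml//.
under [X in X + _]eq_bigr do rewrite deriveZl//.
under [X in _ + ch X _]eq_bigr do rewrite deriveZl//.
have -> : ch (\sum_i c i *: 'D_(w i) f0 x0) (Y x0) = \sum_i c i *: ch ('D_(w i) f0 x0) (Y x0).
  elim: (index_enum I) => [|a r IH].
    rewrite !big_nil.
    by have := ch_linear (-1) 0 0 (Y x0); rewrite scaler0 addr0 scaleN1r addNr.
  by rewrite !big_cons ch_linear IH.
by rewrite -big_split; apply: eq_bigr => i _; rewrite scalerDr.
Qed.

(** Schwarz for the derivative part, symmetry of [ch] for the Christoffel part. *)
Lemma nabla_coord_swap k l : nabla (coord_vec k) (delta_mx 0 l) = nabla (coord_vec l) (delta_mx 0 k).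
Proof.
have h k' l' : 'D_(delta_mx 0 l') (coord_vec k') x0 =
    'D_((delta_mx 0 l', 0) : 'rV[R]_m * R^o)
      (fun z => 'D_((delta_mx 0 k', 0) : 'rV[R]_m * R^o) F z) (x0, 0).
  exact: derive_slice1 (fun z => 'D_((delta_mx 0 k', 0) : 'rV[R]_m * R^o) F z) x0 0 _.
have h0 k' : 'D_(delta_mx 0 k') f0 x0 = coord_vec k' x0 := derive_f0 _ _.
apply: (congr2 +%R).
  exact: (etrans (h k l) (etrans (derive_F_swap _ _ Ux0) (esym (h l k)))).
exact: (etrans (congr2 ch (h0 l) erefl) (etrans (ch_sym _ _) (esym (congr2 ch (h0 k) erefl)))).
Qed.

(* Torsion-freeness: the difference of the two covariant derivatives is the image
   of the Lie bracket of the two fields. *)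
Lemma nabla_frame_vec_swap i r :
  nabla (T i) (e r x0) = nabla (T r) (e i x0) +
    \sum_k ('D_(e r x0) (fun x => e i x 0 k : R^o) x0 -
            'D_(e i x0) (fun x => e r x 0 k : R^o) x0) *: coord_vec k x0.
Proof.
have step i' r' : nabla (T i') (e r' x0) =
    \sum_k 'D_(e r' x0) (fun x => e i' x 0 k : R^o) x0 *: coord_vec k x0 +
    \sum_k \sum_l (e i' x0 0 k * e r' x0 0 l) *: nabla (coord_vec k) (delta_mx 0 l).
  rewrite {1}/nabla (cder_near _ _ _ (frame_vec_near i')) -/(nabla _ _) nabla_sum; last first.
    by move=> k; apply: differentiable_scale => //; exact: differentiable_coord_vec.
  rewrite -big_split; apply: eq_bigr => k _ /=.
  rewrite nabla_scale//; last exact: differentiable_coord_vec.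
  congr (_ + _); rewrite {1}(row_sum_delta (e r' x0)) nabla_lin; last exact: differentiable_coord_vec.
  by rewrite scaler_sumr; apply: eq_bigr => l _; rewrite scalerA.
apply: (bracket_algebra (step i r) (step r i)).
rewrite exchange_big; apply: eq_bigr => k _; apply: eq_bigr => l _.
exact: (congr2 *:%R (mulrC _ _) (nabla_coord_swap _ _)).
Qed.

Lemma is_derive_form Y Z w : differentiable Y x0 -> differentiable Z x0 ->
  is_derive x0 w (fun x => g x (Y x) (Z x) : R^o)
    (g0 (nabla Y w) (Z x0) + g0 (Y x0) (nabla Z w)).
Proof. exact: (is_derive_coef_form dgam gam_sym compat w erefl df0). Qed.

Lemma is_derive_frame_mx i k l :
  is_derive x0 (e l x0) (fun x => A x i k : R^o)
    (g0 (nabla (T i) (e l x0)) (X k y0) + g0 (T i x0) (nabla_frame k (T l x0))).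
Proof.
have dXf : differentiable (X k \o f0) x0 by apply: differentiable_comp.
have := is_derive_form (e l x0) (differentiable_frame_vec i) dXf.
rewrite /nabla (cder_chain ch (e l x0) (erefl y0) df0 (dX k)) -/(nabla _ _).
have -> : (fun x => A x i k : R^o) = (fun x => g x (T i x) ((X k \o f0) x) : R^o).
  by apply/funext => x; rewrite mxE.
by rewrite (derive_f0 (e l x0) x0).
Qed.

Let rho0 := rho x0.
Let prv := pairing_row deg d (A x0).

Let rho_linear x c y z : rho x (c *: y + z) = c *: rho x y + rho x z.
Proof. by apply/rowP => k; rewrite !mxE /g coef_form_linear. Qed.

Lemma rho_prv_sum x (I : finType) (c : I -> R) (y : I -> 'rV[R]_n) :
  pairing_row deg d (A x) (rho x (\sum_i c i *: y i)) =
  \sum_i c i *: pairing_row deg d (A x) (rho x (y i)).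
Proof.
have -> : rho x (\sum_i c i *: y i) = \sum_i c i *: rho x (y i).
  have r0 : rho x 0 = 0.
    by have := rho_linear x (-1) 0 0; rewrite scaler0 addr0 scaleN1r addNr.
  elim: (index_enum I) => [|a r IH]; first by rewrite !big_nil.
  by rewrite !big_cons rho_linear IH.
by rewrite pairing_row_sum; apply: eq_bigr => i _; rewrite pairing_rowZ.
Qed.

Lemma rho_prvD x y z :
  pairing_row deg d (A x) (rho x (y + z)) =
  pairing_row deg d (A x) (rho x y) + pairing_row deg d (A x) (rho x z).
Proof. by rewrite -{1}[y]scale1r rho_linear scale1r pairing_rowD. Qed.

Lemma prv_frame x l : pairing_row deg d (A x) (rho x (T l x)) =
  pairing deg d (A x) (A x) *: delta_mx 0 l.
Proof. by rewrite -pairing_row_row; congr pairing_row; apply/rowP => k; rewrite !mxE. Qed.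

(** The entries of the frame matrix vary with the tangent vectors and with the adapted frame; the
    first variation gives the sum of pairing rows, the second one [f_mx]. *)
Lemma is_derive_frame_area l :
  is_derive x0 (e l x0) (Th : _ -> R^o)
    ((\sum_i prv (rho0 (nabla (T i) (e l x0))) 0 i + dpairing deg d (A x0) (f_mx (T l x0))) / Th x0).
Proof.
pose M1 : 'M[R]_(m, n) := \matrix_(i, k) g0 (nabla (T i) (e l x0)) (X k y0).
have dA i k : is_derive x0 (e l x0) (fun x => A x i k : R^o) ((M1 + f_mx (T l x0)) i k).
  have -> : (M1 + f_mx (T l x0)) i k =
     g0 (nabla (T i) (e l x0)) (X k y0) + g0 (T i x0) (nabla_frame k (T l x0)) by rewrite !mxE.
  exact: is_derive_frame_mx.
have h := is_derive_sqrt_pairing dA area_gt0.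
apply: (is_derive_eq h); congr (_ / _).
rewrite -{1}[M1]scale1r dpairing_is_linear mul1r; congr (_ + _).
rewrite dpairingE; apply: eq_bigr => i _; congr (pairing_row _ _ _ _ _ _).
by apply/rowP => k; rewrite !mxE.
Qed.

Lemma nabla_unit i w : g0 (nabla (T i) w) (T i x0) = 0.
Proof.
have dT := differentiable_frame_vec i.
have [_ e1] := is_derive_form w dT dT.
have e2 : 'D_w (fun x => g x (T i x) (T i x) : R^o) x0 = 0.
  rewrite -[RHS](derive_cst (1 : R^o) x0 w); apply: near_eq_derive.
  by apply: filterS TT => x /(_ i i); rewrite eqxx.
have e3 := etrans (esym e1) e2.
have gs := nbhs_singleton g_sym.
move: e3; rewrite [X in _ + X](gs (T i x0) _) => /eqP.
by rewrite -mulr2n mulrn_eq0 /= => /eqP.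
Qed.

Definition frame_coef x : 'M[R]_m := \matrix_(i, k) e i x 0 k.
Local Notation em := frame_coef.

Let g_linear x : forall a u v w, g x (a *: u + v) w = a * g x u w + g x v w.
Proof. exact: coef_form_linear. Qed.

Let g0_linear : forall a u v w, g0 (a *: u + v) w = a * g0 u w + g0 v w.
Proof. exact: coef_form_linear. Qed.

Let TT0 : forall i j, g0 (T i x0) (T j x0) = (i == j)%:R.
Proof. exact: nbhs_singleton TT. Qed.

Lemma frame_mx_coef : \forall x \near x0,
  \matrix_i T i x = em x *m \matrix_k coord_vec k x.
Proof.
apply: filterS Ux => x xU.
apply/row_matrixP => i; rewrite rowK row_mul mulmx_sum_row /T coord_vec_sum//.
by apply: eq_bigr => k _; rewrite mxE mxE rowK.
Qed.

Lemma frame_coef_unit : \forall x \near x0, em x \in unitmx.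
Proof.
near=> x.
have TC : \matrix_i T i x = em x *m \matrix_k coord_vec k x by near: x; exact: frame_mx_coef.
have xT : forall i j, g x (T i x) (T j x) = (i == j)%:R by near: x; exact: TT.
have xs : forall a b, g x a b = g x b a by near: x; exact: g_sym.
have := gram_mx (@g_linear x) xs (T ^~ x) (T ^~ x).
rewrite {1}TC -mulmxA => h; apply: (proj1 (mulmx1_unit (etrans h _))).
by apply/matrixP => i j; rewrite !mxE.
Unshelve. all: by end_near. Qed.

Lemma leq_frame_dim : (m <= n)%N.
Proof.
exact: (orthonormal_leq (@g_linear x0) (nbhs_singleton g_sym) (nbhs_singleton TT)).
Qed.

Lemma orthonormal_decomp : \forall x \near x0, forall v,
  v = \sum_j g x v (Nn j x) *: Nn j x + \sum_l g x v (T l x) *: T l x.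
Proof.
near=> x => v.
have xT : forall i j, g x (T i x) (T j x) = (i == j)%:R by near: x; exact: TT.
have xN : forall j k, g x (Nn j x) (Nn k x) = (j == k)%:R by near: x; exact: NN.
have xNT : forall j i, g x (Nn j x) (T i x) = 0 by near: x; exact: NT.
have xs : forall a b, g x a b = g x b a by near: x; exact: g_sym.
(* The tangent and the normal frame together form an orthonormal basis of the ambient space. *)
pose B (i : 'I_(m + (n - m))) := match fintype.split i with inl l => T l x | inr j => Nn j x end.
have BB i j : g x (B i) (B j) = (i == j)%:R.
  rewrite -(splitK i) -(splitK j) /B !unsplitK (can_eq (@unsplitK _ _)).
  by case: (fintype.split i) => a; case: (fintype.split j) => b //=; rewrite xs.
rewrite {1}(orthonormal_basis_decomp (@g_linear x) xs BB (subnKC leq_frame_dim) v).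
rewrite big_split_ord /= addrC; congr (_ + _); apply: eq_bigr => i _.
  by rewrite /B (unsplitK (inr i)).
by rewrite /B (unsplitK (inl i)).
Unshelve. all: by end_near. Qed.

Lemma frame_mxE : \forall x \near x0, A x = em x *m coord_mx (x, 0).
Proof.
apply: filterS Ux => x xU; apply/matrixP => i k; rewrite !mxE /T coord_vec_sum//.
rewrite (form_suml (@g_linear x)); apply: eq_bigr => l _.
by rewrite (formZl (@g_linear x)) !mxE.
Qed.

(** The Riemannian density of the induced metric, since the rows of [em] are the coordinates of an
    orthonormal frame. *)
Let J x : R := `|\det (em x)|^-1.

Lemma frame_areaE : \forall x \near x0, Th x = `|\det (em x)| * coord_area (x, 0).
Proof.
apply: filterS frame_mxE => x; rewrite /Th => ->.
by rewrite pairing_mull sqrtrM ?sqr_ge0// sqrtr_sqr.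
Qed.

(** The flux is the density times a vector field with components in the frame [e]:
    [pairing_row_mull] contributes the square of the determinant and the area one factor
    [|\det (em x)|]. *)
Lemma flux_frame : \forall x \near x0, forall k,
  flux k x = J x * \sum_i (pairing_row deg d (A x) (rho x (V x)) 0 i / Th x) * e i x 0 k.
Proof.
near=> x => k.
have AE : A x = em x *m coord_mx (x, 0) by near: x; exact: frame_mxE.
have ThE : Th x = `|\det (em x)| * coord_area (x, 0) by near: x; exact: frame_areaE.
have eu : em x \in unitmx by near: x; exact: frame_coef_unit.
rewrite unitmxE unitfE in eu.
have := pairing_row_mull deg d (em x) (coord_mx (x, 0)) (rho x (V x)).
rewrite -AE => /rowP/(_ k); rewrite mxE [in RHS]mxE => h.
have pk : pairing_row deg d (coord_mx (x, 0)) (rho x (V x)) 0 k =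
    (\det (em x) ^+ 2)^-1 * \sum_j pairing_row deg d (A x) (rho x (V x)) 0 j * e j x 0 k.
  rewrite -[LHS](mulKf (expf_neq0 2 eu)) -h; congr (_ * _).
  by apply: eq_bigr => j _; rewrite mxE.
have e1 := congr1 (fun z => z / coord_area (x, 0)) pk.
have e2 := congr1 (fun z => J x * \sum_i (pairing_row deg d (A x) (rho x (V x)) 0 i / z) * e i x 0 k) ThE.
exact: (etrans e1 (etrans (scaled_sum_div _ _ _ _) (esym e2))).
Unshelve. all: by end_near. Qed.

Let a j x := g x (V x) (Nn j x).
Let b l x := g x (V x) (T l x).

(** Splitting [V] turns the flux into an expression in the [xi i j] and the area. This form can be
    differentiated by the product rule. *)
Lemma flux_near k : \forall x \near x0,
  flux k x = J x * \sum_i (\sum_j a j x * xi i j x + b i x * Th x) * e i x 0 k.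
Proof.
near=> x.
have fE : flux k x = J x * \sum_i (pairing_row deg d (A x) (rho x (V x)) 0 i / Th x) * e i x 0 k.
  by near: x; apply: filterS flux_frame => x; exact.
have VE : forall v, v = \sum_j g x v (Nn j x) *: Nn j x + \sum_l g x v (T l x) *: T l x.
  by near: x; exact: orthonormal_decomp.
rewrite fE; congr (_ * _); apply: eq_bigr => i _; congr (_ * _).
rewrite [in LHS](VE (V x)) rho_prvD !rho_prv_sum mxE !summxE mulrDl; congr (_ + _).
  by rewrite big_distrl; apply: eq_bigr => j _ /=; rewrite mxE -mulrA.
rewrite (bigD1 i)//= big1 => [|l li]; last by rewrite mxE prv_frame !mxE eq_sym (negPf li) !mulr0.
rewrite addr0 mxE prv_frame !mxE !eqxx mulr1 -mulrA; congr (_ * _).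
have := pairing_ge0 deg d (A x); rewrite /Th; set P := pairing _ _ _ _ => P0.
(* The area is assumed positive at [x0] alone; where it vanishes both sides are 0. *)
have [->|Pn] := eqVneq P 0; first by rewrite sqrtr0 mul0r.
by rewrite -{1}(sqr_sqrtr P0) expr2 mulfK// sqrtr_eq0 -ltNge lt_def Pn.
Unshelve. all: by end_near. Qed.

Lemma differentiable_form Y Z : differentiable Y x0 -> differentiable Z x0 ->
  differentiable (fun x => g x (Y x) (Z x) : R^o) x0.
Proof.
move=> dY dZ; apply: differentiable_bigsum => i _; apply: differentiable_bigsum => j _.
apply: (@differentiableM _ _ (fun x => Y x 0 i * Z x 0 j : R^o)).
  apply: (@differentiableM _ _ (fun x => Y x 0 i : R^o)).
    by have /differentiable_mxP := dY.
  by have /differentiable_mxP := dZ.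
exact: differentiable_comp.
Qed.

Lemma differentiable_frame_mx i k : differentiable (fun x => A x i k : R^o) x0.
Proof.
have -> : (fun x => A x i k : R^o) = (fun x => g x (T i x) ((X k \o f0) x) : R^o).
  by apply/funext => x; rewrite mxE.
apply: differentiable_form; first exact: differentiable_frame_vec.
exact: differentiable_comp.
Qed.

Lemma differentiable_frame_area : differentiable (Th : _ -> R^o) x0.
Proof.
apply: (@differentiable_sqrt _ _ (fun x => pairing deg d (A x) (A x))) => //.
by apply: differentiable_pairing; exact: differentiable_frame_mx.
Qed.

Lemma frame_area_gt0 : 0 < Th x0.
Proof. by rewrite sqrtr_gt0. Qed.

Lemma differentiable_frame_xi i j : differentiable (xi i j : _ -> R^o) x0.
Proof.
apply: (@differentiableM _ _ (fun x => pairing_row deg d (A x) (rho x (Nn j x)) 0 i : R^o)).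
  apply: differentiable_pairing_row; first exact: differentiable_frame_mx.
  move=> k; under eq_fun do rewrite mxE.
  by apply: differentiable_form => //; exact: differentiable_comp.
apply: differentiableV; first exact: differentiable_frame_area.
by rewrite gt_eqF// frame_area_gt0.
Qed.

Let dem w : 'M[R]_m := \matrix_(i, k) 'D_w (fun x => e i x 0 k : R^o) x0.
Let iem := invmx (em x0).
Let em_u : em x0 \in unitmx. Proof. exact: nbhs_singleton frame_coef_unit. Qed.
Let det_neq0 : \det (em x0) != 0. Proof. by rewrite -unitfE -unitmxE. Qed.

Lemma is_derive_frame_det w :
  is_derive x0 w (fun x => \det (em x) : R^o) (\det (em x0) * \tr (dem w *m iem)).
Proof.
have h i k : is_derive x0 w (fun x => e i x 0 k : R^o) (dem w i k).
  by rewrite mxE; apply: differentiable_is_derive.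
apply: (is_derive_eq (is_derive_det h)).
rewrite -[\matrix_(i, j) _]/(em x0) /iem /invmx em_u -scalemxAr mxtraceZ.
by rewrite mulrA divff// mul1r.
Qed.

(** In this form the absolute value is differentiated through the square root of a positive
    function. *)
Lemma frame_jacE x : J x = (Num.sqrt (\det (em x) ^+ 2))^-1.
Proof. by rewrite sqrtr_sqr. Qed.

Lemma is_derive_frame_jac w :
  is_derive x0 w (J : _ -> R^o) (- J x0 * \tr (dem w *m iem)).
Proof.
have D0 : 0 < \det (em x0) ^+ 2 by rewrite exprn_even_gt0.
have s0 : Num.sqrt (\det (em x0) ^+ 2) != 0 by rewrite gt_eqF// sqrtr_gt0.
have -> : (J : _ -> R^o) = (fun x => (Num.sqrt (\det (em x) ^+ 2))^-1 : R^o).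
  by apply/funext => x; rewrite frame_jacE.
have h := @is_derive_sqrt _ _ (fun x => \det (em x) ^+ 2) x0 w _ D0
   (is_deriveM (is_derive_frame_det w) (is_derive_frame_det w)).
have hV := @is_derive_inv R _ (fun x => Num.sqrt (\det (em x) ^+ 2)) x0 w _ s0 h.
apply: (is_derive_eq hV).
move: s0; set q := Num.sqrt _; set D := \det _; set t := \tr _ => q0.
have qD : q ^+ 2 = D ^+ 2 by rewrite sqr_sqrtr// ltW.
have -> : D *: (D * t) + D *: (D * t) = 2 * (q ^+ 2 * t) by rewrite qD /GRing.scale /=; ring.
by rewrite /GRing.scale /=; field.
Qed.

Lemma differentiable_frame_jac : differentiable (J : _ -> R^o) x0.
Proof.
have -> : (J : _ -> R^o) = (fun x => (Num.sqrt (\det (em x) ^+ 2))^-1 : R^o).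
  by apply/funext => x; rewrite frame_jacE.
have D0 : 0 < \det (em x0) ^+ 2 by rewrite exprn_even_gt0.
apply: differentiableV; last by rewrite gt_eqF// sqrtr_gt0.
apply: differentiable_sqrt => //.
have dd : differentiable (fun x => \det (em x) : R^o) x0.
  by apply: differentiable_det => i k; under eq_fun do rewrite mxE.
exact: (@differentiableM _ _ (fun x => \det (em x) : R^o)).
Qed.

(** The sum over [i] of the [i]-th component of the bracket of [e_i] and [e_l]: row [k] of [iem]
    holds the components of the [k]-th coordinate vector in the frame. *)
Definition bracket_trace l := \sum_i \sum_k ('D_(e i x0) (fun x => e l x 0 k : R^o) x0 -
            'D_(e l x0) (fun x => e i x 0 k : R^o) x0) * iem k i.

(** The divergence of [e_l] for the density [J]: its coordinate divergence plus the logarithmic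
    derivative of [J] along [e_l], which is minus the trace. *)
Lemma bracket_traceE l :
  bracket_trace l = \sum_k 'D_(delta_mx 0 k) (fun x => e l x 0 k : R^o) x0 - \tr (dem (e l x0) *m iem).
Proof.
have h k : 'D_(delta_mx 0 k) (fun x => e l x 0 k : R^o) x0 =
   \sum_i 'D_(e i x0) (fun x => e l x 0 k : R^o) x0 * iem k i.
  have [D DP] : exists D : 'I_m -> R, forall s, 'D_(delta_mx 0 s) (fun x => e l x 0 k : R^o) x0 = D s.
    by exists (fun s => 'D_(delta_mx 0 s) (fun x => e l x 0 k : R^o) x0).
  transitivity (\sum_i (\sum_s e i x0 0 s * D s) * iem k i); last first.
    by apply: eq_bigr => i _; rewrite derive_coord//; congr (_ * _); apply: eq_bigr => s _; rewrite DP.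
  under eq_bigr do rewrite big_distrl /=.
  rewrite exchange_big DP /=.
  transitivity (\sum_s (iem *m em x0) k s * D s).
    rewrite /iem mulVmx// (bigD1 k)//= !mxE eqxx mul1r big1 ?addr0// => s sk.
    by rewrite !mxE eq_sym (negPf sk) mul0r.
  apply: eq_bigr => s _; rewrite mxE big_distrl; apply: eq_bigr => i _ /=.
  by rewrite mxE; ring.
under [X in _ = X - _]eq_bigr do rewrite h.
rewrite exchange_big /= /bracket_trace /mxtrace -sumrB; apply: eq_bigr => i _.
by rewrite mxE -sumrB; apply: eq_bigr => k _; rewrite mxE mulrBl.
Qed.

Lemma coord_vec_frame k : coord_vec k x0 = \sum_l iem k l *: T l x0.
Proof.
have h := nbhs_singleton frame_mx_coef.
have h1 : \matrix_k coord_vec k x0 = iem *m \matrix_i T i x0.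
  exact: (esym (etrans (congr1 (mulmx iem) h) (mulKmx em_u _))).
move: h1 => /(congr1 (row k)); rewrite rowK row_mul mulmx_sum_row => ->.
by apply: eq_bigr => l _; rewrite mxE rowK.
Qed.

(** Torsion-freeness replaces the derivative of [T_l] along [e_r] by that of [T_r] along [e_l] plus
    a bracket; the inner product of the former with [T_r] is 0 because [T_r] has constant length. *)
Lemma divergence_frame l : divergence (T l) = bracket_trace l.
Proof.
apply: eq_bigr => r _; rewrite nabla_frame_vec_swap (formDl (@g0_linear)) nabla_unit add0r.
rewrite (form_suml (@g0_linear)); apply: eq_bigr => k _.
rewrite (formZl (@g0_linear)) coord_vec_frame (form_suml (@g0_linear)); congr (_ * _).
rewrite (bigD1 r)//= big1 => [|s sr]; rewrite (formZl (@g0_linear)) TT0.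
  by rewrite eqxx mulr1 addr0.
by rewrite (negPf sr) mulr0.
Qed.

Lemma divergence_frame_xi i j :
  divergence (fun x => xi i j x *: T i x) = 'D_(e i x0) (xi i j : _ -> R^o) x0 + xi i j x0 * bracket_trace i.
Proof.
rewrite -divergence_frame /divergence big_distrr /=.
transitivity (\sum_k ('D_(e k x0) (xi i j : _ -> R^o) x0 * (i == k)%:R +
    xi i j x0 * g0 (nabla (T i) (e k x0)) (T k x0))).
  apply: eq_bigr => k _.
  rewrite (nabla_scale _ (differentiable_frame_xi i j) (differentiable_frame_vec i)).
  by rewrite (formDl (@g0_linear)) !(formZl (@g0_linear)) TT0.
rewrite big_split; congr (_ + _); rewrite (bigD1 i)//= big1 ?addr0 ?eqxx ?mulr1// => k ki.
by rewrite eq_sym (negPf ki) mulr0.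
Qed.

Let prv_lin y (I : finType) (c : I -> R) (w : I -> 'rV[R]_n) i :
  prv (rho0 (y + \sum_k c k *: w k)) 0 i = prv (rho0 y) 0 i + \sum_k c k * prv (rho0 (w k)) 0 i.
Proof.
rewrite /prv rho_prvD mxE rho_prv_sum; congr (_ + _); rewrite summxE.
by apply: eq_bigr => k _; rewrite mxE.
Qed.

Let prv_frame0 i l : prv (rho0 (T l x0)) 0 i = Th x0 ^+ 2 * (l == i)%:R.
Proof.
by rewrite /prv prv_frame !mxE eqxx sqr_sqrtr ?pairing_ge0// eq_sym.
Qed.

Let prv_0 i : prv (rho0 0) 0 i = 0.
Proof. by have := prv_lin 0 (fun=> -1) (fun _ : 'I_1 => 0) i; rewrite !big_ord1 scaler0 addr0 mulN1r subrr. Qed.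

(** The left side is how a motion along [T_l] changes the tangent planes. After the exchange it is
    the part of the derivative of the area along [e_l] due to the tangent frame, up to a
    divergence. *)
Lemma prv_nabla_swap l :
  \sum_i prv (rho0 (nabla (T l) (e i x0))) 0 i / Th x0 =
  \sum_i prv (rho0 (nabla (T i) (e l x0))) 0 i / Th x0 + Th x0 * bracket_trace l.
Proof.
rewrite /bracket_trace big_distrr -big_split; apply: eq_bigr => i _ /=.
have h := congr1 (fun y => prv (rho0 y) 0 i / Th x0) (nabla_frame_vec_swap l i).
apply: (etrans h); apply: (etrans (congr1 (fun z => z / Th x0) (prv_lin _ _ _ _))).
apply: (etrans (mulrDl _ _ _)); apply: (congr1 (fun z => _ + z)).
rewrite big_distrl big_distrr; apply: eq_bigr => k _ /=.
have -> : prv (rho0 (coord_vec k x0)) 0 i = Th x0 ^+ 2 * iem k i.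
  rewrite coord_vec_frame -[X in rho0 X]add0r prv_lin.
  rewrite prv_0 add0r (bigD1 i)//= big1 => [|s si]; rewrite prv_frame0.
    by rewrite eqxx mulr1 addr0 mulrC.
  by rewrite (negPf si) !mulr0.
have := frame_area_gt0 => /lt0r_neq0 t0.
by rewrite expr2; field.
Qed.

(** The time derivative of [coord_mx]. Schwarz and the symmetry of [ch] turn the covariant time
    derivative of the [i]-th coordinate vector into that of [V] in the direction [i]. *)
Let B : 'M[R]_(m, n) :=
  \matrix_(i, k) (g0 (nabla V (delta_mx 0 i)) (X k y0) + g0 (coord_vec i x0) (nabla_frame k (V x0))).

Lemma is_derive_coord_mx i k :
  is_derive ((x0, 0) : 'rV[R]_m * R^o) ((0, 1) : 'rV[R]_m * R^o) (fun z => coord_mx z i k : R^o) (B i k).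
Proof.
have dXF : differentiable (X k \o F) ((x0, 0) : 'rV[R]_m * R^o).
  by apply: differentiable_comp; [exact: dF | exact: dX].
have h := is_derive_coef_form dgam gam_sym compat ((0, 1) : 'rV[R]_m * R^o) erefl (dF Ux0)
  (dDF ((delta_mx 0 i, 0) : 'rV[R]_m * R^o) Ux0) dXF.
have -> : (fun z => coord_mx z i k : R^o) = (fun z => coef_form gam (F z)
    ('D_((delta_mx 0 i, 0) : 'rV[R]_m * R^o) F z) ((X k \o F) z) : R^o).
  by apply/funext => z; rewrite mxE.
apply: (is_derive_eq h).
have e1 : cder ch F (fun z => 'D_((delta_mx 0 i, 0) : 'rV[R]_m * R^o) F z)
    ((x0, 0) : 'rV[R]_m * R^o) ((0, 1) : 'rV[R]_m * R^o) = nabla V (delta_mx 0 i).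
  have h1 : 'D_(delta_mx 0 i) V x0 = 'D_((delta_mx 0 i, 0) : 'rV[R]_m * R^o)
      (fun z => 'D_((0, 1) : 'rV[R]_m * R^o) F z) (x0, 0).
    exact: derive_slice1 (fun z => 'D_((0, 1) : 'rV[R]_m * R^o) F z) x0 0 _.
  have h2 : 'D_(delta_mx 0 i) f0 x0 = coord_vec i x0 := derive_f0 _ _.
  apply: (congr2 +%R); first exact: (etrans (derive_F_swap _ _ Ux0) (esym h1)).
  exact: (etrans (ch_sym _ _) (esym (congr2 ch h2 erefl))).
have e2 := cder_chain ch ((0, 1) : 'rV[R]_m * R^o) (erefl y0) (dF Ux0) (dX k).
apply: (etrans (congr2 (fun p q => g0 p (X k y0) + g0 (coord_vec i x0) q) e1 e2)).
by rewrite mxE.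
Qed.

Lemma coord_pairing_gt0 : 0 < pairing deg d (coord_mx (x0, 0)) (coord_mx (x0, 0)).
Proof.
move: area_gt0; rewrite (nbhs_singleton frame_mxE) pairing_mull.
by rewrite pmulr_rgt0// exprn_even_gt0.
Qed.

Lemma frame_mx_var : em x0 *m B =
  \matrix_(i, k) g0 (nabla V (e i x0)) (X k y0) + f_mx (V x0).
Proof.
apply/matrixP => i k; rewrite !mxE.
have Ti : T i x0 = \sum_s e i x0 0 s *: coord_vec s x0 := nbhs_singleton (frame_vec_near i).
rewrite {1}Ti {1}(row_sum_delta (e i x0)) nabla_lin; last exact: differentiable_var_vec.
rewrite !(form_suml (@g0_linear)) -big_split; apply: eq_bigr => s _.
by rewrite !mxE !(formZl (@g0_linear)) mulrDr.
Qed.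

Lemma is_derive_coord_area : is_derive (0 : R) (1 : R) (fun t : R => coord_area (x0, t) : R)
  (J x0 * (\sum_i prv (rho0 (nabla V (e i x0))) 0 i / Th x0 + dpairing deg d (A x0) (f_mx (V x0)) / Th x0)).
Proof.
have h := is_derive_slice2 (is_derive_sqrt_pairing is_derive_coord_mx coord_pairing_gt0).
apply: (is_derive_eq h).
have ThE := nbhs_singleton frame_areaE.
have e1 : dpairing deg d (A x0) (em x0 *m B) = \det (em x0) ^+ 2 * dpairing deg d (coord_mx (x0, 0)) B.
  exact: (etrans (congr2 (dpairing deg d) (nbhs_singleton frame_mxE) erefl) (dpairing_mull _ _ _ _ _)).
have e2 : dpairing deg d (A x0) (em x0 *m B) =
    \sum_i prv (rho0 (nabla V (e i x0))) 0 i + dpairing deg d (A x0) (f_mx (V x0)).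
  apply: (etrans (congr1 (dpairing deg d (A x0)) frame_mx_var)).
  apply: (etrans (congr1 (dpairing deg d (A x0)) (congr1 (fun z => z + f_mx (V x0)) (esym (scale1r _))))).
  apply: (etrans (dpairing_is_linear _ _ _ _ _ _)); rewrite mul1r; apply: (congr1 (fun z => z + _)).
  rewrite dpairingE; apply: eq_bigr => i _; congr (pairing_row _ _ _ _ _ _).
  by apply/rowP => k; rewrite !mxE.
rewrite -[Num.sqrt _]/(coord_area (x0, 0)).
apply: (@etrans _ _ (J x0 * ((\sum_i prv (rho0 (nabla V (e i x0))) 0 i + dpairing deg d (A x0) (f_mx (V x0))) / Th x0))); last first.
  by apply: (congr1 (fun z => _ * z)); rewrite mulrDl big_distrl.
have e3 := etrans (esym e2) e1.
apply: (etrans _ (congr2 (fun p q => J x0 * (p / q)) (esym e3) (esym ThE))).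
(* The square of the determinant in [dpairing], against its absolute value in the area, leaves one
   factor, which [J x0] cancels. *)
have aux (D p q : R) : D != 0 -> p / q = `|D|^-1 * ((D ^+ 2 * p) / (`|D| * q)).
  move=> D0; rewrite -(real_normK (num_real D)) invfM.
  have nD : `|D| != 0 by rewrite normr_eq0.
  by move: (q^-1) => qi; field.
exact: aux.
Qed.

Let differentiable_a j : differentiable (a j : _ -> R^o) x0.
Proof. by apply: differentiable_form; [exact: differentiable_var_vec | exact: dN]. Qed.
Let differentiable_b l : differentiable (b l : _ -> R^o) x0.
Proof. by apply: differentiable_form; [exact: differentiable_var_vec | exact: differentiable_frame_vec]. Qed.

Lemma nabla_var w : nabla V w =
  \sum_j ('D_w (a j : _ -> R^o) x0 *: Nn j x0 + a j x0 *: nabla (Nn j) w) +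
  \sum_l ('D_w (b l : _ -> R^o) x0 *: T l x0 + b l x0 *: nabla (T l) w).
Proof.
have VE : \forall x \near x0, V x = \sum_j a j x *: Nn j x + \sum_l b l x *: T l x.
  by apply: filterS orthonormal_decomp => x; exact.
have h1 j : differentiable (fun x => a j x *: Nn j x) x0 by apply: differentiable_scale.
have h2 l : differentiable (fun x => b l x *: T l x) x0.
  by apply: differentiable_scale => //; exact: differentiable_frame_vec.
apply: (etrans (cder_near ch f0 w VE)).
apply: (etrans (cderD ch_sym ch_linear f0 w _ _)); [exact: differentiable_bigsum | exact: differentiable_bigsum |].
apply: (congr2 +%R).
  apply: (etrans (nabla_sum _ h1)); apply: eq_bigr => j _.
  exact: (nabla_scale w (differentiable_a j) (dN j)).
apply: (etrans (nabla_sum _ h2)); apply: eq_bigr => l _.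
exact: (nabla_scale w (differentiable_b l) (differentiable_frame_vec l)).
Qed.

Let P i j := prv (rho0 (nabla (Nn j) (e i x0))) 0 i / Th x0.
Let Q i l := prv (rho0 (nabla (T l) (e i x0))) 0 i / Th x0.

Lemma prv_nabla_var i : prv (rho0 (nabla V (e i x0))) 0 i / Th x0 =
  \sum_j ('D_(e i x0) (a j : _ -> R^o) x0 * xi i j x0 + a j x0 * P i j) +
  ('D_(e i x0) (b i : _ -> R^o) x0 * Th x0 + \sum_l b l x0 * Q i l).
Proof.
have [a' a'E] : exists a' : 'I_(n - m) -> R, forall j, 'D_(e i x0) (a j : _ -> R^o) x0 = a' j.
  by exists (fun j => 'D_(e i x0) (a j : _ -> R^o) x0).
have [b' b'E] : exists b' : 'I_m -> R, forall l, 'D_(e i x0) (b l : _ -> R^o) x0 = b' l.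
  by exists (fun l => 'D_(e i x0) (b l : _ -> R^o) x0).
have VE : nabla V (e i x0) = \sum_j a' j *: Nn j x0 + \sum_j a j x0 *: nabla (Nn j) (e i x0) +
    \sum_l b' l *: T l x0 + \sum_l b l x0 *: nabla (T l) (e i x0).
  apply: (etrans (nabla_var (e i x0))); rewrite -[RHS]addrA -!big_split; apply: (congr2 +%R).
    by apply: eq_bigr => j _; rewrite a'E.
  by apply: eq_bigr => l _; rewrite b'E.
pose L y := prv (rho0 y) 0 i / Th x0.
have LP c u v : L (c *: u + v) = c * L u + L v.
  rewrite /L /prv /rho0 rho_linear -[pairing_row _ _ _ _]/(prv _) {1}/prv pairing_row_is_linear.
  by rewrite mxE mxE mulrDl mulrA.
apply: (etrans (congr1 L VE)).
apply: (etrans (scalar_linearD LP _ _)).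
apply: (etrans (congr1 (fun z => z + _) (scalar_linearD LP _ _))).
apply: (etrans (congr1 (fun z => z + _ + _) (scalar_linearD LP _ _))).
apply: (etrans (esym (addrA _ _ _))); apply: (congr2 +%R).
  apply: (etrans (congr2 +%R (scalar_linear_sum LP _ _) (scalar_linear_sum LP _ _))).
  apply: (etrans (esym (big_split _ _ _ _ _))); apply: eq_bigr => j _.
  by apply: (congr1 (fun z => z * xi i j x0 + _)); rewrite a'E.
apply: (congr2 +%R (etrans (scalar_linear_sum LP _ _) _) (scalar_linear_sum LP _ _)).
have LT l : L (T l x0) = Th x0 * (l == i)%:R.
  by rewrite /L prv_frame0 expr2 mulrAC mulfK// gt_eqF// frame_area_gt0.
apply: (etrans (eq_bigr _ (fun l _ => congr1 (fun z => b' l * z) (LT l)))).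
apply: (etrans _ (congr1 (fun z => z * Th x0) (esym (b'E i)))).
move: (Th x0) => t; rewrite (bigD1 i)//= eqxx mulr1 big1 ?addr0// => l li.
by rewrite (negPf li) !mulr0.
Qed.

Lemma f_mx_var : dpairing deg d (A x0) (f_mx (V x0)) / Th x0 =
  \sum_j a j x0 * (dpairing deg d (A x0) (f_mx (Nn j x0)) / Th x0) +
  \sum_l b l x0 * (dpairing deg d (A x0) (f_mx (T l x0)) / Th x0).
Proof.
have nfP k c u v : nabla_frame k (c *: u + v) = c *: nabla_frame k u + nabla_frame k v.
  rewrite /nabla_frame /cder !derive_id deriveDl; last exact: dX.
  rewrite deriveZl; last exact: dX.
  by rewrite ch_linear scalerDr addrACA.
have fP c u v : f_mx (c *: u + v) = c *: f_mx u + f_mx v.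
  have fE w i k : f_mx w i k = g0 (T i x0) (nabla_frame k w) by rewrite mxE.
  have mE (M1 M2 : 'M[R]_(m, n)) i k : (c *: M1 + M2) i k = c * M1 i k + M2 i k by rewrite !mxE.
  apply/matrixP => i k; apply: (etrans (fE _ i k)).
  apply: (etrans (congr1 (g0 (T i x0)) (nfP k c u v))).
  apply: (etrans (formDr (@g0_linear) (nbhs_singleton g_sym) _ _ _)).
  apply: (etrans (congr1 (fun z => z + _) (formZr (@g0_linear) (nbhs_singleton g_sym) _ _ _))).
  exact: (esym (etrans (mE _ _ i k) (congr2 (fun p q => c * p + q) (fE _ i k) (fE _ i k)))).
pose L v := dpairing deg d (A x0) (f_mx v) / Th x0.
have LP c u v : L (c *: u + v) = c * L u + L v.
  by rewrite /L fP dpairing_is_linear mulrDl mulrA.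
have VE := nbhs_singleton orthonormal_decomp (V x0).
apply: (etrans (congr1 L VE)); apply: (etrans (scalar_linearD LP _ _)).
exact: (congr2 +%R (scalar_linear_sum LP _ _) (scalar_linear_sum LP _ _)).
Qed.

Lemma differentiable_flux k : differentiable (flux k : _ -> R^o) x0.
Proof.
apply: (@near_eq_differentiable _ _ _ (fun x => J x * \sum_i (\sum_j a j x * xi i j x + b i x * Th x) * e i x 0 k : R^o)).
  by apply: filterS (flux_near k) => x /esym; exact.
apply: (@differentiableM _ _ (J : _ -> R^o)); first exact: differentiable_frame_jac.
apply: differentiable_bigsum => i _.
apply: (@differentiableM _ _ (fun x => \sum_j a j x * xi i j x + b i x * Th x : R^o)) => //.
apply: differentiableD; last first.
  by apply: (@differentiableM _ _ (b i : _ -> R^o)) => //; exact: differentiable_frame_area.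
apply: differentiable_bigsum => j _.
by apply: (@differentiableM _ _ (a j : _ -> R^o)) => //; exact: differentiable_frame_xi.
Qed.

(** The time derivative and the divergence of the flux are both expanded along the normal and the
    tangent frame; the derivatives of the components of [V] cancel between them, and the tangent
    part cancels altogether. *)
Lemma first_variation_euclid : exists2 D : R,
  is_derive (0 : R) (1 : R) (fun t : R => coord_area (x0, t) : R) D &
  D - \sum_k 'D_(delta_mx 0 k) (flux k : _ -> R^o) x0 =
  J x0 * \sum_j a j x0 *
    (- \sum_i divergence (fun x => xi i j x *: T i x) + \sum_i P i j +
     dpairing deg d (A x0) (f_mx (Nn j x0)) / Th x0).
Proof.
exists (J x0 * (\sum_i prv (rho0 (nabla V (e i x0))) 0 i / Th x0 + dpairing deg d (A x0) (f_mx (V x0)) / Th x0)).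
  exact: is_derive_coord_area.
pose W i (x : 'rV[R]_m) : R^o := \sum_j a j x * xi i j x + b i x * Th x.
have dW i : differentiable (W i) x0.
  apply: differentiableD; last first.
    by apply: (@differentiableM _ _ (b i : _ -> R^o)) => //; exact: differentiable_frame_area.
  apply: differentiable_bigsum => j _.
  by apply: (@differentiableM _ _ (a j : _ -> R^o)) => //; exact: differentiable_frame_xi.
have fluxE : \sum_k 'D_(delta_mx 0 k) (flux k : _ -> R^o) x0 =
    \sum_i (J x0 * 'D_(e i x0) (W i) x0 + W i x0 * (- J x0 * \tr (dem (e i x0) *m iem))
    + J x0 * W i x0 * \sum_k 'D_(delta_mx 0 k) (fun x => e i x 0 k : R^o) x0).
  have h1 := derive_flux_sum differentiable_frame_jac dW dek.
  apply: (etrans _ (etrans h1 _)).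
    by apply: eq_bigr => k _; exact: near_eq_derive (flux_near k).
  apply: eq_bigr => i _; apply: (congr1 (fun z => z + _)); apply: (congr1 (fun z => _ + _ * z)).
  by have [_] := is_derive_frame_jac (e i x0).
have WE i := derive_sum_mul (e i x0) differentiable_a (differentiable_frame_xi i) (differentiable_b i)
  differentiable_frame_area.
have ThE l : 'D_(e l x0) (Th : _ -> R^o) x0 =
    \sum_i prv (rho0 (nabla (T i) (e l x0))) 0 i / Th x0 + dpairing deg d (A x0) (f_mx (T l x0)) / Th x0.
  have [_ h] := is_derive_frame_area l; apply: (etrans h).
  by rewrite mulrDl big_distrl.
(* A variation along [T_l] changes the area by [Th'] along [e_l] plus [Th] times the divergence of
   [T_l]: the hypothesis that removes the tangent part. *)
have HQ l : \sum_i Q i l + dpairing deg d (A x0) (f_mx (T l x0)) / Th x0 =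
    'D_(e l x0) (Th : _ -> R^o) x0 + Th x0 * bracket_trace l.
  apply: (etrans (congr1 (fun z => z + _) (prv_nabla_swap l))).
  apply: (etrans _ (congr1 (fun z => z + _) (esym (ThE l)))).
  exact: addrAC.
have key := @first_variation_algebra R m (n - m) (J x0) (Th x0) (a^~ x0)
  (fun j => dpairing deg d (A x0) (f_mx (Nn j x0)) / Th x0) (b^~ x0)
  (fun i => 'D_(e i x0) (b i : _ -> R^o) x0) (fun l => 'D_(e l x0) (Th : _ -> R^o) x0) bracket_trace
  (fun l => \tr (dem (e l x0) *m iem)) _ (fun l => dpairing deg d (A x0) (f_mx (T l x0)) / Th x0) (W^~ x0)
  (fun i j => xi i j x0) (fun i j => 'D_(e i x0) (a j : _ -> R^o) x0)
  (fun i j => 'D_(e i x0) (xi i j : _ -> R^o) x0) P Q HQ bracket_traceE (fun i => erefl).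
apply: (etrans _ (etrans key _)).
  apply: (congr2 (fun u v => u - v)).
    apply: (congr1 (fun z => J x0 * z)); apply: (congr2 +%R).
      by apply: eq_bigr => i _; exact: prv_nabla_var.
    exact: f_mx_var.
  apply: (etrans fluxE); apply: eq_bigr => i _.
  by apply: (congr1 (fun z => J x0 * z + _ + _)); exact: WE.
apply: (congr1 (fun z => J x0 * z)); apply: eq_bigr => j _.
apply: (congr1 (fun z => a j x0 * (- z + _ + _))); apply: eq_bigr => i _.
exact: esym (divergence_frame_xi i j).
Qed.

End FirstVariationEuclid.

(** * From coordinates to the manifold *)

Section ChartChange.
Context (R : realType) (n : nat) (N : manifold R n).
Implicit Types (p q r s : N) (c : chart R n N).

Lemma chart_image_near c q : cdom c q -> \forall x \near cmap c q, (cmap c @` cdom c) x.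
Proof. by move=> cq; apply: open_nbhs_nbhs; split; [exact: cimg_open | exists q]. Qed.

Lemma cinvK c x : (cmap c @` cdom c) x -> cdom c (cinv c x) /\ cmap c (cinv c x) = x.
Proof. by move=> [q cq <-]; rewrite cmapK. Qed.

Lemma cinv_near c q (P : set N) : cdom c q -> nbhs q P -> \forall x \near cmap c q, P (cinv c x).
Proof.
move=> cq Pq; have := cinv_continuous (ex_intro2 _ _ q cq erefl).
by rewrite /prop_for /continuous_at cmapK//; exact.
Qed.

Lemma cdom_nbhs c q : cdom c q -> nbhs q (cdom c).
Proof. by move=> cq; apply: open_nbhs_nbhs; split=> //; exact: cdom_open. Qed.

(** Differential at [q] of the transition between the charts around [p] and [r]. With [q] itself as
    source or target it is [to_chart] or [of_chart], so that one cocycle rule covers all cases. *)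
Definition chart_change p r q (v : 'rV[R]_n) : 'rV[R]_n :=
  'D_v (cmap (chart_at r) \o cinv (chart_at p)) (cmap (chart_at p) q).

Lemma Ck_transition k p r : 
  Ck k (cmap (chart_at p) @` (cdom (chart_at p) `&` cdom (chart_at r)))
    (cmap (chart_at r) \o cinv (chart_at p)).
Proof. exact: chart_at_smooth. Qed.

Lemma transition_dom_open p r :
  open (cmap (chart_at p) @` (cdom (chart_at p) `&` cdom (chart_at r))).
Proof.
rewrite openE => _ [q [pq rq] <-].
apply: filterS2 (chart_image_near pq) (cinv_near pq (cdom_nbhs rq)) => x /cinvK[dx xE] rx.
by exists (cinv (chart_at p) x).
Qed.

Lemma differentiable_transition p r q : cdom (chart_at p) q -> cdom (chart_at r) q ->
  differentiable (cmap (chart_at r) \o cinv (chart_at p)) (cmap (chart_at p) q).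
Proof. by move=> pq rq; have [d _] := Ck_transition 1 p r; apply: d; exists q. Qed.

Lemma chart_change_comp p r s q v : cdom (chart_at p) q -> cdom (chart_at r) q -> cdom (chart_at s) q ->
  chart_change r s q (chart_change p r q v) = chart_change p s q v.
Proof.
move=> pq rq sq; rewrite /chart_change.
have e : (cmap (chart_at r) \o cinv (chart_at p)) (cmap (chart_at p) q) = cmap (chart_at r) q.
  by rewrite /= cmapK.
have d1 := differentiable_transition pq rq; have d2 := differentiable_transition rq sq.
have h := @derive_chain _ _ _ _ (cmap (chart_at s) \o cinv (chart_at r))
  (cmap (chart_at r) \o cinv (chart_at p)) (cmap (chart_at p) q) v d1.
rewrite e in h; apply: (etrans (esym (h d2))); apply: near_eq_derive.
apply: filterS (cinv_near pq (cdom_nbhs rq)) => x rx /=.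
by rewrite cmapK.
Qed.

Lemma chart_change_id p q v : cdom (chart_at p) q -> chart_change p p q v = v.
Proof.
move=> pq; have h : \forall x \near cmap (chart_at p) q,
    (cmap (chart_at p) \o cinv (chart_at p)) x = id x.
  by apply: filterS (chart_image_near pq) => x /cinvK[].
have e : chart_change p p q v = 'D_v id (cmap (chart_at p) q) := near_eq_derive v h.
by rewrite e derive_id.
Qed.

Lemma chart_changeK p r q v : cdom (chart_at p) q -> cdom (chart_at r) q ->
  chart_change r p q (chart_change p r q v) = v.
Proof. by move=> pq rq; rewrite chart_change_comp// chart_change_id. Qed.

Lemma chart_change_linear p r q a u v : cdom (chart_at p) q -> cdom (chart_at r) q ->
  chart_change p r q (a *: u + v) = a *: chart_change p r q u + chart_change p r q v.
Proof.
move=> pq rq; have d := differentiable_transition pq rq.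
by rewrite /chart_change deriveDl// deriveZl.
Qed.

Lemma chart_change0 p r q : cdom (chart_at p) q -> cdom (chart_at r) q -> chart_change p r q 0 = 0.
Proof.
move=> pq rq; have := chart_change_linear (-1) 0 0 pq rq.
by rewrite scaler0 addr0 scaleN1r addNr.
Qed.

Lemma chart_changeZ p r q a v : cdom (chart_at p) q -> cdom (chart_at r) q ->
  chart_change p r q (a *: v) = a *: chart_change p r q v.
Proof.
by move=> pq rq; have := chart_change_linear a v 0 pq rq; rewrite addr0 (chart_change0 pq rq) addr0.
Qed.

Lemma to_chartE p q v : to_chart (chart_at p) q v = chart_change q p q v.
Proof. by []. Qed.

End ChartChange.

Section MapsInCharts.
Context (R : realType) (m n : nat) (M : manifold R m) (N : manifold R n).

(* The target chart of [map_in_charts F q] depends on [q]; this compares it with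
   fixed charts around [p] and [b]. *)
Lemma chart_change_dmap (F : M -> N) (p q : M) (b : N) v :
  {for q, continuous F} -> cdom (chart_at p) q -> cdom (chart_at b) (F q) ->
  differentiable (cmap (chart_at b) \o F \o cinv (chart_at p)) (cmap (chart_at p) q) ->
  chart_change (F q) b (F q) (dmap F q (chart_change p q q v)) =
  'D_v (cmap (chart_at b) \o F \o cinv (chart_at p)) (cmap (chart_at p) q).
Proof.
move=> cF pq bq dF; have qq := chart_atP q; have fq := chart_atP (F q).
set G := cmap (chart_at b) \o F \o cinv (chart_at p) in dF *.
pose tF := cmap (chart_at (F q)) \o cinv (chart_at b); pose tq := cmap (chart_at p) \o cinv (chart_at q).
have e : map_in_charts F q = cmap (chart_at (F q)) \o F \o cinv (chart_at q) by [].
have near1 : \forall x \near pt q, map_in_charts F q x = (tF \o (G \o tq)) x.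
  have nF : nbhs q (F @^-1` cdom (chart_at b)) by apply: cF; exact: cdom_nbhs.
  apply: filterS2 (cinv_near qq (cdom_nbhs pq)) (cinv_near qq nF) => x px bx.
  by rewrite /tF /tq /G /map_in_charts /= !cmapK.
have tqE : tq (pt q) = cmap (chart_at p) q by rewrite /tq /pt /= cmapK.
have GE : G (cmap (chart_at p) q) = cmap (chart_at b) (F q) by rewrite /G /= cmapK.
have dtq : differentiable tq (pt q) by exact: differentiable_transition.
have dtF : differentiable tF (cmap (chart_at b) (F q)) by exact: differentiable_transition.
have dG : differentiable G (tq (pt q)) by rewrite tqE.
have dGtq : differentiable (G \o tq) (pt q) by exact: differentiable_comp.
have dtF' : differentiable tF ((G \o tq) (pt q)) by rewrite /comp tqE GE.
have step w : dmap F q w = chart_change b (F q) (F q) ('D_(chart_change q p q w) G (cmap (chart_at p) q)).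
  apply: (etrans (near_eq_derive w near1)); apply: (etrans (derive_chain w dGtq dtF')).
  apply: (etrans (congr1 (fun z => 'D_z tF _) (derive_chain w dtq dG))).
  by rewrite /comp tqE GE.
have e1 := congr1 (chart_change (F q) b (F q)) (step (chart_change p q q v)).
apply: (etrans e1); apply: (etrans (chart_changeK _ bq fq)).
by rewrite chart_changeK.
Qed.

End MapsInCharts.

(** * Orthonormal bases, m-vectors and adapted frames *)

Section PositiveForms.
Context (R : realType) (n : nat) (h : 'rV[R]_n -> 'rV[R]_n -> R).
Hypothesis hlin : forall a u v w, h (a *: u + v) w = a * h u w + h v w.
Hypothesis hsym : forall u v, h u v = h v u.
Hypothesis hpos : forall v, v != 0 -> 0 < h v v.

(** One vector at a time: the vectors orthogonal to the [k < n] previous ones form the kernel of a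
    matrix with [k] columns, which is not zero. *)
Lemma orthonormal_exists k : (k <= n)%N ->
  exists Y : 'I_k -> 'rV[R]_n, forall i j, h (Y i) (Y j) = (i == j)%:R.
Proof.
elim: k => [_|k IH kn]; first by exists (fun=> 0) => -[].
have [Y YY] := IH (ltnW kn).
pose A : 'M[R]_(n, k) := \matrix_(i, j) h (delta_mx 0 i) (Y j).
have hA v j : (v *m A) 0 j = h v (Y j).
  rewrite {2}(row_sum_delta v) (form_suml hlin) mxE.
  by apply: eq_bigr => i _; rewrite (formZl hlin) mxE.
have : kermx A != 0.
  rewrite -mxrank_eq0 mxrank_ker subn_eq0 -ltnNge.
  exact: leq_ltn_trans (rank_leq_col A) kn.
move=> /rowV0Pn[v /sub_kermxP vA v0].
have hv j : h v (Y j) = 0 by rewrite -hA vA mxE.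
have c0 := hpos v0.
have s0 : Num.sqrt (h v v) != 0 by rewrite gt_eqF// sqrtr_gt0.
pose w := (Num.sqrt (h v v))^-1 *: v.
have ww : h w w = 1.
  rewrite /w (formZl hlin) (formZr hlin hsym) mulrA -invfM -expr2 sqr_sqrtr ?ltW//.
  by rewrite mulVf// gt_eqF.
have wY j : h w (Y j) = 0 by rewrite /w (formZl hlin) hv mulr0.
exists (fun i => if unlift ord_max i is Some j then Y j else w) => i j.
case: (unliftP ord_max i) => [i' ->|->]; case: (unliftP ord_max j) => [j' ->|->].
- by rewrite YY (inj_eq lift_inj).
- by rewrite hsym wY eq_sym (negPf (neq_lift _ _)).
- by rewrite wY (negPf (neq_lift _ _)).
- by rewrite ww eqxx.
Qed.

Lemma form_mx_unit : form_mx h \in unitmx.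
Proof.
rewrite unitmxE unitfE; apply/det0P => -[v v0 /(congr1 (fun u => (u *m v^T) 0 0))].
by rewrite -(formE hlin hsym) mul0mx mxE => e; have := hpos v0; rewrite e ltxx.
Qed.

End PositiveForms.

Lemma det_set_col_sum (R : realType) m (A B : 'M[R]_m) :
  \sum_k \det (\matrix_(i, l) if l == k then B i k else A i l) = \tr (B *m \adj A).
Proof.
rewrite mxtrace_mulC; apply: eq_bigr => k _; rewrite mxE.
transitivity (\det (\matrix_(i, l) if l == k then (col k B) i 0 else A i l)).
  by congr (\det _); apply/matrixP => i l; rewrite !mxE.
by rewrite det_set_col mxE; apply: eq_bigr => i _; rewrite !mxE.
Qed.

Section WedgeFrames.
Context (R : realType) (n m : nat) (h : 'rV[R]_n -> 'rV[R]_n -> R).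
Hypothesis hlin : forall a u v w, h (a *: u + v) w = a * h u w + h v w.
Hypothesis hsym : forall u v, h u v = h v u.

Definition comp_mx (X : 'I_n -> 'rV[R]_n) (u : 'I_m -> 'rV[R]_n) : 'M[R]_(m, n) :=
  \matrix_(i, k) h (u i) (X k).
Definition comp_row (X : 'I_n -> 'rV[R]_n) (y : 'rV[R]_n) : 'rV[R]_n := \row_k h y (X k).

Lemma mdot_wedge_frame X (u : 'I_m -> 'rV[R]_n) (J : midx n m) :
  mdot h (wedge u) (wedge_frame X J) = minor J (comp_mx X u).
Proof.
rewrite /wedge_frame (mdot_wedge hlin hsym) /minor; congr (\det _).
by apply/matrixP => i k; rewrite !mxE.
Qed.

Lemma mdot_wedge_at_frame X (u : 'I_m -> 'rV[R]_n) i y (J : midx n m) :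
  mdot h (wedge_at u i y) (wedge_frame X J) = minor J (set_mxrow (comp_mx X u) i (comp_row X y)).
Proof.
rewrite /wedge_at mdot_wedge_frame; congr (minor _ _).
by apply/matrixP => k l; rewrite !mxE; case: ifP.
Qed.

Section Orthonormal.
Context (X : 'I_n -> 'rV[R]_n).
Hypothesis XX : forall i j, h (X i) (X j) = (i == j)%:R.

Lemma wedge_frame_orthonormal (J K : midx n m) :
  mdot h (wedge_frame X J) (wedge_frame X K) = (J == K)%:R.
Proof.
rewrite /wedge_frame (mdot_wedge hlin hsym).
have [->|JK] := eqVneq J K.
  rewrite [X in \det X](_ : _ = 1%:M) ?det1//.
  by apply/matrixP => i k; rewrite !mxE XX (inj_eq (@midx_inj _ _ K)).
rewrite /determinant big1// => s _.
have [i si] : exists i, val J i != val K (s i).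
  apply/existsP; apply: contraNT JK => /existsPn JK; apply/eqP.
  have [|-> //] := @midx_perm_inj m n J K 1%g s.
  by move=> i; rewrite perm1; have := JK i; rewrite negbK => /eqP.
by rewrite (bigD1 i)//= mxE XX (negPf si) mul0r mulr0.
Qed.

Context (deg : 'I_n -> nat) (d : nat).

(** [mvec_part] for an explicit frame in place of the one picked by [xget]. *)
Definition graded_part (w : mvec R n m) : mvec R n m :=
  \sum_(J | jdeg deg J == d) mdot h w (wedge_frame X J) *: wedge_frame X J.

Lemma mdot_graded_part w w' :
  mdot h w' (graded_part w) =
  \sum_(J | jdeg deg J == d) mdot h w' (wedge_frame X J) * mdot h w (wedge_frame X J).
Proof. by rewrite mdot_sumr; apply: eq_bigr => J _; rewrite mdotZr mulrC. Qed.

Lemma mdot_graded_part2 w : mdot h (graded_part w) (graded_part w) =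
  \sum_(J | jdeg deg J == d) mdot h w (wedge_frame X J) * mdot h w (wedge_frame X J).
Proof.
rewrite mdot_graded_part; apply: eq_bigr => J Jd; congr (_ * _).
rewrite mdot_suml (bigD1 J)//= big1 ?addr0 => [|K /andP[_ KJ]]; rewrite mdotZl wedge_frame_orthonormal.
  by rewrite eqxx mulr1.
by rewrite (negPf KJ) mulr0.
Qed.

Lemma mnorm_graded_part (u : 'I_m -> 'rV[R]_n) :
  mnorm h (graded_part (wedge u)) = Num.sqrt (pairing deg d (comp_mx X u) (comp_mx X u)).
Proof.
rewrite /mnorm mdot_graded_part2; congr Num.sqrt.
by apply: eq_bigr => J _; rewrite mdot_wedge_frame.
Qed.

Lemma mdot_unit_graded_part (u : 'I_m -> 'rV[R]_n) i y (w := graded_part (wedge u)) :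
  mdot h (wedge_at u i y) ((mnorm h w)^-1 *: w) =
  pairing_row deg d (comp_mx X u) (comp_row X y) 0 i /
    Num.sqrt (pairing deg d (comp_mx X u) (comp_mx X u)).
Proof.
rewrite mdotZr /w mnorm_graded_part mulrC; congr (_ / _).
rewrite mdot_graded_part pairing_rowE; apply: eq_bigr => J _.
by rewrite mdot_wedge_at_frame mdot_wedge_frame.
Qed.

End Orthonormal.

(** A derivation of [X_J] replaces one factor at a time, that is, one column of the matrix of inner
    products; the sum is the trace in Jacobi's formula. *)
Lemma dpairing_wedge (deg : 'I_n -> nat) (d : nat) (X Y : 'I_n -> 'rV[R]_n) (u : 'I_m -> 'rV[R]_n) :
  \sum_(J | jdeg deg J == d)
    mdot h (wedge u) (\sum_(k < m) wedge_at (fun l => X (val J l)) k (Y (val J k))) *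
    mdot h (wedge u) (wedge_frame X J) =
  dpairing deg d (comp_mx X u) (comp_mx Y u).
Proof.
apply: eq_bigr => J _; rewrite mdot_wedge_frame mulrC; congr (_ * _).
rewrite mdot_sumr -det_set_col_sum; apply: eq_bigr => k _.
rewrite /wedge_at (mdot_wedge hlin hsym); congr (\det _); apply/matrixP => i l; rewrite !mxE.
by case: ifP.
Qed.

(* The transition matrix between two orthonormal bases adapted to the same flag
   preserves degrees, so the pairings do not depend on the basis. *)
Section ChangeFrame.
Context (X Y : 'I_n -> 'rV[R]_n).
Hypothesis XX : forall i j, h (X i) (X j) = (i == j)%:R.
Hypothesis YY : forall i j, h (Y i) (Y j) = (i == j)%:R.

Definition frame_change : 'M[R]_n := \matrix_(k, l) h (X k) (Y l).

Lemma frame_change_orthogonal : frame_change *m frame_change^T = 1%:M.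
Proof.
apply/matrixP => i j; rewrite !mxE -XX (parseval hlin hsym YY erefl).
by apply: eq_bigr => k _; rewrite !mxE.
Qed.

Lemma comp_mx_change u : comp_mx Y u = comp_mx X u *m frame_change.
Proof.
apply/matrixP => i l; rewrite !mxE (parseval hlin hsym XX erefl).
by apply: eq_bigr => k _; rewrite !mxE [h (Y l) _]hsym.
Qed.

Lemma comp_row_change y : comp_row Y y = comp_row X y *m frame_change.
Proof.
apply/rowP => l; rewrite !mxE (parseval hlin hsym XX erefl).
by apply: eq_bigr => k _; rewrite !mxE [h (Y l) _]hsym.
Qed.

End ChangeFrame.

End WedgeFrames.

Section AdaptedFrames.
Context (R : realType) (n : nat) (N : manifold R n)
  (g : riemannian_metric N) (H : equiregular_grading N).

(** A vector [X k] in the [i]-th step of the flag is a combination of the [Y] vectors spanning that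
    step, so it is orthogonal to all later ones. Used both ways, this puts [k] and [l] in the same
    steps. *)
Lemma frame_change_vdeg y (X Y : 'I_n -> 'rV[R]_n) k l :
  adapted_orthonormal g H y X -> adapted_orthonormal g H y Y ->
  frame_change (g y) X Y k l != 0 -> vdeg H k = vdeg H l.
Proof.
have glin := metric_linear g y; have gsym := metric_sym g y.
have key (X' Y' : 'I_n -> 'rV[R]_n) i k' l' : adapted_orthonormal g H y X' ->
    adapted_orthonormal g H y Y' -> g y (X' k') (Y' l') != 0 -> (k' < rk H i)%N -> (l' < rk H i)%N.
  move=> [aX oX] [aY oY] kl ki; apply: contraNT kl; rewrite -leqNgt => il; apply/eqP.
  have : X' k' \in H i y.
    rewrite aX; apply: memv_span; apply/mapP; exists k' => //.
    by rewrite mem_filter ki mem_enum.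
  rewrite aY => /(@coord_span _ _ _ (in_tuple _)) ->; rewrite (form_suml glin) big1// => j _.
  rewrite (formZl glin) /=; set s := [seq _ | _ <- _].
  have /mapP[j' jj ->] : s`_j \in s by exact: mem_nth.
  rewrite oY (_ : (j' == l') = false) ?mulr0//; apply/negP => /eqP e.
  by move: jj; rewrite mem_filter e ltnNge il.
move=> aX aY; rewrite mxE => kl.
have kl' i : (k < rk H i)%N = (l < rk H i)%N.
  by apply/idP/idP; [exact: (key X Y) | apply: (key Y X) => //; rewrite gsym].
rewrite /vdeg; congr (xget _ _); apply/seteqP; split=> i /=.
  by rewrite ![(rk H i.-1 <= _)%N]leqNgt !kl'.
by rewrite ![(rk H i.-1 <= _)%N]leqNgt !kl'.
Qed.

Context (m d : nat).
Local Notation deg := (vdeg H).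

Lemma pairing_adapted y (X Y : 'I_n -> 'rV[R]_n) (u v : 'I_m -> 'rV[R]_n) :
  adapted_orthonormal g H y X -> adapted_orthonormal g H y Y ->
  pairing deg d (comp_mx (g y) Y u) (comp_mx (g y) Y v) =
  pairing deg d (comp_mx (g y) X u) (comp_mx (g y) X v).
Proof.
move=> aX aY; have glin := metric_linear g y; have gsym := metric_sym g y.
rewrite !(comp_mx_change glin gsym Y (proj2 aX)) pairing_mulr//.
  by apply: frame_change_orthogonal => //; [exact: (proj2 aX) | exact: (proj2 aY)].
by move=> k l; exact: frame_change_vdeg.
Qed.

Lemma pairing_row_adapted y (X Y : 'I_n -> 'rV[R]_n) (u : 'I_m -> 'rV[R]_n) v :
  adapted_orthonormal g H y X -> adapted_orthonormal g H y Y ->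
  pairing_row deg d (comp_mx (g y) Y u) (comp_row (g y) Y v) =
  pairing_row deg d (comp_mx (g y) X u) (comp_row (g y) X v).
Proof.
move=> aX aY; have glin := metric_linear g y; have gsym := metric_sym g y.
rewrite (comp_mx_change glin gsym Y (proj2 aX)) (comp_row_change glin gsym Y (proj2 aX)) pairing_row_mulr//.
  by apply: frame_change_orthogonal => //; [exact: (proj2 aX) | exact: (proj2 aY)].
by move=> k l; exact: frame_change_vdeg.
Qed.

Lemma mvec_partE y (w : mvec R n m) (X := xget (fun=> 0) [set X | adapted_orthonormal g H y X]) :
  mvec_part g H d y w = graded_part (g y) X deg d w.
Proof. by []. Qed.

Lemma mnorm_mvec_part y X (u : 'I_m -> 'rV[R]_n) : adapted_orthonormal g H y X ->
  mnorm (g y) (mvec_part g H d y (wedge u)) =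
  Num.sqrt (pairing deg d (comp_mx (g y) X u) (comp_mx (g y) X u)).
Proof.
move=> aX; have glin := metric_linear g y; have gsym := metric_sym g y.
rewrite mvec_partE; case: xgetP => [Y -> aY|/(_ _ aX)//].
rewrite (mnorm_graded_part glin gsym (proj2 aY)); congr Num.sqrt.
exact: pairing_adapted.
Qed.

Lemma mdot_unit_mvec_part y X (u : 'I_m -> 'rV[R]_n) i v (w := mvec_part g H d y (wedge u)) :
  adapted_orthonormal g H y X ->
  mdot (g y) (wedge_at u i v) ((mnorm (g y) w)^-1 *: w) =
  pairing_row deg d (comp_mx (g y) X u) (comp_row (g y) X v) 0 i /
    Num.sqrt (pairing deg d (comp_mx (g y) X u) (comp_mx (g y) X u)).
Proof.
move=> aX; have glin := metric_linear g y; have gsym := metric_sym g y.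
rewrite /w mvec_partE; case: xgetP => [Y -> aY|/(_ _ aX)//].
rewrite (mdot_unit_graded_part glin gsym (proj2 aY)).
by rewrite (pairing_row_adapted _ _ aX aY) (pairing_adapted _ _ aX aY).
Qed.

End AdaptedFrames.

Lemma smooth_at_forall (R : realType) (V W : normedModType R) (I : finType) (f : I -> V -> W) x :
  (forall i, smooth_at (f i) x) ->
  exists2 U : set V, open_nbhs x U & forall i, smooth_on U (f i).
Proof.
move=> sf; have /choice[U UP] : forall i, exists U : set V, open_nbhs x U /\ smooth_on U (f i).
  by move=> i; have [U oU sU] := sf i; exists U.
have nU : nbhs x [set y | forall i, U i y].
  by apply: filter_forall => i; apply: open_nbhs_nbhs; exact: (proj1 (UP i)).
exists (interior [set y | forall i, U i y]); first by split; [exact: open_interior | exact: nU].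
move=> i k; apply: Ck_subset (proj2 (UP i) k) => y /interior_subset; exact.
Qed.

Lemma smooth_at_differentiable (R : realType) (V W : normedModType R) (f : V -> W) x :
  smooth_at f x -> differentiable f x.
Proof. by move=> [U [oU Ux] sU]; have [d _] := sU 1%N; exact: d. Qed.

(** * The Levi-Civita connection at the centre of a chart *)

Section MetricInCharts.
Context (R : realType) (n : nat) (N : manifold R n) (g : riemannian_metric N).

Definition metric_coef (b : N) (i j : 'I_n) (z : 'rV[R]_n) : R^o :=
  form_in_chart g (chart_at b) (delta_mx 0 i) (delta_mx 0 j) z.

Lemma chart_change_sum p r q (v : 'rV[R]_n) : cdom (chart_at p) q -> cdom (chart_at r) q ->
  chart_change p r (q : N) v = \sum_i v 0 i *: chart_change p r q (delta_mx 0 i).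
Proof.
move=> pq rq; rewrite {1}(row_sum_delta v) /chart_change derive_suml; last exact: differentiable_transition.
by apply: eq_bigr => i _; rewrite deriveZl//; exact: differentiable_transition.
Qed.

Lemma coef_form_chart b y u v : cdom (chart_at b) y ->
  coef_form (metric_coef b) (cmap (chart_at b) y) u v =
  g y (chart_change b y y u) (chart_change b y y v).
Proof.
move=> yb; have yy := chart_atP y.
rewrite (chart_change_sum u yb yy) (chart_change_sum v yb yy).
rewrite (form_suml (metric_linear g y)); apply: eq_bigr => i _.
rewrite (form_sumr (metric_linear g y) (metric_sym g y)); apply: eq_bigr => j _.
rewrite (formZl (metric_linear g y)) (formZr (metric_linear g y) (metric_sym g y)).
rewrite mulrA /metric_coef /form_in_chart cmapK//.
Qed.

Lemma coef_form_pt y u v : coef_form (metric_coef y) (pt y) u v = g y u v.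
Proof. by rewrite coef_form_chart; [rewrite !chart_change_id//; exact: chart_atP | exact: chart_atP]. Qed.

Lemma metric_coef_sym b i j z : metric_coef b i j z = metric_coef b j i z.
Proof. exact: metric_sym. Qed.

Lemma metric_coef_smooth b : exists2 O : set 'rV[R]_n, open_nbhs (pt b) O &
  forall k i j, Ck k O (metric_coef b i j).
Proof.
have [Ob oOb ObP] := @smooth_at_forall R _ _ ('I_n * 'I_n)%type (fun ij => metric_coef b ij.1 ij.2) (pt b)
  (fun ij => metric_smooth g b (delta_mx 0 ij.1) (delta_mx 0 ij.2)).
by exists Ob => // k i j; exact: (ObP (i, j) k).
Qed.

Lemma differentiable_metric_coef b i j : differentiable (metric_coef b i j) (pt b).
Proof. exact: smooth_at_differentiable (metric_smooth _ _ _ _). Qed.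

Lemma derive_form_in_chart y (u a b : 'rV[R]_n) :
  'D_u (form_in_chart g (chart_at y) a b) (pt y) =
  \sum_i \sum_j a 0 i * b 0 j * 'D_u (metric_coef y i j) (pt y).
Proof.
have h : \forall z \near pt y, form_in_chart g (chart_at y) a b z = coef_form (metric_coef y) z a b :> R^o.
  apply: filterS (chart_image_near (chart_atP y)) => z /cinvK[yz zE].
  by rewrite -{2}zE coef_form_chart.
rewrite (near_eq_derive _ h).
have [D DP] : exists D : 'I_n -> 'I_n -> R, forall i j, is_derive (pt y) u (metric_coef y i j) (D i j).
  exists (fun i j => 'D_u (metric_coef y i j) (pt y)) => i j.
  exact/differentiable_is_derive/differentiable_metric_coef.
have H : is_derive (pt y) u (fun z => coef_form (metric_coef y) z a b : R^o) (\sum_i \sum_j a 0 i * b 0 j * D i j).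
  apply: is_derive_bigsum => i _; apply: is_derive_bigsum => j _.
have [_ ->] := H; apply: eq_bigr => i _; apply: eq_bigr => j _.
by have [_ ->] := DP i j.
Qed.

Let G (y : N) (u a b : 'rV[R]_n) : R := \sum_i \sum_j a 0 i * b 0 j * 'D_u (metric_coef y i j) (pt y).

Let koszulE y u v w : koszul g y u v w = 2^-1 * (G y u v w + G y v u w - G y w u v).
Proof.
exact: (congr1 (fun z => 2^-1 * z) (congr2 (fun s t => s - t)
  (congr2 +%R (derive_form_in_chart y u v w) (derive_form_in_chart y v u w)) (derive_form_in_chart y w u v))).
Qed.

Let G_coef_linear y u c a a' b : G y u (c *: a + a') b = c * G y u a b + G y u a' b.
Proof.
rewrite /G big_distrr -big_split; apply: eq_bigr => i _ /=.
by rewrite big_distrr -big_split; apply: eq_bigr => j _ /=; rewrite !mxE; ring.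
Qed.

Let G_sym y u a b : G y u a b = G y u b a.
Proof.
rewrite /G exchange_big; apply: eq_bigr => i _; apply: eq_bigr => j _.
have e : metric_coef y j i = metric_coef y i j by apply/funext => z; exact: metric_coef_sym.
exact: (congr2 *%R (mulrC _ _) (congr1 (fun f => 'D_u f (pt y)) e)).
Qed.

Let G_dir_linear y c u u' a b : G y (c *: u + u') a b = c * G y u a b + G y u' a b.
Proof.
rewrite /G big_distrr -big_split; apply: eq_bigr => i _ /=.
rewrite big_distrr -big_split; apply: eq_bigr => j _ /=.
have d := differentiable_metric_coef y i j.
rewrite deriveDl// deriveZl// /GRing.scale /=.
by move: ('D_u _ _) ('D_u' _ _) => p q; ring.
Qed.

(** Presents the derivative of the metric as an opaque trilinear form, so that the identities drawn
    from the Koszul formula reduce to algebra. *)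
Lemma metric_derivative_exists y : exists D : 'rV[R]_n -> 'rV[R]_n -> 'rV[R]_n -> R,
  [/\ forall u a b : 'rV[R]_n, \sum_i \sum_j a 0 i * b 0 j * 'D_u (metric_coef y i j) (pt y) = D u a b,
      forall u c a a' b, D u (c *: a + a') b = c * D u a b + D u a' b,
      forall u a b, D u a b = D u b a,
      forall c u u' a b, D (c *: u + u') a b = c * D u a b + D u' a b
    & forall u v w, koszul g y u v w = 2^-1 * (D u v w + D v u w - D w u v)].
Proof.
exists (G y); split; [by [] | exact: G_coef_linear | exact: G_sym | exact: G_dir_linear | exact: koszulE].
Qed.

Lemma metric_christoffel y u v w : g y (christoffel g y u v) w = koszul g y u v w.
Proof.
have glin := metric_linear g y; have gsym := metric_sym g y.
have [D [_ Dlin Dsym Ddir kE]] := metric_derivative_exists y.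
have klin c a b : koszul g y u v (c *: a + b) = c * koszul g y u v a + koszul g y u v b.
  rewrite !kE (Dsym _ v (_ + _)) Dlin (Dsym _ u (_ + _)) Dlin Ddir.
  by rewrite (Dsym u a v) (Dsym u b v) (Dsym v a u) (Dsym v b u); ring.
rewrite (formE glin gsym) /christoffel -/(form_mx (g y)) mulmxKV; last first.
  exact: form_mx_unit glin gsym (@metric_pos _ _ _ g y).
rewrite {2}(row_sum_delta w) mxE (scalar_linear_sum klin).
by apply: eq_bigr => k _; rewrite !mxE mulrC.
Qed.

Lemma metric_inj y a b : (forall w, g y a w = g y b w) -> a = b.
Proof.
move=> ab; apply/eqP; rewrite -subr_eq0; apply: contraT => /(@metric_pos _ _ _ g y).
by rewrite -scaleN1r addrC metric_linear ab mulN1r addNr ltxx.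
Qed.

Lemma christoffel_sym y u v : christoffel g y u v = christoffel g y v u.
Proof.
have [D [_ Dlin Dsym Ddir kE]] := metric_derivative_exists y.
apply: (@metric_inj y) => w.
apply: (etrans (etrans (metric_christoffel y u v w) (kE u v w))).
apply: (etrans _ (esym (etrans (metric_christoffel y v u w) (kE v u w)))).
by rewrite (Dsym w u v) (addrC (D u v w)).
Qed.

Lemma christoffel_linear y c u u' v :
  christoffel g y (c *: u + u') v = c *: christoffel g y u v + christoffel g y u' v.
Proof.
have [D [_ Dlin Dsym Ddir kE]] := metric_derivative_exists y.
apply: (@metric_inj y) => w; rewrite metric_linear.
apply: (etrans (etrans (metric_christoffel y _ v w) (kE _ v w))).
apply: (etrans _ (esym (congr2 (fun s t => c * s + t) (etrans (metric_christoffel y u v w) (kE u v w))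
  (etrans (metric_christoffel y u' v w) (kE u' v w))))).
by rewrite Ddir !Dlin; ring.
Qed.

Lemma christoffel_compat y (u a b : 'rV[R]_n) :
  \sum_i \sum_j a 0 i * b 0 j * 'D_u (metric_coef y i j) (pt y) =
  coef_form (metric_coef y) (pt y) (christoffel g y u a) b +
  coef_form (metric_coef y) (pt y) a (christoffel g y u b).
Proof.
have [D [DE Dlin Dsym Ddir kE]] := metric_derivative_exists y.
apply: (etrans (DE u a b)); rewrite !coef_form_pt [g y a _]metric_sym.
apply: (etrans _ (esym (congr2 +%R (etrans (metric_christoffel y u a b) (kE u a b))
  (etrans (metric_christoffel y u b a) (kE u b a))))).
by rewrite (Dsym u b a) (Dsym a u b) (Dsym b u a); field.
Qed.

End MetricInCharts.

(** * The area density of an immersion in a chart *)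

Section ImmersedArea.
Context (R : realType) (m n : nat) (M : manifold R m) (N : manifold R n)
  (g : riemannian_metric N) (H : equiregular_grading N) (d : nat).
Local Notation deg := (vdeg H).

Lemma comp_mx_sum y (X : 'I_n -> 'rV[R]_n) p (a : 'M[R]_(p, m)) (u : 'I_m -> 'rV[R]_n) (w : 'I_p -> 'rV[R]_n) :
  (forall i, w i = \sum_k a i k *: u k) -> comp_mx (g y) X w = a *m comp_mx (g y) X u.
Proof.
move=> wE; apply/matrixP => i l; rewrite !mxE wE (form_suml (metric_linear g y)).
by apply: eq_bigr => k _; rewrite (formZl (metric_linear g y)) mxE.
Qed.

Context (F : M -> N) (q : M).
Hypothesis dF : differentiable (map_in_charts F q) (pt q).

Lemma dmap_linear a u v : dmap F q (a *: u + v) = a *: dmap F q u + dmap F q v.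
Proof. by rewrite /dmap deriveDl// deriveZl. Qed.

Lemma pullback_linear a u v w :
  pullback g F q (a *: u + v) w = a * pullback g F q u w + pullback g F q v w.
Proof. by rewrite /pullback dmap_linear metric_linear. Qed.

Lemma pullback_sym u v : pullback g F q u v = pullback g F q v u.
Proof. exact: metric_sym. Qed.

Hypothesis injF : forall v, dmap F q v = 0 -> v = 0.

Lemma pullback_pos v : v != 0 -> 0 < pullback g F q v v.
Proof. by move=> v0; apply: metric_pos; apply: contra_neq v0 => /injF. Qed.

(** Orthonormality reads [a *m Hm *m a^T = 1%:M] for the matrix [Hm] of the metric, whence [\det Hm]
    is the inverse square of [\det a]. *)
Lemma density_orthonormal p (e : 'I_m -> 'rV[R]_m) : cdom (chart_at p) q -> orthonormal_basis g F q e ->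
  let a : 'M[R]_m := \matrix_(i, k) (to_chart (chart_at p) q (e i)) 0 k in
  \det a != 0 /\ density (pullback g F) (chart_at p) (cmap (chart_at p) q) = `|\det a|^-1.
Proof.
move=> pq eo a; have qq := chart_atP q.
have eE i : e i = \sum_k a i k *: of_chart (chart_at p) q (delta_mx 0 k).
  rewrite -{1}(@chart_changeK _ _ _ q p q (e i))// (chart_change_sum _ pq qq).
  by apply: eq_bigr => k _; rewrite mxE.
pose Hm := \matrix_(i, j) form_in_chart (pullback g F) (chart_at p) (delta_mx 0 i) (delta_mx 0 j)
  (cmap (chart_at p) q).
have aHa : a *m (Hm *m a^T) = 1%:M.
  apply/matrixP => i j; rewrite [RHS]mxE -eo {1}eE (form_suml pullback_linear) mxE.
  apply: eq_bigr => k _; rewrite (formZl pullback_linear) eE (form_sumr pullback_linear pullback_sym).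
  congr (_ * _); rewrite [LHS]mxE; apply: eq_bigr => l _; rewrite (formZr pullback_linear pullback_sym).
  by rewrite mulrC [a^T l j]mxE [Hm k l]mxE /form_in_chart cmapK.
have h := congr1 determinant aHa; rewrite det1 !det_mulmx det_tr in h.
have a0 : \det a != 0 by case: eqVneq h => // ->; rewrite mul0r => /esym/eqP; rewrite oner_eq0.
split=> //; rewrite /density -/Hm.
have -> : \det Hm = (\det a)^-1 ^+ 2.
  by apply: (mulfI a0); apply: (mulIf a0); rewrite -mulrA h; field.
by rewrite sqrtr_sqr normfV.
Qed.

(** Frees [Theta] from its choice of a basis: two orthonormal bases differ by an orthogonal matrix,
    whose determinant has square 1. *)
Lemma Theta_orthonormal X (e : 'I_m -> 'rV[R]_m) :
  adapted_orthonormal g H (F q) X -> orthonormal_basis g F q e ->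
  Theta g H d F q = Num.sqrt (pairing deg d
    (comp_mx (g (F q)) X (fun i => dmap F q (e i))) (comp_mx (g (F q)) X (fun i => dmap F q (e i)))).
Proof.
move=> aX eo; rewrite /Theta; case: xgetP => [e' _ eo'|/(_ _ eo)//].
rewrite (mnorm_mvec_part d _ aX).
have OO := frame_change_orthogonal pullback_linear pullback_sym eo eo'.
have eE i : dmap F q (e i) = \sum_k frame_change (pullback g F q) e e' i k *: dmap F q (e' k).
  rewrite {1}(orthonormal_basis_decomp pullback_linear pullback_sym eo' erefl (e i)) /dmap derive_suml//.
  by apply: eq_bigr => k _; rewrite deriveZl// mxE.
rewrite (comp_mx_sum _ _ eE) pairing_mull.
have := congr1 determinant OO; rewrite det_mulmx det_tr det1 -expr2 => ->.
by rewrite mul1r.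
Qed.

(* The Jacobians of the change from the coordinate basis of the chart around [p]
   to an orthonormal one cancel. *)
Lemma Theta_density p X (u := fun k : 'I_m => dmap F q (of_chart (chart_at p) q (delta_mx 0 k))) :
  cdom (chart_at p) q -> adapted_orthonormal g H (F q) X ->
  Theta g H d F q * density (pullback g F) (chart_at p) (cmap (chart_at p) q) =
  Num.sqrt (pairing deg d (comp_mx (g (F q)) X u) (comp_mx (g (F q)) X u)).
Proof.
move=> pq aX; have qq := chart_atP q.
have [e eo] := orthonormal_exists pullback_linear pullback_sym pullback_pos (leqnn m).
have [a0 ->] := density_orthonormal pq eo; set a := \matrix_(i, k) _ in a0 *.
have weE i : dmap F q (e i) = \sum_k a i k *: u k.
  rewrite -{1}(@chart_changeK _ _ _ q p q (e i))// (chart_change_sum _ pq qq) /dmap derive_suml//.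
  by apply: eq_bigr => k _; rewrite deriveZl// mxE.
rewrite (Theta_orthonormal aX eo) (comp_mx_sum _ _ weE) pairing_mull sqrtrM ?sqr_ge0// sqrtr_sqr.
by rewrite mulrAC mulfV ?mul1r// normr_eq0.
Qed.

End ImmersedArea.

(** * The variation read in charts *)

Section VariationInCharts.
Context (R : realType) (m n : nat) (M : manifold R m) (N : manifold R n)
  (g : riemannian_metric N) (H : equiregular_grading N) (d : nat) (Gam : M -> R -> N).
Local Notation deg := (vdeg H).

Definition var_in_charts (p : M) (b : N) (z : 'rV[R]_m * R^o) : 'rV[R]_n :=
  cmap (chart_at b) (Gam (cinv (chart_at p) z.1) z.2).

Definition frame_in_chart (Xf : 'I_n -> N -> 'rV[R]_n) (b : N) (k : 'I_n) : 'rV[R]_n -> 'rV[R]_n :=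
  field_in_charts idfun (Xf k) b.

Lemma field_in_chartE (Y : N -> 'rV[R]_n) b y : cdom (chart_at b) y ->
  field_in_charts idfun Y b (cmap (chart_at b) y) = chart_change y b y (Y y).
Proof. by move=> yb; rewrite /field_in_charts cmapK. Qed.

Section AtPoint.
Context (p q : M) (b : N) (t : R).
Local Notation y := (Gam q t).
Local Notation x := (cmap (chart_at p) q).
Local Notation F := (var_in_charts p b).
Hypothesis pq : cdom (chart_at p) q.
Hypothesis by_ : cdom (chart_at b) y.
Hypothesis cG : {for q, continuous (Gam ^~ t)}.
Hypothesis dF : differentiable F (x, t : R^o).

Definition image_vec (k : 'I_m) : 'rV[R]_n :=
  dmap (Gam ^~ t) q (of_chart (chart_at p) q (delta_mx 0 k)).

Lemma var_in_chartsE : F (x, t : R^o) = cmap (chart_at b) y.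
Proof. by rewrite /var_in_charts /= cmapK. Qed.

Lemma derive_var_space v :
  'D_((v, 0) : 'rV[R]_m * R^o) F (x, t : R^o) =
  chart_change y b y (dmap (Gam ^~ t) q (of_chart (chart_at p) q v)).
Proof.
have dF1 := differentiable_slice1 dF.
exact: (etrans (esym (derive_slice1 F x t v)) (esym (chart_change_dmap v cG pq by_ dF1))).
Qed.

Lemma differentiable_map_in_charts : differentiable (map_in_charts (Gam ^~ t) q) (pt q).
Proof.
have dF1 := differentiable_slice1 dF; have qq := chart_atP q; have yy := chart_atP y.
pose tF := cmap (chart_at y) \o cinv (chart_at b); pose tq := cmap (chart_at p) \o cinv (chart_at q).
have tqE : tq (pt q) = x by rewrite /tq /pt /= cmapK.
apply: (@near_eq_differentiable _ _ _ (tF \o ((fun x' => F (x', t : R^o)) \o tq))).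
  have nF : nbhs q ((Gam ^~ t) @^-1` cdom (chart_at b)) by apply: cG; exact: cdom_nbhs.
  apply: filterS2 (cinv_near qq (cdom_nbhs pq)) (cinv_near qq nF) => x' px' bx'.
  by rewrite /tF /tq /var_in_charts /map_in_charts /= !cmapK.
apply: differentiable_comp.
  apply: differentiable_comp; first exact: differentiable_transition.
  by rewrite tqE.
by rewrite /comp tqE var_in_chartsE; exact: differentiable_transition.
Qed.

Context (Xf : 'I_n -> N -> 'rV[R]_n).
Local Notation X := (frame_in_chart Xf b).

(** The vectors and the frame undergo the same change of chart, and the coefficients of the metric
    undo it: no trace of [b] is left. *)
Lemma coord_mx_intrinsic : coord_mx (metric_coef g b) F X (x, t : R^o) = comp_mx (g y) (Xf ^~ y) image_vec.
Proof.
have yy := chart_atP y.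
apply/matrixP => i k; rewrite mxE [RHS]mxE derive_var_space var_in_chartsE.
rewrite /frame_in_chart field_in_chartE// coef_form_chart//.
by rewrite !chart_changeK.
Qed.

Lemma coord_area_intrinsic : coord_area deg d (metric_coef g b) F X (x, t : R^o) =
  Num.sqrt (pairing deg d (comp_mx (g y) (Xf ^~ y) image_vec) (comp_mx (g y) (Xf ^~ y) image_vec)).
Proof. by rewrite /coord_area coord_mx_intrinsic. Qed.

End AtPoint.

Section AtTime0.
Context (p q : M) (b : N).
Local Notation y := (Gam q 0).
Local Notation x := (cmap (chart_at p) q).
Local Notation F := (var_in_charts p b).
Hypothesis pq : cdom (chart_at p) q.
Hypothesis by_ : cdom (chart_at b) y.
Hypothesis cG : {for q, continuous (Gam ^~ 0)}.
Hypothesis cGt : {for 0, continuous (Gam q)}.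
Hypothesis dF : differentiable F (x, 0 : R^o).

Lemma derive_var_time :
  'D_((0, 1) : 'rV[R]_m * R^o) F (x, 0 : R^o) = chart_change y b y (variational_field Gam q).
Proof.
have yy := chart_atP y.
have dF2 := differentiable_slice2 dF.
have h := derive_slice2 F x (0 : R^o).
apply: (etrans (esym h)).
pose tF := cmap (chart_at b) \o cinv (chart_at y).
pose f := (fun t : R^o => cmap (chart_at y) (Gam q t)).
pose tF' := cmap (chart_at y) \o cinv (chart_at b).
pose f' := fun s : R^o => F (x, s).
have f'E s : f' s = cmap (chart_at b) (Gam q s) by rewrite /f' /var_in_charts /= cmapK.
have nb : \forall s \near (0 : R^o), cdom (chart_at b) (Gam q s) by apply: cGt; exact: cdom_nbhs.
have e2 : \forall s \near (0 : R^o), f s = (tF' \o f') s.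
  by apply: filterS nb => s bs; rewrite /f /tF' /= f'E cmapK.
have dtF' : differentiable tF' (f' 0) by rewrite f'E; exact: differentiable_transition.
have e3 : variational_field Gam q = chart_change b y y ('D_(1 : R^o) f' 0).
  apply: (etrans (near_eq_derive (1 : R^o) e2)); apply: (etrans (derive_chain (1 : R^o) dF2 dtF')).
  exact: (congr1 (fun z => 'D_('D_(1 : R^o) f' 0) tF' z) (f'E 0)).
exact: (esym (etrans (congr1 (chart_change y b y) e3) (chart_changeK _ by_ yy))).
Qed.

Context (Xf : 'I_n -> N -> 'rV[R]_n).
Local Notation X := (frame_in_chart Xf b).

Lemma frame_comp_intrinsic v :
  frame_comp (metric_coef g b) F X x (chart_change y b y v) = comp_row (g y) (Xf ^~ y) v.
Proof.
have yy := chart_atP y; have e := var_in_chartsE b 0 pq.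
apply/rowP => k; rewrite !mxE e /frame_in_chart field_in_chartE// coef_form_chart//.
by rewrite !chart_changeK.
Qed.

Lemma flux_intrinsic k : flux deg d (metric_coef g b) F X k x =
  pairing_row deg d (comp_mx (g y) (Xf ^~ y) (image_vec p q 0))
    (comp_row (g y) (Xf ^~ y) (variational_field Gam q)) 0 k /
  Num.sqrt (pairing deg d (comp_mx (g y) (Xf ^~ y) (image_vec p q 0)) (comp_mx (g y) (Xf ^~ y) (image_vec p q 0))).
Proof.
rewrite /flux coord_area_intrinsic//; congr (_ / _).
by rewrite coord_mx_intrinsic// /var_vec derive_var_time frame_comp_intrinsic.
Qed.

End AtTime0.

End VariationInCharts.

Lemma continuous_at_pair (T U V : topologicalType) (f : T -> U) (g : T -> V) x :
  {for x, continuous f} -> {for x, continuous g} -> {for x, continuous (fun y => (f y, g y))}.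
Proof.
move=> cf cg.
exact: (@cvg_pair _ _ _ (nbhs x) (nbhs (f x)) (nbhs (g x)) _ _ _ _ _ cf cg).
Qed.

Section FieldsInCharts.
Context (R : realType) (m n : nat) (M : manifold R m) (N : manifold R n).

(* A field along [F], read in the chart around [p] at the source and in the chart
   around [b] at the target. *)
Definition field_along (F : M -> N) (Y : M -> 'rV[R]_n) (p : M) (b : N) (x : 'rV[R]_m) : 'rV[R]_n :=
  let q := cinv (chart_at p) x in chart_change (F q) b (F q) (Y q).

Lemma field_along_near F Y p q : cdom (chart_at p) q ->
  \forall x \near cmap (chart_at p) q, field_along F Y p (F q) x =
    (field_in_charts F Y q \o (cmap (chart_at q) \o cinv (chart_at p))) x.
Proof.
move=> pq; apply: filterS (cinv_near pq (cdom_nbhs (chart_atP q))) => x qx.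
by rewrite /field_along /field_in_charts /= cmapK.
Qed.

Lemma differentiable_field_along F Y p q : cdom (chart_at p) q ->
  differentiable (field_in_charts F Y q) (pt q) ->
  differentiable (field_along F Y p (F q)) (cmap (chart_at p) q).
Proof.
move=> pq dY; apply: (@near_eq_differentiable _ _ _
  (field_in_charts F Y q \o (cmap (chart_at q) \o cinv (chart_at p)))).
  by apply: filterS (field_along_near F Y pq) => x /esym; exact.
apply: differentiable_comp; first exact: (differentiable_transition pq (chart_atP q)).
by rewrite /= cmapK.
Qed.

Lemma derive_field_along F Y p q w : cdom (chart_at p) q ->
  differentiable (field_in_charts F Y q) (pt q) ->
  'D_w (field_along F Y p (F q)) (cmap (chart_at p) q) =
  'D_(of_chart (chart_at p) q w) (field_in_charts F Y q) (pt q).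
Proof.
move=> pq dY; apply: (etrans (near_eq_derive w (field_along_near F Y pq))).
have dt := differentiable_transition pq (chart_atP q).
have e : (cmap (chart_at q) \o cinv (chart_at p)) (cmap (chart_at p) q) = pt q by rewrite /= cmapK.
have dY' : differentiable (field_in_charts F Y q) ((cmap (chart_at q) \o cinv (chart_at p)) (cmap (chart_at p) q)).
  by rewrite e.
apply: (etrans (derive_chain w dt dY')).
exact: (congr1 (fun z => 'D__ (field_in_charts F Y q) z) e).
Qed.

(** Regularity is given in the chart at [q]. In the chart at [p] the components are multiplied by
    the Jacobian matrix of the transition, whose entries are differentiable. *)
Lemma differentiable_tangent_field (E : M -> 'rV[R]_m) p q : cdom (chart_at p) q ->
  differentiable (field_in_charts idfun E q) (pt q) ->
  differentiable (field_in_charts idfun E p) (cmap (chart_at p) q).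
Proof.
move=> pq dE; have qq := chart_atP q.
pose s := cmap (chart_at p) \o cinv (chart_at q); pose t := cmap (chart_at q) \o cinv (chart_at p).
have tE : t (cmap (chart_at p) q) = pt q by rewrite /t /= cmapK.
have dt : differentiable t (cmap (chart_at p) q) by exact: differentiable_transition.
apply: (@near_eq_differentiable _ _ _ (fun x => \sum_k (field_in_charts idfun E q (t x) 0 k : R^o) *:
    'D_(delta_mx 0 k) s (t x))).
  apply: filterS2 (chart_image_near pq) (cinv_near pq (cdom_nbhs qq)) => x /cinvK[px xE] qx.
  set q' := cinv (chart_at p) x in px xE qx *.
  have txE : t x = cmap (chart_at q) q' by [].
  have -> : field_in_charts idfun E q (t x) = chart_change q' q q' (E q').
    by rewrite /field_in_charts txE cmapK.
  transitivity (chart_change q p q' (chart_change q' q q' (E q'))).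
    by rewrite (chart_change_sum _ qx px).
  by rewrite chart_change_comp//; exact: chart_atP.
apply: differentiable_bigsum => k _; apply: differentiable_scale.
  apply: (@differentiable_comp _ _ _ _ t (fun z => field_in_charts idfun E q z 0 k : R^o)) => //.
  by rewrite tE; have /differentiable_mxP := dE.
apply: (@differentiable_comp _ _ _ _ t (fun z => 'D_(delta_mx 0 k) s z)) => //.
rewrite tE; have [_ /(_ (delta_mx 0 k))[ds _]] := Ck_transition 2 q p.
by apply: ds; exists q.
Qed.

End FieldsInCharts.

Section LocalDomain.
Context (R : realType) (m n : nat) (M : manifold R m) (N : manifold R n)
  (g : riemannian_metric N) (H : equiregular_grading N) (Gam : M -> R -> N) (eps : R)
  (X : M -> 'I_n -> N -> 'rV[R]_n).
Local Notation Phi := (Gam ^~ 0).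
Hypothesis eps_gt0 : 0 < eps.
Hypothesis cGam : forall (p : M) (t : R), `|t| < eps -> {for (p, t), continuous (fun z : M * R => Gam z.1 z.2)}.
Hypothesis sGam : forall p, smooth_at (var_in_charts Gam p (Phi p)) (pt p, 0 : R^o).
Hypothesis XP : forall p, adapted_frame g H (Phi p) (X p).

Lemma variation_continuous_space t q : `|t| < eps -> {for q, continuous (Gam ^~ t)}.
Proof.
move=> te.
have h : {for q, continuous (fun q' : M => (q', t))}.
  by apply: continuous_at_pair; [exact: cvg_id | exact: cvg_cst].
exact: (continuous_comp h (@cGam q t te)).
Qed.

Lemma variation_continuous_time t q : `|t| < eps -> {for t, continuous (Gam q)}.
Proof.
move=> te.
have h : {for t, continuous (fun t' : R => (q, t'))}.
  by apply: continuous_at_pair; [exact: cvg_cst | exact: cvg_id].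
exact: (continuous_comp h (@cGam q t te)).
Qed.

Lemma variation_continuous_chart p x (t : R^o) : (cmap (chart_at p) @` cdom (chart_at p)) x -> `|t| < eps ->
  {for (x, t), continuous (fun z : 'rV[R]_m * R^o => Gam (cinv (chart_at p) z.1) z.2)}.
Proof.
move=> px te.
have h : {for (x, t), continuous (fun z : 'rV[R]_m * R^o => (cinv (chart_at p) z.1, z.2 : R))}.
  apply: continuous_at_pair; last exact: cvg_snd.
  by apply: (@continuous_comp _ _ _ fst (cinv (chart_at p))); [exact: cvg_fst | exact: cinv_continuous].
exact: (@continuous_comp _ _ _ (fun z : 'rV[R]_m * R^o => (cinv (chart_at p) z.1, z.2 : R))
  (fun z : M * R => Gam z.1 z.2) (x, t) h (@cGam _ t te)).
Qed.

Lemma var_in_charts_continuous p b x (t : R^o) : (cmap (chart_at p) @` cdom (chart_at p)) x -> `|t| < eps ->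
  cdom (chart_at b) (Gam (cinv (chart_at p) x) t) ->
  {for (x, t), continuous (var_in_charts Gam p b)}.
Proof.
move=> px te bx.
exact: (@continuous_comp _ _ _ (fun z : 'rV[R]_m * R^o => Gam (cinv (chart_at p) z.1) z.2)
  (cmap (chart_at b)) (x, t) (variation_continuous_chart px te) (cmap_continuous bx)).
Qed.

(** The metric and the frame are asked to be smooth after composition with the variation, because
    each of them is known to be smooth near the centre [Phi p] of the chart only. *)
Definition local_domain (p : M) (U : set ('rV[R]_m * R^o)) : Prop :=
  [/\ open U,
      forall z, U z -> let y := Gam (cinv (chart_at p) z.1) z.2 in
        [/\ (cmap (chart_at p) @` cdom (chart_at p)) z.1, `|z.2 : R| < eps,
            cdom (chart_at (Phi p)) y & adapted_orthonormal g H y (X p ^~ y)],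
      forall k, Ck k U (var_in_charts Gam p (Phi p)),
      forall k i j, Ck k U (metric_coef g (Phi p) i j \o var_in_charts Gam p (Phi p))
    & forall k i, Ck k U (frame_in_chart (X p) (Phi p) i \o var_in_charts Gam p (Phi p))].

Lemma local_domain_exists p : exists2 U, U (pt p, 0 : R^o) & local_domain p U.
Proof.
set b := Phi p; set F := var_in_charts Gam p b.
have pp := chart_atP p; have bb := chart_atP b.
have [U1 [oU1 U1p] sF] := sGam p.
have [W1 [oW1 W1b] sg] := metric_coef_smooth g b.
have [UX [oUX UXb] UXP] := XP p.
have [W2 [oW2 W2b] sX] := @smooth_at_forall R _ _ 'I_n (frame_in_chart (X p) b) (pt b)
  (fun i => proj1 (UXP b UXb) i).
have pI : (cmap (chart_at p) @` cdom (chart_at p)) (pt p) by exists p.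
have z0 : `|0 : R| < eps by rewrite normr0.
have ye : Gam (cinv (chart_at p) (pt p)) 0 = b by rewrite /pt cmapK.
have Fe : F (pt p, 0 : R^o) = pt b by rewrite /F /var_in_charts /= ye.
have cy : (fun z : 'rV[R]_m * R^o => Gam (cinv (chart_at p) z.1) z.2) @ (pt p, 0 : R^o) --> b.
  by have := variation_continuous_chart pI z0; rewrite /prop_for /continuous_at /= ye.
have cF : F @ (pt p, 0 : R^o) --> pt b.
  have h : cdom (chart_at b) (Gam (cinv (chart_at p) (pt p)) 0) by rewrite ye.
  have := @var_in_charts_continuous p b (pt p) 0 pI z0 h.
  by rewrite /prop_for /continuous_at -/F Fe.
pose A := [set z : 'rV[R]_m * R^o | [/\ U1 z, (cmap (chart_at p) @` cdom (chart_at p)) z.1, `|z.2 : R| < eps &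
  [/\ cdom (chart_at b) (Gam (cinv (chart_at p) z.1) z.2), UX (Gam (cinv (chart_at p) z.1) z.2), W1 (F z) & W2 (F z)]]].
have nA : nbhs (pt p, 0 : R^o) A.
  have n1 : \forall z \near (pt p, 0 : R^o), U1 z by exact: open_nbhs_nbhs.
  have n2 : \forall z \near ((pt p, 0) : 'rV[R]_m * R^o), (cmap (chart_at p) @` cdom (chart_at p)) z.1.
    exact: (@cvg_fst _ _ (nbhs (pt p)) (nbhs (0 : R^o)) _ _ (chart_image_near pp)).
  have n3 : \forall z \near ((pt p, 0) : 'rV[R]_m * R^o), `|z.2 : R| < eps.
    apply: (@cvg_snd _ _ (nbhs (pt p)) (nbhs (0 : R^o)) _ [set t : R | `|t| < eps]).
    by exists eps => //= t; rewrite /ball_ /= sub0r normrN.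
  have n4 := cy _ (cdom_nbhs bb); have n5 := cy _ (open_nbhs_nbhs (conj oUX UXb)).
  have n6 := cF _ (open_nbhs_nbhs (conj oW1 W1b)); have n7 := cF _ (open_nbhs_nbhs (conj oW2 W2b)).
  near=> z; split; [by near: z | by near: z | by near: z |].
  by split; [near: z; exact: n4 | near: z; exact: n5 | near: z; exact: n6 | near: z; exact: n7].
have sub : interior A `<=` A by exact: interior_subset.
have oU : open (interior A) by exact: open_interior.
have cFk k : Ck k (interior A) F by apply: Ck_subset (sF k) => z /sub[].
exists (interior A); first exact: nA.
split=> //.
- move=> z /sub[_ z1 z2 [z3 z4 _ _]] y; split=> //.
  exact: (proj2 (UXP _ z4)).
- move=> k i j; have h z : interior A z -> W1 (F z) by move=> /sub[_ _ _ []].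
  exact: (Ck_comp oU h (cFk k) (sg k i j)).
- move=> k i; have h z : interior A z -> W2 (F z) by move=> /sub[_ _ _ []].
  exact: (Ck_comp_mx oU oW2 h (cFk k) (sX i k)).
Unshelve. all: by end_near. Qed.

End LocalDomain.

Lemma coef_form_chart_change (R : realType) (n : nat) (N : manifold R n) (g : riemannian_metric N) b y u v :
  cdom (chart_at b) y ->
  coef_form (metric_coef g b) (cmap (chart_at b) y) (chart_change y b y u) (chart_change y b y v) = g y u v.
Proof.
by move=> yb; have yy := chart_atP y; rewrite coef_form_chart// !chart_changeK.
Qed.

(** * The pointwise identity on the manifold *)

Section Pointwise.
Context (R : realType) (m n : nat) (M : manifold R m) (N : manifold R n)
  (g : riemannian_metric N) (H : equiregular_grading N) (d : nat) (Gam : M -> R -> N) (eps : R)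
  (X : M -> 'I_n -> N -> 'rV[R]_n) (E : M -> 'I_m -> M -> 'rV[R]_m)
  (Nu : M -> 'I_(n - m) -> M -> 'rV[R]_n).
Local Notation Phi := (Gam ^~ 0).
Local Notation deg := (vdeg H).
Hypothesis eps_gt0 : 0 < eps.
Hypothesis cGam : forall (p : M) (t : R), `|t| < eps -> {for (p, t), continuous (fun z : M * R => Gam z.1 z.2)}.
Hypothesis XP : forall p, adapted_frame g H (Phi p) (X p).
Hypothesis EP : forall p, tangent_frame g Phi p (E p).
Hypothesis NuP : forall p, normal_frame g Phi p (Nu p).
Context (p : M) (U : set ('rV[R]_m * R^o)).
Hypothesis dU : local_domain g H Gam eps X p U.
Let F := var_in_charts Gam p (Phi p).
Let c := chart_at p.

Let zero_eps : `|0 : R| < eps. Proof. by rewrite normr0. Qed.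

Lemma local_domain_differentiable z : U z -> differentiable F z.
Proof. by have [_ _ /(_ 1%N)[h _] _ _] := dU; exact: h. Qed.

Section At.
Context (q : M).
Hypothesis pq : cdom c q.
Let x0 : 'rV[R]_m := cmap c q.
Hypothesis Ux0 : U (x0, 0 : R^o).
Let b := Phi q.
Let Fb := var_in_charts Gam p b.
(** The part of [U] where the variation also stays in the chart centred at [Phi q], so that both
    target charts can be used. *)
Let U' : set ('rV[R]_m * R^o) := [set z | U z /\
  (cmap (chart_at (Phi p)) @` (cdom (chart_at (Phi p)) `&` cdom (chart_at b))) (F z)].

Let oU' : open U'.
Proof.
rewrite openE => z [Uz Fz]; have [oU _ _ _ _] := dU.
have cF := differentiable_continuous (local_domain_differentiable Uz).
have n2 : nbhs z (F @^-1` (cmap (chart_at (Phi p)) @` (cdom (chart_at (Phi p)) `&` cdom (chart_at b)))).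
  by apply: cF; apply: open_nbhs_nbhs; split=> //; exact: transition_dom_open.
have n1 : nbhs z U by exact: open_nbhs_nbhs.
by apply: filterS2 n1 n2.
Qed.

Let U'P z : U' z -> [/\ (cmap c @` cdom c) z.1, `|z.2 : R| < eps &
  cdom (chart_at b) (Gam (cinv c z.1) z.2)].
Proof.
case=> Uz [y' [y'p y'b] yF]; have [_ /(_ z Uz) + _ _ _] := dU => -[z1 z2 z3 _]; split=> //.
have := congr1 (cinv (chart_at (Phi p))) yF; rewrite cmapK// /F /var_in_charts cmapK//.
by move=> <-.
Qed.

Let FbE z : U' z -> Fb z = (cmap (chart_at b) \o cinv (chart_at (Phi p))) (F z).
Proof.
by case=> Uz _; have [_ /(_ z Uz) + _ _ _] := dU => -[z1 z2 z3 _]; rewrite /F /var_in_charts /= cmapK.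
Qed.

Let cFb : Ck 2 U' Fb.
Proof.
have [_ _ /(_ 2%N) cF _ _] := dU.
have h : Ck 2 U' ((cmap (chart_at b) \o cinv (chart_at (Phi p))) \o F).
  have h0 z : U' z -> (cmap (chart_at (Phi p)) @` (cdom (chart_at (Phi p)) `&` cdom (chart_at b))) (F z) by case.
  have h1 : Ck 2 U' F by apply: Ck_subset cF => z [].
  exact: (Ck_comp_mx oU' (@transition_dom_open R n N (Phi p) b) h0 h1 (@Ck_transition R n N 2 (Phi p) b)).
by apply: Ck_eq h => // z U'z; rewrite FbE.
Qed.

Let qx0 : cinv c x0 = q. Proof. exact: cmapK. Qed.

Let U'x0 : U' (x0, 0 : R^o).
Proof.
split=> //; have [_ /(_ _ Ux0) + _ _ _] := dU => -[_ _ z3 _].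
rewrite /= qx0 in z3; exists b; first by split=> //; exact: chart_atP.
by rewrite /F /var_in_charts /= qx0.
Qed.

Let y0E : Fb (x0, 0 : R^o) = pt b.
Proof. by rewrite /Fb /var_in_charts /= qx0. Qed.

Let dFb z : U' z -> differentiable Fb z.
Proof. by have [h _] := cFb; exact: h. Qed.

Let near_x0 (P : M -> Prop) : (\forall q' \near q, P q') -> \forall x \near x0, P (cinv c x).
Proof. exact: cinv_near. Qed.

Let near_dom : \forall x \near x0, U' (x, 0 : R^o) /\ (cmap c @` cdom c) x.
Proof.
have cp : {for x0, continuous (fun x : 'rV[R]_m => (x, 0 : R^o))}.
  by apply: continuous_at_pair; [exact: cvg_id | exact: cst_continuous].
have n1 : \forall x \near x0, U' (x, 0 : R^o) by apply: cp; exact: open_nbhs_nbhs.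
have n2 := chart_image_near pq.
by apply: filterS2 n1 n2.
Qed.

Definition local_tangent (i : 'I_m) : 'rV[R]_m -> 'rV[R]_m := field_in_charts idfun (E q i) p.
Definition local_normal (j : 'I_(n - m)) : 'rV[R]_m -> 'rV[R]_n := field_along Phi (Nu q j) p b.
Local Notation e := local_tangent.
Local Notation Nn := local_normal.
Local Notation Xb := (frame_in_chart (X q) b).
Local Notation gam := (metric_coef g b).
Local Notation ch := (christoffel g b).
Local Notation tv q' := (fun i => dmap Phi q' (E q i q')).

Let local_fields : \forall x \near x0, let q' := cinv c x in
  [/\ cdom c q' /\ cmap c q' = x, U' (x, 0 : R^o),
      forall i, frame_vec Fb e i x = chart_change (Phi q') b (Phi q') (dmap Phi q' (E q i q')),
      orthonormal_basis g Phi q' (E q ^~ q') &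
      [/\ forall j v, g (Phi q') (Nu q j q') (dmap Phi q' v) = 0,
          forall j k, g (Phi q') (Nu q j q') (Nu q k q') = (j == k)%:R
        & adapted_orthonormal g H (Phi q') (X q ^~ (Phi q'))]].
Proof.
have [UE [oUE UEq] EE] := EP q; have [UN [oUN UNq] NN] := NuP q; have [UX [oUX UXq] XX] := XP q.
have cPhi : {for q, continuous Phi} := variation_continuous_space cGam zero_eps.
have n1 := near_x0 (open_nbhs_nbhs (conj oUE UEq)); have n2 := near_x0 (open_nbhs_nbhs (conj oUN UNq)).
have n3 := near_x0 (cPhi _ (open_nbhs_nbhs (conj oUX UXq))).
near=> x => q'.
have [Ux xc] : U' (x, 0 : R^o) /\ (cmap c @` cdom c) x by near: x; exact: near_dom.
have [pq' xE] := cinvK xc; rewrite -/q' in pq' xE.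
have [_ _ bq'] := U'P Ux; rewrite /= -/q' in bq'.
have Eq : UE q' by rewrite /q'; near: x; exact: n1.
have Nq : UN q' by rewrite /q'; near: x; exact: n2.
have Xq : UX (Phi q') by rewrite /q'; near: x; exact: n3.
split=> //; last by split; [have [] := NN _ Nq | have [] := NN _ Nq | exact: (proj2 (XX _ Xq))].
  move=> i; have cq' : {for q', continuous Phi} := variation_continuous_space cGam zero_eps.
  have dF' : differentiable Fb (cmap c q', 0 : R^o) by rewrite xE; exact: dFb.
  have h := derive_var_space pq' bq' cq' dF' (e i x).
  rewrite xE in h; apply: (etrans h); congr chart_change; congr dmap.
  by rewrite /e /field_in_charts -/c -/q'; exact: (chart_changeK _ (chart_atP q') pq').
exact: (proj2 (EE _ Eq)).
Unshelve. all: by end_near. Qed.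

Let at_q : [/\ orthonormal_basis g Phi q (E q ^~ q),
    forall j v, g b (Nu q j q) (dmap Phi q v) = 0 & adapted_orthonormal g H b (X q ^~ b)].
Proof. by have := nbhs_singleton local_fields; rewrite /= qx0 => -[_ _ _ ? [? _ ?]]. Qed.

Let gam_form x u v : coef_form gam x u v = coef_form gam x v u.
Proof. by apply: coef_form_sym => i j; exact: metric_coef_sym. Qed.

Let near_TT : \forall x \near x0, forall i j,
  coef_form gam (Fb (x, 0 : R^o)) (frame_vec Fb e i x) (frame_vec Fb e j x) = (i == j)%:R.
Proof.
apply: filterS local_fields => x [[pq' xE] Ux Tx Eo _] i j; have [_ _ bq'] := U'P Ux.
apply: (etrans (congr2 (coef_form gam _) (Tx i) (Tx j))).
exact: (etrans (coef_form_chart_change g _ _ bq') (Eo i j)).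
Qed.

Let near_NT : \forall x \near x0, forall j i,
  coef_form gam (Fb (x, 0 : R^o)) (Nn j x) (frame_vec Fb e i x) = 0.
Proof.
apply: filterS local_fields => x [[pq' xE] Ux Tx _ [NT _ _]] j i; have [_ _ bq'] := U'P Ux.
apply: (etrans (congr1 (coef_form gam _ _) (Tx i))).
exact: (etrans (coef_form_chart_change g _ _ bq') (NT j _)).
Qed.

Let near_NN : \forall x \near x0, forall j k,
  coef_form gam (Fb (x, 0 : R^o)) (Nn j x) (Nn k x) = (j == k)%:R.
Proof.
apply: filterS local_fields => x [[pq' xE] Ux Tx _ [_ NN _]] j k; have [_ _ bq'] := U'P Ux.
exact: (etrans (coef_form_chart_change g _ _ bq') (NN j k)).
Qed.

Let near_frame_mx : \forall x \near x0, let q' := cinv c x in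
  frame_mx gam Fb Xb e x = comp_mx (g (Phi q')) (X q ^~ (Phi q')) (tv q').
Proof.
apply: filterS local_fields => x [[pq' xE] Ux Tx _ _] q'; have [_ _ bq'] := U'P Ux.
have yy := chart_atP (Phi q').
apply/matrixP => i k; rewrite mxE [RHS]mxE.
apply: (etrans (congr2 (coef_form gam _) (Tx i) (field_in_chartE (X q k) bq'))).
exact: coef_form_chart_change.
Qed.

Let near_comp j : \forall x \near x0, let q' := cinv c x in
  frame_comp gam Fb Xb x (Nn j x) = comp_row (g (Phi q')) (X q ^~ (Phi q')) (Nu q j q').
Proof.
apply: filterS local_fields => x [[pq' xE] Ux Tx _ _]; have [_ _ bq'] := U'P Ux.
apply/rowP => k; rewrite mxE [RHS]mxE.
apply: (etrans (congr1 (coef_form gam _ _) (field_in_chartE (X q k) bq'))).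
exact: coef_form_chart_change.
Qed.

Let near_xi i j : \forall x \near x0,
  frame_xi deg d gam Fb Xb e Nn i j x = xi g H d Phi (E q) (Nu q) i j (cinv c x).
Proof.
near=> x; have [_ _ _ _ [_ _ aX]] : let q' := cinv c x in
  [/\ cdom c q' /\ cmap c q' = x, U' (x, 0 : R^o),
      forall i, frame_vec Fb e i x = chart_change (Phi q') b (Phi q') (dmap Phi q' (E q i q')),
      orthonormal_basis g Phi q' (E q ^~ q') &
      [/\ forall j v, g (Phi q') (Nu q j q') (dmap Phi q' v) = 0,
          forall j k, g (Phi q') (Nu q j q') (Nu q k q') = (j == k)%:R
        & adapted_orthonormal g H (Phi q') (X q ^~ (Phi q'))]] by near: x; exact: local_fields.
have e1 : frame_mx gam Fb Xb e x = comp_mx (g (Phi (cinv c x))) (X q ^~ (Phi (cinv c x))) (tv (cinv c x)).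
  by near: x; exact: near_frame_mx.
have e2 : frame_comp gam Fb Xb x (Nn j x) =
    comp_row (g (Phi (cinv c x))) (X q ^~ (Phi (cinv c x))) (Nu q j (cinv c x)).
  by near: x; exact: near_comp.
rewrite /xi /unit_part (mdot_unit_mvec_part d _ i _ aX) /frame_xi /frame_area.
exact: (congr2 (fun P y => pairing_row deg d P y 0 i / Num.sqrt (pairing deg d P P)) e1 e2).
Unshelve. all: by end_near. Qed.

Let near_tangent i : \forall x \near x0,
  frame_vec Fb e i x = field_along Phi (fun q' => dmap Phi q' (E q i q')) p b x.
Proof. by apply: filterS local_fields => x [_ _ Tx _ _]; rewrite Tx. Qed.

(** The target chart is centred at [Phi q], as in the definition of [cov]: the Christoffel symbols
    are the same, and only the source chart has to be changed. *)
Let cov_nabla (Y : M -> 'rV[R]_n) (Y' : 'rV[R]_m -> 'rV[R]_n) i :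
  differentiable Y' x0 -> (\forall x \near x0, Y' x = field_along Phi Y p b x) ->
  nabla ch Fb x0 Y' (e i x0) = cov g Phi Y q (E q i q).
Proof.
move=> dY' YE; have qq := chart_atP q.
have eE : of_chart c q (e i x0) = E q i q.
  by rewrite /e /field_in_charts -/c qx0; exact: chart_changeK.
have cq : {for q, continuous Phi} := variation_continuous_space cGam zero_eps.
have dfield : differentiable (field_in_charts Phi Y q) (pt q).
  pose s := cmap c \o cinv (chart_at q).
  have sE : s (pt q) = x0 by rewrite /s /pt /= cmapK.
  have ds : differentiable s (pt q) by exact: differentiable_transition.
  apply: (@near_eq_differentiable _ _ _ (Y' \o s)); last first.
    by apply: differentiable_comp; [exact: ds | rewrite sE; exact: dY'].
  have n1 := cinv_near qq (cdom_nbhs pq).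
  have n2 : \forall x \near pt q, Y' (s x) = field_along Phi Y p b (s x).
    have cs := differentiable_continuous ds; rewrite /prop_for /continuous_at sE in cs.
    exact: (cs _ YE).
  apply: filterS2 n1 n2 => x px /= ->.
  by rewrite /s /field_along /= cmapK.
have h1 : 'D_(e i x0) Y' x0 = 'D_(E q i q) (field_in_charts Phi Y q) (pt q).
  apply: (etrans (near_eq_derive _ YE)); apply: (etrans (derive_field_along (e i x0) pq dfield)).
  by rewrite eE.
have h2 : 'D_(e i x0) (fun x => Fb (x, 0 : R^o)) x0 = dmap Phi q (E q i q).
  have bb : cdom (chart_at b) (Gam q 0) := chart_atP _.
  apply: (etrans (derive_f0 Fb (e i x0) x0)).
  apply: (etrans (derive_var_space pq bb cq (dFb U'x0) (e i x0))).
  by rewrite eE chart_change_id.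
have h3 : Y' x0 = Y q.
  by rewrite (nbhs_singleton YE) /field_along -/c qx0 chart_change_id//; exact: chart_atP.
by rewrite /nabla /cder h1 h2 h3.
Qed.

Let differentiable_tangent_q i : differentiable (local_tangent i) x0.
Proof.
apply: differentiable_tangent_field => //; have [UE [oUE UEq] EE] := EP q.
exact: smooth_at_differentiable (proj1 (EE _ UEq) i).
Qed.

Let differentiable_normal_q j : differentiable (local_normal j) x0.
Proof.
apply: differentiable_field_along => //; have [UN [oUN UNq] NN] := NuP q.
by have [sN _ _] := NN _ UNq; exact: smooth_at_differentiable (sN j).
Qed.

Let differentiable_frame_q k : differentiable (Xb k) (pt b).
Proof.
have [UX [oUX UXq] XX] := XP q.
exact: smooth_at_differentiable (proj1 (XX _ UXq) k).
Qed.

Let dPhi : differentiable (map_in_charts Phi q) (pt q).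
Proof.
have cq : {for q, continuous Phi} := variation_continuous_space cGam zero_eps.
exact: (@differentiable_map_in_charts _ _ _ _ _ _ p q b 0 pq (chart_atP b) cq (dFb U'x0)).
Qed.

Hypothesis Theta_q : Theta g H d Phi q != 0.

Let P0 := comp_mx (g b) (X q ^~ b) (tv q).

Let ThetaE : Theta g H d Phi q = Num.sqrt (pairing deg d P0 P0).
Proof. by have [Eo _ aX] := at_q; exact: Theta_orthonormal. Qed.

Let frame_mx0 : frame_mx gam Fb Xb e x0 = P0.
Proof. by have := nbhs_singleton near_frame_mx; rewrite /= qx0. Qed.

Let area_gt0 : 0 < pairing deg d (frame_mx gam Fb Xb e x0) (frame_mx gam Fb Xb e x0).
Proof.
rewrite frame_mx0; have := Theta_q; rewrite ThetaE sqrtr_eq0 -ltNge; exact.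
Qed.

Let frame_area0 : frame_area deg d gam Fb Xb e x0 = Theta g H d Phi q.
Proof. by rewrite ThetaE /frame_area frame_mx0. Qed.

Let frame_comp0 v : frame_comp gam Fb Xb x0 v = comp_row (g b) (X q ^~ b) v.
Proof.
by apply/rowP => k; rewrite mxE [RHS]mxE y0E /frame_in_chart field_in_chartE ?chart_change_id ?coef_form_pt//; exact: chart_atP.
Qed.

Let tangent0 i : frame_vec Fb e i x0 = tv q i.
Proof.
have := nbhs_singleton local_fields; rewrite /= qx0 => -[_ _ Tx _ _].
by rewrite Tx chart_change_id//; exact: chart_atP.
Qed.

Let normal0 j : local_normal j x0 = Nu q j q.
Proof. by rewrite /local_normal /field_along -/c qx0 chart_change_id//; exact: chart_atP. Qed.

Let var0 : var_vec Fb x0 = variational_field Gam q.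
Proof.
have cq : {for q, continuous Phi} := variation_continuous_space cGam zero_eps.
have ct : {for 0, continuous (Gam q)} := variation_continuous_time cGam zero_eps.
have bb := chart_atP b.
apply: (etrans (derive_var_time pq bb ct (dFb U'x0))).
by rewrite chart_change_id.
Qed.

Let nabla_frame0 k v : nabla_frame ch Fb x0 Xb k v = cov g idfun (X q k) b v.
Proof.
have bb := chart_atP b.
have e1 : dmap idfun b v = v by exact: (@chart_change_id _ _ N b b v bb).
have e2 : frame_in_chart (X q) b k (pt b) = X q k b.
  exact: (etrans (field_in_chartE (X q k) bb) (chart_change_id _ bb)).
rewrite /nabla_frame /cder /cov y0E derive_id e1 e2.
by [].
Qed.

Let f_mx0 v : f_mx gam ch Fb x0 Xb e v = comp_mx (g b) (fun k => cov g idfun (X q k) b v) (tv q).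
Proof.
apply/matrixP => i k; rewrite mxE [RHS]mxE y0E coef_form_pt.
exact: (congr2 (g b) (tangent0 i) (nabla_frame0 k v)).
Qed.

Let f_fun0 v : dpairing deg d (frame_mx gam Fb Xb e x0) (f_mx gam ch Fb x0 Xb e v) =
  f_fun g H d Phi (E q) (X q) q v.
Proof.
apply: (etrans (congr2 (dpairing deg d) frame_mx0 (f_mx0 v))).
exact: (esym (dpairing_wedge (metric_linear g b) (metric_sym g b) deg d (X q ^~ b)
  (fun k => cov g idfun (X q k) b v) (tv q))).
Qed.

Let pairing0 v i : pairing_row deg d (frame_mx gam Fb Xb e x0) (frame_comp gam Fb Xb x0 v) 0 i /
    frame_area deg d gam Fb Xb e x0 =
  mdot (g b) (wedge_at (tvec Phi (E q) q) i v) (unit_part g H d Phi (E q) q).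
Proof.
have [_ _ aX] := at_q.
apply: (etrans _ (esym (mdot_unit_mvec_part d (tvec Phi (E q) q) i v aX))).
exact: (congr2 (fun P y => pairing_row deg d P y 0 i / Num.sqrt (pairing deg d P P)) frame_mx0 (frame_comp0 v)).
Qed.

Let cov_normal j i : nabla ch Fb x0 (local_normal j) (e i x0) = cov g Phi (Nu q j) q (E q i q).
Proof.
apply: cov_nabla; first exact: differentiable_normal_q.
by apply: (@filterE _ (nbhs x0)) => x.
Qed.

Let divergence0 i j :
  divergence gam ch Fb x0 e (fun x => frame_xi deg d gam Fb Xb e Nn i j x *: frame_vec Fb e i x) =
  div_along g Phi (E q) (fun q' => xi g H d Phi (E q) (Nu q) i j q' *: tvec Phi (E q) q' i) q.
Proof.
have [oU _ _ _ _] := dU.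
have yE : Fb (x0, 0 : R^o) = pt b := y0E.
have dgam : forall i j, differentiable (gam i j) (Fb (x0, 0 : R^o)).
  by move=> i' j'; rewrite yE; exact: differentiable_metric_coef.
have dX : forall k, differentiable (Xb k) (Fb (x0, 0 : R^o)) by move=> k; rewrite yE.
apply: eq_bigr => k _; rewrite yE coef_form_pt.
apply: (congr2 (g b)); last exact: tangent0.
apply: cov_nabla.
  apply: differentiable_scale.
    exact: (@differentiable_frame_xi _ _ _ deg d gam Fb x0 U' dgam oU' U'x0 cFb Xb e Nn dX
      differentiable_tangent_q differentiable_normal_q area_gt0 i j).
  exact: (@differentiable_frame_vec _ _ _ Fb x0 U' oU' U'x0 cFb e differentiable_tangent_q i).
near=> x.
have e1 : frame_xi deg d gam Fb Xb e Nn i j x = xi g H d Phi (E q) (Nu q) i j (cinv c x).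
  by near: x; exact: near_xi.
have e2 : frame_vec Fb e i x = field_along Phi (fun q' => dmap Phi q' (E q i q')) p b x.
  by near: x; exact: near_tangent.
have [pq' bq'] : cdom c (cinv c x) /\ cdom (chart_at b) (Phi (cinv c x)).
  near: x; apply: filterS near_dom => x [Ux' xc]; have [pq' _] := cinvK xc.
  by have [_ _ bx] := U'P Ux'; split; [exact: pq' | exact: bx].
apply: (etrans (congr2 *:%R e1 e2)).
have yy := chart_atP (Phi (cinv c x)).
exact: esym (chart_changeZ (xi g H d Phi (E q) (Nu q) i j (cinv c x)) (tvec Phi (E q) (cinv c x) i) yy bq').
Unshelve. all: by end_near. Qed.

Local Notation X0 := (frame_in_chart (X p) (Phi p)).
Local Notation gam0 := (metric_coef g (Phi p)).

(** Both sides equal an expression that does not depend on the target chart, and the two adapted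
    frames give the same pairings. *)
Let areas_agree : \forall t \near (0 : R),
  coord_area deg d gam Fb Xb (x0, t : R^o) = coord_area deg d gam0 F X0 (x0, t : R^o).
Proof.
have [oU UP _ _ _] := dU.
have ct : {for 0, continuous (Gam q)} := variation_continuous_time cGam zero_eps.
have [UX [oUX UXq] XX] := XP q.
have cp : {for (0 : R), continuous (fun t : R => (x0, t : R^o))}.
  by apply: continuous_at_pair; [exact: cst_continuous | exact: cvg_id].
have n1 : \forall t \near (0 : R), U' (x0, t : R^o) by exact: (cp _ (open_nbhs_nbhs (conj oU' U'x0))).
have n2 : \forall t \near (0 : R), UX (Gam q t) by exact: (ct _ (open_nbhs_nbhs (conj oUX UXq))).
apply: filterS2 n1 n2 => t Ut Xt.
have [_ te bq] := U'P Ut; have [Ut0 _] := Ut; have [_ _ bq0 aX0] := UP _ Ut0.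
rewrite /= qx0 in bq bq0 aX0.
have ctq : {for q, continuous (Gam ^~ t)} := variation_continuous_space cGam te.
have e1 := coord_area_intrinsic g H d pq bq ctq (dFb Ut) (X q).
have e2 := coord_area_intrinsic g H d pq bq0 ctq (local_domain_differentiable Ut0) (X p).
apply: (etrans e1); apply: (etrans _ (esym e2)); congr Num.sqrt.
exact: (pairing_adapted d _ _ aX0 (proj2 (XX _ Xt))).
Qed.

Let flux_agree k : \forall x \near x0,
  flux deg d gam Fb Xb k x = flux deg d gam0 F X0 k x.
Proof.
have [oU UP _ _ _] := dU.
near=> x.
have [[pq' xE] Ux _ _ [_ _ aX]] : let q' := cinv c x in
  [/\ cdom c q' /\ cmap c q' = x, U' (x, 0 : R^o),
      forall i, frame_vec Fb e i x = chart_change (Phi q') b (Phi q') (dmap Phi q' (E q i q')),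
      orthonormal_basis g Phi q' (E q ^~ q') &
      [/\ forall j v, g (Phi q') (Nu q j q') (dmap Phi q' v) = 0,
          forall j k, g (Phi q') (Nu q j q') (Nu q k q') = (j == k)%:R
        & adapted_orthonormal g H (Phi q') (X q ^~ (Phi q'))]] by near: x; exact: local_fields.
set q' := cinv c x in pq' xE aX.
have [_ te bq] := U'P Ux; have [Ux' _] := Ux; have [_ _ bq0 aX0] := UP _ Ux'.
rewrite /= -/c -/q' in bq bq0 aX0.
have cq' : {for q', continuous Phi} := variation_continuous_space cGam zero_eps.
have ct' : {for 0, continuous (Gam q')} := variation_continuous_time cGam zero_eps.
have d1 : differentiable Fb (cmap c q', 0 : R^o) by rewrite xE; exact: dFb.
have d2 : differentiable F (cmap c q', 0 : R^o) by rewrite xE; exact: local_domain_differentiable.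
have e1 := flux_intrinsic g H d pq' bq cq' ct' d1 (X q) k.
have e2 := flux_intrinsic g H d pq' bq0 cq' ct' d2 (X p) k.
rewrite xE in e1 e2; apply: (etrans e1); apply: (etrans _ (esym e2)).
exact: (congr2 (fun (u : 'rV[R]_m) P => u 0 k / Num.sqrt P) (pairing_row_adapted d _ _ aX0 aX)
  (pairing_adapted d _ _ aX0 aX)).
Unshelve. all: by end_near. Qed.

(** The coordinate identity is applied at [q] with the chart and the frames of [q], then restated
    for the chart and the adapted frame of [p], which serve for all points of the patch at once. *)
Lemma first_variation_pointwise :
  (forall k, differentiable (flux deg d gam0 F X0 k : _ -> R^o) x0) /\
  exists2 D : R, is_derive (0 : R) (1 : R) (fun t : R => coord_area deg d gam0 F X0 (x0, t : R^o) : R) D &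
    D - \sum_k 'D_(delta_mx 0 k) (flux deg d gam0 F X0 k : _ -> R^o) x0 =
    density (pullback g Phi) c x0 *
      g b (variational_field Gam q) (mean_curvature g H d Phi (E q) (Nu q) (X q) q).
Proof.
have yE : Fb (x0, 0 : R^o) = pt b := y0E.
have dgam : forall i j, differentiable (gam i j) (Fb (x0, 0 : R^o)).
  by move=> i' j'; rewrite yE; exact: differentiable_metric_coef.
have dX : forall k, differentiable (Xb k) (Fb (x0, 0 : R^o)) by move=> k; rewrite yE.
have gsym0 i j : gam i j (Fb (x0, 0 : R^o)) = gam j i (Fb (x0, 0 : R^o)) by exact: metric_coef_sym.
have near_sym : \forall x \near x0, forall u v, coef_form gam (Fb (x, 0 : R^o)) u v = coef_form gam (Fb (x, 0 : R^o)) v u.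
  by apply: (@filterE _ (nbhs x0)) => x u v; exact: gam_form.
have compat (u a b' : 'rV[R]_n) :
    \sum_i \sum_j a 0 i * b' 0 j * 'D_u (gam i j) (Fb (x0, 0 : R^o)) =
    coef_form gam (Fb (x0, 0 : R^o)) (ch u a) b' + coef_form gam (Fb (x0, 0 : R^o)) a (ch u b').
  by rewrite yE; exact: christoffel_compat.
have h1 := @differentiable_flux _ _ _ deg d gam Fb x0 U' dgam oU' U'x0 cFb Xb e Nn dX
  differentiable_tangent_q differentiable_normal_q near_sym near_TT near_NT near_NN area_gt0.
have h2 := @first_variation_euclid _ _ _ deg d gam ch Fb x0 U' dgam gsym0 (@christoffel_sym R n N g b)
  (@christoffel_linear R n N g b) compat oU' U'x0 cFb Xb e Nn dX
  differentiable_tangent_q differentiable_normal_q near_sym near_TT near_NT near_NN area_gt0.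
split; first by move=> k; apply: near_eq_differentiable (h1 k); exact: flux_agree.
have [D hD DE] := h2; exists D.
  exact: (@near_eq_is_derive _ _ _ (fun t : R => coord_area deg d gam Fb Xb (x0, t : R^o) : R)
    (fun t : R => coord_area deg d gam0 F X0 (x0, t : R^o) : R) 0 1 D areas_agree hD).
have fE : \sum_k 'D_(delta_mx 0 k) (flux deg d gam0 F X0 k : _ -> R^o) x0 =
    \sum_k 'D_(delta_mx 0 k) (flux deg d gam Fb Xb k : _ -> R^o) x0.
  by apply: eq_bigr => k _; exact: esym (near_eq_derive _ (flux_agree k)).
apply: (etrans (congr1 (fun z => D - z) fE)); apply: (etrans DE).
have [Eo _ _] := at_q.
have [_ dens] := density_orthonormal dPhi pq Eo.
apply: (congr2 *%R).
  apply: (etrans _ (esym dens)); congr (`|\det _|^-1); apply/matrixP => i k.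
  by rewrite mxE [RHS]mxE /local_tangent /field_in_charts -/c qx0.
have glin := metric_linear g b; have gsym := metric_sym g b.
transitivity (\sum_j g b (variational_field Gam q) (Nu q j q) *
  (- (\sum_i div_along g Phi (E q) (fun q' => xi g H d Phi (E q) (Nu q) i j q' *: tvec Phi (E q) q' i) q)
   + \sum_i mdot (g b) (wedge_at (tvec Phi (E q) q) i (cov g Phi (Nu q j) q (E q i q))) (unit_part g H d Phi (E q) q)
   + f_fun g H d Phi (E q) (X q) q (Nu q j q) / Theta g H d Phi q)).
  apply: eq_bigr => j _.
  apply: (congr2 *%R).
    apply: (etrans (congr2 (coef_form gam (Fb (x0, 0 : R^o))) var0 (normal0 j))).
    by rewrite yE coef_form_pt.
  apply: (congr2 +%R); first apply: (congr2 (fun u v => - u + v)).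
  - by apply: eq_bigr => i _; exact: divergence0.
  - apply: eq_bigr => i _.
    apply: (etrans _ (pairing0 _ i)).
    by rewrite cov_normal.
  - apply: (congr2 (fun u v => u / v)); last exact: frame_area0.
    apply: (etrans _ (f_fun0 _)); exact: (congr1 (fun v => dpairing deg d _ (f_mx gam ch Fb x0 Xb e v)) (normal0 j)).
rewrite /mean_curvature (formDr glin gsym) (formDr glin gsym).
rewrite -scaleN1r (formZr glin gsym) mulN1r -/b !(form_sumr glin gsym) -sumrN -!big_split.
apply: eq_bigr => j _ /=.
rewrite !(form_sumr glin gsym) (formZr glin gsym).
under [in RHS]eq_bigr do rewrite (formZr glin gsym).
under [X in _ = _ + X + _]eq_bigr do rewrite (formZr glin gsym).
by rewrite -!big_distrl /= !mulrDr mulrN; congr (_ + _ + _); [rewrite mulrC | rewrite mulrC | rewrite mulrC].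
Qed.

(* The tangent field whose divergence is the tangential part of the first
   variation. *)
Definition tangential_field : 'rV[R]_m :=
  \sum_i mdot (g b) (wedge_at (tvec Phi (E q) q) i (variational_field Gam q))
    (unit_part g H d Phi (E q) q) *: E q i q.

(** Valid also where [Theta] vanishes, the inverse of 0 being 0; it thus shows that the flux
    vanishes with [V]. *)
Lemma flux_tangential k : flux deg d gam0 F X0 k x0 =
  density (pullback g Phi) c x0 * to_chart c q tangential_field 0 k.
Proof.
have near_sym : \forall x \near x0, forall u v, coef_form gam (Fb (x, 0 : R^o)) u v = coef_form gam (Fb (x, 0 : R^o)) v u.
  by apply: (@filterE _ (nbhs x0)) => x u v; exact: gam_form.
have h := nbhs_singleton (@flux_frame _ _ _ deg d gam Fb x0 U' oU' U'x0 cFb Xb e near_sym near_TT) k.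
have [Eo _ _] := at_q; have [_ dens] := density_orthonormal dPhi pq Eo.
apply: (etrans (esym (nbhs_singleton (flux_agree k)))); apply: (etrans h).
apply: (congr2 *%R).
  apply: (etrans _ (esym dens)); congr (`|\det _|^-1); apply/matrixP => i l.
  by rewrite mxE [RHS]mxE /local_tangent /field_in_charts -/c qx0.
have dt := differentiable_transition (chart_atP q) pq.
rewrite /to_chart /tangential_field (derive_suml _ dt) summxE; apply: eq_bigr => i _.
rewrite (deriveZl _ _ dt) mxE; apply: (congr2 *%R).
  apply: (etrans _ (pairing0 _ i)).
  exact: (congr1 (fun v => pairing_row deg d _ (frame_comp gam Fb Xb x0 v) 0 i / _) var0).
by rewrite /local_tangent /field_in_charts -/c qx0.
Qed.

(** The time derivative of the minors involves the covariant derivatives of [V], hence the condition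
    on a neighbourhood. The area follows through [is_derive0_dist], without any division by its
    value. *)
Lemma coord_area_derive0 : (\forall q' \near q, variational_field Gam q' = 0) ->
  is_derive (0 : R) (1 : R) (fun t : R => coord_area deg d gam0 F X0 (x0, t : R^o) : R) 0.
Proof.
move=> V0; have yE : Fb (x0, 0 : R^o) = pt b := y0E.
have dgam : forall i j, differentiable (gam i j) (Fb (x0, 0 : R^o)).
  by move=> i' j'; rewrite yE; exact: differentiable_metric_coef.
have dX : forall k, differentiable (Xb k) (Fb (x0, 0 : R^o)) by move=> k; rewrite yE.
have gsym0 i j : gam i j (Fb (x0, 0 : R^o)) = gam j i (Fb (x0, 0 : R^o)) by exact: metric_coef_sym.
have compat (u a b' : 'rV[R]_n) :
    \sum_i \sum_j a 0 i * b' 0 j * 'D_u (gam i j) (Fb (x0, 0 : R^o)) =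
    coef_form gam (Fb (x0, 0 : R^o)) (ch u a) b' + coef_form gam (Fb (x0, 0 : R^o)) a (ch u b').
  by rewrite yE; exact: christoffel_compat.
have ch0 v : ch 0 v = 0.
  by have := @christoffel_linear R n N g b (-1) 0 0 v; rewrite scaler0 addr0 scaleN1r addNr.
have var_near0 : \forall x \near x0, var_vec Fb x = 0.
  apply: filterS2 near_dom (near_x0 V0) => x [Ux xc] Vx.
  have [pq' xE] := cinvK xc; have [_ _ bq] := U'P Ux.
  have ct' : {for 0, continuous (Gam (cinv c x))} := variation_continuous_time cGam zero_eps.
  have d1 : differentiable Fb (cmap c (cinv c x), 0 : R^o) by rewrite xE; exact: dFb.
  have h := derive_var_time pq' bq ct' d1; rewrite xE Vx in h.
  by apply: (etrans h); apply: chart_change0; [exact: chart_atP | exact: bq].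
have nabla0 w : nabla ch Fb x0 (var_vec Fb) w = 0.
  apply: (etrans (cder_near ch (fun x => Fb (x, 0 : R^o)) w var_near0)).
  by rewrite /cder derive_cst christoffel_sym ch0 addr0.
have nablaf0 k : nabla_frame ch Fb x0 Xb k (var_vec Fb x0) = 0.
  rewrite (nbhs_singleton var_near0) /nabla_frame /cder derive_id ch0 addr0.
  have dXb := dX k.
  have := @deriveZl R _ _ (Xb k) (Fb (x0, 0 : R^o)) 0 0 dXb.
  by rewrite !scale0r.
have h1 i k := is_derive_coord_mx dgam gsym0 (@christoffel_sym R n N g b) compat oU' U'x0 cFb dX i k.
have glin := coef_form_linear gam (Fb (x0, 0 : R^o)).
have h2 J : is_derive (0 : R) (1 : R) (fun t : R => minor J (coord_mx gam Fb Xb (x0, t : R^o)) : R) 0.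
  have h3 := is_derive_slice2 (is_derive_minor J h1).
  apply: (is_derive_eq h3).
  set B := \matrix_(i, k) _; have -> : B = 0; last first.
    have -> : colsub (val J) (0 : 'M[R]_(m, n)) = 0 by apply/matrixP => i k; rewrite !mxE.
    by rewrite mul0mx linear0.
  apply/matrixP => i k; rewrite mxE [RHS]mxE nabla0 nablaf0 (form0l glin).
  by rewrite (gam_form _ _ 0) (form0l glin) addr0.
apply: (@near_eq_is_derive _ _ _ (fun t : R => coord_area deg d gam Fb Xb (x0, t : R^o) : R)
    (fun t : R => coord_area deg d gam0 F X0 (x0, t : R^o) : R) 0 1 0 areas_agree).
apply: (@is_derive0_dist R _ (fun J : midx n m => jdeg deg J == d) _
  (fun J t => minor J (coord_mx gam Fb Xb (x0, t : R^o)))) => t.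
exact: sqrt_sum_dist.
Qed.

Lemma tangential_field0 : variational_field Gam q = 0 -> tangential_field = 0.
Proof.
move=> V0; have [_ _ aX] := at_q; apply: big1 => i _; rewrite V0.
rewrite /unit_part (mdot_unit_mvec_part d _ i _ aX).
have -> : comp_row (g b) (X q ^~ b) 0 = 0.
  by apply/rowP => k; rewrite !mxE (form0l (metric_linear g b)).
by rewrite pairing_row0 mxE mul0r scale0r.
Qed.

End At.
End Pointwise.

Section CkExtra.
Context (R : realType) (V : normedModType R).

Lemma Ck_minor m n k (U : set V) (A : V -> 'M[R]_(m, n)) (J : midx n m) : open U ->
  (forall i j, Ck k U (fun z => A z i j : R^o)) -> Ck k U (fun z => minor J (A z) : R^o).
Proof.
move=> oU cA; apply: Ck_det => //; apply/Ck_mxP => // i j.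
by under eq_fun do rewrite mxE.
Qed.

Lemma Ck_pairing m n k (deg : 'I_n -> nat) d (U : set V) (A B : V -> 'M[R]_(m, n)) : open U ->
  (forall i j, Ck k U (fun z => A z i j : R^o)) -> (forall i j, Ck k U (fun z => B z i j : R^o)) ->
  Ck k U (fun z => pairing deg d (A z) (B z) : R^o).
Proof.
by move=> oU cA cB; apply: Ck_sum => // J _; apply: Ck_mul => //; exact: Ck_minor.
Qed.

Lemma Ck_pairing_row m n k (deg : 'I_n -> nat) d (U : set V) (A : V -> 'M[R]_(m, n)) (y : V -> 'rV[R]_n) i :
  open U -> (forall i j, Ck k U (fun z => A z i j : R^o)) -> (forall j, Ck k U (fun z => y z 0 j : R^o)) ->
  Ck k U (fun z => pairing_row deg d (A z) (y z) 0 i : R^o).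
Proof.
move=> oU cA cy; under eq_fun do rewrite pairing_rowE.
apply: Ck_pairing => // k' j.
by case: (eqVneq k' i) => ki; under eq_fun do rewrite mxE ?ki ?eqxx ?(negPf ki).
Qed.

Lemma Ck_form n k (gam : 'I_n -> 'I_n -> 'rV[R]_n -> R^o) (U : set V) (f Y Z : V -> 'rV[R]_n) : open U ->
  (forall i j, Ck k U (gam i j \o f)) -> Ck k U Y -> Ck k U Z ->
  Ck k U (fun z => coef_form gam (f z) (Y z) (Z z) : R^o).
Proof.
move=> oU cg /(Ck_mxP _ _ oU) cY /(Ck_mxP _ _ oU) cZ.
apply: Ck_sum => // i _; apply: Ck_sum => // j _.
have cYZ : Ck k U (fun x => Y x 0 i * Z x 0 j : R^o) by apply: Ck_mul.
exact: (Ck_mul oU cYZ (cg i j)).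
Qed.

Lemma Ck_derive (W : normedModType R) k (U : set V) (f : V -> W) v :
  Ck k.+1 U f -> Ck k U (fun x => 'D_v f x).
Proof. by case=> _; exact. Qed.

End CkExtra.

Lemma Ck_slice (R : realType) (m k : nat) (W : normedModType R) (U : set ('rV[R]_m * R^o))
    (f : 'rV[R]_m * R^o -> W) (t : R^o) :
  Ck k U f -> Ck k [set x | U (x, t)] (fun x => f (x, t)).
Proof.
elim: k f => [|k IH] f /= => [cf x Ux|[df cf]].
  have h : {for x, continuous (fun x : 'rV[R]_m => (x, t))}.
    by apply: continuous_at_pair; [exact: cvg_id | exact: cst_continuous].
  exact: (continuous_comp h (cf _ Ux)).
split=> [x Ux|v]; first by apply: differentiable_slice1; exact: df.
have -> : (fun x => 'D_v (fun x0 : 'rV[R]_m => f (x0, t)) x) =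
    (fun x => 'D_((v, 0) : 'rV[R]_m * R^o) f (x, t)).
  by apply/funext => x; exact: derive_slice1.
exact: (IH _ (cf ((v, 0) : 'rV[R]_m * R^o))).
Qed.

Lemma open_slice (R : realType) (m : nat) (U : set ('rV[R]_m * R^o)) (t : R^o) :
  open U -> open [set x | U (x, t)].
Proof.
move=> oU; rewrite openE => x Ux.
have h : {for x, continuous (fun x : 'rV[R]_m => (x, t))}.
  by apply: continuous_at_pair; [exact: cvg_id | exact: cst_continuous].
by apply: h; exact: open_nbhs_nbhs.
Qed.

(** * Regularity of the area density and of the flux *)

Section SmoothArea.
Context (R : realType) (m n : nat) (M : manifold R m) (N : manifold R n)
  (g : riemannian_metric N) (H : equiregular_grading N) (d : nat) (Gam : M -> R -> N) (eps : R)
  (X : M -> 'I_n -> N -> 'rV[R]_n).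
Local Notation Phi := (Gam ^~ 0).
Local Notation deg := (vdeg H).
Hypothesis cGam : forall (p : M) (t : R), `|t| < eps -> {for (p, t), continuous (fun z : M * R => Gam z.1 z.2)}.
Context (p : M) (U : set ('rV[R]_m * R^o)).
Hypothesis dU : local_domain g H Gam eps X p U.
Local Notation F := (var_in_charts Gam p (Phi p)).
Local Notation c := (chart_at p).
Local Notation X0 := (frame_in_chart (X p) (Phi p)).
Local Notation gam0 := (metric_coef g (Phi p)).
Local Notation cm := (coord_mx gam0 F X0).

Let oU : open U. Proof. by have [] := dU. Qed.
Let cF k : Ck k U F. Proof. by have [_ _ + _ _] := dU; exact. Qed.
Let cgam k i j : Ck k U (gam0 i j \o F). Proof. by have [_ _ _ + _] := dU; exact. Qed.
Let cX k i : Ck k U (X0 i \o F). Proof. by have [_ _ _ _] := dU; exact. Qed.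

Lemma Ck_coord_mx k i l : Ck k U (fun z => cm z i l : R^o).
Proof.
under eq_fun do rewrite mxE.
apply: (@Ck_form _ _ _ _ gam0 U F (fun z => 'D_((delta_mx 0 i, 0) : 'rV[R]_m * R^o) F z) (X0 l \o F)) => //.
exact: Ck_derive (cF k.+1).
Qed.

(** The components of the velocity at all times, so that the flux is the slice at time 0 of a
    function of [(x, t)]. *)
Definition var_comp (z : 'rV[R]_m * R^o) : 'rV[R]_n :=
  \row_l coef_form gam0 (F z) ('D_((0, 1) : 'rV[R]_m * R^o) F z) (X0 l (F z)).

Lemma Ck_var_comp k l : Ck k U (fun z => var_comp z 0 l : R^o).
Proof.
under eq_fun do rewrite mxE.
apply: (@Ck_form _ _ _ _ gam0 U F (fun z => 'D_((0, 1) : 'rV[R]_m * R^o) F z) (X0 l \o F)) => //.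
exact: Ck_derive (cF k.+1).
Qed.

Let Up := [set z | U z /\ 0 < pairing deg d (cm z) (cm z)].

Let Ck_area k : Ck k U (fun z => pairing deg d (cm z) (cm z) : R^o).
Proof. by apply: Ck_pairing => // i j; exact: Ck_coord_mx. Qed.

Let oUp : open Up.
Proof.
rewrite openE => z [Uz Pz].
have n2 : \forall w \near z, 0 < pairing deg d (cm w) (cm w).
  have cP := Ck_continuous (Ck_area 0) Uz.
  exact: (cvgr_gt _ cP _ Pz).
have n1 : nbhs z U by exact: open_nbhs_nbhs.
by apply: filterS2 n1 n2.
Qed.

Lemma Ck_flux k i : Ck k [set x | Up (x, 0 : R^o)] (fun x => flux deg d gam0 F X0 i x : R^o).
Proof.
have sub : Up `<=` U by move=> z [].
have h : Ck k Up (fun z => pairing_row deg d (cm z) (var_comp z) 0 i / Num.sqrt (pairing deg d (cm z) (cm z)) : R^o).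
  have h1 : Ck k Up (fun z => pairing_row deg d (cm z) (var_comp z) 0 i : R^o).
    exact: (Ck_subset sub (Ck_pairing_row deg d i oU (Ck_coord_mx k) (Ck_var_comp k))).
  have h2 : Ck k Up (fun z => Num.sqrt (pairing deg d (cm z) (cm z)) : R^o).
    have P0 z : Up z -> 0 < pairing deg d (cm z) (cm z) by case.
    exact: (@Ck_sqrt _ _ k Up (fun z => pairing deg d (cm z) (cm z) : R^o) oUp P0 (Ck_subset sub (Ck_area k))).
  have s0 z : Up z -> Num.sqrt (pairing deg d (cm z) (cm z)) != 0 by case=> _ z0; rewrite gt_eqF// sqrtr_gt0.
  exact: (Ck_mul oUp h1 (Ck_inv oUp s0 h2)).
exact: (Ck_slice (0 : R^o) h).
Qed.

Lemma flux_smooth_near x : U (x, 0 : R^o) -> 0 < coord_area deg d gam0 F X0 (x, 0 : R^o) ->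
  exists2 O : set 'rV[R]_m, open_nbhs x O &
    forall k i, Ck k O (fun x => flux deg d gam0 F X0 i x : R^o).
Proof.
move=> Ux Sx; exists [set x | Up (x, 0 : R^o)]; last exact: Ck_flux.
split; first exact: open_slice.
by split=> //; move: Sx; rewrite /coord_area sqrtr_gt0.
Qed.

Lemma coord_area_lipschitz z w :
  `|coord_area deg d gam0 F X0 z - coord_area deg d gam0 F X0 w| <=
  \sum_(J | jdeg deg J == d) `|minor J (cm z) - minor J (cm w)|.
Proof. exact: sqrt_sum_dist. Qed.

Lemma coord_area_le z :
  coord_area deg d gam0 F X0 z <= \sum_(J | jdeg deg J == d) `|minor J (cm z)|.
Proof.
have := @sqrt_sum_dist R _ (index_enum _) (fun J : midx n m => jdeg deg J == d) (fun J => minor J (cm z)) (fun=> 0).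
rewrite [X in `|_ - Num.sqrt X|]big1 => [|J _]; last by rewrite mulr0.
rewrite sqrtr0 subr0 ger0_norm ?sqrtr_ge0// => h; apply: (le_trans h).
by apply: ler_sum => J _; rewrite subr0.
Qed.

Lemma coord_area_continuous z : U z -> {for z, continuous (fun z => coord_area deg d gam0 F X0 z : R^o)}.
Proof.
move=> Uz; apply: (@continuous_comp _ _ _ (fun z => pairing deg d (cm z) (cm z)) Num.sqrt).
  exact: (Ck_continuous (Ck_area 0) Uz).
exact: sqrt_continuous.
Qed.

Lemma density_continuous z : U z ->
  {for z, continuous (fun z : 'rV[R]_m * R^o => density (pullback g (Gam ^~ z.2)) c z.1 : R^o)}.
Proof.
move=> Uz.
pose h (z : 'rV[R]_m * R^o) : 'M[R]_m := \matrix_(i, j) coef_form gam0 (F z)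
  ('D_((delta_mx 0 i, 0) : 'rV[R]_m * R^o) F z) ('D_((delta_mx 0 j, 0) : 'rV[R]_m * R^o) F z).
have ch : Ck 0 U (fun z => \det (h z) : R^o).
  apply: (Ck_det oU); apply: (iffRL (Ck_mxP 0 h oU)) => i j.
  have e : (fun z => h z i j : R^o) = (fun z => coef_form gam0 (F z)
      ('D_((delta_mx 0 i, 0) : 'rV[R]_m * R^o) F z) ('D_((delta_mx 0 j, 0) : 'rV[R]_m * R^o) F z) : R^o).
    by apply/funext => w; rewrite mxE.
  rewrite e; exact: (Ck_form oU (cgam 0) (Ck_derive _ (cF 1)) (Ck_derive _ (cF 1))).
have e : \forall w \near z, Num.sqrt (\det (h w)) = density (pullback g (Gam ^~ w.2)) c w.1.
  have n1 : nbhs z U by exact: open_nbhs_nbhs.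
  apply: filterS n1 => -[x t] Uw; congr (Num.sqrt (\det _)); apply/matrixP => i j; rewrite !mxE.
  have [_ /(_ _ Uw)[px te by_ _] _ _ _] := dU.
  have [pq xE] := cinvK px; rewrite /= in pq xE te by_.
  have cG : {for cinv c x, continuous (Gam ^~ t)} := variation_continuous_space cGam te.
  have dF : differentiable F (cmap c (cinv c x), t : R^o).
    by rewrite xE; exact: (local_domain_differentiable dU).
  have e1 v := derive_var_space pq by_ cG dF v.
  rewrite xE in e1.
  apply: (etrans (congr2 (coef_form gam0 _) (e1 (delta_mx 0 i)) (e1 (delta_mx 0 j)))).
  exact: coef_form_chart_change.
have c1 : {for z, continuous (fun w => Num.sqrt (\det (h w)) : R^o)}.
  by apply: (@continuous_comp _ _ _ (fun w => \det (h w)) Num.sqrt); [exact: ch | exact: sqrt_continuous].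
rewrite /prop_for /continuous_at -(nbhs_singleton e).
apply: cvg_trans c1; apply: near_eq_cvg; exact: e.
Qed.

Lemma coord_area_Theta x (t : R) : U (x, t : R^o) -> immersion (Gam ^~ t) ->
  coord_area deg d gam0 F X0 (x, t : R^o) =
  Theta g H d (Gam ^~ t) (cinv c x) * density (pullback g (Gam ^~ t)) c x.
Proof.
move=> Ux immG.
have [_ /(_ _ Ux)[px te by_ aX] _ _ _] := dU.
have [pq xE] := cinvK px; rewrite /= in pq xE te by_ aX.
have cG : {for cinv c x, continuous (Gam ^~ t)} := variation_continuous_space cGam te.
have dF : differentiable F (cmap c (cinv c x), t : R^o).
  by rewrite xE; exact: (local_domain_differentiable dU).
have e1 := coord_area_intrinsic g H d pq by_ cG dF (X p).
have dmF := differentiable_map_in_charts pq by_ cG dF.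
have e2 := Theta_density d dmF (proj2 immG (cinv c x)) pq aX.
rewrite xE in e1 e2.
exact: (etrans e1 (esym e2)).
Qed.

Lemma density_gt0 x (t : R) : U (x, t : R^o) -> immersion (Gam ^~ t) ->
  0 < density (pullback g (Gam ^~ t)) c x.
Proof.
move=> Ux immG.
have [_ /(_ _ Ux)[px te by_ aX] _ _ _] := dU.
have [pq xE] := cinvK px; rewrite /= in pq xE te by_ aX.
have cG : {for cinv c x, continuous (Gam ^~ t)} := variation_continuous_space cGam te.
have dF : differentiable F (cmap c (cinv c x), t : R^o).
  by rewrite xE; exact: (local_domain_differentiable dU).
have dmF := differentiable_map_in_charts pq by_ cG dF.
have [e eo] := orthonormal_exists (pullback_linear g dmF) (pullback_sym g (Gam ^~ t) (cinv c x))
  (pullback_pos g (proj2 immG (cinv c x))) (leqnn m).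
have [a0] := density_orthonormal dmF pq eo; rewrite xE => ->.
by rewrite invr_gt0 normr_gt0.
Qed.

(** [Theta] rests on choices made point by point; its continuity is read off the quotient of the
    coordinate area by the positive density. *)
Lemma Theta_continuous q (t : R) : cdom c q -> U (cmap c q, t : R^o) -> immersion (Gam ^~ t) ->
  {for q, continuous (Theta g H d (Gam ^~ t) : M -> R^o)}.
Proof.
move=> pq Ux immG.
have n1 : \forall q' \near q, cdom c q' /\ U (cmap c q', t : R^o).
  have cp : {for q, continuous (fun q' : M => (cmap c q', t : R^o))}.
    by apply: continuous_at_pair; [exact: cmap_continuous | exact: cst_continuous].
  have n2 : \forall q' \near q, U (cmap c q', t : R^o) by apply: cp; exact: open_nbhs_nbhs.
  have n3 := cdom_nbhs pq.
  by apply: filterS2 n3 n2.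
pose f (x : 'rV[R]_m) : R^o := coord_area deg d gam0 F X0 (x, t : R^o) / density (pullback g (Gam ^~ t)) c x.
have e : \forall q' \near q, f (cmap c q') = Theta g H d (Gam ^~ t) q'.
  apply: filterS n1 => q' [pq' Ux']; rewrite /f coord_area_Theta// cmapK// mulfK//.
  by rewrite gt_eqF// density_gt0.
have cs : {for cmap c q, continuous (fun x : 'rV[R]_m => (x, t : R^o))}.
  by apply: continuous_at_pair; [exact: cvg_id | exact: cst_continuous].
have cf : {for cmap c q, continuous f}.
  have c1 : {for cmap c q, continuous (fun x => coord_area deg d gam0 F X0 (x, t : R^o) : R^o)}.
    exact: (@continuous_comp _ _ _ (fun x : 'rV[R]_m => (x, t : R^o))
      (fun z => coord_area deg d gam0 F X0 z : R^o) (cmap c q) cs (coord_area_continuous Ux)).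
  have c2 : {for cmap c q, continuous (fun x => density (pullback g (Gam ^~ t)) c x : R^o)}.
    exact: (@continuous_comp _ _ _ (fun x : 'rV[R]_m => (x, t : R^o))
      (fun z : 'rV[R]_m * R^o => density (pullback g (Gam ^~ z.2)) c z.1 : R^o) (cmap c q) cs (density_continuous Ux)).
  have d0 : density (pullback g (Gam ^~ t)) c (cmap c q) != 0 by rewrite gt_eqF// density_gt0.
  exact: (cvgM c1 (cvgV d0 c2)).
have cfc := continuous_comp (cmap_continuous pq) cf.
rewrite /prop_for /continuous_at -(nbhs_singleton e).
apply: cvg_trans cfc; apply: near_eq_cvg; exact: e.
Qed.

End SmoothArea.

(** * The variation near a point *)

Section LocalizedProduct.
Context (R : realType) (V : normedModType R) (a z : V -> R^o) (x v : V).

(** What makes a product of class C^1 near [x] when neither factor need be so: [a] will be a cut-off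
    function, [z] a component of the flux. *)
Definition localizable : Prop :=
  [\/ \forall y \near x, a y = 0, \forall y \near x, z y = 0 |
      exists2 O : set V, open_nbhs x O & Ck 1 O a /\ Ck 1 O z].

Let derive0 (f : V -> R^o) : (\forall y \near x, f y = 0) -> \forall y \near x, 'D_v f y = 0.
Proof.
move=> f0; near=> y; rewrite -[RHS](derive_cst (0 : R^o) y v); apply: near_eq_derive.
by near: y; exact: near_join f0.
Unshelve. all: by end_near. Qed.

Let near0 (f : V -> R^o) : (\forall y \near x, f y = 0) -> differentiable f x /\ {for x, continuous f}.
Proof.
move=> f0; have df : differentiable f x.
  apply: (@near_eq_differentiable _ _ _ (cst (0 : R^o))); last exact: differentiable_cst.
  by apply: filterS f0 => y ->.
by split=> //; exact: differentiable_continuous.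
Qed.

Lemma localizable_product : localizable ->
  [/\ differentiable (fun y => a y * z y : R^o) x,
      {for x, continuous (fun y => 'D_v (fun w => a w * z w : R^o) y : R^o)},
      {for x, continuous (fun y => z y * 'D_v a y : R^o)} &
      'D_v (fun y => a y * z y : R^o) x = a x * 'D_v z x + z x * 'D_v a x].
Proof.
case=> [a0|z0|[U oU [ca cz]]].
- have p0 : \forall y \near x, a y * z y = 0 :> R^o by apply: filterS a0 => y ->; rewrite mul0r.
  have q0 : \forall y \near x, z y * 'D_v a y = 0 :> R^o.
    by apply: filterS (derive0 a0) => y ->; rewrite mulr0.
  split; [exact: (near0 p0).1 | exact: (near0 (derive0 p0)).2 | exact: (near0 q0).2 |].
  by rewrite (nbhs_singleton (derive0 p0)) (nbhs_singleton (derive0 a0)) (nbhs_singleton a0) mul0r mulr0 addr0.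
- have p0 : \forall y \near x, a y * z y = 0 :> R^o by apply: filterS z0 => y ->; rewrite mulr0.
  have q0 : \forall y \near x, z y * 'D_v a y = 0 :> R^o by apply: filterS z0 => y ->; rewrite mul0r.
  split; [exact: (near0 p0).1 | exact: (near0 (derive0 p0)).2 | exact: (near0 q0).2 |].
  by rewrite (nbhs_singleton (derive0 p0)) (nbhs_singleton (derive0 z0)) (nbhs_singleton z0) mul0r mulr0 addr0.
- have [oU1 Ux] := oU; have caz := Ck_mul oU1 ca cz.
  split.
  + by have [d _] := caz; exact: d.
  + exact: (Ck_continuous (Ck_derive v caz) Ux).
  + exact: (Ck_continuous (Ck_mul oU1 (CkW cz) (Ck_derive v ca)) Ux).
  + have [da _] := ca; have [dz _] := cz.
    by rewrite deriveM//; exact: diff_derivable (_ x Ux).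
Unshelve. all: by end_near. Qed.

End LocalizedProduct.

Section ChartIntegrable.
Context (R : realType) (m : nat) (M : manifold R m).
Context (l : {sigma_finite_measure set (borel 'rV[R]_m) -> \bar R}).
Hypothesis lL : is_lebesgue l.

(** Only the product with the density is known to be integrable; dividing by the positive density
    recovers the measurability of [f]. *)
Lemma chart_integrable (h : M -> 'rV[R]_m -> 'rV[R]_m -> R)
    (mu : {measure set (borel M) -> \bar R}) (p : M) (C : set (borel M)) (f : M -> R)
    (D : set (borel 'rV[R]_m) := cmap (chart_at p) @` C) :
  is_riemannian_measure h mu -> compact (C : set M) -> C `<=` cdom (chart_at p) ->
  measurable_fun D (density h (chart_at p)) -> (forall x, D x -> 0 < density h (chart_at p) x) ->
  l.-integrable D (EFin \o (fun x => f (cinv (chart_at p) x) * density h (chart_at p) x)) ->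
  mu.-integrable C (EFin \o f) /\
  \int[mu]_(q in C) f q = \int[l]_(x in D) (f (cinv (chart_at p) x) * density h (chart_at p) x).
Proof.
move=> muP cC Cc md d0 intf; set c := chart_at p in D Cc md d0 intf *.
have mC : measurable C by apply: borel_closed; apply: compact_closed => //; exact: mhausdorff.
have mD : measurable D.
  by apply: borel_closed; apply: compact_closed; [exact: norm_hausdorff | exact: chart_compact_image].
have m1 : measurable_fun D (fun x => f (cinv c x) * density h c x).
  by apply/measurable_EFinP; exact: (measurable_int _ intf).
have m2 : measurable_fun D (fun x => (density h c x)^-1).
  apply: (@measurable_comp _ _ _ _ _ _ [set y : R | y != 0] (GRing.inv : R -> R) D (density h c)) => //.
  - exact: open_measurable (@open_neq R 0).
  - by move=> _ [x Dx <-] /=; rewrite gt_eqF// d0.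
  - apply: open_continuous_measurable_fun; first exact: open_neq.
    by move=> y /[!inE] /= y0; exact: inv_continuous.
have mF : measurable_fun D (fun x => f (cinv c x) * density h c x / density h c x).
  exact: (measurable_funM m1 m2).
have mcm : measurable_fun C (cmap c : borel M -> borel 'rV[R]_m).
  have mc : measurable (cdom c : set (borel M)) by apply: borel_open; exact: cdom_open.
  apply: (measurable_funS mc Cc).
  by apply: (continuous_borel_measurable (@cdom_open _ _ _ c)) => q; exact: cmap_continuous.
have mf : measurable_fun C f.
  have e q : C q -> f q = (fun x => f (cinv c x) * density h c x / density h c x) (cmap c q).
    move=> Cq; rewrite /= cmapK ?mulfK//; last exact: Cc.
    by rewrite gt_eqF// d0//; exists q.
  have mFc : measurable_fun C ((fun x => f (cinv c x) * density h c x / density h c x) \o cmap c).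
    by apply: (measurable_comp mD) => // _ [q Cq <-]; exists q.
  by apply: eq_measurable_fun mFc => q /[!inE] Cq; rewrite e.
have mEf : measurable_fun C (EFin \o f) by exact/measurable_EFinP.
split.
  apply/integrableP; split=> //.
  have := @chart_integral R m M l lL h mu p C (fun q => `|(f q)%:E|)%E muP cC Cc md.
  rewrite -/c => ->; last exact: measurableT_comp.
  have /integrableP[_] := intf.
  rewrite (@eq_integral _ _ _ l D (fun x => `|(f (cinv c x))%:E| * (density h c x)%:E)%E)//.
  move=> x /[!inE] Dx; rewrite [LHS](_ : _ = `|(f (cinv c x))%:E * (density h c x)%:E|%E)// abseM; congr (_ * _)%E.
  by rewrite gee0_abs// lee_fin ltW// d0.
rewrite /Rintegral (@chart_integral R m M l lL h mu p C (EFin \o f) muP cC Cc md mEf).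
by [].
Qed.

End ChartIntegrable.

Section RealIntegrals.
Context d (T : measurableType d) (R : realType) (mu : {measure set T -> \bar R}) (D : set T).
Hypothesis mD : measurable D.

Lemma eq_Rintegrable (f h : T -> R) : (forall x, D x -> f x = h x) ->
  mu.-integrable D (EFin \o f) -> mu.-integrable D (EFin \o h).
Proof. by move=> fh; apply: eq_integrable => // x /[!inE] Dx /=; rewrite fh. Qed.

Lemma RintegrableB (f h : T -> R) : mu.-integrable D (EFin \o f) -> mu.-integrable D (EFin \o h) ->
  mu.-integrable D (EFin \o (fun x => f x - h x)).
Proof. exact: integrableB. Qed.

Lemma Rintegrable_sum (I : finType) (f : I -> T -> R) :
  (forall i, mu.-integrable D (EFin \o f i)) ->
  mu.-integrable D (EFin \o (fun x => \sum_i f i x)) /\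
  \int[mu]_(x in D) (\sum_i f i x) = \sum_i \int[mu]_(x in D) f i x.
Proof.
move=> intf; have e x : (\sum_i f i x)%:E = (\sum_i (EFin \o f i) x)%E by rewrite -sumEFin.
split.
  have := @integrable_sum _ _ _ mu D mD _ (index_enum I) xpredT (fun i => EFin \o f i) (fun i _ => intf i).
  by apply: eq_integrable => // x _ /=; rewrite sumEFin.
rewrite /Rintegral; under eq_integral do rewrite e.
rewrite (@integral_sum _ _ _ mu D mD _ (fun i => EFin \o f i) intf) -sum_fine// => i _.
exact: integrable_fin_num.
Qed.

End RealIntegrals.

Section LocalVariation.
Context (R : realType) (m n : nat) (M : manifold R m) (N : manifold R n)
  (g : riemannian_metric N) (H : equiregular_grading N) (d : nat) (Gam : M -> R -> N) (eps : R)
  (X : M -> 'I_n -> N -> 'rV[R]_n) (E : M -> 'I_m -> M -> 'rV[R]_m)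
  (Nu : M -> 'I_(n - m) -> M -> 'rV[R]_n) (mu : R -> {measure set (borel M) -> \bar R}) (K : set M).
Local Notation Phi := (Gam ^~ 0).
Local Notation deg := (vdeg H).
Hypothesis eps_gt0 : 0 < eps.
Hypothesis cGam : forall (p : M) (t : R), `|t| < eps -> {for (p, t), continuous (fun z : M * R => Gam z.1 z.2)}.
Hypothesis XP : forall p, adapted_frame g H (Phi p) (X p).
Hypothesis EP : forall p, tangent_frame g Phi p (E p).
Hypothesis NuP : forall p, normal_frame g Phi p (Nu p).
Hypothesis immG : \forall t \near (0 : R), immersion (Gam ^~ t).
Hypothesis muP : \forall t \near (0 : R), is_riemannian_measure (pullback g (Gam ^~ t)) (mu t).
Hypothesis cK : compact K.
Let S := closure [set q | variational_field Gam q != 0].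
Hypothesis SK : S `<=` K.
Hypothesis Theta_S : forall q, S q -> Theta g H d Phi q != 0.

Definition speed (q : M) : R :=
  g (Phi q) (variational_field Gam q) (mean_curvature g H d Phi (E q) (Nu q) (X q) q).

(** The term [W(chi_j)] of the overview, in the preferred chart at [q], where the components of the
    tangential field are given. *)
Definition tangential_derivative (f : M -> R) (q : M) : R :=
  'D_(tangential_field g H d Gam E q) (fun x => f (cinv (chart_at q) x) : R^o) (pt q).

Lemma variation_off_support q : ~ S q -> \forall q' \near q, variational_field Gam q' = 0.
Proof.
move=> nS; have : nbhs q (~` S) by apply: open_nbhs_nbhs; split=> //; exact/closed_openC/closed_closure.
by apply: filterS => q' nS'; apply/eqP; apply: contra_notT nS' => ?; exact: subset_closure.
Qed.

Context (p : M) (U : set ('rV[R]_m * R^o)).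
Hypothesis dU : local_domain g H Gam eps X p U.
Hypothesis Up : U (pt p, 0 : R^o).
Local Notation F := (var_in_charts Gam p (Phi p)).
Local Notation c := (chart_at p).
Local Notation X0 := (frame_in_chart (X p) (Phi p)).
Local Notation gam0 := (metric_coef g (Phi p)).
Local Notation cm := (coord_mx gam0 F X0).
Local Notation Sd := (coord_area deg d gam0 F X0).
Local Notation Z := (flux deg d gam0 F X0).
Local Notation dens t := (density (pullback g (Gam ^~ t)) c).

Let oU : open U. Proof. by have [] := dU. Qed.

(** The constant [L] comes from bounds on the minors and on their time derivatives: the former bound
    the area, and the latter, by the mean value theorem, its increments. *)
Lemma local_box_exists : exists2 r : R, 0 < r &
  [/\ forall x (t : R), `|x - pt p| <= r -> `|t| < r -> U (x, t : R^o),
      forall t : R, `|t| < r -> immersion (Gam ^~ t) /\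
        is_riemannian_measure (pullback g (Gam ^~ t)) (mu t)
    & exists L : R, forall x (t : R), `|x - pt p| <= r -> `|t| < r ->
        `|Sd (x, t : R^o)| <= L /\ `|Sd (x, t : R^o) - Sd (x, 0 : R^o)| <= L * `|t|].
Proof.
pose f (J : midx n m) (z : 'rV[R]_m * R^o) : R^o := minor J (cm z).
pose f' (J : midx n m) (z : 'rV[R]_m * R^o) : R^o := 'D_((0, 1) : 'rV[R]_m * R^o) (f J) z.
have cf J k : Ck k U (f J).
  by apply: Ck_minor => // i j; exact: Ck_coord_mx dU k i j.
have cf' J : Ck 0 U (f' J) by exact: Ck_derive (cf J 1%N).
(* By continuity each function stays within 1 of its value at the centre. *)
pose B J : R := Num.max (`|f J (pt p, 0 : R^o)| + 1) (`|f' J (pt p, 0 : R^o)| + 1).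
have nB J : \forall z \near (pt p, 0 : R^o), `|f J z| <= B J /\ `|f' J z| <= B J.
  have c1 := Ck_continuous (cf J 0%N) Up; have c2 := Ck_continuous (cf' J) Up.
  have b (h : 'rV[R]_m * R^o -> R^o) : {for (pt p, 0 : R^o), continuous h} ->
      \forall z \near (pt p, 0 : R^o), `|h z| <= `|h (pt p, 0 : R^o)| + 1.
    move=> ch; near=> z.
    have : `|h (pt p, 0 : R^o) - h z| <= 1 by near: z; have /cvgrPdist_le := ch; apply.
    by move=> hz; rewrite -lerBlDl; apply: le_trans hz; rewrite distrC; exact: lerB_dist.
  near=> z; split; rewrite le_max; apply/orP; [left|right].
    by near: z; exact: b.
  by near: z; exact: b.
have nBall : \forall z \near (pt p, 0 : R^o), forall J, `|f J z| <= B J /\ `|f' J z| <= B J.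
  exact: (@filter_forall _ (midx n m) (fun J z => `|f J z| <= B J /\ `|f' J z| <= B J) _ _ nB).
have nU : \forall z \near (pt p, 0 : R^o), U z by exact: open_nbhs_nbhs.
have nUB : \forall z \near ((pt p, 0) : 'rV[R]_m * R^o), U z /\ forall J, `|f J z| <= B J /\ `|f' J z| <= B J.
  by apply: filterS2 nU nBall.
have nIM : \forall t \near (0 : R), immersion (Gam ^~ t) /\ is_riemannian_measure (pullback g (Gam ^~ t)) (mu t).
  by apply: filterS2 immG muP.
have [e1 /= e10 e1P] := iffLR (nbhs_ballP _ _) nUB.
have [e2 /= e20 e2P] := iffLR (nbhs_ballP _ _) nIM.
(* Halving puts the closed ball of radius [r] inside the open one. *)
pose r := Num.min e1 e2 / 2.
have r0 : 0 < r by rewrite divr_gt0// lt_min e10.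
have re : r < Num.min e1 e2 by rewrite ltr_pdivrMr// ltr_pMr ?ltr1n// lt_min e10.
have re1 : r < e1 by apply: lt_le_trans re _; rewrite ge_min lexx.
have re2 : r < e2 by apply: lt_le_trans re _; rewrite ge_min lexx orbT.
have box x (t : R) : `|x - pt p| <= r -> `|t| < r -> U (x, t : R^o) /\ forall J, `|f J (x, t : R^o)| <= B J /\ `|f' J (x, t : R^o)| <= B J.
  move=> xr tr; apply: e1P; split=> /=; rewrite -ball_normE /ball_ /=.
    by rewrite distrC (le_lt_trans xr).
  by rewrite sub0r normrN (lt_trans tr).
exists r => //; split.
- by move=> x t xr tr; have [] := box x t xr tr.
- move=> t tr; apply: e2P; rewrite -ball_normE /ball_ /= sub0r normrN.
  exact: lt_trans re2.
exists (\sum_(J | jdeg deg J == d) B J) => x t xr tr; split.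
  rewrite ger0_norm ?sqrtr_ge0//; apply: (le_trans (coord_area_le g H d Gam X p _)).
  by apply: ler_sum => J _; have [_ /(_ J)[]] := box x t xr tr.
apply: (le_trans (coord_area_lipschitz g H d Gam X p _ _)).
rewrite big_distrl /=; apply: ler_sum => J _.
have h1 s : `|s| < r -> is_derive s (1 : R) (fun s : R => f J (x, s : R^o) : R) (f' J (x, s : R^o)).
  move=> sr; have [Us _] := box x s xr sr; have [df _] := cf J 1%N.
  exact: (is_derive_slice2 (differentiable_is_derive _ (df _ Us))).
have h2 s : `|s| < r -> `|f' J (x, s : R^o) : R| <= B J.
  by move=> sr; have [_ /(_ J)[]] := box x s xr sr.
exact: (mvt_bound h1 h2 tr).
Unshelve. all: by end_near. Qed.

Context (r L : R).
Hypothesis r_gt0 : 0 < r.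
Hypothesis boxU : forall x (t : R), `|x - pt p| <= r -> `|t| < r -> U (x, t : R^o).
Hypothesis boxI : forall t : R, `|t| < r -> immersion (Gam ^~ t) /\
  is_riemannian_measure (pullback g (Gam ^~ t)) (mu t).
Hypothesis boxL : forall x (t : R), `|x - pt p| <= r -> `|t| < r ->
  `|Sd (x, t : R^o)| <= L /\ `|Sd (x, t : R^o) - Sd (x, 0 : R^o)| <= L * `|t|.
Context (l : {sigma_finite_measure set (borel 'rV[R]_m) -> \bar R}).
Hypothesis lL : is_lebesgue l.

Definition coord_ball : set 'rV[R]_m := [set x | `|x - pt p| <= r].
Local Notation B := coord_ball.
Local Notation Bm := (cinv c @` B).

Let r0 : `|0 : R| < r. Proof. by rewrite normr0. Qed.

Lemma coord_ballP x : B x -> cdom c (cinv c x) /\ cmap c (cinv c x) = x.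
Proof.
move=> Bx; have [_ /(_ _ (boxU Bx r0))[px _ _ _] _ _ _] := dU.
exact: cinvK.
Qed.

Lemma coord_ball_closed : closed B.
Proof.
have -> : B = (fun x => x - pt p) @^-1` ((fun x => `|x|) @^-1` [set y : R | y <= r]) by [].
apply: closed_comp; first by move=> x _; exact: (cvgD cvg_id (cvg_cst (- pt p))).
by apply: closed_comp; [move=> x _; exact: norm_continuous | exact: closed_le].
Qed.

Lemma coord_ball_bound x : B x -> `|x| <= r + `|pt p|.
Proof.
by move=> Bx; rewrite -(subrK (pt p) x) (le_trans (ler_normD _ _))// lerD2r.
Qed.

Lemma coord_ball_compact : compact B.
Proof.
apply: bounded_closed_compact; last exact: coord_ball_closed.
exists (r + `|pt p|); split; first exact: num_real.
by move=> a ha x /= /coord_ball_bound xr; rewrite (le_trans xr)// ltW.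
Qed.

Lemma local_ball_compact : compact Bm.
Proof.
apply: continuous_compact coord_ball_compact; apply: continuous_in_subspaceT => x /[!inE] Bx.
by have [px xE] := coord_ballP Bx; apply: cinv_continuous; exists (cinv c x).
Qed.

Lemma local_ball_dom q : Bm q -> cdom c q /\ B (cmap c q).
Proof. by move=> [x Bx <-]; have [px xE] := coord_ballP Bx; rewrite xE. Qed.

Let C : set (borel M) := K `&` Bm.
Let D : set (borel 'rV[R]_m) := cmap c @` C.

Let cC : compact (C : set M).
Proof.
apply: (@subclosed_compact _ _ K) => //; last by move=> q [].
by apply: closedI; apply: compact_closed => //; [exact: mhausdorff | exact: mhausdorff | exact: local_ball_compact].
Qed.

Let Cc : C `<=` cdom c. Proof. by move=> q [_ /local_ball_dom[]]. Qed.

Let DP x : D x -> [/\ B x, K (cinv c x), cdom c (cinv c x) & cmap c (cinv c x) = x].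
Proof.
move=> [q [Kq Bq] <-]; have [pq Bx] := local_ball_dom Bq.
by rewrite !cmapK.
Qed.

Let DE x : B x -> K (cinv c x) -> D x.
Proof.
move=> Bx Kx; have [px xE] := coord_ballP Bx.
by exists (cinv c x) => //; split=> //; exists x.
Qed.

Let mC : measurable C.
Proof. by apply: borel_closed; apply: compact_closed => //; exact: mhausdorff. Qed.

Let mD : measurable D.
Proof.
by apply: borel_closed; apply: compact_closed; [exact: norm_hausdorff | exact: chart_compact_image].
Qed.

Let lD : (l D < +oo)%E.
Proof.
have [_ lfin _] := lL; apply: le_lt_trans (lfin (r + `|pt p|)).
apply: le_measure; rewrite ?inE//; first exact: closed_ball_measurable.
by move=> x /DP[Bx _ _ _]; exact: coord_ball_bound.
Qed.

Let slice_open t : open [set x | U (x, t : R^o)]. Proof. exact: open_slice. Qed.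

Let dens_measurable t : `|t| < r -> measurable_fun D (dens t).
Proof.
move=> tr; have mU : measurable ([set x | U (x, t : R^o)] : set (borel 'rV[R]_m)) by apply: borel_open.
apply: (measurable_funS mU); first by move=> x /DP[Bx _ _ _]; exact: boxU.
apply: (continuous_real_measurable (@slice_open t)) => x Ux.
have cs : {for x, continuous (fun x : 'rV[R]_m => (x, t : R^o))}.
  by apply: continuous_at_pair; [exact: cvg_id | exact: cst_continuous].
exact: (@continuous_comp _ _ _ (fun x : 'rV[R]_m => (x, t : R^o))
  (fun z : 'rV[R]_m * R^o => density (pullback g (Gam ^~ z.2)) c z.1 : R^o) x cs (density_continuous cGam dU Ux)).
Qed.

Let Sd_measurable t : `|t| < r -> measurable_fun D (fun x => Sd (x, t : R^o)).
Proof.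
move=> tr; have mU : measurable ([set x | U (x, t : R^o)] : set (borel 'rV[R]_m)) by apply: borel_open.
apply: (measurable_funS mU); first by move=> x /DP[Bx _ _ _]; exact: boxU.
apply: (continuous_real_measurable (@slice_open t)) => x Ux.
have cs : {for x, continuous (fun x : 'rV[R]_m => (x, t : R^o))}.
  by apply: continuous_at_pair; [exact: cvg_id | exact: cst_continuous].
have c1 : {for x, continuous (fun x : 'rV[R]_m => Sd (x, t : R^o) : R^o)}.
  apply: (@continuous_comp _ _ _ (fun x : 'rV[R]_m => (x, t : R^o)) (fun z => Sd z : R^o) x cs).
  exact: (coord_area_continuous dU Ux).
exact: c1.
Qed.

Let dens_pos t x : `|t| < r -> D x -> 0 < dens t x.
Proof.
move=> tr /DP[Bx _ _ _]; apply: (density_gt0 cGam dU); first exact: boxU.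
by have [] := boxI tr.
Qed.

Context (chi : M -> R).
Hypothesis chi_off : forall q, ~ Bm q -> chi q = 0.
Hypothesis chi_le1 : forall q, `|chi q| <= 1.
Hypothesis chi_meas : measurable_fun C chi.
Hypothesis chi_smooth : forall q, S q -> Bm q ->
  exists2 O : set 'rV[R]_m, open_nbhs (cmap c q) O & Ck 1 O (fun x => chi (cinv c x) : R^o).

(** Extended by zero beyond the ball, since translation invariance is used on the whole of R^m and
    [cinv] has no meaning outside the chart. *)
Let chic : 'rV[R]_m -> R^o := (fun x => chi (cinv c x)) \_ B.

Let chicE x : B x -> chic x = chi (cinv c x).
Proof. by move=> Bx; rewrite /chic patchE mem_set. Qed.

Let chic0 x : ~ B x -> chic x = 0.
Proof. by move=> nBx; rewrite /chic patchE memNset. Qed.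

Let chic_dom x : (cmap c @` cdom c) x -> chic x = chi (cinv c x).
Proof.
move=> /cinvK[px xE]; have [Bx|nBx] := pselect (B x); first exact: chicE.
rewrite chic0// chi_off// => -[y By yx]; apply: nBx.
have [_ yE] := coord_ballP By; rewrite -xE -yx yE; exact: By.
Qed.

Let flux_off x : B x -> ~ S (cinv c x) -> \forall y \near x, variational_field Gam (cinv c y) = 0 /\
  forall k, Z k y = 0.
Proof.
move=> Bx nSx; have [px xE] := coord_ballP Bx.
have n1 := cinv_near px (variation_off_support nSx); rewrite xE in n1.
have n2 : \forall y \near x, U (y, 0 : R^o).
  by apply: open_nbhs_nbhs; split; [exact: slice_open | exact: boxU].
apply: filterS2 n1 n2 => y Vy Uy; split=> // k.
have [_ /(_ _ Uy)[py _ _ _] _ _ _] := dU; have [py' yE] := cinvK py.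
have Uy' : U (cmap c (cinv c y), 0 : R^o) by rewrite yE.
have h := flux_tangential d eps_gt0 cGam XP EP NuP dU py' Uy' k.
rewrite yE in h; rewrite h.
rewrite (tangential_field0 d eps_gt0 cGam XP EP NuP dU py' Uy' Vy).
by rewrite to_chartE chart_change0 ?mxE ?mulr0//; exact: chart_atP.
Qed.

(** Outside the ball the cut-off vanishes; off the support of [V] the flux vanishes; on the support
    [Theta] is nonzero, so the area is positive and the flux is smooth. *)
Let local_cases k x : localizable chic (Z k : _ -> R^o) x.
Proof.
have [Bx|nBx] := pselect (B x); last first.
  apply: Or31; have oB : open (~` B) by exact/closed_openC/coord_ball_closed.
  by apply: filterS (open_nbhs_nbhs (conj oB nBx)) => y; exact: chic0.
have [Sx|nSx] := pselect (S (cinv c x)); last first.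
  by apply: Or32; apply: filterS (flux_off Bx nSx) => y [_]; exact.
apply: Or33; have [px xE] := coord_ballP Bx.
have [W1' openW1 chiO] := chi_smooth Sx (ex_intro2 _ _ x Bx erefl); rewrite xE in openW1.
have Ux := boxU Bx r0; have [imm0 _] := boxI r0.
have Spos : 0 < Sd (x, 0 : R^o).
  rewrite (coord_area_Theta d cGam dU Ux imm0) mulr_gt0 ?(density_gt0 cGam dU Ux imm0)//.
  by rewrite lt_def Theta_S// sqrtr_ge0.
have [W2' openW2 ZO] := flux_smooth_near dU Ux Spos.
have oI : open (cmap c @` cdom c) := @cimg_open _ _ _ c.
exists (W1' `&` W2' `&` (cmap c @` cdom c)).
  split; first by apply: openI => //; apply: openI; [exact: (proj1 openW1) | exact: (proj1 openW2)].
  by split; [split; [exact: (proj2 openW1) | exact: (proj2 openW2)] | exists (cinv c x)].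
split; last by apply: Ck_subset (ZO 1%N k) => y [[]].
apply: (@Ck_eq _ _ _ _ _ (fun x => chi (cinv c x) : R^o)).
- by apply: openI => //; apply: openI; [exact: (proj1 openW1) | exact: (proj1 openW2)].
- by move=> y [_ Iy]; rewrite chic_dom.
- by apply: Ck_subset chiO => y [[]].
Qed.

Let off_D x : ~ D x -> \forall y \near x, forall k, chic y * Z k y = 0.
Proof.
move=> nDx; have [Bx|nBx] := pselect (B x); last first.
  have oB : open (~` B) by exact/closed_openC/coord_ball_closed.
  by apply: filterS (open_nbhs_nbhs (conj oB nBx)) => y nBy k; rewrite (chic0 nBy) mul0r.
have nSx : ~ S (cinv c x) by move=> /SK Kx; apply: nDx; exact: DE.
by apply: filterS (flux_off Bx nSx) => y [_ Z0] k; rewrite Z0 mulr0.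
Qed.

Let area_derivative (x : 'rV[R]_m) : R :=
  dens 0 x * speed (cinv c x) + \sum_k 'D_(delta_mx 0 k) (Z k : _ -> R^o) x.

(** One formula for both cases: off the support of [V] the speed and the divergence of the flux are
    0, and so is the time derivative. *)
Let is_derive_area x : B x ->
  is_derive (0 : R) (1 : R) (fun t : R => Sd (x, t : R^o) : R) (area_derivative x).
Proof.
move=> Bx; have [px xE] := coord_ballP Bx.
have Ux : U (cmap c (cinv c x), 0 : R^o) by rewrite xE; exact: boxU.
have [Sx|nSx] := pselect (S (cinv c x)).
  have := first_variation_pointwise eps_gt0 cGam XP EP NuP dU px Ux (Theta_S Sx).
  rewrite xE => -[_ [D' DD' e]]; rewrite /area_derivative /speed -e subrK; exact: DD'.
have := coord_area_derive0 d eps_gt0 cGam XP dU px Ux (variation_off_support nSx).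
rewrite xE => h; have fo := flux_off Bx nSx.
suff -> : area_derivative x = 0 by exact: h.
rewrite /area_derivative; have [V0 _] := nbhs_singleton fo.
rewrite /speed V0 (form0l (metric_linear g _)) mulr0 add0r big1// => k _.
rewrite -[RHS](derive_cst (0 : R^o) x (delta_mx 0 k)); apply: near_eq_derive.
by apply: filterS fo => y [_ ->].
Qed.

Let tangential_density x : B x ->
  tangential_derivative chi (cinv c x) * dens 0 x =
  \sum_k Z k x * 'D_(delta_mx 0 k) (chic : _ -> R^o) x.
Proof.
move=> Bx; have [px xE] := coord_ballP Bx; set q := cinv c x in px xE *.
have Ux : U (cmap c q, 0 : R^o) by rewrite xE; exact: boxU.
have qq := chart_atP q.
pose W := tangential_field g H d Gam E q.
have Zk k : Z k x = dens 0 x * to_chart c q W 0 k.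
  by have := flux_tangential d eps_gt0 cGam XP EP NuP dU px Ux k; rewrite xE.
have [Sx|nSx] := pselect (S q); last first.
  have [V0 Z0] := nbhs_singleton (flux_off Bx nSx).
  have W0 : W = 0 by exact: (tangential_field0 d eps_gt0 cGam XP EP NuP dU px Ux V0).
  rewrite big1 => [|k _]; last by rewrite Z0 mul0r.
  rewrite /tangential_derivative -/W W0 derive_line.
  by under eq_fun do rewrite scaler0 add0r; rewrite derive_cst mul0r.
have [W1' openW1 chiO] := chi_smooth Sx (ex_intro2 _ _ x Bx erefl).
have dchi : differentiable (fun y => chi (cinv c y) : R^o) (cmap c q).
  by have [dO _] := chiO; apply: dO; exact: (proj2 openW1).
have nx : \forall y \near x, chic y = chi (cinv c y).
  have oI : open (cmap c @` cdom c) := @cimg_open _ _ _ c.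
  have Ix : (cmap c @` cdom c) x by exists q.
  by apply: filterS (open_nbhs_nbhs (conj oI Ix)) => y; exact: chic_dom.
have -> : tangential_derivative chi q = 'D_(to_chart c q W) (fun y => chi (cinv c y) : R^o) (cmap c q).
  rewrite /tangential_derivative -/W.
  have ne : \forall y \near pt q, (chi (cinv (chart_at q) y) : R^o) =
      ((fun y => chi (cinv c y) : R^o) \o (cmap c \o cinv (chart_at q))) y.
    by apply: filterS (cinv_near qq (cdom_nbhs px)) => y cy /=; rewrite cmapK.
  apply: (etrans (near_eq_derive W ne)).
  have dt := differentiable_transition qq px.
  have e : (cmap c \o cinv (chart_at q)) (pt q) = cmap c q by rewrite /= cmapK.
  apply: (etrans (derive_chain W dt _)); first by rewrite e.
  exact: (congr1 (fun z => 'D__ (fun y => chi (cinv c y) : R^o) z) e).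
rewrite (derive_coord _ dchi) big_distrl /=; apply: eq_bigr => k _.
rewrite Zk xE (near_eq_derive (delta_mx 0 k) nx).
by rewrite -[_ *: _]/(_ * _) mulrAC (mulrC (dens 0 x)).
Qed.

Let flux_continuous k : continuous (fun y => 'D_(delta_mx 0 k) (fun w => chic w * Z k w : R^o) y : R^o) /\
  continuous (fun y => Z k y * 'D_(delta_mx 0 k) chic y : R^o).
Proof. by split=> x; have [_ ? ? _] := localizable_product (delta_mx 0 k) (local_cases k x). Qed.

Let bounded_int (f : 'rV[R]_m -> R) : continuous f -> (forall x, ~ B x -> f x = 0) ->
  l.-integrable D (EFin \o f).
Proof.
move=> cf f0.
have [|b fb] := @continuous_bounded_support R m f (r + `|pt p|) cf.
  by move=> x xr; apply: f0 => /coord_ball_bound; rewrite leNgt xr.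
apply: (@bounded_integrable _ _ _ l D mD lD _ b) => [|x _]; last exact: fb.
have := @continuous_real_measurable R 'rV[R]_m setT f openT (fun x _ => cf x).
by apply: measurable_funS => //; exact: measurableT.
Qed.

(** The cut-off first variation on one patch. Integrating the flux term by parts leaves the
    derivative of the cut-off along the tangential field. *)
Lemma local_variation :
  [/\ forall t, `|t| < r -> (mu t).-integrable C (EFin \o (fun q => chi q * Theta g H d (Gam ^~ t) q)),
      (mu 0).-integrable C (EFin \o (fun q => chi q * speed q)),
      (mu 0).-integrable C (EFin \o tangential_derivative chi) &
      is_derive (0 : R) (1 : R) (fun t : R => \int[mu t]_(q in C) (chi q * Theta g H d (Gam ^~ t) q) : R)
        (\int[mu 0]_(q in C) (chi q * speed q) - \int[mu 0]_(q in C) tangential_derivative chi q)].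
Proof.
have chi_cmeas : measurable_fun D chic.
  have mI : measurable (cmap c @` cdom c : set (borel 'rV[R]_m)) by apply: borel_open; exact: cimg_open.
  have mcinv : measurable_fun D (cinv c : borel 'rV[R]_m -> borel M).
    apply: (measurable_funS mI); first by move=> x /DP[_ _ px xE]; exists (cinv c x).
    by apply: (continuous_borel_measurable (@cimg_open _ _ _ c)) => x; exact: cinv_continuous.
  have : measurable_fun D (chi \o cinv c).
    apply: (measurable_comp mC _ chi_meas mcinv) => _ [x Dx <-].
    by have [Bx Kx _ _] := DP Dx; split=> //; exists x.
  by apply: eq_measurable_fun => x /[!inE] /DP[Bx _ _ _]; rewrite /= chicE.
have chic_le x : `|chic x : R| <= 1.
  by have [Bx|/chic0->] := pselect (B x); rewrite ?chicE// normr0.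
pose f (t : R) (x : 'rV[R]_m) : R := chic x * Sd (x, t : R^o).
have intf t : `|t| < r -> l.-integrable D (EFin \o f t).
  move=> tr; apply: (@bounded_integrable _ _ _ l D mD lD _ L).
    by apply: measurable_funM => //; exact: Sd_measurable.
  move=> x /DP[Bx _ _ _]; have [SL _] := boxL Bx tr.
  by rewrite normrM (le_trans _ SL)// ler_piMl.
have df x : D x -> is_derive (0 : R) (1 : R) (f ^~ x : R -> R) (chic x * area_derivative x).
  by move=> /DP[Bx _ _ _]; apply: is_deriveZ; exact: is_derive_area.
have fL t x : `|t| < r -> D x -> `|f t x - f 0 x| <= L * `|t|.
  move=> tr /DP[Bx _ _ _]; have [_ SL] := boxL Bx tr.
  by rewrite /f -mulrBr normrM (le_trans _ SL)// ler_piMl.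
have [intf' derf] := is_derive_under_integral mD lD r_gt0 intf df fL.
pose a k (x : 'rV[R]_m) : R := 'D_(delta_mx 0 k) (fun w => chic w * Z k w : R^o) x.
pose b k (x : 'rV[R]_m) : R := Z k x * 'D_(delta_mx 0 k) chic x.
have oB : open (~` B) by exact/closed_openC/coord_ball_closed.
have inta k : l.-integrable D (EFin \o a k).
  apply: bounded_int; first by have [] := flux_continuous k.
  move=> x nBx; rewrite /a -[RHS](derive_cst (0 : R^o) x (delta_mx 0 k)); apply: near_eq_derive.
  by apply: filterS (open_nbhs_nbhs (conj oB nBx)) => y nBy; rewrite chic0// mul0r.
have intb k : l.-integrable D (EFin \o b k).
  apply: bounded_int; first by have [] := flux_continuous k.
  move=> x nBx; rewrite /b [X in _ * X](_ : _ = 0) ?mulr0//.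
  rewrite -[RHS](derive_cst (0 : R^o) x (delta_mx 0 k)); apply: near_eq_derive.
  by apply: filterS (open_nbhs_nbhs (conj oB nBx)) => y nBy; rewrite chic0.
have a0 k : \int[l]_(x in D) a k x = 0.
  apply: (@integral_derive_eq0 R m l lL (fun w => chic w * Z k w : R^o) (delta_mx 0 k) (r + `|pt p|) D).
  - by move=> x; have [] := localizable_product (delta_mx 0 k) (local_cases k x).
  - by have [] := flux_continuous k.
  - move=> x xr; rewrite chic0 ?mul0r// => /coord_ball_bound; by rewrite leNgt xr.
  - move=> x nDx; rewrite -[RHS](derive_cst (0 : R^o) x (delta_mx 0 k)); apply: near_eq_derive.
    by apply: filterS (off_D nDx) => y ->.
(* Integration by parts: [a k] is the derivative of a product supported in the ball and has integral
   0, while [b k] carries the derivative of the cut-off. *)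
have fE x : D x -> chic x * area_derivative x =
    (chi (cinv c x) * speed (cinv c x)) * dens 0 x + (\sum_k a k x - \sum_k b k x).
  move=> /DP[Bx _ _ _]; rewrite /area_derivative mulrDr chicE// mulrA [in X in X + _]mulrAC; congr (_ + _).
  rewrite -sumrB mulr_sumr; apply: eq_bigr => k _.
  have [_ _ _ e] := localizable_product (delta_mx 0 k) (local_cases k x).
  by rewrite /a /b e addrK chicE.
have [intA eA] := Rintegrable_sum mD inta.
have [intB eB] := Rintegrable_sum mD intb.
have intAB := RintegrableB mD intA intB.
(* The frames in [speed] change with the point, so its integrability is deduced from that of the
   other terms. *)
have ints : l.-integrable D (EFin \o (fun x => (chi (cinv c x) * speed (cinv c x)) * dens 0 x)).
  by apply: (eq_Rintegrable mD _ (RintegrableB mD intf' intAB)) => x Dx /=; rewrite fE// addrK.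
have td x : D x -> \sum_k b k x = tangential_derivative chi (cinv c x) * dens 0 x.
  by move=> /DP[Bx _ _ _]; rewrite tangential_density.
have intt : l.-integrable D (EFin \o (fun x => tangential_derivative chi (cinv c x) * dens 0 x)).
  by apply: (eq_Rintegrable mD _ intB) => x Dx; rewrite td.
have dens0 x : D x -> 0 < dens 0 x by exact: dens_pos.
have [_ mu0] := boxI r0.
have [i1 e1] := @chart_integrable _ _ _ _ lL _ _ _ C (fun q => chi q * speed q) mu0 cC Cc (dens_measurable r0) dens0 ints.
have [i2 e2] := @chart_integrable _ _ _ _ lL _ _ _ C (tangential_derivative chi) mu0 cC Cc (dens_measurable r0) dens0 intt.
have tr_int t : `|t| < r -> (mu t).-integrable C (EFin \o (fun q => chi q * Theta g H d (Gam ^~ t) q)) /\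
    \int[mu t]_(q in C) (chi q * Theta g H d (Gam ^~ t) q) = \int[l]_(x in D) f t x.
  move=> tr; have [immt mut] := boxI tr.
  have fE' x : D x -> f t x = (chi (cinv c x) * Theta g H d (Gam ^~ t) (cinv c x)) * dens t x.
    move=> /DP[Bx _ _ _]; rewrite /f chicE// -mulrA; congr (_ * _).
    by apply: (coord_area_Theta d cGam dU _ immt); exact: boxU.
  have intt' : l.-integrable D (EFin \o (fun x => (chi (cinv c x) * Theta g H d (Gam ^~ t) (cinv c x)) * dens t x)).
    by apply: (eq_Rintegrable mD _ (intf t tr)) => x Dx; rewrite fE'.
  have [j1 j2] := @chart_integrable _ _ _ _ lL _ _ _ C (fun q => chi q * Theta g H d (Gam ^~ t) q) mut cC Cc (dens_measurable tr) (fun x => dens_pos tr) intt'.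
  split; first exact: j1.
  by apply: (etrans j2); apply: eq_Rintegral => x /[!inE] Dx; rewrite fE'.
split=> //; first by move=> t /tr_int[].
have nr : \forall t \near (0 : R), `|t| < r.
  by apply/nbhs_ballP; exists r => //= t; rewrite /ball /= sub0r normrN.
have val : \int[l]_(x in D) (chic x * area_derivative x) =
    \int[mu 0]_(q in C) (chi q * speed q) - \int[mu 0]_(q in C) tangential_derivative chi q.
  rewrite e1 e2 (@eq_Rintegral _ _ _ l D (fun x => (chi (cinv c x) * speed (cinv c x)) * dens 0 x +
    (\sum_k a k x - \sum_k b k x))); last by move=> x /[!inE] Dx; rewrite fE.
  rewrite RintegralD// RintegralB// eA (eq_bigr (fun=> 0)) => [|k _]; last exact: a0.
  rewrite big1// sub0r; congr (_ - _); apply: eq_Rintegral => x /[!inE] Dx; exact: td.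
rewrite -val; apply: (@near_eq_is_derive _ _ _ (fun t : R => \int[l]_(x in D) f t x : R)
  (fun t : R => \int[mu t]_(q in C) (chi q * Theta g H d (Gam ^~ t) q) : R) 0 1 _ _ derf).
by apply: filterS nr => t tr; have [_ ->] := tr_int t tr.
Qed.

End LocalVariation.

(** * Partition of unity and globalisation *)

Section Bump.
Context (R : realType).

(* [2 max(0, s)^2], a function of class C^1 *)
Definition posquare (s : R^o) : R^o := s * (s + `|s|).

Lemma posquare_le0 s : s <= 0 -> posquare s = 0.
Proof. by move=> s0; rewrite /posquare ler0_norm// addrN mulr0. Qed.

Lemma posquare_gt0 s : 0 < s -> 0 < posquare s.
Proof. by move=> s0; rewrite /posquare mulr_gt0// gtr0_norm// addr_gt0. Qed.

Lemma posquare_ge0 s : 0 <= posquare s.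
Proof. by have [/posquare_gt0/ltW|/posquare_le0->] := ltP 0 s. Qed.

Lemma is_derive_posquare s : is_derive s (1 : R^o) posquare (2 * (s + `|s|)).
Proof.
have [s0|s0|->] := ltgtP s 0.
- have n : \forall y \near s, cst (0 : R^o) y = posquare y.
    near=> y; rewrite posquare_le0//; near: y; exact: lt_le_nbhsl.
  rewrite ltr0_norm// addrN mulr0.
  exact: (@near_eq_is_derive _ _ _ (cst 0) posquare s 1 0 n (is_derive_cst _ _ _)).
- have n : \forall y \near s, y * (2 * y) = posquare y.
    near=> y; rewrite /posquare gtr0_norm ?mulr2n ?mulrDl ?mul1r//; near: y; exact: lt_nbhsr.
  rewrite gtr0_norm//.
  apply: (@near_eq_is_derive _ _ _ (fun y : R^o => y * (2 * y) : R^o) posquare s 1 _ n).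
  by apply: is_derive_eq; rewrite /GRing.scale /= ; ring.
- rewrite normr0 addr0 mulr0.
  (* At the junction [posquare] is dominated by [2 y^2], whose derivative at 0 is 0. *)
  apply: (@is_derive0_dist R 'I_1 xpredT posquare (fun _ y => y * (2 * y))) => [_ _|t].
    by apply: is_derive_eq; rewrite /GRing.scale /=; ring.
  rewrite big_ord1 /posquare !mul0r !subr0 !normrM ler_wpM2l// (le_trans (ler_normD _ _))//.
  by rewrite normr_id (ger0_norm (ler0n _ 2)) mulr2n mulrDl mul1r.
Unshelve. all: by end_near. Qed.

Lemma Ck1_posquare (V : normedModType R) (U : set V) (u : V -> R^o) : open U ->
  Ck 1 U u -> Ck 1 U (posquare \o u).
Proof.
move=> oU cu; have [du cdu] := cu.
have dp s : differentiable posquare s.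
  by apply/derivable1_diffP; have [] := is_derive_posquare s.
split=> [x Ux|v]; first by apply: differentiable_comp; [exact: du | exact: dp].
apply: (@Ck_eq _ _ _ 0 _ (fun x => 'D_v u x * (2 * (u x + `|u x|)) : R^o)) => // [x Ux|].
  rewrite (derive_chain v (du x Ux) (dp _)).
  have -> : 'D_v u x = 'D_v u x *: (1 : R^o) by rewrite -[RHS]/(_ * 1) mulr1.
  rewrite deriveZl// (@derive_val _ _ _ _ _ _ _ (is_derive_posquare (u x))).
  by rewrite -[_ *: 1]/(_ * 1) mulr1.
apply: Ck_mul => //; first exact: cdu.
have cux := CkW cu.
apply: Ck_mul => //; first exact: Ck_cst.
apply: Ck_add => //.
move=> x Ux; exact: (@continuous_comp _ _ _ u (@Num.norm _ R) x (cux x Ux) (@norm_continuous _ R _)).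
Qed.

Context (m : nat) (M : manifold R m) (p : M) (r : R).
Hypothesis r_gt0 : 0 < r.
Local Notation c := (chart_at p).
Local Notation B := [set x : 'rV[R]_m | `|x - pt p| <= r].
Hypothesis ball_chart : B `<=` cmap c @` cdom c.
Hypothesis ball_closed : closed (cinv c @` B).

(** The norm of row vectors is the maximum norm, which is not differentiable, hence the sum of
    squares. The Euclidean ball of radius [r] lies inside the ball of the maximum norm. *)
Definition bump_coord (x : 'rV[R]_m) : R^o :=
  posquare (r ^+ 2 - \sum_k (x - pt p) 0 k ^+ 2).

Definition bump : M -> R^o := (bump_coord \o cmap c) \_ (cdom c).

Lemma bump_dom q : cdom c q -> bump q = bump_coord (cmap c q).
Proof. by move=> cq; rewrite /bump patchE mem_set. Qed.

Lemma bump_ge0 q : 0 <= bump q.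
Proof. by rewrite /bump patchE; case: ifP => // _; exact: posquare_ge0. Qed.

Lemma bump_center : 0 < bump p.
Proof.
rewrite bump_dom; last exact: chart_atP.
rewrite posquare_gt0// big1 ?subr0 ?exprn_gt0// => k _.
by rewrite subrr mxE expr0n.
Qed.

Lemma bump_off q : ~ (cinv c @` B) q -> bump q = 0.
Proof.
move=> nB; have [cq|ncq] := pselect (cdom c q); last by rewrite /bump patchE memNset.
rewrite bump_dom//; apply: posquare_le0.
rewrite subr_le0 leNgt; apply/negP => small; apply: nB.
exists (cmap c q); last exact: cmapK.
rewrite /= [leLHS]/Num.Def.normr/= mx_normrE; apply: bigmax_le => [|[i k] _ /=]; first exact: ltW.
rewrite (ord1 i) /=; set a := (X in `|X|).
suff : `|a| ^+ 2 <= r ^+ 2 by rewrite ler_sqr// nnegrE ltW.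
rewrite -normrX ger0_norm ?sqr_ge0// /a.
apply: le_trans (ltW small); rewrite (bigD1 k)//= lerDl sumr_ge0// => j _; exact: sqr_ge0.
Qed.

Lemma Ck1_bump_coord : Ck 1 setT bump_coord.
Proof.
apply: Ck1_posquare; first exact: openT.
apply: Ck_add; [exact: openT | exact: Ck_cst|].
have -> : (fun x : 'rV[R]_m => - \sum_k (x - pt p) 0 k ^+ 2 : R^o) =
    (fun x : 'rV[R]_m => \sum_k (-1) * ((x 0 k + - pt p 0 k) * (x 0 k + - pt p 0 k)) : R^o).
  by apply/funext => x; rewrite -sumrN; apply: eq_bigr => k _; rewrite !mxE mulN1r expr2.
have oT := @openT 'rV[R]_m.
apply: Ck_sum => // k _; apply: Ck_mul => //; first exact: Ck_cst.
have h : Ck 1 setT (fun x : 'rV[R]_m => x 0 k + - pt p 0 k : R^o).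
  apply: Ck_add => //; last exact: Ck_cst.
  split=> [x _|v]; first exact: differentiable_coord.
  have -> : (fun x : 'rV[R]_m => 'D_v (fun y : 'rV[R]_m => y 0 k : R^o) x) = cst (v 0 k : R^o).
    by apply/funext => x; rewrite -(derive_mxE (f := fun y : 'rV[R]_m => y))// derive_id.
  exact: Ck_cst.
exact: Ck_mul.
Qed.

(** At a point outside the chart domain, the patch being closed, the function vanishes on a
    neighbourhood, so the extension by zero creates no singularity. *)
Lemma bump_smooth p' q : cdom (chart_at p') q ->
  exists2 O : set 'rV[R]_m, open_nbhs (cmap (chart_at p') q) O &
    Ck 1 O (fun x => bump (cinv (chart_at p') x) : R^o).
Proof.
move=> pq; have oI : open (cmap (chart_at p') @` cdom (chart_at p')) := @cimg_open _ _ _ (chart_at p').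
have [cq|ncq] := pselect (cdom c q).
  pose O := cmap (chart_at p') @` (cdom (chart_at p') `&` cdom c).
  have oO : open O by exact: transition_dom_open.
  exists O; first by split=> //; exists q.
  apply: (@Ck_eq _ _ _ 1 _ (bump_coord \o (cmap c \o cinv (chart_at p')))) => //.
    by move=> _ [y [py cy] <-]; rewrite /= cmapK// bump_dom.
  exact: (Ck_comp oO (fun _ _ => I) (@Ck_transition _ _ _ 1 p' p) Ck1_bump_coord).
have nB : nbhs q (~` (cinv c @` B)).
  apply: open_nbhs_nbhs; split; first exact: closed_openC.
  move=> [x /ball_chart /cinvK[cx _] xq]; apply: ncq; by rewrite -xq.
exists ([set x | (~` (cinv c @` B)) (cinv (chart_at p') x)]^°).
  by split; [exact: open_interior | exact: (cinv_near pq nB)].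
apply: (@Ck_eq _ _ _ 1 _ (cst (0 : R^o))); [exact: open_interior | | exact: Ck_cst].
by move=> x /interior_subset nBx; rewrite bump_off.
Qed.

Lemma bump_continuous : continuous (bump : M -> R^o).
Proof.
move=> q; have qq := chart_atP q; have [W1 openW1 cW1] := bump_smooth qq.
have n : \forall q' \near q, ((fun x => bump (cinv (chart_at q) x) : R^o) \o cmap (chart_at q)) q' = bump q'.
  by apply: filterS (cdom_nbhs qq) => q' qq' /=; rewrite cmapK.
rewrite /prop_for /continuous_at -(nbhs_singleton n).
have cc := @continuous_comp _ _ _ (cmap (chart_at q)) (fun x => bump (cinv (chart_at q) x) : R^o) q
  (cmap_continuous qq) (Ck_continuous cW1 (proj2 openW1)).
by apply: cvg_trans cc; apply: near_eq_cvg; exact: n.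
Qed.

End Bump.

Section PartitionOfUnity.
Context (R : realType) (m : nat) (M : manifold R m) (I : finType) (P : I -> M) (r : I -> R) (K : set M).
Local Notation ball i := [set x : 'rV[R]_m | `|x - pt (P i)| <= r i].
Local Notation patch i := (cinv (chart_at (P i)) @` ball i).
Hypothesis r_gt0 : forall i, 0 < r i.
Hypothesis ball_chart : forall i, ball i `<=` cmap (chart_at (P i)) @` cdom (chart_at (P i)).
Hypothesis ball_closed : forall i, closed (patch i).
Hypothesis cover : forall q, K q -> exists i, 0 < bump (P i) (r i) q.

Definition bump_sum (q : M) : R^o := \sum_i bump (P i) (r i) q.

(** A partition of unity near [K] only: away from [K] the sum may vanish and the quotient need not
    be continuous. *)
Definition unity (i : I) (q : M) : R := bump (P i) (r i) q / bump_sum q.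

Lemma bump_sum_gt0 q : K q -> 0 < bump_sum q.
Proof.
move=> /cover[i bi]; rewrite /bump_sum (bigD1 i)//= ltr_pwDl// sumr_ge0// => j _; exact: bump_ge0.
Qed.

Lemma unity_off i q : ~ patch i q -> unity i q = 0.
Proof. by move=> nq; rewrite /unity bump_off// mul0r. Qed.

Lemma unity_le1 i q : `|unity i q| <= 1.
Proof.
have b0 : 0 <= bump_sum q by apply: sumr_ge0 => j _; exact: bump_ge0.
rewrite /unity normrM normfV (ger0_norm (bump_ge0 _ _ _)) (ger0_norm b0).
have [->|bn0] := eqVneq (bump_sum q) 0; first by rewrite invr0 mulr0.
rewrite ler_pdivrMr ?lt_def ?bn0// mul1r /bump_sum (bigD1 i)//= lerDl sumr_ge0// => j _.
exact: bump_ge0.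
Qed.

Lemma bump_sum_continuous : continuous bump_sum.
Proof.
rewrite /bump_sum -(fct_sumE (index_enum I) xpredT (fun i => bump (P i) (r i))).
apply: (big_ind (fun f : M -> R^o => continuous f)) => [q|f h cf ch q|i _].
- exact: cst_continuous.
- exact: (cvgD (cf q) (ch q)).
- exact: bump_continuous.
Qed.

Lemma bump_sum_near q : K q -> \forall q' \near q, 0 < bump_sum q'.
Proof. by move=> Kq; have := @cvgr_gt _ _ _ _ _ _ (@bump_sum_continuous q); apply; exact: bump_sum_gt0. Qed.

Lemma unity_sum q : K q -> \forall q' \near q, \sum_i unity i q' = 1.
Proof.
move=> Kq; apply: filterS (bump_sum_near Kq) => q' b0.
by rewrite /unity -big_distrl /= divff// gt_eqF.
Qed.

Lemma unity_smooth i p q : K q -> cdom (chart_at p) q ->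
  exists2 O : set 'rV[R]_m, open_nbhs (cmap (chart_at p) q) O &
    Ck 1 O (fun x => unity i (cinv (chart_at p) x) : R^o).
Proof.
move=> Kq pq.
have smooth j : exists W : set 'rV[R]_m, open_nbhs (cmap (chart_at p) q) W /\
    Ck 1 W (fun x => bump (P j) (r j) (cinv (chart_at p) x) : R^o).
  by have [W ? ?] := bump_smooth (r_gt0 j) (@ball_chart j) (@ball_closed j) pq; exists W.
have [W WP] := choice smooth.
have nWj j : \forall x \near cmap (chart_at p) q, W j x.
  by have [oW _] := WP j; exact: open_nbhs_nbhs.
have nW : \forall x \near cmap (chart_at p) q, forall j, W j x.
  exact: (@filter_forall _ I (fun j x => W j x) _ _ nWj).
have nb := cinv_near pq (bump_sum_near Kq).
have n2 : \forall x \near cmap (chart_at p) q, (forall j, W j x) /\ 0 < bump_sum (cinv (chart_at p) x).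
  by apply: filterS2 nW nb.
pose V := [set x | (forall j, W j x) /\ 0 < bump_sum (cinv (chart_at p) x)]^°.
have oV : open V by exact: open_interior.
exists V; first by split.
have VW j : Ck 1 V (fun x => bump (P j) (r j) (cinv (chart_at p) x) : R^o).
  by have [_ cW] := WP j; apply: Ck_subset cW => x /interior_subset[].
apply: (Ck_mul oV (VW i)); apply: (Ck_inv oV) => [x /interior_subset[_ b0]|]; first by rewrite gt_eqF.
by rewrite /bump_sum; apply: Ck_sum.
Qed.

Lemma unity_measurable i (C : set (borel M)) : measurable C -> C `<=` K ->
  measurable_fun C (unity i : borel M -> R).
Proof.
move=> mC CK.
have mb (f : M -> R^o) : continuous f -> measurable_fun C (f : borel M -> R).
  move=> cf; have := @continuous_real_measurable R M setT f openT (fun x _ => cf x).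
  by apply: measurable_funS => //; exact: measurableT.
apply: measurable_funM; first by apply: mb; exact: bump_continuous.
apply: (@measurable_comp _ _ _ _ _ _ [set y : R | y != 0] (GRing.inv : R -> R) C (bump_sum : borel M -> R)).
- exact: open_measurable (@open_neq R 0).
- by move=> _ [x Cx <-] /=; rewrite gt_eqF// bump_sum_gt0//; exact: CK.
- apply: open_continuous_measurable_fun; first exact: open_neq.
  by move=> y /[!inE] /= y0; exact: inv_continuous.
- by apply: mb; exact: bump_sum_continuous.
Qed.

End PartitionOfUnity.

Lemma Rintegral_extend d (T : measurableType d) (R : realType) (mu : {measure set T -> \bar R})
    (C D : set T) (f : T -> R) : measurable C -> measurable D -> C `<=` D ->
  (forall x, D x -> ~ C x -> f x = 0) -> mu.-integrable C (EFin \o f) ->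
  mu.-integrable D (EFin \o f) /\ \int[mu]_(x in D) f x = \int[mu]_(x in C) f x.
Proof.
move=> mC mD CD f0.
have e : (EFin \o f) \_ C = (EFin \o f) \_ D.
  apply/funext => x; rewrite !patchE; have [Cx|nCx] := pselect (C x).
    by rewrite !mem_set//; exact: CD.
  rewrite (memNset nCx); have [Dx|nDx] := pselect (D x); last by rewrite memNset.
  by rewrite mem_set//= f0.
move=> /(integrable_mkcond _ mC); rewrite e => /(integrable_mkcond _ mD) intD; split=> //.
by rewrite /Rintegral integral_mkcond [in RHS]integral_mkcond -e.
Qed.

(** * Summation over the partition of unity *)

Section GlobalVariation.
Context (R : realType) (m n : nat) (M : manifold R m) (N : manifold R n)
  (g : riemannian_metric N) (H : equiregular_grading N) (d : nat) (Gam : M -> R -> N) (eps : R)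
  (X : M -> 'I_n -> N -> 'rV[R]_n) (E : M -> 'I_m -> M -> 'rV[R]_m)
  (Nu : M -> 'I_(n - m) -> M -> 'rV[R]_n) (mu : R -> {measure set (borel M) -> \bar R}) (K : set M).
Local Notation Phi := (Gam ^~ 0).
Hypothesis eps_gt0 : 0 < eps.
Hypothesis cGam : forall (p : M) (t : R), `|t| < eps -> {for (p, t), continuous (fun z : M * R => Gam z.1 z.2)}.
Hypothesis sGam : forall p, smooth_at (var_in_charts Gam p (Phi p)) (pt p, 0 : R^o).
Hypothesis XP : forall p, adapted_frame g H (Phi p) (X p).
Hypothesis EP : forall p, tangent_frame g Phi p (E p).
Hypothesis NuP : forall p, normal_frame g Phi p (Nu p).
Hypothesis immG : \forall t \near (0 : R), immersion (Gam ^~ t).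
Hypothesis muP : \forall t \near (0 : R), is_riemannian_measure (pullback g (Gam ^~ t)) (mu t).
Hypothesis cK : compact K.
Let S := closure [set q | variational_field Gam q != 0].
Hypothesis SK : S `<=` K.
Hypothesis Theta_S : forall q, S q -> Theta g H d Phi q != 0.
Local Notation spd := (speed g H d Gam X E Nu).
Local Notation tder := (tangential_derivative g H d Gam E).
Local Notation ball p r := [set x : 'rV[R]_m | `|x - pt p| <= r].
Local Notation patch p r := (cinv (chart_at p) @` ball p r).

(** The radius is fixed before the cut-off, because the partition of unity is built from the radii
    of all patches. *)
Lemma local_patch p : exists r : R, [/\ 0 < r, ball p r `<=` cmap (chart_at p) @` cdom (chart_at p),
  compact (patch p r : set M) &
  forall (chi : M -> R) (C := K `&` patch p r : set (borel M)),
    (forall q, ~ patch p r q -> chi q = 0) -> (forall q, `|chi q| <= 1) ->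
    measurable_fun C (chi : borel M -> R) ->
    (forall q, S q -> patch p r q ->
      exists2 O : set 'rV[R]_m, open_nbhs (cmap (chart_at p) q) O &
        Ck 1 O (fun x => chi (cinv (chart_at p) x) : R^o)) ->
  [/\ forall t, `|t| < r -> (mu t).-integrable C (EFin \o (fun q => chi q * Theta g H d (Gam ^~ t) q)),
      (mu 0).-integrable C (EFin \o (fun q => chi q * spd q)),
      (mu 0).-integrable C (EFin \o tder chi) &
      is_derive (0 : R) (1 : R) (fun t : R => \int[mu t]_(q in C) (chi q * Theta g H d (Gam ^~ t) q) : R)
        (\int[mu 0]_(q in C) (chi q * spd q) - \int[mu 0]_(q in C) tder chi q)]].
Proof.
have [U Up dU] := local_domain_exists eps_gt0 cGam sGam XP p.
have [r r0 [boxU boxI [L boxL]]] := local_box_exists d immG muP dU Up.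
have [l lL] := lebesgue_exists R m.
exists r; split=> //.
- by move=> x /(coord_ballP dU r0 boxU)[px xE]; exists (cinv (chart_at p) x).
- exact: (local_ball_compact dU r0 boxU).
move=> chi C chi_off chi_le1 chi_meas chi_smooth.
exact: (local_variation eps_gt0 cGam XP EP NuP cK SK Theta_S dU r0 boxU boxI boxL lL
  chi_off chi_le1 chi_meas chi_smooth).
Qed.

Lemma tangential_derivative_off (chi : M -> R) q : (\forall q' \near q, chi q' = 0) -> tder chi q = 0.
Proof.
move=> chi0; rewrite /tangential_derivative -[RHS](derive_cst (0 : R^o) (pt q) (tangential_field g H d Gam E q)).
by apply: near_eq_derive; exact: (cinv_near (chart_atP q) chi0).
Qed.

Lemma tangential_derivative_unity (I : finType) (chi : I -> M -> R) q : K q ->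
  (\forall q' \near q, \sum_i chi i q' = 1) ->
  (forall i, exists2 O : set 'rV[R]_m, open_nbhs (pt q) O &
        Ck 1 O (fun x => chi i (cinv (chart_at q) x) : R^o)) ->
  \sum_i tder (chi i) q = 0.
Proof.
move=> Kq chi1 chiC; set v := tangential_field g H d Gam E q.
have n1 := cinv_near (chart_atP q) chi1.
have h i : is_derive (pt q) v (fun x => chi i (cinv (chart_at q) x) : R^o) (tder (chi i) q).
  have [W [_ Wq] [dW _]] := chiC i.
  exact: (differentiable_is_derive v (dW _ Wq)).
have [_ <-] := is_derive_bigsum (P := xpredT) (fun i _ => h i);
 rewrite -[RHS](derive_cst (1 : R^o) (pt q) v).
exact: near_eq_derive.
Qed.

Lemma variation_on_compact : [/\
  \forall t \near (0 : R), (mu t).-integrable K (EFin \o Theta g H d (Gam ^~ t)),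
  (mu 0).-integrable K (EFin \o spd) &
  is_derive (0 : R) (1 : R) (fun t : R => \int[mu t]_(q in K) Theta g H d (Gam ^~ t) q : R)
    (\int[mu 0]_(q in K) spd q)].
Proof.
have [rf rP] := choice local_patch.
have r0 p : 0 < rf p by have [] := rP p.
have bch p : ball p (rf p) `<=` cmap (chart_at p) @` cdom (chart_at p) by have [] := rP p.
have clP p : closed (patch p (rf p) : set M).
  by apply: compact_closed; [exact: mhausdorff | have [_ _ ? _] := rP p].
(* Covering [K] by these sets rather than by the patches makes the sum of the bumps positive on
   [K]. *)
pose U p := [set q | 0 < bump p (rf p) q].
have oU p : open (U p).
  have -> : U p = (bump p (rf p) : M -> R^o) @^-1` [set y : R | 0 < y] by [].
  by apply: open_comp => [q _|]; [exact: bump_continuous | exact: open_gt].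
have [D' _ cov] : finite_subset_cover setT U K.
  move: cK; rewrite compact_cover; apply; first by move=> p _; exact: oU.
  by move=> q Kq; exists q => //; exact: bump_center.
pose P (i : D') : M := val i; pose r i := rf (P i).
have cover q : K q -> exists i : D', 0 < bump (P i) (r i) q.
  by move=> /cov[p /= pD Upq]; exists [` pD]%fset.
pose chi i := unity P r i.
pose C i : set (borel M) := K `&` patch (P i) (r i).
have closedK : closed K by apply: compact_closed => //; exact: mhausdorff.
have mK : measurable (K : set (borel M)) by exact: borel_closed.
have mC i : measurable (C i) by apply: borel_closed; apply: closedI => //; exact: clP.
have CK i : C i `<=` K by move=> q [].
have chi_off i q : ~ patch (P i) (r i) q -> chi i q = 0.
  exact: (unity_off (fun i => r0 (P i))).
have chi_smooth i p q : K q -> cdom (chart_at p) q ->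
    exists2 O : set 'rV[R]_m, open_nbhs (cmap (chart_at p) q) O &
      Ck 1 O (fun x => chi i (cinv (chart_at p) x) : R^o).
  exact: (unity_smooth (fun i => r0 (P i)) (fun i => bch (P i)) (fun i => clP (P i)) cover).
have patch_dom i q : patch (P i) (r i) q -> cdom (chart_at (P i)) q.
  by move=> [x /bch/cinvK[px _] <-].
have local i : [/\ forall t, `|t| < r i -> (mu t).-integrable (C i) (EFin \o (fun q => chi i q * Theta g H d (Gam ^~ t) q)),
      (mu 0).-integrable (C i) (EFin \o (fun q => chi i q * spd q)),
      (mu 0).-integrable (C i) (EFin \o tder (chi i)) &
      is_derive (0 : R) (1 : R) (fun t : R => \int[mu t]_(q in C i) (chi i q * Theta g H d (Gam ^~ t) q) : R)
        (\int[mu 0]_(q in C i) (chi i q * spd q) - \int[mu 0]_(q in C i) tder (chi i) q)].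
  have [_ _ _ h] := rP (P i); apply: h.
  - exact: chi_off.
  - exact: unity_le1.
  - exact: (unity_measurable (fun i => r0 (P i)) (fun i => bch (P i)) (fun i => clP (P i)) cover i (mC i) (@CK i)).
  - by move=> q Sq pq; apply: chi_smooth; [exact: SK | exact: patch_dom].
have chi_sum q : K q -> \sum_i chi i q = 1.
  move=> Kq; exact: (nbhs_singleton (unity_sum (fun i => r0 (P i)) (fun i => bch (P i)) (fun i => clP (P i)) cover Kq)).
have off_C i q : K q -> ~ C i q -> ~ patch (P i) (r i) q by move=> Kq nC pq; apply: nC.
(* Integrals over different patches become integrals over the common set [K], on the rest of which
   the cut-off vanishes. *)
have ext t i (f : M -> R) : (mu t).-integrable (C i) (EFin \o (fun q => chi i q * f q)) ->
    (mu t).-integrable K (EFin \o (fun q => chi i q * f q)) /\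
    \int[mu t]_(q in K) (chi i q * f q) = \int[mu t]_(q in C i) (chi i q * f q).
  move=> intf; apply: Rintegral_extend => // q Kq nCq.
  by rewrite chi_off ?mul0r//; exact: off_C.
have sumK t (f : M -> R) : (forall i, (mu t).-integrable (C i) (EFin \o (fun q => chi i q * f q))) ->
    (mu t).-integrable K (EFin \o f) /\
    \int[mu t]_(q in K) f q = \sum_i \int[mu t]_(q in C i) (chi i q * f q).
  move=> intf; have e q : K q -> \sum_i chi i q * f q = f q.
    by move=> Kq; rewrite -big_distrl /= chi_sum// mul1r.
  have [int1 e1] := Rintegrable_sum mK (fun i => (ext t i f (intf i)).1).
  split; first exact: (eq_Rintegrable mK e int1).
  rewrite (@eq_Rintegral _ _ _ (mu t) K _ f (fun q qK => esym (e q (set_mem qK)))) e1.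
  by apply: eq_bigr => i _; have [_ ->] := ext t i f (intf i).
have nr : \forall t \near (0 : R), forall i, `|t| < r i.
  have nri i : \forall t \near (0 : R), `|t| < r i.
    by apply: nbhs0_lt; exact: r0.
  exact: (@filter_forall _ D' (fun i t => `|t| < r i) _ _ nri).
have intT t : (forall i, `|t| < r i) -> forall i,
    (mu t).-integrable (C i) (EFin \o (fun q => chi i q * Theta g H d (Gam ^~ t) q)).
  by move=> tr i; have [h _ _ _] := local i; exact: h.
have [ints es] := sumK 0 spd (fun i => let: And4 _ h _ _ := local i in h).
split=> //.
  by apply: filterS nr => t tr; have [] := sumK t _ (intT t tr).
have td0 : \sum_i \int[mu 0]_(q in C i) tder (chi i) q = 0.
  have tdext i : (mu 0).-integrable K (EFin \o tder (chi i)) /\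
      \int[mu 0]_(q in K) tder (chi i) q = \int[mu 0]_(q in C i) tder (chi i) q.
    apply: Rintegral_extend => //; last by have [] := local i.
    (* The patch is closed, so the cut-off vanishes on a whole neighbourhood and its derivative is
       0. *)
    move=> q Kq nCq; apply: tangential_derivative_off.
    have nB : nbhs q (~` (patch (P i) (r i))).
      by apply: open_nbhs_nbhs; split; [exact/closed_openC/clP | exact: off_C].
    by apply: filterS nB => q'; exact: chi_off.
  rewrite -(eq_bigr _ (fun i _ => (tdext i).2)).
  have [_ <-] := Rintegrable_sum mK (fun i => (tdext i).1).
  rewrite (@eq_Rintegral _ _ _ (mu 0) K (cst 0)); first by rewrite Rintegral_cst// mul0r.
  move=> q /[!inE] Kq; apply: tangential_derivative_unity => //.
    exact: (unity_sum (fun i => r0 (P i)) (fun i => bch (P i)) (fun i => clP (P i)) cover Kq).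
  by move=> i; apply: chi_smooth => //; exact: chart_atP.
have derl i : is_derive (0 : R) (1 : R) (fun t : R => \int[mu t]_(q in C i) (chi i q * Theta g H d (Gam ^~ t) q) : R)
    (\int[mu 0]_(q in C i) (chi i q * spd q) - \int[mu 0]_(q in C i) tder (chi i) q).
  by have [_ _ _ h] := local i.
have der := @is_derive_bigsum R R^o D' xpredT _ _ _ _ (fun i _ => derl i).
rewrite /= sumrB td0 subr0 -es in der.
apply: (@near_eq_is_derive _ _ _ (fun t : R => \sum_i \int[mu t]_(q in C i) (chi i q * Theta g H d (Gam ^~ t) q) : R)
  (fun t : R => \int[mu t]_(q in K) Theta g H d (Gam ^~ t) q : R) 0 1 _ _ der).
by apply: filterS nr => t tr; have [_ ->] := sumK t _ (intT t tr).
Qed.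

End GlobalVariation.

Lemma indic_mul_eq (R : realType) (T : Type) (A : set T) (x : T) (a b : R) :
  (A x -> a = b) -> \1_A x * a = \1_A x * b.
Proof.
by move=> ab; rewrite indicE; have [Ax|nAx] := pselect (A x); [rewrite ab | rewrite memNset// !mul0r].
Qed.

Section IntegralSplit.
Context d (T : measurableType d) (R : realType).

Lemma ge0_integral_split (mu : {measure set T -> \bar R}) (A D : set T) (f : T -> R) :
  measurable A -> measurable D -> A `<=` D -> measurable_fun A f -> measurable_fun (D `\` A) f ->
  (forall x, 0 <= f x) ->
  (\int[mu]_(x in D) (f x)%:E = \int[mu]_(x in A) (f x)%:E + \int[mu]_(x in D `\` A) (f x)%:E)%E.
Proof.
move=> mA mD AD m1 m2 f0; have mDA : measurable (D `\` A) by exact: measurableD.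
have DE : D = A `|` (D `\` A) by rewrite setDUK.
rewrite {1}DE ge0_integral_setU//.
- by apply/measurable_EFinP; apply/measurable_funU.
- by move=> x _; rewrite lee_fin.
- by apply/disj_setPS => x [Ax []].
Qed.

Lemma integral_agree (mu nu : {measure set T -> \bar R}) (D : set T) (f h : T -> \bar R) :
  (forall A, measurable A -> A `<=` D -> mu A = nu A) -> (forall x, D x -> f x = h x) ->
  (\int[mu]_(x in D) f x = \int[nu]_(x in D) h x)%E.
Proof.
by move=> mn fh; rewrite (eq_measure_integral nu mn); apply: eq_integral => x /[!inE]; exact: fh.
Qed.

End IntegralSplit.

(** * Agreement of the areas outside the compact set *)

Section CountableCharts.
Context (R : realType) (m : nat) (M : manifold R m).

Lemma countable_chart_cover : exists V : nat -> set M,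
  [/\ forall k, open (V k), forall k, exists p, V k `<=` cdom (chart_at p) & \bigcup_k V k = setT].
Proof.
have [B /countable_injP[f finj] [oB Bbase]] := @msecond_countable _ _ M.
pose inchart (b : set M) := exists p, b `<=` cdom (chart_at p).
(* As [f] is injective on the basis, this union has at most one member; it is empty when [k] is not
   the number of a set inside a chart. *)
pose V k : set M := \bigcup_(b in [set b | [/\ B b, f b = k & inchart b]]) b.
exists V; split.
- by move=> k; apply: bigcup_open => b [Bb _ _]; exact: oB.
- move=> k; have [[q [b [Bb fb [p bp]] bq]]|nV] := pselect (exists q, V k q).
    exists p => q' [b' [Bb' fb' _] b'q']; apply: bp.
    by rewrite (finj b b')// ?inE// fb fb'.
  (* An empty set lies in any chart; the manifold is not empty. *)
  by exists point => q Vq; case: nV; exists q.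
- rewrite -subTset => q _.
  have [b [Bb bq] bc] := Bbase q _ (cdom_nbhs (chart_atP q)).
  by exists (f b) => //; exists b => //; split=> //; exists q.
Qed.

(** Cuts [A] into countably many disjoint Borel pieces, each inside one chart. *)
Lemma chart_measure_ext (mu nu : {measure set (borel M) -> \bar R}) (A : set (borel M)) : measurable A ->
  (forall p (B : set (borel M)), measurable B -> B `<=` cdom (chart_at p) -> B `<=` A -> mu B = nu B) ->
  mu A = nu A.
Proof.
move=> mA mn; have [V [oV Vc Vcover]] := countable_chart_cover.
pose F k : set (borel M) := A `&` V k.
have mV k : measurable (V k : set (borel M)) by exact: borel_open.
have mF k : measurable (F k) by exact: measurableI.
have mS k : measurable (seqDU F k) by apply: measurableD => //; exact: bigsetU_measurable.
have AE : A = \bigcup_k seqDU F k by rewrite -seqDU_bigcup_eq -setI_bigcupr Vcover setIT.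
have m1 (l : {measure set (borel M) -> \bar R}) : l A = (\sum_(k <oo) l (seqDU F k))%E.
  by rewrite {1}AE measure_semi_bigcup//; rewrite -AE.
rewrite !m1; apply: eq_eseriesr => k _; have [p Vp] := Vc k.
apply: (mn p) => // [q [[_ Vq] _]|q [[]]//].
exact: Vp.
Qed.

End CountableCharts.

Section Agreement.
Context (R : realType) (m n : nat) (M : manifold R m) (N : manifold R n)
  (g : riemannian_metric N) (H : equiregular_grading N).

Lemma dmap_near (F G : M -> N) q : (\forall q' \near q, F q' = G q') -> dmap F q = dmap G q.
Proof.
move=> FG; have e := nbhs_singleton FG; apply/funext => v; apply: near_eq_derive.
apply: filterS (cinv_near (chart_atP q) FG) => x xE.
by rewrite /map_in_charts /= e xE.
Qed.

Lemma pullback_near (F G : M -> N) q : (\forall q' \near q, F q' = G q') -> pullback g F q = pullback g G q.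
Proof.
move=> FG; apply/funext => u; apply/funext => v.
by rewrite /pullback (dmap_near FG) (nbhs_singleton FG).
Qed.

Lemma Theta_near d (F G : M -> N) q : (\forall q' \near q, F q' = G q') ->
  Theta g H d F q = Theta g H d G q.
Proof.
move=> FG; have e : orthonormal_basis g F q = orthonormal_basis g G q.
  by apply/funext => b; rewrite /orthonormal_basis (pullback_near FG).
by rewrite /Theta e (dmap_near FG) (nbhs_singleton FG).
Qed.

(** The measures at different times are given independently; they are compared through their
    densities, which agree where the maps do. *)
Lemma measure_near (F G : M -> N) (mu nu : {measure set (borel M) -> \bar R}) (A : set (borel M)) :
  is_riemannian_measure (pullback g F) mu -> is_riemannian_measure (pullback g G) nu ->
  measurable A -> (forall q, A q -> \forall q' \near q, F q' = G q') -> mu A = nu A.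
Proof.
move=> muF nuG mA FG; apply: chart_measure_ext => // p B mB Bp BA.
apply: (etrans (muF p B mB Bp)); apply: (etrans _ (esym (nuG p B mB Bp))).
apply: (congr1 (@lebesgue_int R m)); apply/funext => x; apply: (congr1 EFin).
apply: indic_mul_eq => -[q Bq <-].
apply: (congr1 (fun A => Num.sqrt (\det A))); apply/matrixP => i j; rewrite !mxE.
have [cq FGq] := (Bp q Bq, FG q (BA q Bq)).
by rewrite /form_in_chart cmapK// (pullback_near FGq).
Qed.

End Agreement.

Theorem theorem8p5 (R : realType) (m n : nat)
    (M : manifold R m) (N : manifold R n)
    (g : riemannian_metric N) (H : equiregular_grading N)
    (Phi : M -> N) (d : nat)
    (immPhi : immersion Phi) (degPhi : immersion_degree H Phi d)
    (eps : R) (eps_gt0 : 0 < eps) (K : set M) (Gam : M -> R -> N)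
    (admGam : admissible_variation H d Phi eps K Gam)
    (* the Riemannian measures of the pullback metrics Gam_t^* g *)
    (mu : R -> {measure set (borel M) -> \bar R})
    (muP : \forall t \near (0 : R),
       is_riemannian_measure (pullback g (Gam ^~ t)) (mu t))
    (* H_d is defined on the support of the variational field *)
    (Theta_neq0 : forall p,
       closure [set q | variational_field Gam q != 0] p -> Theta g H d Phi p != 0)
    (* local frames: around every point p, (E p i)_i is a frame of TM, (Nu p j)_j
       a frame of its normal bundle, (X p i)_i an adapted frame around Phi p *)
    (E : M -> 'I_m -> M -> 'rV[R]_m)
    (Nu : M -> 'I_(n - m) -> M -> 'rV[R]_n)
    (X : M -> 'I_n -> N -> 'rV[R]_n)
    (EP : forall p, tangent_frame g Phi p (E p))
    (NuP : forall p, normal_frame g Phi p (Nu p))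
    (XP : forall p, adapted_frame g H (Phi p) (X p)) :
  (* for D = setT this is the area of the whole submanifold *)
  forall D : set (borel M), measurable D -> K `<=` D ->
    (area g H d Phi (mu 0%R) D < +oo)%E ->
    is_derive (0 : R) (1 : R)
      (fun t : R => fine (area g H d (Gam ^~ t) (mu t) D) : R)
      (\int[mu 0]_p
         g (Phi p) (variational_field Gam p)
           (mean_curvature g H d Phi (E p) (Nu p) (X p) p))%R.
Proof.
case: admGam => cs G0 immd cK Koff; subst Phi.
set Phi := Gam ^~ 0 in immPhi degPhi Koff Theta_neq0 EP NuP XP *.
have cGam p t : `|t| < eps -> {for (p, t), continuous (fun z : M * R => Gam z.1 z.2)}.
  by move=> te; have [] := cs p t te.
have e0 : `|0 : R| < eps by rewrite normr0.
have sGam p : smooth_at (var_in_charts Gam p (Phi p)) (pt p, 0 : R^o) by have [_] := cs p 0 e0.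
have immG : \forall t \near (0 : R), immersion (Gam ^~ t) by apply: filterS immd => t [].
have clK : closed (K : set M) by apply: compact_closed => //; exact: mhausdorff.
have mK : measurable (K : set (borel M)) by exact: borel_closed.
have offK q : ~ K q -> \forall q' \near q, ~ K q'.
  by move=> nKq; apply: open_nbhs_nbhs; split=> //; exact: closed_openC.
have V0 q : ~ K q -> variational_field Gam q = 0.
  move=> nKq; rewrite /variational_field -[RHS](derive_cst (cmap (chart_at (Gam q 0)) (Gam q 0)) (0 : R^o) 1).
  apply: near_eq_derive; apply: filterS (nbhs0_lt eps_gt0) => t te /=.
  by rewrite Koff.
have SK : closure [set q | variational_field Gam q != 0] `<=` K.
  rewrite [X in _ `<=` X](closure_id K).1//; apply: closureS => q /= Vq.
  by apply: contrapT => /V0 V0q; rewrite V0q eqxx in Vq.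
have [intT ints der] := variation_on_compact eps_gt0 cGam sGam XP EP NuP immG muP cK SK Theta_neq0.
move=> D mD KD areaD.
have mDK : measurable (D `\` K : set (borel M)) by exact: measurableD.
have cTheta : continuous (Theta g H d Phi : M -> R^o).
  move=> q; have [U Uq dU] := local_domain_exists eps_gt0 cGam sGam XP q.
  exact: (Theta_continuous cGam dU (chart_atP q) Uq immPhi).
have mTheta0 : measurable_fun setT (Theta g H d Phi : borel M -> R).
  exact: (@continuous_real_measurable R M setT _ openT (fun x _ => cTheta x)).
have eqG t q : `|t| < eps -> ~ K q -> \forall q' \near q, Gam q' t = Phi q'.
  by move=> te nKq; apply: filterS (offK q nKq) => q' nKq'; exact: Koff.
have mu0 := nbhs_singleton muP.
(* The part of the area that does not move: near each point outside [K] the maps coincide, so the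
   integrands and the measures do as well. *)
pose rest := area g H d Phi (mu 0) (D `\` K).
have Theta_ge0 (F : M -> N) (q : M) : 0 <= Theta g H d F q by exact: sqrtr_ge0.
have split_area t : `|t| < eps -> is_riemannian_measure (pullback g (Gam ^~ t)) (mu t) ->
    (mu t).-integrable K (EFin \o Theta g H d (Gam ^~ t)) ->
    area g H d (Gam ^~ t) (mu t) D = (area g H d (Gam ^~ t) (mu t) K + rest)%E.
  move=> te mut intt.
  have eT q : (D `\` K) q -> Theta g H d (Gam ^~ t) q = Theta g H d Phi q.
    by move=> [_ nKq]; exact: (Theta_near g H d (eqG t q te nKq)).
  have m1 : measurable_fun (K : set (borel M)) (Theta g H d (Gam ^~ t) : borel M -> R).
    by apply/measurable_EFinP; exact: (measurable_int _ intt).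
  have m2 : measurable_fun (D `\` K) (Theta g H d (Gam ^~ t) : borel M -> R).
    have m0 : measurable_fun (D `\` K) (Theta g H d Phi : borel M -> R).
      exact: (measurable_funS measurableT (@subsetT _ _) mTheta0).
    by apply: eq_measurable_fun m0 => q /[!inE] /eT ->.
  have sp := ge0_integral_split (mu t) mK mD KD m1 m2 (fun q => Theta_ge0 (Gam ^~ t) q).
  apply: (etrans sp); apply: (congr2 adde erefl).
  apply: integral_agree => [A mA AD|q DKq]; last exact: (congr1 EFin (eT q DKq)).
  by apply: (measure_near mut mu0 mA) => q /AD[_ nKq]; exact: eqG.
have rest_fin : rest \is a fin_num.
  have r0 : (0 <= rest)%E by apply: integral_ge0 => q _; rewrite lee_fin.
  rewrite ge0_fin_numE//; apply: le_lt_trans areaD.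
  rewrite (split_area 0 e0 mu0 (nbhs_singleton intT)) leeDr//.
  by apply: integral_ge0 => q _; rewrite lee_fin.
(* [fine] is additive here because both parts are finite: the moving one by integrability, the other
   one by [areaD]. *)
have near_area : \forall t \near (0 : R),
    \int[mu t]_(q in K) Theta g H d (Gam ^~ t) q + fine rest = fine (area g H d (Gam ^~ t) (mu t) D).
  apply: filterS3 (nbhs0_lt eps_gt0) muP intT => t te mut intt.
  apply: (etrans (esym (fineD (integrable_fin_num (mK : measurable (K : set (borel M))) intt) rest_fin))).
  exact: (congr1 fine (esym (split_area t te mut intt))).
(* The integrand vanishes outside [K] together with [V]. *)
have valE : \int[mu 0]_p g (Phi p) (variational_field Gam p)
    (mean_curvature g H d Phi (E p) (Nu p) (X p) p) = \int[mu 0]_(q in K) speed g H d Gam X E Nu q.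
  have [] := @Rintegral_extend _ _ R (mu 0) K setT (speed g H d Gam X E Nu) mK measurableT (@subsetT _ _) _ ints => //.
  by move=> q _ nKq; rewrite /speed V0// (form0l (metric_linear g _)).
rewrite valE.
apply: (@near_eq_is_derive _ _ _ (fun t : R => \int[mu t]_(q in K) Theta g H d (Gam ^~ t) q + fine rest : R)
  (fun t : R => fine (area g H d (Gam ^~ t) (mu t) D) : R) 0 1 _ near_area).
have := is_deriveD der (is_derive_cst (fine rest : R^o) (0 : R^o) (1 : R^o)).
by rewrite addr0.
Qed.
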